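(* Fix $\beta\ge 4$. There is a constant $C'_\beta\le c\,\beta$ ($c$ an absolute constant) such that the following holds. Let the golfing partition (see context) be built with $P=L/Q=\tfrac12\log_2\big(4\beta K\log(LN)\big)$ (assumed to be an integer dividing $L$), let $\mu_0^2$ be defined from it, and put $\alpha_1=\log(K\log(LN))$, $\alpha_2=\log(S\log(LN))$. If $$\max\big(\mu_0^2\,\alpha_1 K,\ \mu_{\max}^2\, S\,\alpha_2\log^2 S\big)\le \frac{L}{C'_\beta\,\alpha_1\log^2(LN)}\qquad\text{and}\qquad N\ge C'_\beta\,\rho_0^2\,\alpha_1\log(LN),$$ then, with probability at least $1-\mathcal O((LN)^{4-\beta})$ (over the Gaussian matrices $\mathbf C_n$ and the random partition), $\mathbf X_0=\mathbf h\mathbf m^*=\mathbf h(\mathbf m_1^*,\dots,\mathbf m_N^* )$ is the unique solution of $$\min_{\mathbf X\in\mathbb C^{L\times KN}}\|\mathbf X\|_*\quad\text{subject to}\quad \mathcal A(\mathbf X)=\mathcal A(\mathbf X_0).$$ Consequently $\mathbf w=\mathbf B\mathbf h$ and $\mathbf x_n=\mathbf C_n\mathbf m_n$, $n\in[N]$, are recovered up to a global scalar from the circular convolutions $\mathbf y_n=\mathbf w*\mathbf x_n$.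
   Context: Let $L$ be an even positive integer and $K,N,S$ positive integers with $K\le L$, $S\le L$; $[M]=\{1,\dots,M\}$. $\mathbf F$ is the $L\times L$ DFT matrix, $F[\omega,\ell]=L^{-1/2}e^{-\mathrm j2\pi(\omega-1)(\ell-1)/L}$, with $\ell$-th row $\mathbf f_\ell^*$. $\mathbf B$ is a real $L\times L$ orthonormal matrix, $\hat{\mathbf B}=\mathbf F\mathbf B$, and $\mathbf b_\ell:=\mathbf B^*\mathbf f_\ell$ (so $\mathbf b_\ell^*$ is the $\ell$-th row of $\hat{\mathbf B}$ and $\{\mathbf b_\ell\}_{\ell\in[L]}$ is an orthonormal basis of $\mathbb C^L$). $\mathbf h\in\mathbb R^L$ is nonzero with support $\Omega$, $|\Omega|\le S$, and $\mathbf m=(\mathbf m_1^*,\dots,\mathbf m_N^* )^*\in\mathbb R^{KN}$, $\mathbf m_n\in\mathbb R^K$, is nonzero. The matrices $\mathbf C_1,\dots,\mathbf C_N\in\mathbb R^{L\times K}$ have i.i.d. $\mathcal N(0,1/L)$ entries, and $\mathbf c_{\ell,n}\in\mathbb C^K$ is defined by $\bar{\mathbf c}_{\ell,n}=\sqrt L\,\mathbf C_n^*\mathbf f_\ell$. The vector $\boldsymbol\phi_{\ell,n}\in\mathbb C^{KN}$ equals $\mathbf c_{\ell,n}$ on the $n$-th block of coordinates $\{(n-1)K+1,\dots,nK\}$ and is zero elsewhere; $\mathbf D_n$ is the $KN\times KN$ diagonal $0/1$ matrix projecting onto that block. $\langle\mathbf A,\mathbf X\rangle=\operatorname{tr}(\mathbf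 A^*\mathbf X)$. The linear map $\mathcal A:\mathbb C^{L\times KN}\to\mathbb C^{LN}$ is $\mathcal A(\mathbf X)=(\langle \mathbf b_\ell\boldsymbol\phi_{\ell,n}^*,\mathbf X\rangle)_{(\ell,n)\in[L]\times[N]}$ (these are, in the Fourier domain, the convolution measurements of $\mathbf w=\mathbf B\mathbf h$ and $\mathbf x_n=\mathbf C_n\mathbf m_n$, which depend linearly on $\mathbf h\mathbf m^*$). Coherences: $\mu_{\max}^2=L\max_{\omega,\ell}|\hat B[\omega,\ell]|^2$; $\rho_0^2=N\max_n\|\mathbf m_n\|_2^2/\|\mathbf m\|_2^2$. $\mathcal P(\mathbf X)=\mathbf I_{L\times\Omega}\mathbf I_{L\times\Omega}^*\mathbf X$, where $\mathbf I_{L\times\Omega}$ consists of the columns of $\mathbf I_L$ indexed by $\Omega$ (i.e. $\mathcal P$ zeroes the rows outside $\Omega$). Golfing partition: $Q$ is a positive integer dividing $L$ and $P=L/Q$; independently for each $n\in[N]$, $(\Delta_{n,1},\dots,\Delta_{n,P})$ is a uniformly random partition of $[L]$ into $P$ disjoint sets of size $Q$, independent of the $\mathbf C_n$. $\mathbf S_{n,p}=\sum_{\ell\in\Delta_{n,p}}(\mathcal P\mathbf b_\ell)(\mathcal P\mathbf b_\ell)^*$ and $\mathbf S_{n,p}^\ddagger=\mathbf I_{L\times\Omega}(\mathbf I_{L\times\Omega}^*\mathbf S_{n,p}\mathbf I_{L\times\Omega})^{-1}\mathbf I_{L\times\Omega}^*$ (when the inverse exists). The coherence of $\mathbf h$ is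 $$\mu_0^2=L\max\Big\{\frac{\|\hat{\mathbf B}\mathbf h\|_\infty^2}{\|\mathbf h\|_2^2},\ \frac{Q^2}{L^2}\max_{n,p}\frac{\|\hat{\mathbf B}\mathbf S_{n,p}^\ddagger\mathbf h\|_\infty^2}{\|\mathbf h\|_2^2},\ \max_{n,n'}\frac{\|\hat{\mathbf B}\mathbf S_{n,2}^\ddagger\mathbf S_{n',1}\mathbf h\|_\infty^2}{\|\mathbf h\|_2^2}\Big\}.$$ $\|\cdot\|_*$ is the nuclear norm. *)

(* Defs.v *)
From mathcomp Require Import all_boot all_order all_algebra.
From mathcomp Require Import all_classical all_reals all_analysis.
From mathcomp Require Import complex.
Set Implicit Arguments.
Unset Strict Implicit.
Unset Printing Implicit Defensive.
Import Order.TTheory GRing.Theory Num.Theory.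
Local Open Scope ring_scope.

Definition rc {R : realType} (x : R) : R[i] := Complex x 0.
Definition cconj {R : realType} (z : R[i]) : R[i] := complex.conjc z.
Definition cmod2 {R : realType} (z : R[i]) : R :=
  complex.Re z ^+ 2 + complex.Im z ^+ 2.
Definition rmx {R : realType} m n (A : 'M[R]_(m, n)) : 'M[R[i]]_(m, n) :=
  map_mx (@rc R) A.
Definition adj {R : realType} m n (A : 'M[R[i]]_(m, n)) : 'M[R[i]]_(n, m) :=
  (map_mx (@cconj R) A)^T.
Definition finner {R : realType} m n (A X : 'M[R[i]]_(m, n)) : R[i] :=
  \tr (adj A *m X).

(* ---------- the DFT matrix (0-based indices: w-1, l-1 in the paper) ----------
   F[w,l] = L^{-1/2} e^{-j 2 pi w l / L} *)
Definition dft {R : realType} (L : nat) : 'M[R[i]]_L :=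
  \matrix_(w < L, l < L)
    (let th := (pi *+ 2 * (w%:R * l%:R) / L%:R : R) in
     rc ((Num.sqrt (L%:R : R))^-1) * Complex (cos th) (- sin th)).

Definition fvec {R : realType} L (l : 'I_L) : 'cV[R[i]]_L := adj (row l (@dft R L)).
Definition bvec {R : realType} L (B : 'M[R]_L) (l : 'I_L) : 'cV[R[i]]_L :=
  adj (rmx B) *m fvec l.
Definition Bhat {R : realType} L (B : 'M[R]_L) : 'M[R[i]]_L := dft L *m rmx B.

Definition cvec {R : realType} L K (Cn : 'M[R]_(L, K)) (l : 'I_L) : 'cV[R[i]]_K :=
  map_mx (@cconj R) (rc (Num.sqrt (L%:R : R)) *: (adj (rmx Cn) *m fvec l)).

(* phi_{l,n} in C^{KN}: equal to c_{l,n} on block n (coordinates n*K + k), 0 elsewhere.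
   Block coordinates are indexed by mxvec_index n k = n*K + k. *)
Definition phivec {R : realType} L N K (Cm : 'I_N -> 'M[R]_(L, K)) (l : 'I_L) (n : 'I_N)
  : 'cV[R[i]]_(N * K) :=
  (mxvec (\matrix_(n' < N, k < K) (if n' == n then cvec (Cm n) l k 0 else 0)))^T.

Definition Aop {R : realType} L N K (B : 'M[R]_L) (Cm : 'I_N -> 'M[R]_(L, K))
  (X : 'M[R[i]]_(L, N * K)) (l : 'I_L) (n : 'I_N) : R[i] :=
  finner (bvec B l *m adj (phivec Cm l n)) X.

(* ---------- nuclear norm, via the singular value decomposition ----------
   X = U Sigma V^* with U, V unitary and Sigma rectangular-diagonal with
   nonnegative (real) diagonal entries (0 <= z in R[i] means z real, z >= 0);
   ||X||_* = sum of the singular values = sum of the entries of Sigma. *)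
Definition unitary {R : realType} n (U : 'M[R[i]]_n) : Prop := U *m adj U = 1%:M.
Definition is_svd_sigma {R : realType} m n (X : 'M[R[i]]_(m, n)) (Sg : 'M[R[i]]_(m, n)) : Prop :=
  exists (U : 'M[R[i]]_m) (V : 'M[R[i]]_n),
    [/\ unitary U, unitary V,
        (forall (i : 'I_m) (j : 'I_n), (i : nat) != j -> Sg i j = 0),
        (forall (i : 'I_m) (j : 'I_n), (i : nat) = j -> 0 <= Sg i j)
      & X = U *m Sg *m adj V].
Definition nuclear_norm {R : realType} m n (X : 'M[R[i]]_(m, n)) : R :=
  complex.Re (\sum_(i < m) \sum_(j < n) (xget 0 (is_svd_sigma X)) i j).

Definition supp {R : realType} L (h : 'cV[R]_L) : {set 'I_L} := [set i | h i 0 != 0].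
Definition IOm {R : realType} L (Om : {set 'I_L}) : 'M[R[i]]_(L, #|Om|) :=
  \matrix_(i < L, j < #|Om|) (if i == enum_val j then 1 else 0).
Definition projP {R : realType} L (Om : {set 'I_L}) n (X : 'M[R[i]]_(L, n)) : 'M[R[i]]_(L, n) :=
  IOm Om *m adj (IOm Om) *m X.
Definition Smat {R : realType} L (B : 'M[R]_L) (Om : {set 'I_L}) (D : {set 'I_L}) : 'M[R[i]]_L :=
  \sum_(l in D) (projP Om (bvec B l) *m adj (projP Om (bvec B l))).
Definition Sred {R : realType} L (B : 'M[R]_L) (Om : {set 'I_L}) (D : {set 'I_L}) :=
  adj (IOm Om) *m Smat B Om D *m IOm Om.
(* S^ddagger (meaningful only when Sred is invertible) *)
Definition Sdag {R : realType} L (B : 'M[R]_L) (Om : {set 'I_L}) (D : {set 'I_L}) : 'M[R[i]]_L :=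
  IOm Om *m invmx (Sred B Om D) *m adj (IOm Om).

Definition is_golf_part L P Q (D : {ffun 'I_P -> {set 'I_L}}) : bool :=
  [&& [forall p, #|D p| == Q],
      [forall p, forall q, (p != q) ==> [disjoint D p & D q]]
    & \bigcup_(p < P) D p == [set: 'I_L]].
Definition golf_parts L N P Q : {set {ffun 'I_N -> {ffun 'I_P -> {set 'I_L}}}} :=
  [set D : {ffun 'I_N -> {ffun 'I_P -> {set 'I_L}}} | [forall n, is_golf_part Q (D n)]].
(* Delta_{n,p+1} with 0-based p (empty if p >= P) *)
Definition Dat L N P (D : {ffun 'I_N -> {ffun 'I_P -> {set 'I_L}}}) (n : 'I_N) (p : nat)
  : {set 'I_L} := if insub p is Some i then D n i else finset.set0.

Definition inf2 {R : realType} L (v : 'cV[R[i]]_L) : R := \big[Num.max/0]_(i < L) cmod2 (v i 0).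
Definition nrm2 {R : realType} n (v : 'cV[R]_n) : R := \sum_(i < n) v i 0 ^+ 2.

Definition sdag_ok {R : realType} L N P (B : 'M[R]_L) (h : 'cV[R]_L)
  (D : {ffun 'I_N -> {ffun 'I_P -> {set 'I_L}}}) : Prop :=
  forall n p, Sred B (supp h) (D n p) \in unitmx.

Definition mu0sq {R : realType} L N P Q (B : 'M[R]_L) (h : 'cV[R]_L)
  (D : {ffun 'I_N -> {ffun 'I_P -> {set 'I_L}}}) : R :=
  let Om := supp h in
  let hc := rmx h in
  L%:R * Num.max (inf2 (Bhat B *m hc) / nrm2 h)
   (Num.max
     ((Q%:R ^+ 2 / L%:R ^+ 2) *
        \big[Num.max/0]_(n < N) \big[Num.max/0]_(p < P)
           (inf2 (Bhat B *m Sdag B Om (D n p) *m hc) / nrm2 h))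
     (\big[Num.max/0]_(n < N) \big[Num.max/0]_(n' < N)
           (inf2 (Bhat B *m Sdag B Om (Dat D n 1) *m Smat B Om (Dat D n' 0) *m hc)
             / nrm2 h))).

Definition mumaxsq {R : realType} L (B : 'M[R]_L) : R :=
  L%:R * \big[Num.max/0]_(w < L) \big[Num.max/0]_(l < L) cmod2 (Bhat B w l).

(* m = (m_1^*, ..., m_N^* )^*, stored as the row vector m^* (m is real), length N*K *)
Definition mrow {R : realType} N K (m : 'I_N -> 'cV[R]_K) : 'rV[R]_(N * K) :=
  mxvec (\matrix_(n < N, k < K) m n k 0).

Definition rho0sq {R : realType} N K (m : 'I_N -> 'cV[R]_K) : R :=
  N%:R * (\big[Num.max/0]_(n < N) nrm2 (m n)) / nrm2 (mrow m)^T.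

Definition gauss_iid {R : realType} {d : measure_display} {T : measurableType d}
  (Pr : probability T R) L N K (Cm : T -> 'I_N -> 'M[R]_(L, K)) (s : R) : Prop :=
  (forall n i k, measurable_fun [set: T] (fun w => Cm w n i k)) /\
  (forall Bs : 'I_N -> 'I_L -> 'I_K -> set R,
     (forall n i k, measurable (Bs n i k)) ->
     Pr [set w : T | forall n i k, Bs n i k (Cm w n i k)]%classic =
     (\prod_(n < N) \prod_(i < L) \prod_(k < K) normal_prob 0 s (Bs n i k))%E).

(* Main.v *)
Require Import Defs.
From HB Require Import structures.
From mathcomp Require Import all_boot all_order all_algebra.
From mathcomp Require Import all_classical all_reals all_analysis.
From mathcomp Require Import measurable_realfun.
From mathcomp Require Import ring lra.
From mathcomp Require Import complex spectral.
Set Implicit Arguments.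
Unset Strict Implicit.
Unset Printing Implicit Defensive.
Import Order.TTheory GRing.Theory Num.Theory.
Import numFieldNormedType.Exports.
Local Open Scope classical_set_scope.
Local Open Scope ring_scope.

(** Apply the orthonormal Hartley transform to the rows of every C_n, and then a rotation of the columns that
    aligns m_n with a coordinate axis: the measurements become functions of an i.i.d. standard Gaussian array
    g(l,n,k), and c_(l,n) is read off g(l) and g(-l). Let e = Bhat h / |h|, p_l = |e_l|^2, a_(l,n) = <c_(l,n), m_n>
    and s_l = |a_l|^2. The dual certificate is exact and explicit, with no golfing iteration: its row l is
    e_l (a_l / s_l + B_l v) expressed in the c_(l,n), where B_l v is the part of (<c_(l,n), v_n>)_n orthogonal to a_l.
    The first tangent condition then holds identically, and the second one is a linear system for
    v in R^(KN), whose matrix sum_l p_l B_l^* B_l is well conditioned orthogonally to m with high probability.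

    The operator norm off the tangent space is controlled by |B_l v|^2 for every l. Since v depends on the data of
    frequency l, it is compared with the solution v0 of the system without the frequencies l and -l: v0 is independent
    of g(l) and g(-l), so its image is small by a Gaussian tail bound, and an energy argument bounds v - v0. All
    random quantities needed are adaptive linear or chi-square Gaussian sums, over a net of the ball of R^K for
    each block, and each is controlled by resampling the coordinates it is linear in. *)

(** * Gaussian families *)

(** A net of the unit ball of R^(KN) would be too large for a union bound; nets of the blocks R^K
    have logarithmic size of order K log K only. The blocks are recombined through their weights:
    block (n, n') of the form [QQ] carries the factor [mu n * mu n'], and as the squares of [mu] sum
    to 1, Cauchy-Schwarz adds up N^2 block errors of size t to a total of order t. The diagonal
    blocks are merely bounded, but they carry [mu n ^+ 2 <= nu], which is where the condition on N
    enters; the coherence of h enters as a bound [w] on the weights p_l.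

    Both conditions have at least one factor alpha_1 more than the concentration estimates consume.
    Once alpha_1 exceeds [Anum beta], this factor pays for all numerical constants, so that C'_beta
    = 1 is enough. It does so as soon as log(LN) >= exp([Anum beta]); below this threshold the
    constant of the O(.), which may depend on beta, makes the probability bound trivial. *)

Section Translation.
Context {R : realType}.
Local Notation mu := (@lebesgue_measure R).
Local Open Scope ereal_scope.

Lemma measurable_shiftr (a : R) : measurable_fun [set: R] (fun x : R => (x + a)%R).
Proof. exact: measurable_funD. Qed.

(** The push-forward under a translation has the right value on half-open intervals, and these
    determine Lebesgue measure. Reflections and dilations are treated in the same way. *)
Lemma lebesgue_shift (a : R) (A : set R) : measurable A ->
  mu [set x | A (x + a)%R] = mu A.
Proof.
move=> mA; apply/esym.
have ms : measurable_fun [set: measurableTypeR R]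
  (fun x : measurableTypeR R => (x + a)%R : measurableTypeR R) by exact: measurable_shiftr.
apply: (@lebesgue_measure_unique R (pushforward mu (fun x : measurableTypeR R => (x + a)%R : measurableTypeR R))) => // X [[u v] _ <-] /=.
rewrite /pushforward /=.
rewrite (_ : _ @^-1` _ = `](u - a)%R, (v - a)%R]%classic); last first.
  by apply/seteqP; split => x /=; rewrite !in_itv/= ltrBlDr lerBrDr.
rewrite !lebesgue_measure_itv/= !lte_fin ltrD2r.
by case: ifP => // _; rewrite -!EFinB; congr EFin; lra.
Qed.

Lemma integral_shift (a : R) (f : R -> \bar R) :
  measurable_fun [set: R] f -> (forall x, 0 <= f x) ->
  \int[mu]_x f (x + a)%R = \int[mu]_x f x.
Proof.
move=> mf f0.
have ms : measurable_fun [set: measurableTypeR R]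
  (fun x : measurableTypeR R => (x + a)%R : measurableTypeR R) by exact: measurable_shiftr.
have := ge0_integral_pushforward ms mu measurableT mf (fun y _ => f0 y).
rewrite preimage_setT => <-.
apply: eq_measure_integral => A mA _; exact: lebesgue_shift.
Qed.

Lemma lebesgue_opp (A : set R) : measurable A -> mu (-%R @^-1` A) = mu A.
Proof.
move=> mA; apply/esym.
have ms : measurable_fun [set: measurableTypeR R]
  (fun x : measurableTypeR R => (- x)%R : measurableTypeR R) by exact: oppr_measurable.
apply: (@lebesgue_measure_unique R (pushforward mu (fun x : measurableTypeR R => (- x)%R : measurableTypeR R))) => // X [[u v] _ <-] /=.
rewrite /pushforward /=.
rewrite (_ : _ @^-1` _ = `[(- v)%R, (- u)%R[%classic); last first.
  by apply/seteqP; split => x /=; rewrite !in_itv/= ltrNr lerNl andbC.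
rewrite !lebesgue_measure_itv/= !lte_fin ltrN2.
by case: ifP => // _; rewrite -!EFinB; congr EFin; lra.
Qed.

Lemma integral_opp (f : R -> \bar R) :
  measurable_fun [set: R] f -> (forall x, 0 <= f x) ->
  \int[mu]_x f (- x)%R = \int[mu]_x f x.
Proof.
move=> mf f0.
have ms : measurable_fun [set: measurableTypeR R]
  (fun x : measurableTypeR R => (- x)%R : measurableTypeR R) by exact: oppr_measurable.
have := ge0_integral_pushforward ms mu measurableT mf (fun y _ => f0 y).
rewrite preimage_setT => <-.
apply: eq_measure_integral => A mA _; exact: lebesgue_opp.
Qed.

Lemma normal_prob_opp (s : R) (A : set R) : s != 0%R -> measurable A ->
  normal_prob 0 s (-%R @^-1` A) = normal_prob 0 s A.
Proof.
move=> s0 mA; rewrite /normal_prob [LHS]integral_mkcond [RHS]integral_mkcond.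
pose f : R -> \bar R := (fun x => (normal_pdf 0 s x)%:E) \_ A.
have mf : measurable_fun [set: R] f.
  have mg : measurable_fun A (fun x : R => (normal_pdf 0 s x)%:E).
    by apply: measurable_funTS; apply/measurable_EFinP; exact: measurable_normal_pdf.
  by apply/(measurable_restrictT _ mA).
have f0 x : 0 <= f x by rewrite /f patchE; case: ifP => // _; rewrite lee_fin normal_pdf_ge0.
refine (etrans _ (integral_opp mf f0)).
apply: eq_integral => x _; rewrite /f !patchE.
have -> : (x \in -%R @^-1` A) = (- x \in A)%R by apply/idP/idP; rewrite !inE.
by case: ifP => // _; rewrite !normal_pdfE// /normal_fun !subr0 sqrrN.
Qed.

End Translation.

Section NormalDensity.
Context {R : realType}.
Local Notation mu := (@lebesgue_measure R).
Local Open Scope ereal_scope.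
Import HBNNSimple.

(** For indicators this is the definition of [normal_prob]; simple functions follow by linearity and
    the general case by monotone convergence on both sides. *)
Lemma ge0_integral_normal_prob (m s : R) (f : R -> \bar R) :
  measurable_fun [set: R] f -> (forall x, 0 <= f x) ->
  \int[normal_prob m s]_x f x = \int[mu]_x (f x * (normal_pdf m s x)%:E).
Proof.
move=> mf f0.
have mg : measurable_fun [set: R] (fun x => (normal_pdf m s x)%:E).
  by apply/measurable_EFinP; exact: measurable_normal_pdf.
have g0 x : 0 <= (normal_pdf m s x)%:E by rewrite lee_fin normal_pdf_ge0.
have mf' : measurable_fun [set: measurableTypeR R] (f : measurableTypeR R -> \bar R) := mf.
pose h := nnsfun_approx measurableT mf'.
have fE x : f x = lim ((EFin \o h n) x @[n --> \oo]).
  by apply/esym/cvg_lim => //; exact: cvg_nnsfun_approx.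
have -> : \int[normal_prob m s]_x f x =
    lim (\int[normal_prob m s]_x (EFin \o h n) x @[n --> \oo]).
  under eq_integral => x _ do rewrite fE.
  apply: monotone_convergence => //.
  - by move=> n; apply/measurable_EFinP/measurable_funP.
  - by move=> n x _; rewrite lee_fin.
  - by move=> x _ a b ab; rewrite lee_fin; exact/lefP/nd_nnsfun_approx.
have -> : \int[mu]_x (f x * (normal_pdf m s x)%:E) =
    lim (\int[mu]_x ((EFin \o h n) x * (normal_pdf m s x)%:E) @[n --> \oo]).
  have H x : f x * (normal_pdf m s x)%:E =
      lim (((EFin \o h n) x * (normal_pdf m s x)%:E) @[n --> \oo]).
    apply/esym/cvg_lim => //; rewrite fE.
    apply: cvgeZr => //.
    by rewrite -fE; exact: cvg_nnsfun_approx.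
  under eq_integral => x _ do rewrite H.
  apply: monotone_convergence => //.
  - move=> n; apply: emeasurable_funM => //.
    by apply/measurable_EFinP/measurable_funP.
  - by move=> n x _; rewrite mule_ge0// lee_fin.
  - move=> x _ a b ab; rewrite lee_wpmul2r// lee_fin.
    exact/lefP/nd_nnsfun_approx.
congr (limn _); apply/funext => n.
have mindic y : measurable (h n @^-1` [set y]) by exact: measurable_sfunP.
have -> : \int[normal_prob m s]_x (EFin \o h n) x =
    \sum_(y \in range (h n)) y%:E * normal_prob m s (h n @^-1` [set y]).
  by rewrite integralT_nnsfun sintegralE.
have -> : \int[mu]_x ((EFin \o h n) x * (normal_pdf m s x)%:E) =
   \int[mu]_x (\sum_(y \in range (h n)) (y * \1_(h n @^-1` [set y]) x)%:E * (normal_pdf m s x)%:E).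
  apply: eq_integral => x _ /=; rewrite fimfunE -fsumEFin//.
  by rewrite ge0_mule_fsuml// => y; rewrite EFinM nnfun_muleindic_ge0.
rewrite ge0_integral_fsum//.
- apply: eq_fsbigr => y /[!inE] -[t _ <-].
  under eq_integral => x _ do rewrite EFinM -muleA.
  rewrite ge0_integralZl//.
  + congr (_ * _); rewrite /normal_prob [LHS]integral_mkcond; apply: eq_integral => x _ /=.
    by rewrite patchE indicE; case: (x \in _); rewrite ?mul1e ?mul0e.
  + apply: emeasurable_funM => //.
    by apply/measurable_EFinP; exact: measurable_indic.
  + by move=> x _; rewrite mule_ge0// lee_fin.
  + by rewrite lee_fin.
- move=> y; apply: emeasurable_funM => //.
  by apply/measurable_EFinP/measurable_funM => //; exact: measurable_indic.
- by move=> y x _; rewrite mule_ge0// EFinM nnfun_muleindic_ge0.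
Qed.

End NormalDensity.

(** A separate name for [I -> R], so that it can carry the sigma-algebra generated by boxes, written
    [Om]. *)
Definition rvec (R : realType) (I : finType) := I -> R.
HB.instance Definition _ (R : realType) (I : finType) := gen_eqMixin (rvec R I).
HB.instance Definition _ (R : realType) (I : finType) := gen_choiceMixin (rvec R I).
HB.instance Definition _ (R : realType) (I : finType) :=
  isPointed.Build (rvec R I) (fun=> 0).

Definition mboxes {R : realType} (I : finType) : set (set (rvec R I)) :=
  [set A | exists2 B : I -> set R, (forall i, measurable (B i)) &
           A = [set x : rvec R I | forall i, B i (x i)]].

Notation Om R I := (g_sigma_algebraType (@mboxes R I)).

Section Law.
Context {R : realType} {I : finType}.
Local Open Scope ereal_scope.

Lemma mboxes_measurable (B : I -> set R) : (forall i, measurable (B i)) ->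
  measurable ([set x | forall i, B i (x i)] : set (Om R I)).
Proof. by move=> mB; apply: sub_sigma_algebra; exists B. Qed.

Lemma measurable_coord (i : I) : measurable_fun [set: Om R I] (fun x : Om R I => x i).
Proof.
move=> _ B mB; rewrite setTI.
rewrite (_ : _ @^-1` _ = [set x : I -> R | forall j, (if j == i then B else setT) (x j)]).
  by apply: (@mboxes_measurable (fun j => if j == i then B else setT)) => j; case: ifP.
apply/seteqP; split => [x /= Bx j|x /= /(_ i)]; last by rewrite eqxx.
by case: eqP => // ->.
Qed.

Lemma measurable_Om d (T : measurableType d) (f : T -> I -> R) :
  (forall i, measurable_fun [set: T] (fun w => f w i)) ->
  measurable_fun [set: T] (f : T -> Om R I).
Proof.
move=> mf; apply: (@measurability _ _ T (Om R I) setT f (@mboxes R I)) => //.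
move=> _ [_ [B mB ->] <-]; rewrite setTI.
rewrite (_ : _ @^-1` _ = \bigcap_(i in [set: I]) ((fun w => f w i) @^-1` (B i))).
  apply: fin_bigcap_measurable => // i _.
  by rewrite -[X in measurable X]setTI; exact: mf.
by apply/seteqP; split => x /= H i; [move=> _; exact: H| exact: H].
Qed.

(** Boxes are closed under intersection and generate the sigma-algebra of [Om], so a finite measure
    is determined by its values on them. *)
Lemma law_unique (m1 m2 : {measure set (Om R I) -> \bar R}) :
  m1 [set: Om R I] < +oo ->
  (forall B : I -> set R, (forall i, measurable (B i)) ->
    m1 [set x | forall i, B i (x i)] = m2 [set x | forall i, B i (x i)]) ->
  forall A, measurable A -> m1 A = m2 A.
Proof.
move=> moo m12 A mA.
apply: (@measure_unique _ R (Om R I) (@mboxes R I) (fun=> setT)) => //.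
- move=> _ _ [B mB ->] [C mC ->]; exists (fun i => B i `&` C i).
    by move=> i; exact: measurableI.
  by apply/seteqP; split => x /=; [move=> [H1 H2] i; split | move=> H; split => i; have [] := H i].
- by move=> i; exists (fun=> setT) => //; apply/seteqP; split.
- by rewrite bigcup_const.
- by move=> _ [B mB ->]; exact: m12.
Qed.

End Law.

Section Iid.
Context {R : realType} {I : finType} (sg : R).
Local Open Scope ereal_scope.

(** [sg] is the standard deviation. The product law is required on boxes only; [law_unique] carries
    it to all measurable sets. *)
Definition iidn d (T : measurableType d) (P : probability T R) (X : T -> rvec R I) :=
  (forall i, measurable_fun [set: T] (fun w => X w i)) /\
  (forall B : I -> set R, (forall i, measurable (B i)) ->
    P [set w | forall i, B i (X w i)] = \prod_i normal_prob 0 sg (B i)).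

Lemma iidn_measurable d (T : measurableType d) (P : probability T R) X :
  iidn P X -> measurable_fun [set: T] (X : T -> Om R I).
Proof. by move=> [mX _]; exact: measurable_Om. Qed.

Lemma measurable_preimageT d d' (T : measurableType d) (T' : measurableType d') (f : T -> T')
  (A : set T') : measurable_fun [set: T] f -> measurable A -> measurable [set w | A (f w)].
Proof. by move=> mf mA; rewrite -[X in measurable X]setTI; exact: mf. Qed.

Definition mix (J : pred I) (x y : rvec R I) : rvec R I := fun i => if J i then x i else y i.

(** On a box the probability factors over the coordinates, so those outside [J] can be taken from an
    independent copy without changing the law. *)
Lemma resample_pair d (T : measurableType d) (P : probability T R) X
   d' (T' : measurableType d') (P' : probability T' R) X' (J : pred I) :
  iidn P X -> iidn P' X' ->
  measurable_fun [set: T * T'] (fun z => mix J (X z.1) (X' z.2) : Om R I) /\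
  forall S : set (Om R I), measurable S ->
  P [set w | S (X w)] = (P \x P') [set z | S (mix J (X z.1) (X' z.2))].
Proof.
move=> iX iX'.
have mX := iidn_measurable iX; have mX' := iidn_measurable iX'.
pose m (z : T * T') : Om R I := mix J (X z.1) (X' z.2).
have mm : measurable_fun setT m.
  apply: measurable_Om => i; rewrite /m /mix; case: (J i).
    by apply: (measurableT_comp (iX.1 i)).
  by apply: (measurableT_comp (iX'.1 i)).
split => // S mS.
apply: (law_unique (m1 := pushforward P (X : T -> Om R I))
   (m2 := pushforward (P \x P') m)) => //=.
  by rewrite /pushforward preimage_setT probability_setT ltry.
move=> B mB; rewrite /pushforward /=.
rewrite (iX.2 B mB).
pose B1 i := if J i then B i else setT.
pose B2 i := if J i then setT else B i.
have mB1 i : measurable (B1 i) by rewrite /B1; case: ifP.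
have mB2 i : measurable (B2 i) by rewrite /B2; case: ifP.
rewrite (_ : _ @^-1` _ = [set w | forall i, B1 i (X w i)] `*` [set w | forall i, B2 i (X' w i)]); last first.
  apply/seteqP; split => [[w w'] /= H|[w w'] /= [H1 H2] i].
    by split => i; have := H i; rewrite /B1 /B2 /m /mix /=; case: (J i).
  by have := H1 i; have := H2 i; rewrite /B1 /B2 /m /mix /=; case: (J i).
rewrite product_measure1E; last 2 first.
- apply: (@measurable_preimageT _ _ T (Om R I) X [set x | forall i, B1 i (x i)]) => //.
  exact: mboxes_measurable.
- apply: (@measurable_preimageT _ _ T' (Om R I) X' [set x | forall i, B2 i (x i)]) => //.
  exact: mboxes_measurable.
apply: (@etrans _ _ ((\prod_i normal_prob 0 sg (B1 i)) * (\prod_i normal_prob 0 sg (B2 i)))); last first.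
  by apply: f_equal2; apply: esym; [exact: iX.2 | exact: iX'.2].
rewrite -big_split/=; apply: eq_bigr => i _.
by rewrite /B1 /B2; case: (J i); rewrite probability_setT ?mule1 ?mul1e.
Qed.

Lemma resample d (T : measurableType d) (P : probability T R) X
   d' (T' : measurableType d') (P' : probability T' R) X' (J : pred I) :
  iidn P X -> iidn P' X' -> forall S : set (Om R I), measurable S ->
  P [set w | S (X w)] = \int[P]_w P' [set w' | S (mix J (X w) (X' w'))].
Proof.
move=> iX iX' S mS; have [mm H] := resample_pair J iX iX'.
rewrite H// /product_measure1 /=; apply: eq_integral => w _; congr (P' _).
by apply/seteqP; split => w' /=; rewrite /xsection /= inE.
Qed.

Lemma resample_int d (T : measurableType d) (P : probability T R) X
   d' (T' : measurableType d') (P' : probability T' R) X' (J : pred I) :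
  iidn P X -> iidn P' X' -> forall F : Om R I -> \bar R,
  measurable_fun [set: Om R I] F -> (forall x, 0 <= F x) ->
  \int[P]_w F (X w) = \int[P]_w \int[P']_w' F (mix J (X w) (X' w')).
Proof.
move=> iX iX' F mF F0; have [mm H] := resample_pair J iX iX'.
have mX := iidn_measurable iX.
have E1 := ge0_integral_pushforward mX P measurableT mF (fun y _ => F0 y).
have E2 := ge0_integral_pushforward mm (P \x P') measurableT mF (fun y _ => F0 y).
rewrite preimage_setT in E1; rewrite preimage_setT in E2.
rewrite /comp in E1 E2; rewrite -E1.
transitivity (\int[pushforward (P \x P') (fun z => mix J (X z.1) (X' z.2) : Om R I)]_y F y).
  by apply: eq_measure_integral => A mA _; exact: H.
rewrite E2 (fubini_tonelli1 (m1 := P) (m2 := P') (fun z => F (mix J (X z.1) (X' z.2))))//.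
exact: (measurableT_comp mF mm).
Qed.

(** The form of conditioning used below: the coordinates in [J] are frozen at an arbitrary value
    [x], and a bound uniform in [x] is integrated. *)
Lemma resample_le d (T : measurableType d) (P : probability T R) X (J : pred I) (dl : \bar R) :
  iidn P X -> forall S : set (Om R I), measurable S ->
  (forall x : rvec R I, P [set w | S (mix J x (X w))] <= dl) -> P [set w | S (X w)] <= dl.
Proof.
move=> iX S mS H; rewrite (resample J iX iX mS).
have d0 : 0 <= dl by apply: le_trans (H point).
apply: (@le_trans _ _ (\int[P]_w cst dl w)).
  case: dl H d0 => [r| |] H d0; [|by rewrite integral_cst//= probability_setT mule1 leey|by []].
  apply: ge0_le_integral => //.
  - have := @measurable_fun_xsection _ _ T T R P.
    pose A := [set z : T * T | S (mix J (X z.1) (X z.2))].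
    have mA : measurable A.
      apply: (@measurable_preimageT _ _ _ (Om R I) (fun z : T * T => mix J (X z.1) (X z.2))) => //.
      apply: measurable_Om => i; rewrite /mix; case: (J i).
        by apply: (measurableT_comp (iX.1 i)).
      by apply: (measurableT_comp (iX.1 i)).
    move=> /(_ A mA); apply: eq_measurable_fun => w _ /=; congr (P _).
    by apply/seteqP; split => w' /=; rewrite /xsection /= inE.
by rewrite integral_cst//= probability_setT mule1.
Qed.

End Iid.

Section ProductDensity.
Context {R : realType} {d : measure_display} {T : measurableType d}.
Local Open Scope ereal_scope.
Variables (mu : {sigma_finite_measure set T -> \bar R})
  (nu : {sigma_finite_measure set T -> \bar R}) (g : T -> R).
Hypothesis mg : measurable_fun [set: T] g.
Hypothesis g0 : forall x, (0 <= g x)%R.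
Hypothesis nuE : forall f : T -> \bar R, measurable_fun [set: T] f ->
  (forall x, 0 <= f x) -> \int[nu]_x f x = \int[mu]_x (f x * (g x)%:E).

Lemma product_density (A : set (T * T)) : measurable A ->
  (nu \x nu) A = \int[mu]_x \int[mu]_y ((\1_A (x, y))%:E * (g x * g y)%:E).
Proof.
move=> mA.
have mi : measurable_fun [set: T * T] (fun z => (\1_A z)%:E : \bar R).
  by apply/measurable_EFinP; exact: measurable_indic.
have i0 z : 0 <= (\1_A z)%:E :> \bar R by rewrite lee_fin.
have -> : (nu \x nu) A = \int[nu \x nu]_z (\1_A z)%:E by rewrite integral_indic// setIT.
rewrite (fubini_tonelli1 (m1 := nu) (m2 := nu))//.
rewrite /fubini_F nuE; last 2 first.
- exact: (measurable_fun_fubini_tonelli_F (m2 := nu) (fun z => (\1_A z)%:E) mi i0).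
- by move=> x; apply: integral_ge0 => y _.
apply: eq_integral => x _.
rewrite nuE; last 2 first.
- exact: (measurableT_comp mi (measurable_pair1 x)).
- by move=> y.
rewrite -ge0_integralZr//.
- by apply: eq_integral => y _; rewrite -muleA -EFinM (mulrC (g y)).
- apply: emeasurable_funM; first exact: (measurableT_comp mi (measurable_pair1 x)).
  exact/measurable_EFinP.
- by move=> y _; rewrite mule_ge0// lee_fin.
- by rewrite lee_fin.
Qed.

End ProductDensity.

(** * Rotation invariance of the Gaussian law *)

Section Rotation2.
Context {R : realType}.
Local Notation mu := (@lebesgue_measure R).
Local Notation RR := (measurableTypeR R).
Local Open Scope ereal_scope.
Implicit Types F : RR * RR -> \bar R.

Lemma integral_shear1 (t : R) F : measurable_fun [set: RR * RR] F -> (forall z, 0 <= F z) ->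
  \int[mu]_x \int[mu]_y F (x, (y + t * x)%R) = \int[mu]_x \int[mu]_y F (x, y).
Proof.
move=> mF F0; apply: eq_integral => x _.
apply: (integral_shift (t * x) (f := fun y => F (x, y))) => //.
exact: (measurableT_comp mF (measurable_pair1 x)).
Qed.

Lemma measurable_shear (u v : R) (a b : R) :
  measurable_fun [set: RR * RR] (fun z : RR * RR => (u * z.1 + v * z.2)%R : RR).
Proof.
apply: (@measurable_funD _ _ R setT (fun z : RR * RR => u * z.1)%R (fun z : RR * RR => v * z.2)%R).
  by apply: measurable_funM; [exact: measurable_cst | exact: measurable_fst].
by apply: measurable_funM; [exact: measurable_cst | exact: measurable_snd].
Qed.

Lemma measurable_linear2 (a b c d : R) :
  measurable_fun [set: RR * RR]
   (fun z : RR * RR => ((a * z.1 + b * z.2)%R : RR, (c * z.1 + d * z.2)%R : RR)).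
Proof. by apply/measurable_fun_pairP; split; exact: measurable_shear. Qed.

Lemma measurable_shear2 (u : R) :
  measurable_fun [set: RR * RR] (fun z : RR * RR => ((z.1 + u * z.2)%R : RR, z.2)).
Proof.
apply: eq_measurable_fun (measurable_linear2 1 u 0 1) => -[x y] _ /=.
by rewrite !mul1r mul0r add0r.
Qed.

Lemma measurable_shear1 (u : R) :
  measurable_fun [set: RR * RR] (fun z : RR * RR => (z.1, (z.2 + u * z.1)%R : RR)).
Proof.
apply: eq_measurable_fun (measurable_linear2 1 0 u 1) => -[x y] _ /=.
by rewrite !mul1r mul0r addr0 addrC.
Qed.

Lemma integral_shear2 (t : R) F : measurable_fun [set: RR * RR] F -> (forall z, 0 <= F z) ->
  \int[mu]_x \int[mu]_y F ((x + t * y)%R, y) = \int[mu]_x \int[mu]_y F (x, y).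
Proof.
move=> mF F0.
have mG := measurableT_comp mF (measurable_shear2 t).
have G0 z : 0 <= (F \o (fun z : RR * RR => ((z.1 + t * z.2)%R : RR, z.2))) z by exact: F0.
refine (etrans (fubini_tonelli (m1 := mu) (m2 := mu) _ mG G0) _).
refine (etrans _ (esym (fubini_tonelli (m1 := mu) (m2 := mu) F mF F0))).
apply: eq_integral => y _.
apply: (integral_shift (t * y) (f := fun x => F (x, y))) => //.
exact: (measurableT_comp mF (measurable_pair2 y)).
Qed.

Lemma integral_rot (c s : R) F : (c ^+ 2 + s ^+ 2 = 1)%R -> s != 0%R ->
  measurable_fun [set: RR * RR] F -> (forall z, 0 <= F z) ->
  \int[mu]_x \int[mu]_y F ((c * x - s * y)%R, (s * x + c * y)%R) = \int[mu]_x \int[mu]_y F (x, y).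
Proof.
(* For [c = cos a] and [s = sin a] this is [- tan (a / 2)], the parameter for which the shears [t],
   [s], [t] compose to the rotation. *)
move=> cs s0 mF F0; pose t : R := ((c - 1) / s)%R.
have mF1 := measurableT_comp mF (measurable_shear2 t).
have mF2 := measurableT_comp mF1 (measurable_shear1 s).
refine (etrans _ (integral_shear2 t mF F0)).
refine (etrans _ (integral_shear1 s mF1 (fun z => F0 _))).
refine (etrans _ (integral_shear2 t mF2 (fun z => F0 _))).
apply: eq_integral => x _; apply: eq_integral => y _.
have ts : (t * s = c - 1)%R by rewrite /t divfK.
have tc : (t * (1 + c) = - s)%R.
  apply: (mulIf s0); rewrite mulrAC ts.
  have -> : ((c - 1) * (1 + c) = c ^+ 2 - 1)%R by ring.
  by rewrite -cs; ring.
congr (F (_, _)) => /=.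
  have -> : (x + t * y + t * (y + s * (x + t * y)) = (1 + t * s) * x + (t * (1 + (1 + t * s)))  * y)%R by ring.
  by rewrite ts (addrC 1%R (c - 1)%R) subrK tc; ring.
have -> : (y + s * (x + t * y) = s * x + (1 + t * s) * y)%R by ring.
by rewrite ts (addrC 1%R (c - 1)%R) subrK.
Qed.

Variable sg : R.
Hypothesis sg0 : sg != 0%R.
Local Notation nu := (normal_prob 0 sg).

(** The product density depends on [x ^+ 2 + y ^+ 2] only, so the rotation invariance of Lebesgue
    measure suffices. *)
Lemma normal_prob_rot (c s : R) (A : set (RR * RR)) : (c ^+ 2 + s ^+ 2 = 1)%R ->
  s != 0%R -> measurable A ->
  (nu \x nu) [set z | A ((c * z.1 - s * z.2)%R, (s * z.1 + c * z.2)%R)] = (nu \x nu) A.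
Proof.
move=> cs s0 mA.
have mr := measurable_linear2 c (- s) s c.
have mA' : measurable [set z : RR * RR | A ((c * z.1 - s * z.2)%R, (s * z.1 + c * z.2)%R)].
  rewrite (_ : mkset _ = [set z : RR * RR | A ((c * z.1 + - s * z.2)%R, (s * z.1 + c * z.2)%R)]).
    exact: (measurable_preimageT mr mA).
  by apply/seteqP; split => z /=; rewrite mulNr.
have mg : measurable_fun [set: RR] (normal_pdf 0 sg) by exact: measurable_normal_pdf.
have HP := product_density (mu := mu) (nu := nu) mg (normal_pdf_ge0 0 sg)
  (@ge0_integral_normal_prob R 0 sg).
refine (etrans (HP _ mA') (etrans _ (esym (HP _ mA)))).
pose F (z : RR * RR) : \bar R := (\1_A z)%:E * (normal_pdf 0 sg z.1 * normal_pdf 0 sg z.2)%:E.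
have mF : measurable_fun setT F.
  apply: emeasurable_funM; first by apply/measurable_EFinP; exact: measurable_indic.
  apply/measurable_EFinP; apply: measurable_funM.
    exact: (measurableT_comp mg measurable_fst).
  exact: (measurableT_comp mg measurable_snd).
have F0 z : 0 <= F z.
  by apply: mule_ge0; rewrite lee_fin// mulr_ge0// normal_pdf_ge0.
refine (etrans _ (integral_rot cs s0 mF F0)).
apply: eq_integral => x _; apply: eq_integral => y _; rewrite /F /=.
congr (_ * _); congr EFin.
rewrite !normal_pdfE// mulrACA [RHS]mulrACA; congr (_ * _)%R.
rewrite /normal_fun !subr0 -!expRD; congr expR.
rewrite -!mulrDl; congr (_ / _)%R.
rewrite -!opprD; congr (- _)%R.
transitivity ((c ^+ 2 + s ^+ 2) * (x ^+ 2 + y ^+ 2))%R; first by rewrite cs mul1r.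
by ring.
Qed.

End Rotation2.

Section Givens.
Context {R : realType} {I : finType} (sg : R).
Hypothesis sg0 : sg != 0.
Local Open Scope ereal_scope.
Local Notation RR := (measurableTypeR R).
Local Notation nu := (normal_prob 0 sg).

Definition law_inv (f : rvec R I -> rvec R I) :=
  forall d (T : measurableType d) (P : probability T R) (X : T -> rvec R I),
    iidn sg P X -> iidn sg P (f \o X).

Lemma iidn_pair d (T : measurableType d) (P : probability T R) (X : T -> rvec R I) (i j : I) : i != j ->
  iidn sg P X -> forall A : set (RR * RR), measurable A ->
  P [set w | A (X w i, X w j)] = (nu \x nu) A.
Proof.
move=> ij iX A mA.
have mp : measurable_fun [set: T] (fun w => (X w i : RR, X w j : RR)).
  by apply/measurable_fun_pairP; split; exact: iX.1.
apply: esym.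
apply: (@product_measure_unique _ _ RR RR R nu nu (pushforward P (fun w => (X w i : RR, X w j : RR)))) => //.
move=> A1 A2 mA1 mA2.
pose B k := if k == i then A1 else if k == j then A2 else setT.
have mB k : measurable (B k) by rewrite /B; do 2 case: ifP => // _.
apply: (@etrans _ _ (P [set w | forall k, B k (X w k)])).
  congr (P _); apply/seteqP; split => [w /= [H1 H2] k|w /= H].
    by rewrite /B; do 2 case: eqP => [->//|_].
  split; first by have := H i; rewrite /B eqxx.
  by have := H j; rewrite /B eqxx eq_sym (negbTE ij).
apply: (etrans (iX.2 _ mB)).
rewrite (bigD1 i)//= (bigD1 j) 1?eq_sym//= big1 ?mule1.
  by rewrite /B !eqxx eq_sym (negbTE ij).
move=> k /andP[ki kj]; rewrite /B (negbTE ki) (negbTE kj).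
exact: (@probability_setT _ _ _ nu).
Qed.

Definition givens (i j : I) (c s : R) (x : rvec R I) : rvec R I := fun k =>
  if k == i then (c * x i - s * x j)%R else if k == j then (s * x i + c * x j)%R else x k.

Lemma measurable_givens i j c s : measurable_fun [set: Om R I] (givens i j c s : Om R I -> Om R I).
Proof.
apply: measurable_Om => k; rewrite /givens; case: (k == i); [|case: (k == j)].
- by apply: measurable_funB; apply: measurable_funM => //; exact: measurable_coord.
- by apply: measurable_funD; apply: measurable_funM => //; exact: measurable_coord.
- exact: measurable_coord.
Qed.

Lemma law_inv_of_sets (f : rvec R I -> rvec R I) :
  measurable_fun [set: Om R I] (f : Om R I -> Om R I) ->
  (forall d (T : measurableType d) (P : probability T R) (X : T -> rvec R I),
    iidn sg P X -> forall S : set (Om R I), measurable S ->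
    P [set w | S (f (X w))] = P [set w | S (X w)]) -> law_inv f.
Proof.
move=> mf H d T P X iX; split=> [i|B mB].
  have mX := iidn_measurable iX.
  exact: (measurableT_comp (measurable_coord i) (measurableT_comp mf mX)).
rewrite -(iX.2 B mB).
exact: (H _ _ _ _ iX [set x | forall i, B i (x i)] (mboxes_measurable mB)).
Qed.

(** All coordinates other than [i] and [j] are frozen by resampling; what remains concerns one pair
    of coordinates and is [normal_prob_rot]. *)
Lemma givens_inv i j c s : i != j -> (c ^+ 2 + s ^+ 2 = 1)%R -> s != 0%R ->
  law_inv (givens i j c s).
Proof.
move=> ij cs s0; have mg := measurable_givens i j c s.
apply: law_inv_of_sets => // d T P X iX S mS.
have mS' : measurable [set x : Om R I | S (givens i j c s x)].
  exact: (measurable_preimageT mg mS).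
pose J : pred I := fun k => (k != i) && (k != j).
refine (etrans (resample J iX iX mS') (etrans _ (esym (resample J iX iX mS)))).
apply: eq_integral => w _; set x := X w.
pose upd (z : RR * RR) : Om R I := fun k => if k == i then z.1 else if k == j then z.2 else x k.
have mupd : measurable_fun [set: RR * RR] upd.
  by apply: measurable_Om => k; rewrite /upd; case: (k == i); [|case: (k == j)] => //; exact: measurable_snd || exact: measurable_fst.
have mA : measurable [set z | S (upd z)] by exact: (measurable_preimageT mupd mS).
have E1 y : mix J x y = upd (y i, y j).
  apply/funext => k; rewrite /mix /upd /J.
  by case: (eqVneq k i) => [->//|ki] /=; case: (eqVneq k j) => [->|].
have E2 y : givens i j c s (mix J x y) = upd ((c * y i - s * y j)%R, (s * y i + c * y j)%R).
  rewrite E1; apply/funext => k; rewrite /givens /upd /= !eqxx (eq_sym j i) (negbTE ij).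
  by case: (k == i) => //; case: (k == j).
transitivity (P [set w' | [set z : RR * RR | [set z | S (upd z)] ((c * z.1 - s * z.2)%R, (s * z.1 + c * z.2)%R)] (X w' i, X w' j)]).
  by congr (P _); apply/seteqP; split => w' /=; rewrite E2.
transitivity (P [set w' | [set z | S (upd z)] (X w' i, X w' j)]); last first.
  by congr (P _); apply/seteqP; split => w' /=; rewrite E1.
rewrite (iidn_pair ij iX mA) -(normal_prob_rot sg0 cs s0 mA).
apply: (iidn_pair ij iX).
rewrite (_ : mkset _ = [set z : RR * RR | [set z | S (upd z)] ((c * z.1 + - s * z.2)%R, (s * z.1 + c * z.2)%R)]).
  exact: (measurable_preimageT (measurable_linear2 c (- s) s c) mA).
by apply/seteqP; split => z /=; rewrite mulNr.
Qed.

Definition flip (i : I) (x : rvec R I) : rvec R I := fun k => if k == i then (- x i)%R else x k.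

Lemma flip_inv i : law_inv (flip i).
Proof.
have mf : measurable_fun [set: Om R I] (flip i : Om R I -> Om R I).
  apply: measurable_Om => k; rewrite /flip; case: (k == i); last exact: measurable_coord.
  by apply: measurableT_comp => //; exact: measurable_coord.
move=> d T P X iX; have mX := iidn_measurable iX; split=> [k|B mB].
  exact: (measurableT_comp (measurable_coord k) (measurableT_comp mf mX)).
pose B' k := if k == i then -%R @^-1` (B k) else B k.
have mN (A : set R) : measurable A -> measurable (-%R @^-1` A).
  by move=> mA; rewrite -[X in measurable X]setTI; exact: oppr_measurable.
have mB' k : measurable (B' k) by rewrite /B'; case: ifP => // _; exact: mN.
rewrite (_ : mkset _ = [set w | forall k, B' k (X w k)]); last first.
  by apply/seteqP; split => w /= H k; have := H k; rewrite /B' /flip /=; case: eqP => // ->.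
apply: (etrans (iX.2 _ mB')); apply: eq_bigr => k _; rewrite /B'; case: ifP => // _.
exact: normal_prob_opp.
Qed.

Lemma law_inv_comp f g : law_inv f -> law_inv g -> law_inv (f \o g).
Proof. by move=> fi gi d T P X iX; have := fi _ _ _ _ (gi _ _ _ _ iX). Qed.

End Givens.

Section Orthogonal.
Context {R : realType} {I : finType} (sg : R).
Hypothesis sg0 : sg != 0.
Implicit Types (x y u : rvec R I) (O : I -> rvec R I).

Definition dot x y : R := \sum_i x i * y i.

Lemma dotC x y : dot x y = dot y x.
Proof. by apply: eq_bigr => i _; rewrite mulrC. Qed.

Lemma dotDl x y u : dot (fun i => x i + y i) u = dot x u + dot y u.
Proof. by rewrite /dot -big_split/=; apply: eq_bigr => i _; rewrite mulrDl. Qed.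

Lemma dotZl a x u : dot (fun i => a * x i) u = a * dot x u.
Proof. by rewrite /dot mulr_sumr; apply: eq_bigr => i _; rewrite mulrA. Qed.

Lemma dotDr x y u : dot u (fun i => x i + y i) = dot u x + dot u y.
Proof. by rewrite dotC dotDl !(dotC u). Qed.

Lemma dotZr a x u : dot u (fun i => a * x i) = a * dot u x.
Proof. by rewrite dotC dotZl (dotC u). Qed.

Lemma dot_ge0 x : 0 <= dot x x.
Proof. by apply: sumr_ge0 => i _; rewrite -expr2 sqr_ge0. Qed.

Lemma dot_eq0 x : dot x x = 0 -> forall i, x i = 0.
Proof.
move=> /psumr_eq0P => H i; have /eqP := H (fun i _ => ltac:(by rewrite -expr2 sqr_ge0)) i isT.
by rewrite -expr2 sqrf_eq0 => /eqP.
Qed.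

Definition ebase (k : I) : rvec R I := fun i => (i == k)%:R.

Lemma dot_ebase x k : dot x (ebase k) = x k.
Proof.
rewrite /dot (bigD1 k)//= big1 ?addr0; first by rewrite /ebase eqxx mulr1.
by move=> i ik; rewrite /ebase (negbTE ik) mulr0.
Qed.

Lemma givens_dot i j c s x y : i != j -> c ^+ 2 + s ^+ 2 = 1 ->
  dot (givens i j c s x) (givens i j c s y) = dot x y.
Proof.
move=> ij cs; rewrite /dot (bigD1 i)//= (bigD1 j) 1?eq_sym//= [RHS](bigD1 i)//= [in RHS](bigD1 j) 1?eq_sym//=.
rewrite !addrA; congr (_ + _); last first.
  by apply: eq_bigr => k /andP[ki kj]; rewrite /givens (negbTE ki) (negbTE kj).
rewrite /givens !eqxx (eq_sym j i) (negbTE ij).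
transitivity ((c ^+ 2 + s ^+ 2) * (x i * y i + x j * y j)); first by ring.
by rewrite cs mul1r.
Qed.

Lemma givensK i j c s x : i != j -> c ^+ 2 + s ^+ 2 = 1 ->
  givens i j c (- s) (givens i j c s x) = x.
Proof.
move=> ij cs; apply/funext => k; rewrite /givens !eqxx (eq_sym j i) (negbTE ij).
case: eqP => [->|_].
  transitivity ((c ^+ 2 + s ^+ 2) * x i); [by ring|by rewrite cs mul1r].
case: eqP => [->|//].
transitivity ((c ^+ 2 + s ^+ 2) * x j); [by ring|by rewrite cs mul1r].
Qed.

Lemma givensB i j c s a x y :
  givens i j c s (fun k => x k - a * y k) =
  (fun k => givens i j c s x k - a * givens i j c s y k).
Proof.
apply/funext => k; rewrite /givens; case: (k == i); first by ring.
by case: (k == j) => //; ring.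
Qed.

(** The Householder reflection in the hyperplane orthogonal to [u]. *)
Definition refl u x : rvec R I := fun i => x i - (2 * dot u x / dot u u) * u i.

Lemma refl_flip i0 u : u i0 != 0 -> (forall j, j != i0 -> u j = 0) -> refl u = flip i0.
Proof.
move=> u0 uj; apply/funext => x; apply/funext => k; rewrite /refl /flip.
have E y : dot u y = u i0 * y i0.
  by rewrite /dot (bigD1 i0)//= big1 ?addr0// => j /uj ->; rewrite mul0r.
rewrite !E; case: eqP => [->|/eqP /uj ->]; last by rewrite mulr0 subr0.
by field; rewrite u0.
Qed.

(** A rotation in the plane of [i0] and [j] moves the [(i0, j)] part of [u] onto [i0]. Conjugation
    by it replaces [u] by a vector that vanishes at [j] and is unchanged away from [i0] and [j]. *)
Lemma refl_givens u i0 j : i0 != j -> u j != 0 ->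
  exists c s, [/\ c ^+ 2 + s ^+ 2 = 1, s != 0, givens i0 j c s u j = 0,
    givens i0 j c s u i0 != 0 &
    refl u = givens i0 j c (- s) \o refl (givens i0 j c s u) \o givens i0 j c s].
Proof.
move=> ij uj.
pose r := Num.sqrt (u i0 ^+ 2 + u j ^+ 2).
have r2 : r ^+ 2 = u i0 ^+ 2 + u j ^+ 2 by rewrite sqr_sqrtr// addr_ge0// sqr_ge0.
have r0 : r != 0.
  rewrite -(sqrf_eq0 r) r2 gt_eqF// ltr_wpDl ?sqr_ge0//.
  by rewrite lt0r sqrf_eq0 uj sqr_ge0.
have cs : (u i0 / r) ^+ 2 + (- u j / r) ^+ 2 = 1.
  rewrite !exprMn sqrrN -mulrDl exprVn -r2 divff//.
  by rewrite sqrf_eq0.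
exists (u i0 / r), (- u j / r); split => //.
- by rewrite mulf_neq0// ?oppr_eq0// invr_eq0.
- rewrite /givens eqxx eq_sym (negbTE ij); field; exact: r0.
- rewrite /givens eqxx (_ : _ - _ = r); first exact: r0.
  apply: (mulIf r0); rewrite -expr2 r2; field; exact: r0.
- apply/funext => x /=; rewrite /refl.
  by rewrite givensB !givens_dot// !givensK.
Qed.

(** Induction on the number of nonzero coordinates of [u] away from [i0]: [refl_givens] removes one
    of them, and when none is left the reflection is a sign change. *)
Lemma refl_inv u : (exists i, u i != 0) -> law_inv sg (refl u).
Proof.
move=> [i0 ui0].
have [n] := ubnP #|[pred j | (j != i0) && (u j != 0)]|.
elim: n u ui0 => // n IH u ui0 un.
have [/existsP[j /andP[ji uj]]|/existsPn H] := boolP [exists j, (j != i0) && (u j != 0)].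
  rewrite eq_sym in ji.
  have [c [s [cs s0 g1 g2 ->]]] := refl_givens ji uj.
  apply: law_inv_comp; last exact: givens_inv.
  apply: law_inv_comp; first by apply: givens_inv; rewrite ?sqrrN ?oppr_eq0.
  apply: IH => //; rewrite ltnS in un; apply: leq_trans un.
  apply: proper_card; apply/properP; split.
    apply/fintype.subsetP => k; rewrite !inE => /andP[ki]; rewrite ki /=.
    apply: contraNneq => uk; apply/eqP; rewrite /givens (negbTE ki).
    have [kj|//] := eqVneq k j.
    by move: g1; rewrite /givens eqxx eq_sym (negbTE ji).
  exists j; rewrite !inE; first by rewrite eq_sym ji.
  by rewrite g1 eqxx andbF.
rewrite (refl_flip ui0); first exact: flip_inv.
by move=> j ji; apply/eqP; have := H j; rewrite ji/= negbK.
Qed.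

Lemma refl_dot u x y : (exists i, u i != 0) -> dot (refl u x) (refl u y) = dot x y.
Proof.
move=> [i ui].
have u0 : dot u u != 0 by apply: contraNneq ui => /dot_eq0 ->.
have E x1 a y1 : (fun i => x1 i - a * y1 i) = (fun i => x1 i + (- a) * y1 i) :> rvec R I.
  by apply/funext => k; rewrite mulNr.
rewrite /refl !E dotDl !dotDr !dotZl !dotZr (dotC x u); field; exact: u0.
Qed.

Lemma reflK u x : (exists i, u i != 0) -> refl u (refl u x) = x.
Proof.
move=> [i ui].
have u0 : dot u u != 0 by apply: contraNneq ui => /dot_eq0 ->.
have E x1 a y1 : (fun i => x1 i - a * y1 i) = (fun i => x1 i + (- a) * y1 i) :> rvec R I.
  by apply/funext => k; rewrite mulNr.
apply/funext => k; rewrite {1}/refl.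
have -> : dot u (refl u x) = - dot u x by rewrite /refl E dotDr dotZr; field; exact: u0.
by rewrite /refl; field; exact: u0.
Qed.

Definition lin O x : rvec R I := fun i => dot (O i) x.

Definition col O k : rvec R I := fun i => O i k.
Definition orthog O := forall j k, dot (col O j) (col O k) = (j == k)%:R.

Lemma lin_id O x : (forall k, col O k = ebase k) -> lin O x = x.
Proof.
move=> H; apply/funext => i; rewrite /lin -[RHS]dot_ebase dotC; congr dot.
by apply/funext => k; have := congr1 (fun f => f i) (H k); rewrite /col /ebase eq_sym.
Qed.

Lemma refl_lin u O x : refl u (lin O x) = lin (fun i j => refl u (col O j) i) x.
Proof.
apply/funext => i; rewrite /lin {1}/refl.
have -> : dot u (lin O x) = \sum_j dot u (col O j) * x j.
  rewrite /dot /lin /dot.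
  under eq_bigr do rewrite mulr_sumr.
  rewrite exchange_big /=; apply: eq_bigr => j _; rewrite mulr_suml; apply: eq_bigr => k _.
  by rewrite mulrA.
rewrite [RHS]/dot /refl.
under [RHS]eq_bigr do rewrite mulrBl.
rewrite sumrB; congr (_ - _).
rewrite !mulr_sumr !mulr_suml; apply: eq_bigr => j _.
by rewrite -!mulrA; congr (_ * (_ * _)); rewrite mulrC -mulrA.
Qed.

(* Induction on the number of basis vectors that O moves: the reflection sending [col O k] to the k-th
   basis vector fixes those already fixed. Reflections in turn are conjugates by Givens rotations of a
   sign change, and a plane rotation is a product of three shears, which preserve Lebesgue measure. *)
Theorem orthog_inv O : orthog O -> law_inv sg (lin O).
Proof.
have [n] := ubnP #|[pred k | ~~ `[< col O k = ebase k >]]|.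
elim: n O => // n IH O nO oO.
have [/existsP[k nk]|/existsPn H] := boolP [exists k, ~~ `[< col O k = ebase k >]]; last first.
  have -> : lin O = id.
    by apply/funext => x; apply: lin_id => k; apply/asboolP; have := H k; rewrite negbK.
  by move=> d T P X.
pose u : rvec R I := fun i => col O k i - ebase k i.
have u0 : exists i, u i != 0.
  apply/existsP; apply: contraNT nk => /existsPn H; apply/asboolP/funext => i.
  by apply/eqP; rewrite -subr_eq0; have := H i; rewrite negbK.
have uu0 : dot u u != 0 by have [i ui] := u0; apply: contraNneq ui => /dot_eq0 ->.
have uE : u = (fun i => col O k i + (-1) * ebase k i) by apply/funext => i; rewrite mulN1r.
have uD x : dot u x = dot (col O k) x - dot (ebase k) x.
  by rewrite uE dotDl dotZl mulN1r.
have Huk : refl u (col O k) = ebase k.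
  have uuE : dot u u = 2 * dot u (col O k).
    rewrite uD (dotC _ u) (dotC _ u) !uD oO eqxx (dotC (ebase k) (col O k)) !dot_ebase.
    by rewrite /ebase eqxx; ring.
  apply/funext => i; rewrite /refl -uuE divff// mul1r /u; ring.
have Huj j : col O j = ebase j -> refl u (col O j) = ebase j.
  move=> Hj; apply/funext => i; rewrite /refl.
  suff -> : dot u (col O j) = 0 by rewrite mulr0 mul0r mul0r subr0 Hj.
  rewrite uD oO Hj dot_ebase /ebase (eq_sym j k); ring.
pose O' i j := refl u (col O j) i.
have cO' j : col O' j = refl u (col O j) by [].
have -> : lin O = refl u \o lin O'.
  by apply/funext => x /=; rewrite /O' -refl_lin reflK.
apply: law_inv_comp; first exact: refl_inv.
apply: IH => [|j1 j2]; last by rewrite !cO' refl_dot.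
rewrite ltnS in nO; apply: leq_trans nO.
apply: proper_card; apply/properP; split.
  apply/fintype.subsetP => j; rewrite !inE; apply: contraNN => /asboolP/Huj E.
  by apply/asboolP; rewrite cO'.
exists k; rewrite !inE//= negbK; apply/asboolP; by rewrite cO'.
Qed.

End Orthogonal.

(** * Exponential moments of the normal law *)

Section Mgf.
Context {R : realType}.
Local Open Scope ereal_scope.
Local Notation nu := (normal_prob (0 : R) 1).
Local Notation mu := (@lebesgue_measure R).

Lemma integral_normal_prob_exp (f : R -> R) : measurable_fun [set: R] f ->
  \int[nu]_x (expR (f x))%:E = \int[mu]_x (expR (f x) * normal_pdf 0 1 x)%:E.
Proof.
move=> mf; apply: (@etrans _ _ (\int[mu]_x ((expR (f x))%:E * (normal_pdf 0 1 x)%:E))) => //.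
apply: (@ge0_integral_normal_prob R 0 1 (fun x => (expR (f x))%:E)) => //.
by apply/measurable_EFinP; exact: (measurableT_comp (@measurable_expR R) mf).
Qed.

Lemma integralZl_exp (a : R) (f : R -> R) : measurable_fun [set: R] f ->
  \int[nu]_x ((expR a)%:E * (expR (f x))%:E) = (expR a)%:E * \int[nu]_x (expR (f x))%:E.
Proof.
move=> mf; apply: ge0_integralZl => //.
- by apply/measurable_EFinP; exact: (measurableT_comp (@measurable_expR R) mf).
Qed.

Lemma integral_cst_pdf (a m s : R) : (0 <= a)%R ->
  \int[mu]_x (a * normal_pdf m s x)%:E = a%:E.
Proof.
move=> a0; under eq_integral => x _ do rewrite EFinM.
rewrite ge0_integralZl//; first by rewrite integral_normal_pdf mule1.
- by apply/measurable_EFinP; exact: measurable_normal_pdf.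
- by move=> x _; rewrite lee_fin normal_pdf_ge0.
Qed.

Lemma mgf_linear (t : R) : \int[nu]_x (expR (t * x))%:E = (expR (t ^+ 2 / 2))%:E.
Proof.
rewrite integral_normal_prob_exp; last by apply: measurable_funM => //; exact: measurable_id.
rewrite -[RHS](@integral_cst_pdf _ t 1 (expR_ge0 _)); apply: eq_integral => x _; congr EFin.
rewrite !normal_pdfE ?oner_eq0// mulrCA [RHS]mulrCA; congr (_ * _)%R.
by rewrite /normal_fun -!expRD; congr expR; field.
Qed.

(** The integrand times the density is a multiple of the normal density of variance
    [(1 - 2 * l)^-1]. *)
Lemma mgf_square (l : R) : (l < 2^-1)%R ->
  \int[nu]_x (expR (l * x ^+ 2))%:E = ((Num.sqrt (1 - 2 * l))^-1)%:E.
Proof.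
move=> l2; have q0 : (0 < 1 - 2 * l)%R by lra.
rewrite integral_normal_prob_exp; last first.
  by apply: measurable_funM => //; apply: measurable_funX; exact: measurable_id.
pose s : R := ((Num.sqrt (1 - 2 * l))^-1)%R.
have s0 : (0 < s)%R by rewrite invr_gt0 sqrtr_gt0.
have s2 : (s ^+ 2 = (1 - 2 * l)^-1)%R by rewrite exprVn sqr_sqrtr// ltW.
rewrite -[RHS](@integral_cst_pdf _ 0 s (ltW s0)); apply: eq_integral => x _; congr EFin.
rewrite !normal_pdfE ?oner_eq0 ?gt_eqF//.
have -> : normal_peak 1 = (s * normal_peak s)%R.
  rewrite /normal_peak expr1n mul1r -mulrnAr sqrtrM ?sqr_ge0// sqrtr_sqr gtr0_norm//.
  by rewrite invfM mulrA divff ?mul1r// gt_eqF.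
rewrite mulrCA -mulrA; congr (_ * (_ * _))%R.
rewrite /normal_fun -!expRD; congr expR; rewrite !subr0 s2.
by field; rewrite gt_eqF.
Qed.

(** After squaring, the claim is [expR (- (2 * l + 4 * l ^+ 2)) <= 1 - 2 * l], which follows from
    [1 + y <= expR y] at [y = l + 2 * l ^+ 2]. *)
Lemma mgf_square_le (l : R) : (`|l| <= 8^-1)%R ->
  \int[nu]_x (expR (l * (x ^+ 2 - 1)))%:E <= (expR (2 * l ^+ 2))%:E.
Proof.
rewrite ler_norml => /andP[l1 l2].
have q0 : (0 < 1 - 2 * l)%R by lra.
have -> : \int[nu]_x (expR (l * (x ^+ 2 - 1)))%:E =
    \int[nu]_x ((expR (- l))%:E * (expR (l * x ^+ 2))%:E).
  apply: eq_integral => x _; rewrite -EFinM -expRD; congr (EFin (expR _)); ring.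
rewrite integralZl_exp; last first.
  by apply: measurable_funM => //; apply: measurable_funX; exact: measurable_id.
rewrite mgf_square; last by lra.
rewrite -EFinM lee_fin ler_pdivrMr ?sqrtr_gt0//.
suff H : (expR (- (2 * l + 4 * l ^+ 2)) <= 1 - 2 * l)%R.
  have e0 := expR_gt0 (2 * l ^+ 2 + l).
  have -> : (expR (- l) = expR (2 * l ^+ 2) * expR (- (2 * l ^+ 2 + l)))%R.
    by rewrite -expRD; congr expR; ring.
  rewrite ler_pM2l ?expR_gt0// -(@ler_pXn2r _ 2) ?nnegrE ?expR_ge0 ?sqrtr_ge0//.
  rewrite sqr_sqrtr ?(ltW q0)// -expRM_natl; apply: le_trans H; rewrite ler_expR; lra.
rewrite expRN -div1r ler_pdivrMr ?expR_gt0//.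
pose y := (l + 2 * l ^+ 2)%R.
have -> : (expR (2 * l + 4 * l ^+ 2) = expR y ^+ 2)%R.
  by rewrite -expRM_natl; congr expR; rewrite /y; ring.
have y1 : (1 + y <= expR y)%R by exact: expR_ge1Dx.
have l22 : (l ^+ 2 <= 64^-1)%R by nra.
have y0 : (0 <= 1 + y)%R by rewrite /y; nra.
have H2 : ((1 + y) ^+ 2 <= expR y ^+ 2)%R by rewrite ler_pXn2r ?nnegrE ?expR_ge0.
apply: (@le_trans _ _ ((1 - 2 * l) * (1 + y) ^+ 2)%R); last by rewrite ler_pM2l.
have -> : ((1 - 2 * l) * (1 + y) ^+ 2 = 1 + l ^+ 2 * (1 - 6 * l - 4 * l ^+ 2 - 8 * l ^+ 3))%R.
  by rewrite /y; ring.
rewrite lerDl mulr_ge0 ?sqr_ge0//.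
have : (l ^+ 3 <= 512^-1)%R.
  have -> : (l ^+ 3 = l * l ^+ 2)%R by ring.
  have := sqr_ge0 l; nra.
nra.
Qed.

Lemma mgf_square_le2 (l : R) : (0 <= l)%R -> (l <= 8^-1)%R ->
  \int[nu]_x (expR (l * x ^+ 2))%:E <= (expR (2 * l))%:E.
Proof.
move=> l0 l8.
have H : (`|l| <= 8^-1)%R by rewrite ger0_norm.
have -> : \int[nu]_x (expR (l * x ^+ 2))%:E =
    \int[nu]_x ((expR l)%:E * (expR (l * (x ^+ 2 - 1)))%:E).
  apply: eq_integral => x _; rewrite -EFinM -expRD; congr (EFin (expR _)); ring.
rewrite integralZl_exp; last first.
  by apply: measurable_funM => //; apply: measurable_funB.
apply: (@le_trans _ _ ((expR l)%:E * (expR (2 * l ^+ 2))%:E)).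
  by rewrite lee_pmul2l ?lte_fin ?expR_gt0// mgf_square_le.
by rewrite -EFinM -expRD lee_fin ler_expR; nra.
Qed.

(** The fourth power of a Gaussian has no exponential moment; cutting one factor [x ^+ 2] at [tau]
    keeps the exponent [f] below [x ^+ 2 / 16]. Then [expR f <= 1 + f * expR f], and x^4 is at most
    [32 ^+ 2] times the exponential of [x ^+ 2 / 16]. There remains the integral of the exponential
    of [x ^+ 2 / 8], at most [4 / 3], and [32 ^+ 2 * 4 / 3 <= 40 ^+ 2]. *)
Lemma mgf_quartic (th tau : R) : (0 <= th)%R -> (0 <= tau)%R -> (th * tau <= 16^-1)%R ->
  \int[nu]_x (expR (th * (Num.min (x ^+ 2) tau * x ^+ 2)))%:E <= (expR (40 ^+ 2 * th))%:E.
Proof.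
move=> th0 tau0 tht.
have b (x : R) : (expR (th * (Num.min (x ^+ 2) tau * x ^+ 2)) <= 1 + 32 ^+ 2 * th * expR (8^-1 * x ^+ 2))%R.
  have m0 : (0 <= Num.min (x ^+ 2) tau)%R by rewrite le_min sqr_ge0 tau0.
  have m1 : (Num.min (x ^+ 2) tau <= x ^+ 2)%R by rewrite ge_min lexx.
  have m2 : (Num.min (x ^+ 2) tau <= tau)%R by rewrite ge_min lexx orbT.
  move: m0 m1 m2; set mm := Num.min _ _ => m0 m1 m2; have x0 := sqr_ge0 x.
  set f := (th * _)%R.
  have f0 : (0 <= f)%R := mulr_ge0 th0 (mulr_ge0 m0 x0).
  have f1 : (f <= 16^-1 * x ^+ 2)%R.
    rewrite /f mulrA ler_wpM2r ?sqr_ge0//; apply: le_trans tht.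
    by rewrite ler_wpM2l.
  have f2 : (f <= th * (x ^+ 2) ^+ 2)%R.
    by rewrite /f ler_wpM2l// expr2 ler_wpM2r.
  set y := (16^-1 * x ^+ 2)%R in f1.
  have y0 : (0 <= y)%R by rewrite /y; lra.
  have e0 := expR_gt0 f.
  have h1 : (expR f <= 1 + f * expR f)%R.
    have := expR_ge1Dx (- f); rewrite expRN => H.
    have : ((1 - f) * expR f <= (expR f)^-1 * expR f)%R by rewrite ler_pM2r.
    by rewrite mulVf ?gt_eqF// mulrBl mul1r lerBlDr.
  have h2 : (y ^+ 2 <= 4 * expR y)%R.
    have := expR_ge1Dx (2^-1 * y); have -> : (expR y = expR (2^-1 * y) ^+ 2)%R.
      by rewrite -expRM_natl; congr expR; field.
    by have := expR_gt0 (2^-1 * y)%R; set e := expR _ => e1 H; nra.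
  have h3 : (expR f <= expR y)%R by rewrite ler_expR.
  have h4 : ((x ^+ 2) ^+ 2 <= 32 ^+ 2 * expR y)%R.
    have -> : ((x ^+ 2) ^+ 2 = 16 ^+ 2 * y ^+ 2)%R by rewrite /y; field.
    lra.
  have -> : (expR (8^-1 * x ^+ 2) = expR y * expR y)%R.
    by rewrite -expRD; congr expR; rewrite /y; field.
  apply: (le_trans h1); rewrite lerD2l mulrA.
  apply: (ler_pM f0 (ltW e0) _ h3).
  apply: (le_trans f2); by rewrite (mulrC (32 ^+ 2)%R) -mulrA ler_wpM2l.
have m8 : measurable_fun [set: R] (fun x : R => 8^-1 * x ^+ 2)%R.
  by apply: measurable_funM => //; apply: measurable_funX; exact: measurable_id.
have mm : measurable_fun [set: R] (fun x : R => th * (Num.min (x ^+ 2) tau * x ^+ 2))%R.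
  apply: measurable_funM => //; apply: measurable_funM => //.
  by apply: measurable_minr => //; apply: measurable_funX; exact: measurable_id.
have me (f : R -> R) : measurable_fun [set: R] f -> measurable_fun [set: R] (fun x => (expR (f x))%:E).
  by move=> mf; apply/measurable_EFinP; exact: (measurableT_comp (@measurable_expR R) mf).
apply: (@le_trans _ _ (\int[nu]_x (1 + (32 ^+ 2 * th)%:E * (expR (8^-1 * x ^+ 2))%:E))).
  apply: ge0_le_integral => //.
  - exact: me.
  - by apply: emeasurable_funD => //; apply: emeasurable_funM => //; exact: me.
  - by move=> x _; rewrite -EFinM -EFinD lee_fin.
have t0 : 0 <= (32 ^+ 2 * th)%:E by rewrite lee_fin mulr_ge0 ?sqr_ge0.
rewrite ge0_integralD//; last 2 first.
- by move=> x _; rewrite mule_ge0// lee_fin expR_ge0.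
- by apply: emeasurable_funM => //; exact: me.
rewrite integral_cst//= probability_setT mule1 ge0_integralZl//; last exact: me.
apply: (@le_trans _ _ (1 + (32 ^+ 2 * th)%:E * (expR (2 * 8^-1))%:E)).
  by rewrite leeD2l// lee_wpmul2l ?lee_fin ?mulr_ge0// mgf_square_le2.
rewrite -EFinM -EFinD lee_fin.
have e4 : (expR (2 * 8^-1) <= 4 / 3 :> R)%R.
  have := expR_ge1Dx (- (2 * 8^-1 : R)); rewrite expRN.
  have := expR_gt0 (2 * 8^-1 : R); set e := expR _ => e0 H.
  have : ((1 - 2 * 8^-1) * e <= e^-1 * e)%R by rewrite ler_pM2r.
  by rewrite mulVf ?gt_eqF//; lra.
apply: le_trans (expR_ge1Dx _); rewrite lerD2l.
have := expR_gt0 (2 * 8^-1 : R); nra.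
Qed.

End Mgf.

Section ChernoffIid.
Context {R : realType} {I : finType}.
Context d (T : measurableType d) (P : probability T R) (X : T -> rvec R I).
Hypothesis iX : iidn 1 P X.
Local Open Scope ereal_scope.
Local Notation nu := (normal_prob (0 : R) 1).

Lemma integral_coord (i : I) (f : R -> \bar R) : measurable_fun [set: R] f ->
  (forall x, 0 <= f x) -> \int[P]_w f (X w i) = \int[nu]_x f x.
Proof.
move=> mf f0.
have mX : measurable_fun [set: T] (fun w => X w i : measurableTypeR R) := iX.1 i.
have := ge0_integral_pushforward mX P measurableT mf (fun y _ => f0 y).
rewrite preimage_setT => E; rewrite /comp in E; rewrite -E.
apply: eq_measure_integral => A mA _.
pose B k := if k == i then A else setT.
have mB k : measurable (B k) by rewrite /B; case: ifP.
apply: (@etrans _ _ (P [set w | forall k, B k (X w k)])).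
  congr (P _); apply/seteqP; split => w /= H; last by have := H i; rewrite /B eqxx.
  by move=> k; rewrite /B; case: eqP => // ->.
apply: (etrans (iX.2 _ mB)); rewrite (bigD1 i)//= big1 ?mule1; first by rewrite /B eqxx.
by move=> k ki; rewrite /B (negbTE ki); exact: (@probability_setT _ _ _ nu).
Qed.

Lemma measurable_sum_coord (s : seq I) (u : I -> R -> R) : (forall i, measurable_fun [set: R] (u i)) ->
  measurable_fun [set: Om R I] (fun x : Om R I => \sum_(i <- s) u i (x i))%R.
Proof.
move=> mu; apply: measurable_sum => i.
by apply: measurableT_comp => //; exact: measurable_coord.
Qed.

(** Induction on the list: resampling every coordinate except [i] separates the factor of [i] from
    the others. *)
Lemma integral_exp_sum (s : seq I) (u : I -> R -> R) : uniq s ->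
  (forall i, measurable_fun [set: R] (u i)) ->
  \int[P]_w (expR (\sum_(i <- s) u i (X w i)))%:E = \prod_(i <- s) \int[nu]_x (expR (u i x))%:E.
Proof.
move=> us mu.
have me (f : Om R I -> R) : measurable_fun setT f -> measurable_fun setT (fun x => (expR (f x))%:E).
  by move=> mf; apply/measurable_EFinP; exact: (measurableT_comp (@measurable_expR R) mf).
elim: s us => [_|i s IH /= /andP[is_ us]].
  under eq_integral do rewrite big_nil expR0.
  by rewrite big_nil integral_cst//= probability_setT mule1.
pose F (x : Om R I) : \bar R := (expR (\sum_(j <- i :: s) u j (x j)))%:E.
have mF : measurable_fun setT F by apply: me; exact: measurable_sum_coord.
have F0 x : 0 <= F x by rewrite lee_fin expR_ge0.
refine (etrans (resample_int (pred1 i) iX iX mF F0) _).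
rewrite big_cons -IH// -(@integral_coord i); last 2 first.
- by apply/measurable_EFinP; exact: (measurableT_comp (@measurable_expR R) (mu i)).
- by move=> x; rewrite lee_fin expR_ge0.
rewrite -ge0_integralZr//; last 2 first.
- apply/measurable_EFinP; apply: (measurableT_comp (@measurable_expR R)).
  exact: (measurableT_comp (mu i) (iX.1 i)).
- by apply: integral_ge0 => x _; rewrite lee_fin expR_ge0.
apply: eq_integral => w _.
rewrite -ge0_integralZl//; last first.
  apply/measurable_EFinP; apply: (measurableT_comp (@measurable_expR R)).
  exact: (measurableT_comp (@measurable_sum_coord s u mu) (iidn_measurable iX)).
apply: eq_integral => w' _; rewrite /F big_cons expRD EFinM /mix /= eqxx.
congr (_ * (expR _)%:E); apply: eq_big_seq => j js.
by have [ji|//] := eqVneq j i; rewrite ji (negbTE is_) in js.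
Qed.

(** The Chernoff parameter is absorbed into [u] and [r]; [c] bounds the logarithms of the
    exponential moments. *)
Lemma chernoff_iid (u : I -> R -> R) (c : I -> R) (r : R) :
  (forall i, measurable_fun [set: R] (u i)) ->
  (forall i, \int[nu]_x (expR (u i x))%:E <= (expR (c i))%:E) ->
  P [set w | r <= \sum_i u i (X w i)]%R <= (expR (\sum_i c i - r))%:E.
Proof.
move=> mu uc; pose f w := (\sum_i u i (X w i))%R.
have mf : measurable_fun setT f.
  exact: (measurableT_comp (@measurable_sum_coord (index_enum I) u mu) (iidn_measurable iX)).
have mA : measurable [set w | (r <= f w)%R].
  rewrite -[X in measurable X]setTI; exact: (measurable_fun_ler _ mf).
have me : measurable_fun setT (fun w => (expR (f w))%:E).
  by apply/measurable_EFinP; exact: (measurableT_comp (@measurable_expR R) mf).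
have H : (expR r)%:E * P [set w | (r <= f w)%R] <= \int[P]_w (expR (f w))%:E.
  rewrite -[X in P X]setIT -integral_indic//.
  have mi : measurable_fun [set: T] (fun x : T => (\1_[set w | (r <= f w)%R] x)%:E : \bar R).
    by apply/measurable_EFinP; exact: measurable_indic.
  rewrite -ge0_integralZl//.
  apply: ge0_le_integral => //; first exact: emeasurable_funM.
  move=> w _; rewrite -EFinM lee_fin indicE.
  case: (boolP (w \in _)) => [|_]; last by rewrite mulr0 expR_ge0.
  by rewrite inE /= mulr1 ler_expR.
rewrite /f in H.
rewrite integral_exp_sum ?index_enum_uniq// in H.
have H2 : \prod_(i <- index_enum I) \int[nu]_x (expR (u i x))%:E <= (expR (\sum_i c i))%:E.
  elim: (index_enum I) => [|i s IH]; first by rewrite !big_nil expR0.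
  rewrite !big_cons expRD EFinM; apply: lee_pmul => //.
  - by apply: integral_ge0 => x _; rewrite lee_fin expR_ge0.
  - elim: (s) => [|j t IHt]; rewrite ?big_nil// big_cons mule_ge0//.
    by apply: integral_ge0 => x _; rewrite lee_fin expR_ge0.
have := le_trans H H2.
rewrite expRD expRN EFinM.
by rewrite lee_pdivlMr ?expR_gt0// muleC.
Qed.

End ChernoffIid.

(** * Tail bounds *)

Section Tails.
Context {R : realType} {I : finType}.
Context d (T : measurableType d) (P : probability T R) (X : T -> rvec R I).
Hypothesis iX : iidn 1 P X.

Lemma measurable_coordT (f : rvec R I -> R) : measurable_fun [set: Om R I] (f : Om R I -> R) ->
  measurable_fun [set: T] (fun w => f (X w)).
Proof. by move=> mf; exact: (measurableT_comp mf (iidn_measurable iX)). Qed.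

Lemma tail_two_sided (f : rvec R I -> R) (r : R) (b : \bar R) :
  measurable_fun [set: Om R I] (f : Om R I -> R) ->
  (P [set w | (r <= f (X w))%R] <= b)%E -> (P [set w | (r <= - f (X w))%R] <= b)%E ->
  (P [set w | (r <= `|f (X w)|)%R] <= b + b)%E.
Proof.
move=> mf H1 H2; have mF := measurable_coordT mf.
have m1 : measurable [set w | (r <= f (X w))%R].
  by rewrite -[X in measurable X]setTI; exact: (measurable_fun_ler _ mF).
have m2 : measurable [set w | (r <= - f (X w))%R].
  by rewrite -[X in measurable X]setTI; apply: (measurable_fun_ler _ _) => //; exact: measurableT_comp.
apply: (@le_trans _ _ (P ([set w | (r <= f (X w))%R] `|` [set w | (r <= - f (X w))%R]))).
  apply: le_measure; rewrite ?inE.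
  - rewrite -[X in measurable X]setTI; apply: (measurable_fun_ler _ _) => //.
    exact: measurableT_comp.
  - exact: measurableU.
  - by move=> w /=; rewrite ler_normr => /orP[]; [left|right].
by apply: (le_trans (measureU2 _ m1 m2)); exact: leeD.
Qed.

Lemma measurable_dot (t : rvec R I) : measurable_fun [set: Om R I] (fun x : Om R I => dot t x).
Proof.
by apply: measurable_sum => i; apply: measurable_funM => //; exact: measurable_coord.
Qed.

Lemma tail_linear (t : rvec R I) (V r : R) : 0 < V -> dot t t <= V -> 0 <= r ->
  (P [set w | (r <= `|dot t (X w)|)%R] <= (2 * expR (- (r ^+ 2 / (2 * V))))%:E)%E.
Proof.
move=> V0 tV r0.
have H (u : rvec R I) : dot u u <= V ->
    (P [set w | (r <= dot u (X w))%R] <= (expR (- (r ^+ 2 / (2 * V))))%:E)%E.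
  move=> uV; have [->|rn0] := eqVneq r 0.
    by rewrite expr0n /= mul0r oppr0 expR0 probability_le1//; rewrite -[X in measurable X]setTI;
      apply: (measurable_fun_ler _ _) => //; apply: measurable_coordT; exact: measurable_dot.
  have rp : 0 < r by rewrite lt0r rn0.
  (* [a = r / V] minimizes the exponent [a ^+ 2 * V / 2 - a * r]. *)
  have := @chernoff_iid R I d T P X iX (fun i x => r / V * u i * x)
    (fun i => (r / V * u i) ^+ 2 / 2) (r / V * r).
  have -> : [set w | (r / V * r <= \sum_i r / V * u i * X w i)%R] = [set w | (r <= dot u (X w))%R].
    apply/seteqP; split => w /=.
      under eq_bigr do rewrite -mulrA; rewrite -mulr_sumr ler_pM2l ?divr_gt0//.
    by move=> H; under eq_bigr do rewrite -mulrA; rewrite -mulr_sumr ler_pM2l ?divr_gt0.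
  move=> H; apply: le_trans (H _ _) _.
  - by move=> i; apply: measurable_funM => //; exact: measurable_id.
  - by move=> i; rewrite mgf_linear.
  rewrite lee_fin ler_expR.
  have -> : \sum_i (r / V * u i) ^+ 2 / 2 = (r / V) ^+ 2 / 2 * dot u u.
    by rewrite /dot mulr_sumr; apply: eq_bigr => i _; field; rewrite gt_eqF.
  apply: (@le_trans _ _ ((r / V) ^+ 2 / 2 * V - r / V * r)).
    by rewrite lerD2r ler_wpM2l// divr_ge0// sqr_ge0.
  rewrite le_eqVlt; apply/orP; left; apply/eqP; field; rewrite gt_eqF//.
have -> : (2 * expR (- (r ^+ 2 / (2 * V))))%:E = ((expR (- (r ^+ 2 / (2 * V))))%:E + (expR (- (r ^+ 2 / (2 * V))))%:E)%E.
  by rewrite -EFinD; congr EFin; ring.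
apply: tail_two_sided; [exact: measurable_dot|exact: H|].
have -> : [set w | (r <= - dot t (X w))%R] = [set w | (r <= dot (fun i => - t i) (X w))%R].
  have E w : dot (fun i => - t i) (X w) = - dot t (X w).
    by rewrite /dot -sumrN; apply: eq_bigr => i _; rewrite mulNr.
  by apply/seteqP; split => w /=; rewrite E.
apply: H; apply: le_trans tV; rewrite /dot le_eqVlt; apply/orP; left; apply/eqP.
by apply: eq_bigr => i _; rewrite mulrNN.
Qed.

Lemma measurable_wsum (p : I -> R) (f : R -> R) : measurable_fun [set: R] f ->
  measurable_fun [set: Om R I] (fun x : Om R I => \sum_i p i * f (x i)).
Proof.
move=> mf; apply: measurable_sum => i; apply: measurable_funM => //.
by apply: measurableT_comp => //; exact: measurable_coord.
Qed.

(** The parameter [l] is left free; [stdn_chi2] tunes it to the largest weight and to the accuracy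
    wanted. *)
Lemma tail_chi2 (p : I -> R) (w V l r : R) : (forall i, `|p i| <= w) ->
  \sum_i p i ^+ 2 <= V -> 0 < l -> l * w <= 8^-1 ->
  (P [set z | (r <= `|\sum_i p i * (X z i ^+ 2 - 1)|)%R] <= (2 * expR (2 * l ^+ 2 * V - l * r))%:E)%E.
Proof.
move=> pw pV l0 lw.
have H (u : I -> R) : (forall i, `|u i| <= w) -> \sum_i u i ^+ 2 <= V ->
    (P [set z | (r <= (\sum_i u i * (X z i ^+ 2 - 1))%R)%R] <= (expR (2 * l ^+ 2 * V - l * r))%:E)%E.
  move=> uw uV.
  have := @chernoff_iid R I d T P X iX (fun i x => l * u i * (x ^+ 2 - 1))
    (fun i => 2 * (l * u i) ^+ 2) (l * r).
  have -> : [set z | (l * r <= \sum_i l * u i * (X z i ^+ 2 - 1))%R] = [set z | (r <= \sum_i u i * (X z i ^+ 2 - 1))%R].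
    have E z : \sum_i l * u i * (X z i ^+ 2 - 1) = l * \sum_i u i * (X z i ^+ 2 - 1).
      by rewrite mulr_sumr; apply: eq_bigr => i _; rewrite -mulrA.
    by apply/seteqP; split => z /=; rewrite E ler_pM2l.
  move=> H; apply: le_trans (H _ _) _.
  - by move=> i; apply: measurable_funM => //; apply: measurable_funB.
  - move=> i; apply: mgf_square_le; rewrite normrM gtr0_norm//; apply: le_trans lw.
    by rewrite ler_pM2l.
  rewrite lee_fin ler_expR lerD2r.
  have -> : \sum_i 2 * (l * u i) ^+ 2 = 2 * l ^+ 2 * \sum_i u i ^+ 2.
    by rewrite mulr_sumr; apply: eq_bigr => i _; rewrite exprMn mulrA.
  by rewrite ler_wpM2l// mulr_ge0// sqr_ge0.
have -> : (2 * expR (2 * l ^+ 2 * V - l * r))%:E = ((expR (2 * l ^+ 2 * V - l * r))%:E + (expR (2 * l ^+ 2 * V - l * r))%:E)%E.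
  by rewrite -EFinD; congr EFin; ring.
apply: (@tail_two_sided (fun x => \sum_i p i * (x i ^+ 2 - 1))).
- by apply: (@measurable_wsum p (fun x => x ^+ 2 - 1)); apply: measurable_funB.
- exact: H.
have -> : [set z | (r <= - (\sum_i p i * (X z i ^+ 2 - 1)))%R] = [set z | (r <= \sum_i (- p i) * (X z i ^+ 2 - 1))%R].
  have E z : \sum_i (- p i) * (X z i ^+ 2 - 1) = - (\sum_i p i * (X z i ^+ 2 - 1)).
    by rewrite -sumrN; apply: eq_bigr => i _; rewrite mulNr.
  by apply/seteqP; split => z /=; rewrite E.
by apply: H => [i|]; [rewrite normrN|under eq_bigr do rewrite sqrrN].
Qed.

Lemma tail_square (q : I -> R) (b V r : R) : (forall i, 0 <= q i <= b) ->
  \sum_i q i <= V -> 0 < b ->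
  (P [set z | (r <= (\sum_i q i * X z i ^+ 2)%R)%R] <= (expR ((2 * V - r) / (8 * b)))%:E)%E.
Proof.
move=> qb qV b0; pose l := (8 * b)^-1.
have l0 : 0 < l by rewrite invr_gt0 mulr_gt0.
have := @chernoff_iid R I d T P X iX (fun i x => l * q i * x ^+ 2) (fun i => 2 * (l * q i)) (l * r).
have -> : [set z | (l * r <= \sum_i l * q i * X z i ^+ 2)%R] = [set z | (r <= \sum_i q i * X z i ^+ 2)%R].
  have E z : \sum_i l * q i * X z i ^+ 2 = l * \sum_i q i * X z i ^+ 2.
    by rewrite mulr_sumr; apply: eq_bigr => i _; rewrite -mulrA.
  by apply/seteqP; split => z /=; rewrite E ler_pM2l.
move=> H; apply: le_trans (H _ _) _.
- by move=> i; apply: measurable_funM.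
- move=> i; have /andP[q0 q1] := qb i; apply: mgf_square_le2; first by rewrite mulr_ge0// ltW.
  by rewrite /l invfM -mulrA ler_piMr// mulrC ler_pdivrMr// mul1r.
rewrite lee_fin ler_expR -!mulr_sumr.
have -> : (2 * V - r) / (8 * b) = 2 * (l * V) - l * r by rewrite /l mulrBl; ring.
by rewrite lerD2r !ler_pM2l.
Qed.

Lemma tail_quartic (p : I -> R) (w tau r : R) : (forall i, 0 <= p i <= w) ->
  \sum_i p i <= 1 -> 0 < w -> 0 < tau ->
  (P [set z | (r <= (\sum_i p i * (Num.min (X z i ^+ 2) tau * X z i ^+ 2))%R)%R]
     <= (expR ((40 ^+ 2 - r) / (16 * w * tau)))%:E)%E.
Proof.
move=> pw p1 w0 tau0; pose l := (16 * w * tau)^-1.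
have l0 : 0 < l by rewrite invr_gt0 !mulr_gt0.
have := @chernoff_iid R I d T P X iX (fun i x => l * p i * (Num.min (x ^+ 2) tau * x ^+ 2))
  (fun i => 40 ^+ 2 * (l * p i)) (l * r).
have -> : [set z | (l * r <= \sum_i l * p i * (Num.min (X z i ^+ 2) tau * X z i ^+ 2))%R]
   = [set z | (r <= \sum_i p i * (Num.min (X z i ^+ 2) tau * X z i ^+ 2))%R].
  have E z : \sum_i l * p i * (Num.min (X z i ^+ 2) tau * X z i ^+ 2) = l * \sum_i p i * (Num.min (X z i ^+ 2) tau * X z i ^+ 2).
    by rewrite mulr_sumr; apply: eq_bigr => i _; rewrite -mulrA.
  by apply/seteqP; split => z /=; rewrite E ler_pM2l.
move=> H; apply: le_trans (H _ _) _.
- move=> i; apply: measurable_funM => //; apply: measurable_funM => //.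
  exact: measurable_minr.
- move=> i; have /andP[q0 q1] := pw i; apply: mgf_quartic; [by rewrite mulr_ge0// ltW|exact: ltW|].
  have -> : l * p i * tau = 16^-1 * (p i / w) by rewrite /l; field; rewrite !gt_eqF.
  by rewrite ler_piMr// ler_pdivrMr// mul1r.
rewrite lee_fin ler_expR -!mulr_sumr.
have -> : (40 ^+ 2 - r) / (16 * w * tau) = 40 ^+ 2 * (l * 1) - l * r by rewrite /l mulrBl; ring.
by rewrite lerD2r ler_wpM2l ?sqr_ge0// ler_pM2l.
Qed.

End Tails.

(** * Rescaling, subfamilies and blockwise orthogonal maps *)

Section Scaling.
Context {R : realType}.
Local Notation mu := (@lebesgue_measure R).
Local Open Scope ereal_scope.

Lemma lebesgue_scale (a : R) (A : set R) : (0 < a)%R -> measurable A ->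
  a%:E * mu [set x | A (a * x)%R] = mu A.
Proof.
move=> a0 mA; apply/esym.
have ms : measurable_fun [set: measurableTypeR R]
  (fun x : measurableTypeR R => (a * x)%R : measurableTypeR R) by exact: mulrl_measurable.
pose an := NngNum (ltW a0).
apply: (@lebesgue_measure_unique R (mscale an (pushforward mu (fun x : measurableTypeR R => (a * x)%R : measurableTypeR R)))) => // X [[u v] _ <-] /=.
rewrite /mscale /= /pushforward /=.
rewrite (_ : _ @^-1` _ = `](u / a)%R, (v / a)%R]%classic); last first.
  by apply/seteqP; split => x /=; rewrite !in_itv/= ltr_pdivrMr// ler_pdivlMr// (mulrC x).
rewrite !lebesgue_measure_itv/= !lte_fin ltr_pM2r ?invr_gt0//.
case: ifP => _; last by rewrite mule0.
rewrite -!EFinB -EFinM; congr EFin; field; by rewrite gt_eqF.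
Qed.

Lemma integral_scale (a : R) (f : R -> \bar R) : (0 < a)%R ->
  measurable_fun [set: R] f -> (forall x, 0 <= f x) ->
  a%:E * \int[mu]_x f (a * x)%R = \int[mu]_x f x.
Proof.
move=> a0 mf f0.
have ms : measurable_fun [set: measurableTypeR R]
  (fun x : measurableTypeR R => (a * x)%R : measurableTypeR R) by exact: mulrl_measurable.
have := ge0_integral_pushforward ms mu measurableT mf (fun y _ => f0 y).
rewrite preimage_setT => E; rewrite /comp in E; rewrite -E.
pose an := NngNum (ltW a0).
rewrite -(ge0_integral_mscale _ measurableT an)//.
apply: eq_measure_integral => A mA _; exact: lebesgue_scale.
Qed.

Lemma normal_prob_scale (sg : R) (B : set R) : (0 < sg)%R -> measurable B ->
  normal_prob 0 sg [set x | B (sg^-1 * x)%R] = normal_prob 0 1 B.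
Proof.
move=> s0 mB; rewrite /normal_prob [LHS]integral_mkcond [RHS]integral_mkcond.
have mg m s : measurable_fun [set: R] (fun x : R => (normal_pdf m s x)%:E).
  by apply/measurable_EFinP; exact: measurable_normal_pdf.
pose f : R -> \bar R := (fun x => (normal_pdf 0 sg x)%:E) \_ [set x | B (sg^-1 * x)%R].
have mB' : measurable [set x | B (sg^-1 * x)%R].
  by rewrite -[X in measurable X]setTI; exact: mulrl_measurable.
have mf : measurable_fun [set: R] f.
  by apply/(measurable_restrictT _ mB'); apply: measurable_funTS; exact: mg.
have f0 x : 0 <= f x by rewrite /f patchE; case: ifP => // _; rewrite lee_fin normal_pdf_ge0.
refine (etrans (esym (integral_scale s0 mf f0)) _).
rewrite -ge0_integralZl//; last 2 first.
- have ms : measurable_fun [set: measurableTypeR R]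
    (fun x : measurableTypeR R => (sg * x)%R : measurableTypeR R) by exact: mulrl_measurable.
  exact: (measurableT_comp mf ms).
- by rewrite lee_fin ltW.
apply: eq_integral => x _; rewrite /f !patchE.
have -> : (sg * x)%R \in [set x0 | B (sg^-1 * x0)%R] = (x \in B).
  by apply/idP/idP; rewrite !inE /= mulKf ?gt_eqF.
case: ifP => _; last by rewrite mule0.
rewrite -EFinM !normal_pdfE ?oner_eq0 ?gt_eqF//; congr EFin.
rewrite mulrA; congr (_ * _)%R.
  rewrite /normal_peak expr1n mul1r -mulrnAr sqrtrM ?sqr_ge0// sqrtr_sqr gtr0_norm//.
  by rewrite invfM mulrA divff ?mul1r// gt_eqF.
rewrite /normal_fun; congr expR; rewrite !subr0; field; by rewrite gt_eqF.
Qed.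

End Scaling.

Section SubFamilies.
Context {R : realType}.

Lemma iidn_sub (I J : finType) (sg : R) d (T : measurableType d) (P : probability T R)
  (X : T -> rvec R I) (f : J -> I) : injective f -> iidn sg P X ->
  iidn sg P (fun w => (fun j => X w (f j)) : rvec R J).
Proof.
move=> fi iX; split=> [j|B mB]; first exact: iX.1.
pose B' i := if [pick j | f j == i] is Some j then B j else setT.
have mB' i : measurable (B' i) by rewrite /B'; case: pickP.
have B'f j : B' (f j) = B j.
  rewrite /B'; case: pickP => [j' /eqP/fi -> //|/(_ j)]; by rewrite eqxx.
apply: (@etrans _ _ (P [set w | forall i, B' i (X w i)])).
  congr (P _); apply/seteqP; split => w /= H; last by move=> j; rewrite -B'f.
  by move=> i; rewrite /B'; case: pickP => // j /eqP <-.
rewrite (iX.2 _ mB') (bigID (fun i => i \in codom f))/= [X in (_ * X)%E]big1 ?mule1; last first.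
  move=> i /negP fiN; rewrite /B'; case: pickP => [j /eqP E|_].
    by case: fiN; rewrite -E codom_f.
  exact: (@probability_setT _ _ _ (normal_prob 0 sg)).
rewrite -big_uniq/=; last by rewrite /codom map_inj_uniq// enum_uniq.
rewrite /codom big_map big_enum/=; apply: eq_bigr => j _; by rewrite B'f.
Qed.

(* A Householder matrix whose row [k0] is the unit vector [y]. *)
Lemma orthog_row (K : finType) (k0 : K) (y : rvec R K) : dot y y = 1 ->
  exists U : K -> rvec R K, orthog U /\ (U k0 = y) /\ (forall j k, dot (U j) (U k) = (j == k)%:R).
Proof.
move=> y1.
have [/asboolP ->|/asboolP ye] := boolP (`[< y = ebase k0 >]).
  exists (fun k : K => ebase k : rvec R K).
  have H : orthog (fun k : K => ebase k : rvec R K).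
    move=> j k; rewrite /dot (bigD1 j)//= big1 ?addr0 /col /ebase ?eqxx ?mul1r//.
      by rewrite eq_sym.
    by move=> i ij; rewrite eq_sym (negbTE ij) mul0r.
  split => //; split => //; move=> j k; rewrite dot_ebase /ebase eq_sym//.
pose u : rvec R K := fun i => y i - ebase k0 i.
have u0 : exists i, u i != 0.
  apply/existsP; apply: contra_notT ye => /existsPn H; apply/funext => i.
  by apply/eqP; rewrite -subr_eq0; have := H i; rewrite negbK.
have uu0 : dot u u != 0 by have [i ui] := u0; apply: contraNneq ui => /dot_eq0 ->.
pose U j : rvec R K := refl u (ebase j).
have sU i j : U i j = U j i.
  rewrite /U /refl !dot_ebase /ebase (eq_sym i j); ring.
have dU j k : dot (U j) (U k) = (j == k)%:R.
  by rewrite /U refl_dot// dot_ebase /ebase eq_sym.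
exists U; split.
  move=> j k; rewrite -dU; congr dot; apply/funext => i; exact: sU.
split => //; rewrite /U; apply/funext => i; rewrite /refl dot_ebase.
have ee : dot (ebase k0) (ebase k0 : rvec R K) = 1 by rewrite dot_ebase /ebase eqxx.
have uE : u = (fun i => y i + (-1) * ebase k0 i) by apply/funext => k; rewrite mulN1r.
have uD x : dot u x = dot y x - x k0.
  by rewrite uE dotDl dotZl mulN1r (dotC (ebase k0) x) dot_ebase.
have uk : u k0 = y k0 - 1 by rewrite /u /ebase eqxx.
have uu : dot u u = - (2 * u k0) by rewrite uD (dotC y u) uD y1 uk; ring.
have u2 : 2 * u k0 != 0 by move: uu0; rewrite uu oppr_eq0.
rewrite uu invrN mulrN divff// /u; ring.
Qed.

Lemma sum_pair_eq (A K : finType) (a : A) (F : A -> K -> R) :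
  \sum_(i : A * K) (a == i.1)%:R * F i.1 i.2 = \sum_k F a k.
Proof.
rewrite -(pair_bigA _ (fun b k => (a == b)%:R * F b k))/= (bigD1 a)//= [X in _ + X]big1 ?addr0.
  by apply: eq_bigr => k _; rewrite eqxx mul1r.
by move=> b ba; rewrite big1// => k _; rewrite eq_sym (negbTE ba) mul0r.
Qed.

(** The maps [U a] are the blocks of one orthogonal map on [A * K], to which [orthog_inv]
    applies. *)
Lemma iidn_blocks (A K : finType) (sg : R) d (T : measurableType d) (P : probability T R)
  (X : T -> rvec R (A * K)%type) (U : A -> K -> rvec R K) : sg != 0 ->
  (forall a, orthog (U a)) -> iidn sg P X ->
  iidn sg P (fun w => (fun i => \sum_k U i.1 i.2 k * X w (i.1, k)) : rvec R (A * K)%type).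
Proof.
move=> sg0 oU iX.
pose O (i : A * K) : rvec R (A * K)%type := fun j => (i.1 == j.1)%:R * U i.1 i.2 j.2.
have oO : orthog O.
  move=> [a k] [b l]; rewrite /dot /col /O /=.
  transitivity (\sum_(i : A * K) (a == i.1)%:R * (U i.1 i.2 k * ((i.1 == b)%:R * U i.1 i.2 l))).
    by apply: eq_bigr => i _; rewrite (eq_sym a) -mulrA.
  rewrite (sum_pair_eq a (fun c m => U c m k * ((c == b)%:R * U c m l))).
  have := oU a k l; rewrite /dot /col xpair_eqE => E.
  case: eqP => [_|_] /=; last by rewrite big1// => m _; rewrite mul0r mulr0.
  by rewrite -E; apply: eq_bigr => m _; rewrite mul1r.
have := orthog_inv sg0 oO iX; congr iidn; apply/funext => w; apply/funext => -[a k] /=.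
rewrite /lin /dot /O /=.
rewrite -(sum_pair_eq a (fun c m => U c k m * X w (c, m))).
apply: eq_bigr => -[c m] _ /=; case: eqP => [->|]; by rewrite ?mul1r ?mul0r.
Qed.

(** Each [y a] is completed to an orthogonal matrix having it as row [k0]; of the rotated array only
    the coordinates [(a, k0)] are kept. *)
Lemma iidn_lin (A K : finType) d (T : measurableType d) (P : probability T R)
  (X : T -> rvec R (A * K)%type) (y : A -> rvec R K) :
  (forall a, dot (y a) (y a) = 1) -> iidn 1 P X ->
  iidn 1 P (fun w => (fun a => \sum_k y a k * X w (a, k)) : rvec R A).
Proof.
move=> y1 iX.
(* If [K] is empty there is no unit vector, so [A] is empty too. *)
have [k0 _|K0] := pickP (fun _ : K => true); last first.
  have A0 (a : A) : False.
    have := y1 a; rewrite /dot big1; first by move/eqP; rewrite eq_sym oner_eq0.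
    by move=> k; have := K0 k.
  split=> [a|B mB]; first by case: (A0 a).
  rewrite big1; last by move=> a; case: (A0 a).
  rewrite (_ : mkset _ = setT) ?probability_setT//.
  by apply/seteqP; split => w //= _ a; case: (A0 a).
have /choice[U HU] : forall a, exists U : K -> rvec R K, orthog U /\ U k0 = y a.
  by move=> a; have [U [oU [Uy _]]] := orthog_row k0 (y1 a); exists U.
have H := iidn_blocks (oner_neq0 R) (fun a => (HU a).1) iX.
have := @iidn_sub (A * K)%type A 1 d T P _ (fun a => (a, k0)) _ H.
have inj : injective (fun a : A => (a, k0)) by move=> a b [].
move=> /(_ inj); congr iidn; apply/funext => w; apply/funext => a /=.
by rewrite (HU a).2.
Qed.

Lemma iidn_scale (I : finType) (sg : R) d (T : measurableType d) (P : probability T R)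
  (X : T -> rvec R I) : 0 < sg -> iidn sg P X ->
  iidn 1 P (fun w => (fun i => sg^-1 * X w i) : rvec R I).
Proof.
move=> sg0 iX; split=> [i|B mB]; first by apply: measurable_funM => //; exact: iX.1.
pose B' i := [set x | B i (sg^-1 * x)].
have mB' i : measurable (B' i).
  by rewrite -[X in measurable X]setTI; exact: mulrl_measurable.
apply: (etrans (iX.2 _ mB')); apply: eq_bigr => i _; exact: normal_prob_scale.
Qed.

End SubFamilies.

(** * The certificate equation and its leave-one-out solutions *)

Section CauchySchwarz.
Context {R : realType}.

Lemma sum_CS (I : finType) (P : pred I) (w f g : I -> R) : (forall i, 0 <= w i) ->
  (\sum_(i | P i) w i * f i * g i) ^+ 2 <=
  (\sum_(i | P i) w i * f i ^+ 2) * (\sum_(i | P i) w i * g i ^+ 2).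
Proof.
move=> w0; set A := \sum_(i | P i) w i * f i ^+ 2; set B := \sum_(i | P i) w i * g i ^+ 2.
set C := \sum_(i | P i) _.
have A0 : 0 <= A by apply: sumr_ge0 => i _; rewrite mulr_ge0// sqr_ge0.
have B0 : 0 <= B by apply: sumr_ge0 => i _; rewrite mulr_ge0// sqr_ge0.
have H t : 0 <= A + 2 * t * C + t ^+ 2 * B.
  have -> : A + 2 * t * C + t ^+ 2 * B = \sum_(i | P i) w i * (f i + t * g i) ^+ 2.
    rewrite /A /B /C !mulr_sumr -!big_split/=; apply: eq_bigr => i _; ring.
  by apply: sumr_ge0 => i _; rewrite mulr_ge0// sqr_ge0.
have [B1|B1] := eqVneq B 0.
  have C0 : C = 0.
    apply/eqP; apply: contraT => C0.
    (* For [B = 0] the polynomial in [H] is affine in [t], and at this value of [t] it equals -1. *)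
    have := H (- (A + 1) / (2 * C)); rewrite B1 mulr0 addr0.
    have -> : 2 * (- (A + 1) / (2 * C)) * C = - (A + 1) by field; rewrite C0.
    lra.
  by rewrite C0 B1 expr0n mulr0.
have Bp : 0 < B by rewrite lt0r B1.
have := H (- C / B).
have -> : A + 2 * (- C / B) * C + (- C / B) ^+ 2 * B = (A * B - C ^+ 2) / B by field.
by rewrite pmulr_lge0 ?invr_gt0// subr_ge0.
Qed.

Lemma sum_CS1 (I : finType) (f g : I -> R) :
  (\sum_i f i * g i) ^+ 2 <= (\sum_i f i ^+ 2) * (\sum_i g i ^+ 2).
Proof.
have := @sum_CS I xpredT (fun=> 1) f g (fun=> ler01).
by under eq_bigr do rewrite mul1r; under [X in _ <= X * _]eq_bigr do rewrite mul1r;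
   under [X in _ <= _ * X]eq_bigr do rewrite mul1r.
Qed.

End CauchySchwarz.

Section DetCore.
Context {R : realType} {Nt Lt Kt : finType} (k0 : Kt).
Variables (cr ci : Nt -> Lt -> Kt -> R) (mu : Nt -> R) (p : Lt -> R).
Implicit Types (v u : Nt -> Kt -> R) (l : Lt) (n : Nt).

(* Real and imaginary parts are kept apart, with suffixes r and i: psr + i psi is <c_(l,n), v_n>, ar + i ai
   is its value at the base vector [mbase], hr + i hi is <a_l, Psi_l v>, and beta l v u is the real part of
   <B_l v, B_l u>, where B_l v is the component of Psi_l v orthogonal to a_l. *)
Definition psr l n v := \sum_k cr n l k * v n k.
Definition psi l n v := \sum_k ci n l k * v n k.
Definition ar l n := mu n * cr n l k0.
Definition ai l n := mu n * ci n l k0.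
Definition sl l := \sum_n (ar l n ^+ 2 + ai l n ^+ 2).
Definition hr l v := \sum_n (ar l n * psr l n v + ai l n * psi l n v).
Definition hi l v := \sum_n (ar l n * psi l n v - ai l n * psr l n v).
Definition dPsi l v u := \sum_n (psr l n v * psr l n u + psi l n v * psi l n u).
Definition beta l v u := dPsi l v u - (hr l v * hr l u + hi l v * hi l u) / sl l.
Definition mv v := \sum_n mu n * v n k0.
Definition vn v n := \sum_k v n k ^+ 2.
Definition v2 v := \sum_n vn v n.
Definition lc a u v : Nt -> Kt -> R := fun n k => v n k + a * u n k.
(** [Q] selects the frequencies that are kept. [MM] is the matrix of the linear system for the
    certificate, as a bilinear form; [ee] is the residual of the second tangent condition at v = 0,
    tested against the argument; [QQ] is, up to the factors s_l, what projecting off a_l takes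
    away. *)
Definition MM (Q : pred Lt) v u := \sum_(l | Q l) p l * beta l v u.
Definition ee (Q : pred Lt) v := \sum_(l | Q l) p l * (hr l v / sl l - mv v).
Definition QQ (Q : pred Lt) v := \sum_(l | Q l) p l * (hr l v ^+ 2 + hi l v ^+ 2).
Definition mbase : Nt -> Kt -> R := fun n k => if k == k0 then mu n else 0.

Lemma psr_lc l n a u v : psr l n (lc a u v) = psr l n v + a * psr l n u.
Proof. by rewrite /psr /lc mulr_sumr -big_split; apply: eq_bigr => k _ /=; ring. Qed.
Lemma psi_lc l n a u v : psi l n (lc a u v) = psi l n v + a * psi l n u.
Proof. by rewrite /psi /lc mulr_sumr -big_split; apply: eq_bigr => k _ /=; ring. Qed.
Lemma hr_lc l a u v : hr l (lc a u v) = hr l v + a * hr l u.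
Proof. by rewrite /hr mulr_sumr -big_split; apply: eq_bigr => n _ /=; rewrite psr_lc psi_lc; ring. Qed.
Lemma hi_lc l a u v : hi l (lc a u v) = hi l v + a * hi l u.
Proof. by rewrite /hi mulr_sumr -big_split; apply: eq_bigr => n _ /=; rewrite psr_lc psi_lc; ring. Qed.
Lemma mv_lc a u v : mv (lc a u v) = mv v + a * mv u.
Proof. by rewrite /mv mulr_sumr -big_split; apply: eq_bigr => n _ /=; rewrite /lc; ring. Qed.
Lemma dPsi_lc l a u v x : dPsi l (lc a u v) x = dPsi l v x + a * dPsi l u x.
Proof. by rewrite /dPsi mulr_sumr -big_split; apply: eq_bigr => n _ /=; rewrite psr_lc psi_lc; ring. Qed.
Lemma dPsiC l v u : dPsi l v u = dPsi l u v.
Proof. by apply: eq_bigr => n _; ring. Qed.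
Lemma betaC l v u : beta l v u = beta l u v.
Proof. by rewrite /beta dPsiC; congr (_ - _ / _); ring. Qed.
Lemma beta_lc l a u v x : beta l (lc a u v) x = beta l v x + a * beta l u x.
Proof. by rewrite /beta dPsi_lc hr_lc hi_lc; ring. Qed.
Lemma MMC Q v u : MM Q v u = MM Q u v.
Proof. by apply: eq_bigr => l _; rewrite betaC. Qed.
Lemma MM_lc Q a u v x : MM Q (lc a u v) x = MM Q v x + a * MM Q u x.
Proof. by rewrite /MM mulr_sumr -big_split; apply: eq_bigr => l _ /=; rewrite beta_lc; ring. Qed.
Lemma MM_lcr Q a u v x : MM Q x (lc a u v) = MM Q x v + a * MM Q x u.
Proof. by rewrite MMC MM_lc !(MMC Q x). Qed.
Lemma ee_lc Q a u v : ee Q (lc a u v) = ee Q v + a * ee Q u.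
Proof. by rewrite /ee mulr_sumr -big_split; apply: eq_bigr => l _ /=; rewrite hr_lc mv_lc; ring. Qed.

Lemma vn_ge0 v n : 0 <= vn v n.
Proof. by apply: sumr_ge0 => k _; rewrite sqr_ge0. Qed.
Lemma v2_ge0 v : 0 <= v2 v.
Proof. by apply: sumr_ge0 => n _; rewrite vn_ge0. Qed.
Lemma sl_ge0 l : 0 <= sl l.
Proof. by apply: sumr_ge0 => n _; rewrite addr_ge0 ?sqr_ge0. Qed.
Lemma dPsi_ge0 l v : 0 <= dPsi l v v.
Proof. by apply: sumr_ge0 => n _; rewrite -!expr2 addr_ge0 ?sqr_ge0. Qed.

Definition Br l n v := psr l n v - (ar l n * hr l v - ai l n * hi l v) / sl l.
Definition Bi l n v := psi l n v - (ar l n * hi l v + ai l n * hr l v) / sl l.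

(** Pythagoras: [Br] and [Bi] are the real and imaginary parts of the component of Psi_l v
    orthogonal to a_l. *)
Lemma betaE l v : sl l != 0 -> beta l v v = \sum_n (Br l n v ^+ 2 + Bi l n v ^+ 2).
Proof.
move=> s0; set H := hr l v; set J := hi l v.
have HE : H = \sum_n (ar l n * psr l n v + ai l n * psi l n v) by [].
have JE : J = \sum_n (ar l n * psi l n v - ai l n * psr l n v) by [].
set s1 := sl l; pose q := (H ^+ 2 + J ^+ 2) / s1 ^+ 2.
have A1 : 2 / s1 * (H * H + J * J) = \sum_n 2 / s1 * ((ar l n * psr l n v + ai l n * psi l n v) * H
    + (ar l n * psi l n v - ai l n * psr l n v) * J).
  by rewrite -mulr_sumr big_split/= -!mulr_suml -HE -JE.
have A2 : q * s1 = \sum_n q * (ar l n ^+ 2 + ai l n ^+ 2) by rewrite -mulr_sumr.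
transitivity (dPsi l v v - 2 / s1 * (H * H + J * J) + q * s1).
  by rewrite /beta -/H -/J -/s1 /q; field.
rewrite A1 A2 -sumrN -!big_split/=.
by apply: eq_bigr => n _; rewrite /Br /Bi -/H -/J -/s1 /q; field.
Qed.

Lemma beta_ge0 l v : sl l != 0 -> 0 <= beta l v v.
Proof. by move=> s0; rewrite betaE//; apply: sumr_ge0 => n _; rewrite addr_ge0 ?sqr_ge0. Qed.

Lemma beta_le l v : beta l v v <= dPsi l v v.
Proof.
rewrite /beta gerBl divr_ge0 ?sl_ge0//.
by rewrite -!expr2 addr_ge0 ?sqr_ge0.
Qed.

Lemma h_le l v : sl l != 0 -> hr l v ^+ 2 + hi l v ^+ 2 <= sl l * dPsi l v v.
Proof.
move=> s0; have := beta_ge0 v s0; rewrite /beta subr_ge0.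
have sp : 0 < sl l by rewrite lt0r s0 sl_ge0.
by rewrite ler_pdivrMr// -!expr2 mulrC.
Qed.

Lemma psr_base l n : psr l n mbase = ar l n.
Proof.
rewrite /psr (bigD1 k0)//= big1 ?addr0; first by rewrite /mbase eqxx mulrC.
by move=> k kk; rewrite /mbase (negbTE kk) mulr0.
Qed.
Lemma psi_base l n : psi l n mbase = ai l n.
Proof.
rewrite /psi (bigD1 k0)//= big1 ?addr0; first by rewrite /mbase eqxx mulrC.
by move=> k kk; rewrite /mbase (negbTE kk) mulr0.
Qed.
Lemma hr_base l : hr l mbase = sl l.
Proof. by apply: eq_bigr => n _; rewrite psr_base psi_base -!expr2. Qed.
Lemma hi_base l : hi l mbase = 0.
Proof. by rewrite /hi big1// => n _; rewrite psr_base psi_base mulrC subrr. Qed.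
Lemma dPsi_base l v : dPsi l v mbase = hr l v.
Proof. by apply: eq_bigr => n _; rewrite psr_base psi_base; ring. Qed.
Lemma beta_base l v : sl l != 0 -> beta l v mbase = 0.
Proof. by move=> s0; rewrite /beta dPsi_base hr_base hi_base; field. Qed.
Lemma mv_base : mv mbase = \sum_n mu n ^+ 2.
Proof. by apply: eq_bigr => n _; rewrite /mbase eqxx expr2. Qed.

Lemma MM_base Q v : (forall l, sl l != 0) -> MM Q v mbase = 0.
Proof. by move=> s0; rewrite /MM big1// => l _; rewrite beta_base// mulr0. Qed.
Lemma ee_base Q : (forall l, sl l != 0) -> \sum_n mu n ^+ 2 = 1 -> ee Q mbase = 0.
Proof.
by move=> s0 m1; rewrite /ee big1// => l _; rewrite hr_base mv_base m1 divff// subrr mulr0.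
Qed.

Lemma psi2_le l n v : psr l n v ^+ 2 + psi l n v ^+ 2 <=
  (\sum_k (cr n l k ^+ 2 + ci n l k ^+ 2)) * vn v n.
Proof.
by rewrite big_split mulrDl /=; apply: lerD; exact: sum_CS1.
Qed.

(* The normal equation of the certificate. [mbase] spans the kernel of [MM] and the rank-one term
   mv v * mv u pins the solution to mv v = 0. *)
Definition solves (Q : pred Lt) v := forall u, MM Q v u + mv v * mv u = - ee Q u.

Section Solve.
Variable Q : pred Lt.
Local Notation dim := #|{: Nt * Kt}|.

Definition ebv (i : 'I_dim) : Nt -> Kt -> R := fun n k => (enum_val i == (n, k))%:R.
Definition ofrow (r : 'rV[R]_dim) : Nt -> Kt -> R := fun n k => r 0 (enum_rank (n, k)).
Definition smx : 'M[R]_dim := \matrix_(i, j) (MM Q (ebv i) (ebv j) + mv (ebv i) * mv (ebv j)).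
Definition srow : 'rV[R]_dim := \row_j - ee Q (ebv j).
(* Cramer's rule without the division by the determinant: a polynomial, hence measurable, function of the
   coefficients. *)
Definition psol := srow *m \adj smx.

Lemma lin_ofrow (F : (Nt -> Kt -> R) -> R) (r : 'rV[R]_dim) :
  (forall a u v, F (lc a u v) = F v + a * F u) -> F (ofrow r) = \sum_i r 0 i * F (ebv i).
Proof.
move=> Fl.
have F0 : F (fun _ _ => 0) = 0.
  have := Fl (-1) (fun _ _ => 0) (fun _ _ => 0).
  have -> : lc (-1) (fun _ _ => 0) (fun _ _ => 0) = (fun _ _ => 0) :> (Nt -> Kt -> R).
    by apply/funext => n; apply/funext => k; rewrite /lc mulr0 addr0.
  by rewrite mulN1r subrr.
have H (s : seq 'I_dim) : F (fun n k => \sum_(i <- s) r 0 i * ebv i n k) = \sum_(i <- s) r 0 i * F (ebv i).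
  elim: s => [|i s IH].
    by rewrite big_nil -[RHS]F0; congr F; apply/funext => n; apply/funext => k; rewrite big_nil.
  rewrite big_cons -IH addrC -Fl; congr F; apply/funext => n; apply/funext => k.
  by rewrite big_cons /lc addrC.
rewrite -H; congr F; apply/funext => n; apply/funext => k.
rewrite (bigD1 (enum_rank (n, k)))//= big1 ?addr0.
  by rewrite /ebv enum_rankK eqxx mulr1.
move=> i ink; rewrite /ebv (_ : _ == _ = false) ?mulr0//.
by apply: contraNF ink => /eqP <-; rewrite enum_valK.
Qed.

Lemma ofrowE (v : Nt -> Kt -> R) : v = ofrow (\row_i v (enum_val i).1 (enum_val i).2).
Proof. by apply/funext => n; apply/funext => k; rewrite /ofrow mxE enum_rankK. Qed.

Definition form v u := MM Q v u + mv v * mv u.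

Lemma form_lc a u v x : form (lc a u v) x = form v x + a * form u x.
Proof. by rewrite /form MM_lc mv_lc; ring. Qed.
Lemma formC v u : form v u = form u v.
Proof. by rewrite /form MMC; congr (_ + _); ring. Qed.

Lemma form_ofrow r u : form (ofrow r) u = \sum_i r 0 i * form (ebv i) u.
Proof. by apply: (@lin_ofrow (form^~ u)) => a x y; rewrite form_lc. Qed.

Lemma smx_form r i : form (ofrow r) (ebv i) = (r *m smx) 0 i.
Proof. by rewrite form_ofrow mxE; apply: eq_bigr => j _; rewrite mxE. Qed.

Variable kap : R.
Hypothesis kap0 : 0 < kap.
Hypothesis coer : forall v, kap * v2 v <= MM Q v v + mv v ^+ 2.

(** A vector in the kernel of [smx] has zero energy, hence vanishes by coercivity. *)
Lemma smx_det : \det smx != 0.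
Proof.
apply/negP => /det0P[r r0 rA].
have F0 u : form (ofrow r) u = 0.
  rewrite [u]ofrowE formC form_ofrow big1// => i _.
  by rewrite formC smx_form rA [X in _ * X]mxE mulr0.
have := coer (ofrow r); have := F0 (ofrow r); rewrite /form -expr2 => ->.
rewrite pmulr_rle0// => H.
have /psumr_eq0P E : v2 (ofrow r) = 0 by apply/eqP; rewrite eq_le H v2_ge0.
move/negP: r0; apply; apply/eqP/rowP => j; rewrite mxE.
have := E (fun n _ => vn_ge0 _ n) (enum_val j).1 isT; rewrite /vn => /psumr_eq0P E2.
have := E2 (fun k _ => sqr_ge0 _) (enum_val j).2 isT => /eqP.
by rewrite sqrf_eq0 /ofrow -surjective_pairing enum_valK => /eqP.
Qed.

Lemma psol_solves : solves Q (ofrow ((\det smx)^-1 *: psol)).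
Proof.
move=> u; rewrite -/(form _ _).
have H i : form (ofrow ((\det smx)^-1 *: psol)) (ebv i) = - ee Q (ebv i).
  rewrite smx_form -scalemxAl /psol -mulmxA mul_adj_mx mul_mx_scalar scalerA mulVf ?smx_det//.
  by rewrite scale1r mxE.
rewrite [u]ofrowE formC form_ofrow (lin_ofrow _ (@ee_lc Q)) -sumrN.
by apply: eq_bigr => i _; rewrite formC H mulrN.
Qed.

End Solve.

Section Hyps.
(** [w] bounds the weight of one frequency, [cm] the squared norms of the c_(l,n), [epsQ] the form
    [QQ] on the complement of m, [epse] the residual [ee] per block, and [CD] the diagonal blocks of
    [QQ] relative to [mu n ^+ 2]. *)
Variables (w cm epsQ epse CD : R).
Hypothesis p0 : forall l, 0 <= p l.
Hypothesis p1 : \sum_l p l = 1.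
Hypothesis mu1 : \sum_n mu n ^+ 2 = 1.
Hypothesis mu0 : forall n, 0 <= mu n.
Hypothesis s_lo : forall l, 2^-1 <= sl l.
Hypothesis s_hi : forall l, sl l <= 2.
Hypothesis c_le : forall n l, \sum_k (cr n l k ^+ 2 + ci n l k ^+ 2) <= cm.
Hypothesis G_lo : forall n v, 2 / 5 * vn v n <= \sum_l p l * (psr l n v ^+ 2 + psi l n v ^+ 2).
Hypothesis Q_le : forall v, mv v = 0 -> QQ xpredT v <= epsQ * v2 v.
Hypothesis e_le : forall n v, `|\sum_l p l * ((ar l n * psr l n v + ai l n * psi l n v) / sl l) - mu n * v n k0|
   <= epse * mu n * Num.sqrt (vn v n).
Hypothesis D_le : forall n v, \sum_l p l * ((ar l n ^+ 2 + ai l n ^+ 2) * (psr l n v ^+ 2 + psi l n v ^+ 2))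
   <= CD * mu n ^+ 2 * vn v n.
Hypothesis epsQ_small : epsQ <= 64^-1.
Hypothesis cm0 : 0 <= cm.
Hypothesis w_small : 2 * w * cm <= 16^-1.

Lemma s_neq0 l : sl l != 0.
Proof. by rewrite gt_eqF//; apply: lt_le_trans (s_lo l). Qed.
Lemma s_gt0 l : 0 < sl l.
Proof. by apply: lt_le_trans (s_lo l). Qed.

Lemma MM_ge0 Q v : 0 <= MM Q v v.
Proof. by apply: sumr_ge0 => l _; rewrite mulr_ge0// beta_ge0// s_neq0. Qed.

Lemma dPsi_le_cm l v : dPsi l v v <= cm * v2 v.
Proof.
rewrite /dPsi /v2 mulr_sumr; apply: ler_sum => n _; rewrite -!expr2.
apply: (le_trans (psi2_le _ _ _)); apply: ler_wpM2r => //; exact: vn_ge0.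
Qed.

(** Summing [G_lo] over the blocks gives [2 / 5]; projecting off the a_l takes away at most
    [2 * QQ], hence at most [1 / 32]. *)
Lemma M_lo v : mv v = 0 -> 4^-1 * v2 v <= MM xpredT v v.
Proof.
move=> mv0.
have G : 2 / 5 * v2 v <= \sum_l p l * dPsi l v v.
  rewrite /v2 mulr_sumr; apply: (@le_trans _ _ (\sum_n \sum_l p l * (psr l n v ^+ 2 + psi l n v ^+ 2))).
    by apply: ler_sum => n _; exact: G_lo.
  rewrite exchange_big /=; apply: ler_sum => l _; rewrite -mulr_sumr; apply: ler_wpM2l => //.
have Q : \sum_l p l * ((hr l v * hr l v + hi l v * hi l v) / sl l) <= 2 * QQ xpredT v.
  rewrite /QQ mulr_sumr; apply: ler_sum => l _; rewrite [leRHS]mulrCA; apply: ler_wpM2l => //.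
  rewrite -!expr2 ler_pdivrMr ?s_gt0//.
  have := s_lo l; have : 0 <= hr l v ^+ 2 + hi l v ^+ 2 by rewrite addr_ge0 ?sqr_ge0.
  nra.
have -> : MM xpredT v v = \sum_l p l * dPsi l v v - \sum_l p l * ((hr l v * hr l v + hi l v * hi l v) / sl l).
  by rewrite -sumrB; apply: eq_bigr => l _; rewrite /beta mulrBr.
have := ler_wpM2r (v2_ge0 v) epsQ_small; have := Q_le mv0; have := v2_ge0 v; lra.
Qed.

(** Write [v = t m + u] with [u] orthogonal to m: the form [MM] does not see the component along m,
    and the rank-one term gives back [t ^+ 2]. *)
Lemma M'_lo v : 4^-1 * v2 v <= MM xpredT v v + mv v ^+ 2.
Proof.
set t := mv v; pose u := lc (- t) mbase v.
have mu0' : mv u = 0 by rewrite mv_lc mv_base mu1 -/t; ring.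
have vE : v = lc t mbase u by apply/funext => n; apply/funext => k; rewrite /u /lc; ring.
move: mu0' vE; clearbody u => mu0' vE; clearbody t.
have -> : MM xpredT v v = MM xpredT u u.
  have B x : MM xpredT x mbase = 0 by apply: MM_base; exact: s_neq0.
  have B' x : MM xpredT mbase x = 0 by rewrite MMC.
  have -> : MM xpredT v v = MM xpredT (lc t mbase u) (lc t mbase u) by rewrite -vE.
  by rewrite MM_lc !MM_lcr !B !B'; ring.
have -> : v2 v = v2 u + t ^+ 2.
  have E : v2 v = v2 u + 2 * t * mv u + t ^+ 2 * \sum_n mu n ^+ 2.
    rewrite {1}vE /v2 /mv !mulr_sumr -!big_split/=; apply: eq_bigr => n _.
    rewrite /vn (bigD1 k0)//= [in RHS](bigD1 k0)//= /lc {1}/mbase eqxx.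
    rewrite [X in _ + X = _](eq_bigr (fun k => u n k ^+ 2)); first by ring.
    by move=> k kk; rewrite /mbase (negbTE kk) mulr0 addr0.
  by rewrite E mu0' mu1; ring.
have := M_lo mu0'; have := sqr_ge0 t; lra.
Qed.

Section Loo.
Variable S : pred Lt.
Let NS : pred Lt := fun l => ~~ S l.
Hypothesis S_w : \sum_(l | S l) p l <= 2 * w.
Let q := \sum_(l | S l) p l.

Let q0 : 0 <= q. Proof. by apply: sumr_ge0 => l _. Qed.

Lemma MM_split v u : MM xpredT v u = MM S v u + MM NS v u.
Proof. by rewrite /MM (bigID S). Qed.

Lemma ee_split v : ee xpredT v = ee S v + ee NS v.
Proof. by rewrite /ee (bigID S). Qed.

(** The frequencies in [S] have total weight at most [2 * w]; omitting them lowers the coercivity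
    constant from [1 / 4] to no less than [1 / 8]. *)
Lemma MS_le v : MM S v v <= 16^-1 * v2 v.
Proof.
apply: (@le_trans _ _ (q * (cm * v2 v))).
  rewrite /q mulr_suml; apply: ler_sum => l _; apply: ler_wpM2l => //.
  by apply: (le_trans (beta_le _ _)); exact: dPsi_le_cm.
rewrite mulrA; have v0 := v2_ge0 v; apply: ler_wpM2r => //.
by apply: le_trans w_small; apply: ler_wpM2r.
Qed.

Lemma MNS'_lo v : 8^-1 * v2 v <= MM NS v v + mv v ^+ 2.
Proof. have := M'_lo v; rewrite MM_split; have := MS_le v; have := v2_ge0 v; lra. Qed.

Lemma solves_mv Q v : solves Q v -> mv v = 0.
Proof.
move=> /(_ mbase); rewrite MM_base; last exact: s_neq0.
rewrite ee_base ?oppr0 ?add0r ?mv_base ?mu1 ?mulr1//; exact: s_neq0.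
Qed.

Lemma MS_tri v u a : MM S (lc a u v) (lc a u v) = MM S v v + 2 * a * MM S u v + a ^+ 2 * MM S u u.
Proof. by rewrite MM_lc !MM_lcr (MMC _ v u); ring. Qed.

(* v minimizes an energy that differs from the one minimized by v0 only in the terms of S. *)
Lemma loo_energy v v0 : solves xpredT v -> solves NS v0 ->
  MM S v v <= 4 * MM S v0 v0 + 16 * q ^+ 2 * cm.
Proof.
move=> sv sv0; pose d := lc (-1) v0 v.
have mv1 := solves_mv sv; have mv2 := solves_mv sv0.
have md : mv d = 0 by rewrite mv_lc mv1 mv2; ring.
(* The difference of the two equations, tested against [d = v - v0]. *)
have E : MM NS d d + MM S d d + MM S v0 d = - ee S d.
  have := sv d; rewrite mv1 mul0r addr0 MM_split ee_split.
  have := sv0 d; rewrite mv2 mul0r addr0 => E0 E1.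
  have -> : MM NS d d = MM NS v d - MM NS v0 d by rewrite {1}/d MM_lc; ring.
  have -> : MM S d d = MM S v d - MM S v0 d by rewrite {1}/d MM_lc; ring.
  lra.
have lo : 8^-1 * v2 d <= MM NS d d by have := MNS'_lo d; rewrite md expr0n addr0.
have cs : - MM S v0 d <= 2^-1 * MM S d d + 2^-1 * MM S v0 v0.
  have := MM_ge0 S (lc 1 v0 d); rewrite MS_tri; lra.
have dd0 := MM_ge0 S d; have vv0 := MM_ge0 S v0.
have esq : ee S d ^+ 2 <= q ^+ 2 * (2 * cm * v2 d).
  have -> : ee S d = \sum_(l | S l) p l * 1 * (hr l d / sl l).
    by apply: eq_bigr => l _; rewrite md subr0 mulr1.
  apply: (le_trans (@sum_CS _ _ _ p (fun=> 1) (fun l => hr l d / sl l) p0)).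
  rewrite (eq_bigr p); last by move=> l _; rewrite expr1n mulr1.
  rewrite -/q expr2 -mulrA; apply: ler_wpM2l => //.
  rewrite /q mulr_suml; apply: ler_sum => l _; apply: ler_wpM2l => //.
  rewrite expr_div_n ler_pdivrMr ?exprn_gt0 ?s_gt0//.
  have h1 := h_le d (s_neq0 l); have h2 := dPsi_le_cm l d; have h3 := s_lo l.
  have h4 := dPsi_ge0 l d; have h5 := sqr_ge0 (hi l d).
  apply: (@le_trans _ _ (sl l * (cm * v2 d))).
    by apply: le_trans (ler_wpM2l (ltW (s_gt0 l)) h2); lra.
  have : 0 <= cm * v2 d by lra.
  have : sl l <= 2 * sl l ^+ 2 by nra.
  rewrite -(mulrA 2 cm); nra.
have eb : - ee S d <= 8^-1 * v2 d + 4 * q ^+ 2 * cm.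
  set a := 8^-1 * v2 d; set b := 4 * q ^+ 2 * cm.
  have a0 : 0 <= a by rewrite mulr_ge0// v2_ge0.
  have b0 : 0 <= b by rewrite !mulr_ge0// sqr_ge0.
  have : (ee S d) ^+ 2 <= (a + b) ^+ 2.
    apply: (le_trans esq); have := sqr_ge0 (a - b).
    have -> : q ^+ 2 * (2 * cm * v2 d) = 4 * a * b by rewrite /a /b; field.
    lra.
  rewrite -[leLHS]real_normK ?num_real// ler_pXn2r ?nnegrE ?addr_ge0//.
  by have := ler_norm (- ee S d); rewrite normrN; lra.
have t1 := MM_ge0 S (lc (-1) v0 d).
have -> : MM S v v = MM S d d + 2 * MM S v0 d + MM S v0 v0.
  have -> : v = lc 1 v0 d by apply/funext => n; apply/funext => k; rewrite /d /lc; ring.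
  by rewrite MS_tri /d; ring.
rewrite MS_tri in t1.
have := MM_ge0 S v0.
lra.
Qed.

Definition blk n v : Nt -> Kt -> R := fun n' k => if n' == n then v n' k else 0.

Lemma psr_blk l n m v : psr l m (blk n v) = if m == n then psr l n v else 0.
Proof.
rewrite /psr /blk; case: eqP => [->//|_]; by rewrite big1// => k _; rewrite mulr0.
Qed.
Lemma psi_blk l n m v : psi l m (blk n v) = if m == n then psi l n v else 0.
Proof.
rewrite /psi /blk; case: eqP => [->//|_]; by rewrite big1// => k _; rewrite mulr0.
Qed.
Lemma sum_blk n (F : Nt -> R) : \sum_m (if m == n then F m else 0) = F n.
Proof. by rewrite -big_mkcond big_pred1_eq. Qed.
Lemma hr_blk l n v : hr l (blk n v) = ar l n * psr l n v + ai l n * psi l n v.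
Proof.
rewrite /hr -(sum_blk n (fun m => ar l m * psr l m v + ai l m * psi l m v)).
by apply: eq_bigr => m _; rewrite psr_blk psi_blk; case: eqP => [->//|_]; rewrite !mulr0 addr0.
Qed.
Lemma hi_blk l n v : hi l (blk n v) = ar l n * psi l n v - ai l n * psr l n v.
Proof.
rewrite /hi -(sum_blk n (fun m => ar l m * psi l m v - ai l m * psr l m v)).
by apply: eq_bigr => m _; rewrite psr_blk psi_blk; case: eqP => [->//|_]; rewrite !mulr0 subrr.
Qed.
Lemma mv_blk n v : mv (blk n v) = mu n * v n k0.
Proof.
rewrite /mv -(sum_blk n (fun m => mu m * v m k0)).
by apply: eq_bigr => m _; rewrite /blk; case: eqP => [->//|_]; rewrite mulr0.
Qed.
Lemma dPsi_blk l n v u : dPsi l u (blk n v) = psr l n u * psr l n v + psi l n u * psi l n v.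
Proof.
rewrite /dPsi -(sum_blk n (fun m => psr l m u * psr l m v + psi l m u * psi l m v)).
by apply: eq_bigr => m _; rewrite psr_blk psi_blk; case: eqP => [->//|_]; rewrite !mulr0 addr0.
Qed.
Lemma ee_blk Q v : ee Q v = \sum_n ee Q (blk n v).
Proof.
rewrite /ee exchange_big /=; apply: eq_bigr => l _; rewrite -mulr_sumr; congr (_ * _).
rewrite sumrB -mulr_suml; congr (_ / _ - _).
  by apply: eq_bigr => n _; rewrite hr_blk.
by apply: eq_bigr => n _; rewrite mv_blk.
Qed.

Lemma ler_abs_sqr (x y : R) : 0 <= y -> x ^+ 2 <= y ^+ 2 -> `|x| <= y.
Proof. by move=> y0 H; rewrite -(@ler_pXn2r _ 2) ?nnegrE// real_normK ?num_real. Qed.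

Hypothesis w0 : 0 <= w.
Let epsp := epse + 2 * w * (2 * cm + 1).

(** [e_le] is about all frequencies; removing [S] adds at most its weight times a bound on a single
    term, which is where [2 * w * (2 * cm + 1)] in [epsp] comes from. *)
Lemma ee_NS_blk n v : `|ee NS (blk n v)| <= epsp * mu n * Num.sqrt (vn v n).
Proof.
set y := Num.sqrt _; have y0 : 0 <= y by rewrite sqrtr_ge0.
have y2 : y ^+ 2 = vn v n by rewrite sqr_sqrtr// vn_ge0.
have E1 : ee xpredT (blk n v) = \sum_l p l * ((ar l n * psr l n v + ai l n * psi l n v) / sl l) - mu n * v n k0.
  rewrite /ee; under eq_bigr do rewrite hr_blk mv_blk mulrBr.
  by rewrite sumrB -mulr_suml p1 mul1r.
have -> : ee NS (blk n v) = ee xpredT (blk n v) - ee S (blk n v) by rewrite ee_split; ring.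
apply: (le_trans (ler_normB _ _)).
have -> : epsp * mu n * y = epse * mu n * y + 2 * w * ((2 * cm + 1) * mu n * y) by rewrite /epsp; ring.
apply: lerD; first by rewrite E1; exact: e_le.
have c2 : 0 <= (2 * cm + 1) * mu n * y by rewrite !mulr_ge0// addr_ge0// mulr_ge0.
apply: (@le_trans _ _ (q * ((2 * cm + 1) * mu n * y))); last exact: ler_wpM2r.
apply: (le_trans (ler_norm_sum _ _ _)); rewrite /q mulr_suml; apply: ler_sum => l _.
rewrite normrM ger0_norm//; apply: ler_wpM2l => //.
apply: (le_trans (ler_normB _ _)).
have -> : (2 * cm + 1) * mu n * y = 2 * (cm * mu n * y) + mu n * y by ring.
have vk : v n k0 ^+ 2 <= vn v n.
  by rewrite /vn (bigD1 k0)//= lerDl; apply: sumr_ge0 => k _; rewrite sqr_ge0.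
apply: lerD; last first.
  rewrite mv_blk normrM ger0_norm//; apply: ler_wpM2l => //.
  by apply: ler_abs_sqr => //; rewrite y2.
rewrite normrM normfV (gtr0_norm (s_gt0 l)) ler_pdivrMr ?s_gt0//.
have : `|hr l (blk n v)| <= cm * mu n * y.
  apply: ler_abs_sqr; first by rewrite !mulr_ge0.
  have h1 : hr l (blk n v) ^+ 2 <= (ar l n ^+ 2 + ai l n ^+ 2) * (psr l n v ^+ 2 + psi l n v ^+ 2).
    rewrite hr_blk; have := sqr_ge0 (ar l n * psi l n v - ai l n * psr l n v); nra.
  apply: (le_trans h1).
  have -> : (cm * mu n * y) ^+ 2 = (mu n ^+ 2 * cm) * (cm * vn v n) by rewrite -y2; ring.
  apply: ler_pM; rewrite ?addr_ge0 ?sqr_ge0//.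
    rewrite /ar /ai !exprMn -mulrDr; apply: ler_wpM2l; first exact: sqr_ge0.
    apply: le_trans (c_le n l); rewrite (bigD1 k0)//= lerDl.
    by apply: sumr_ge0 => k _; rewrite addr_ge0 ?sqr_ge0.
  apply: (le_trans (psi2_le _ _ _)); apply: ler_wpM2r => //; exact: vn_ge0.
have := s_lo l; have : 0 <= cm * mu n * y by rewrite !mulr_ge0.
set z := cm * mu n * y; nra.
Qed.

Hypothesis epse0 : 0 <= epse.

Lemma epsp_ge0 : 0 <= epsp.
Proof. by rewrite addr_ge0// !mulr_ge0// addr_ge0// mulr_ge0. Qed.

(** The equation is tested against [v0] itself, and coercivity bounds the left side from below. *)
Lemma loo_v2 v0 : solves NS v0 -> v2 v0 <= (8 * epsp) ^+ 2.
Proof.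
move=> sv; have m0 := solves_mv sv.
have := sv v0; rewrite m0 mul0r addr0 => E.
have lo := MNS'_lo v0; rewrite m0 expr0n addr0 in lo.
set V := Num.sqrt (v2 v0); have V0 : 0 <= V by rewrite sqrtr_ge0.
have V2 : V ^+ 2 = v2 v0 by rewrite sqr_sqrtr// v2_ge0.
have up : - ee NS v0 <= epsp * V.
  apply: (@le_trans _ _ (\sum_n epsp * (mu n * Num.sqrt (vn v0 n)))).
    rewrite ee_blk -sumrN; apply: ler_sum => n _; rewrite mulrA.
    by apply: le_trans (ee_NS_blk n v0); rewrite -normrN ler_norm.
  rewrite -mulr_sumr; apply: ler_wpM2l; first exact: epsp_ge0.
  apply: le_trans (ler_norm _) _; apply: ler_abs_sqr => //.
  apply: (le_trans (sum_CS1 _ _)); rewrite mu1 mul1r V2 le_eqVlt; apply/orP; left; apply/eqP.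
  by apply: eq_bigr => n _; rewrite sqr_sqrtr// vn_ge0.
have e0 := epsp_ge0.
rewrite -V2 in lo *; rewrite ler_pXn2r ?nnegrE ?mulr_ge0//.
have [V1|Vp] := leP V 0; first by apply: le_trans V1 _; rewrite mulr_ge0.
have : 8^-1 * V * V <= epsp * V by rewrite -mulrA -expr2; lra.
rewrite ler_pM2r//; lra.
Qed.

Hypothesis CD0 : 0 <= CD.

(** The equation is tested against the block [n] of [v0]. The coupling to the other blocks passes
    through h_l v0, and Cauchy-Schwarz bounds it by [QQ] at [v0] and [QQ] at that block. The gain is
    the factor [mu n ^+ 2]: no block of [v0] dominates, as the Gaussian tail bound for Psi_l v0
    requires. *)
Lemma loo_vn v0 n : solves NS v0 ->
  vn v0 n <= (4 * epsp * (1 + 16 * Num.sqrt CD)) ^+ 2 * mu n ^+ 2.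
Proof.
move=> sv; have m0 := solves_mv sv.
have := sv (blk n v0); rewrite m0 mul0r addr0 => E.
have eb := ee_NS_blk n v0.
set y := Num.sqrt (vn v0 n) in eb; have y0 : 0 <= y by rewrite sqrtr_ge0.
have y2 : y ^+ 2 = vn v0 n by rewrite sqr_sqrtr// vn_ge0.
pose X l := (hr l v0 * hr l (blk n v0) + hi l v0 * hi l (blk n v0)) / sl l.
have E2 : \sum_(l | NS l) p l * (psr l n v0 ^+ 2 + psi l n v0 ^+ 2) = - ee NS (blk n v0) + \sum_(l | NS l) p l * X l.
  rewrite -E /MM -big_split/=; apply: eq_bigr => l _.
  by rewrite /beta dPsi_blk /X; ring.
have lo : 4^-1 * y ^+ 2 <= \sum_(l | NS l) p l * (psr l n v0 ^+ 2 + psi l n v0 ^+ 2).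
  have h1 := G_lo n v0; rewrite (bigID S)/= in h1.
  have h2 : \sum_(l | S l) p l * (psr l n v0 ^+ 2 + psi l n v0 ^+ 2) <= 16^-1 * y ^+ 2.
    apply: (@le_trans _ _ (q * (cm * vn v0 n))).
      rewrite /q mulr_suml; apply: ler_sum => l _; apply: ler_wpM2l => //.
      apply: (le_trans (psi2_le _ _ _)); apply: ler_wpM2r => //; exact: vn_ge0.
    rewrite y2 mulrA; apply: ler_wpM2r; first exact: vn_ge0.
    by apply: le_trans w_small; apply: ler_wpM2r.
  have := sqr_ge0 y; rewrite -y2 in h1; rewrite /NS; lra.
have Xb : \sum_(l | NS l) p l * X l <= 16 * epsp * Num.sqrt CD * mu n * y.
  apply: le_trans (ler_norm _) _; apply: ler_abs_sqr.
    by rewrite !mulr_ge0 ?epsp_ge0 ?sqrtr_ge0.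
  (* The boolean separates real and imaginary parts, so that a single Cauchy-Schwarz covers both. *)
  pose W (i : Lt * bool) := p i.1.
  pose f (i : Lt * bool) := if i.2 then hr i.1 v0 else hi i.1 v0.
  pose g (i : Lt * bool) := (if i.2 then hr i.1 (blk n v0) else hi i.1 (blk n v0)) / sl i.1.
  have sumb (F : Lt -> bool -> R) : \sum_(i : Lt * bool | NS i.1) F i.1 i.2 = \sum_(l | NS l) (F l true + F l false).
    transitivity (\sum_(l | NS l) \sum_(b : bool) F l b).
      by rewrite pair_big /=; apply: eq_bigl => -[l b] /=; rewrite andbT.
    by apply: eq_bigr => l _; rewrite big_bool.
  have -> : \sum_(l | NS l) p l * X l = \sum_(i | NS i.1) W i * f i * g i.
    rewrite (sumb (fun l b => p l * (if b then hr l v0 else hi l v0) * ((if b then hr l (blk n v0) else hi l (blk n v0)) / sl l))).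
    by apply: eq_bigr => l _; rewrite /X; ring.
  apply: (le_trans (sum_CS _ _ _ _)); first by move=> i; exact: p0.
  rewrite (sumb (fun l b => p l * (if b then hr l v0 else hi l v0) ^+ 2)).
  rewrite (sumb (fun l b => p l * ((if b then hr l (blk n v0) else hi l (blk n v0)) / sl l) ^+ 2)).
  have hA : \sum_(l | NS l) (p l * hr l v0 ^+ 2 + p l * hi l v0 ^+ 2) <= epsp ^+ 2.
    apply: (@le_trans _ _ (QQ xpredT v0)).
      rewrite /QQ [leRHS](bigID NS)/= -[leLHS]addr0; apply: lerD.
        by apply: ler_sum => l _; rewrite mulrDr.
      by apply: sumr_ge0 => l _; rewrite mulr_ge0// addr_ge0 ?sqr_ge0.
    apply: (le_trans (Q_le m0)); have h1 := loo_v2 sv; have h2 := v2_ge0 v0.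
    apply: (le_trans (ler_wpM2r h2 epsQ_small)); rewrite exprMn in h1; lra.
  have hB : \sum_(l | NS l) (p l * (hr l (blk n v0) / sl l) ^+ 2 + p l * (hi l (blk n v0) / sl l) ^+ 2)
      <= 4 * (CD * mu n ^+ 2 * vn v0 n).
    apply: (@le_trans _ _ (4 * \sum_l p l * ((ar l n ^+ 2 + ai l n ^+ 2) * (psr l n v0 ^+ 2 + psi l n v0 ^+ 2)))); last first.
      by apply: ler_wpM2l => //; exact: D_le.
    rewrite mulr_sumr [leRHS](bigID NS)/= -[leLHS]addr0; apply: lerD; last first.
      by apply: sumr_ge0 => l _; rewrite !mulr_ge0// addr_ge0 ?sqr_ge0.
    apply: ler_sum => l _; rewrite -mulrDr mulrCA; apply: ler_wpM2l => //.
    rewrite hr_blk hi_blk !expr_div_n -mulrDl ler_pdivrMr ?exprn_gt0 ?s_gt0//.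
    have -> : (ar l n * psr l n v0 + ai l n * psi l n v0) ^+ 2 + (ar l n * psi l n v0 - ai l n * psr l n v0) ^+ 2 =
      (ar l n ^+ 2 + ai l n ^+ 2) * (psr l n v0 ^+ 2 + psi l n v0 ^+ 2) by ring.
    set Z := _ * (_ + _); have Z0 : 0 <= Z by rewrite mulr_ge0// addr_ge0 ?sqr_ge0.
    have := s_lo l; set s := sl l => hs; have : 4^-1 <= s ^+ 2 by nra.
    nra.
  have z0 : 0 <= \sum_(l | NS l) (p l * hr l v0 ^+ 2 + p l * hi l v0 ^+ 2).
    by apply: sumr_ge0 => l _; rewrite addr_ge0// mulr_ge0// sqr_ge0.
  have z1 : 0 <= \sum_(l | NS l) (p l * (hr l (blk n v0) / sl l) ^+ 2 + p l * (hi l (blk n v0) / sl l) ^+ 2).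
    by apply: sumr_ge0 => l _; rewrite addr_ge0// mulr_ge0// sqr_ge0.
  apply: (le_trans (ler_pM z0 z1 hA hB)).
  have sC : Num.sqrt CD ^+ 2 = CD by rewrite sqr_sqrtr.
  have -> : (16 * epsp * Num.sqrt CD * mu n * y) ^+ 2 = 64 * (epsp ^+ 2 * (4 * (CD * mu n ^+ 2 * vn v0 n))).
    by rewrite -[in RHS]sC -y2; ring.
  have : 0 <= epsp ^+ 2 * (4 * (CD * mu n ^+ 2 * vn v0 n)).
    apply: mulr_ge0; first exact: sqr_ge0.
    by apply: mulr_ge0 => //; apply: mulr_ge0; [apply: mulr_ge0 => //; exact: sqr_ge0|exact: vn_ge0].
  by set z := epsp ^+ 2 * _; move=> ?; lra.
have ep0 := epsp_ge0.
set A := 4 * epsp * _.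
have A4 : 4^-1 * A = epsp * (1 + 16 * Num.sqrt CD) by rewrite /A; field.
have A0 : 0 <= A by rewrite !mulr_ge0 ?epsp_ge0// addr_ge0// mulr_ge0// sqrtr_ge0.
rewrite -y2 -exprMn ler_pXn2r ?nnegrE ?mulr_ge0//.
have ne : - ee NS (blk n v0) <= epsp * mu n * y by apply: le_trans eb; rewrite -normrN ler_norm.
have [y1|yp] := leP y 0; first by apply: le_trans y1 _; rewrite mulr_ge0.
have : 4^-1 * y * y <= (4^-1 * A * mu n) * y.
  rewrite -mulrA -expr2; apply: (le_trans lo); rewrite E2.
  apply: (le_trans (lerD ne Xb)); rewrite A4 le_eqVlt; apply/orP; left; apply/eqP; ring.
rewrite ler_pM2r//; lra.
Qed.

(** The energy estimate bounds the sum over the pair, hence each of its terms. As the pair weighs at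
    most [2 * p l], the factor [p l] survives on the right, however small it is. *)
Lemma loo_conclusion l v v0 bF : S l -> q <= 2 * p l -> p l <= w -> solves xpredT v -> solves NS v0 ->
  (forall l', S l' -> dPsi l' v0 v0 <= bF) ->
  p l * beta l v v <= p l * (8 * bF + 32 * (2 * w * cm)).
Proof.
move=> Sl ql pw sv sv0 HF.
have bF0 : 0 <= bF by apply: le_trans (HF l Sl); exact: dPsi_ge0.
apply: (@le_trans _ _ (MM S v v)).
  rewrite /MM (bigD1 l)//= lerDl; apply: sumr_ge0 => l' _.
  by rewrite mulr_ge0// beta_ge0// s_neq0.
apply: (le_trans (loo_energy sv sv0)).
have h1 : MM S v0 v0 <= q * bF.
  rewrite /q mulr_suml; apply: ler_sum => l' Sl'; apply: ler_wpM2l => //.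
  by apply: (le_trans (beta_le _ _)); exact: HF.
have h2 : q * bF <= 2 * p l * bF by exact: ler_wpM2r.
have h3 : q ^+ 2 * cm <= 4 * (p l * (w * cm)).
  have : q ^+ 2 <= 4 * (p l * w).
    have := p0 l; have := q0; nra.
  by move=> /(ler_wpM2r cm0); rewrite -!mulrA.
lra.
Qed.

End Loo.

End Hyps.

End DetCore.

(** * Nets of balls *)

Section Net.
Context {R : realType} {K : finType}.
Implicit Types y z : rvec R K.

Let s := (16 * #|K|)%N.
(** A cubic grid of step [1 / s] in the cube [[-1, 1]^K], located by [gp]. Its logarithmic size is
    of order K log K, and alpha_1 accounts for the logarithm. *)
Definition netT := {ffun K -> 'I_(2 * s).+1}.
Definition gp (g : netT) : rvec R K := fun k => (g k)%:R / s%:R - 1.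
Definition n2 y := \sum_k y k ^+ 2.

Lemma n2_ge0 y : 0 <= n2 y.
Proof. by apply: sumr_ge0 => k _; exact: sqr_ge0. Qed.

(** From [2 y z <= y^2 / 4 + 4 z^2]: the first term is nearly undisturbed, and the rounding error
    takes the large constant. *)
Lemma n2D y z : n2 (fun k => y k + z k) <= 5 / 4 * n2 y + 5 * n2 z.
Proof.
rewrite /n2 !mulr_sumr -big_split; apply: ler_sum => k _ /=.
by have := sqr_ge0 (2^-1 * y k - 2 * z k); nra.
Qed.

Lemma n2Z a y : n2 (fun k => a * y k) = a ^+ 2 * n2 y.
Proof. by rewrite /n2 mulr_sumr; apply: eq_bigr => k _; rewrite exprMn. Qed.

Lemma coord_n2 y k : y k ^+ 2 <= n2 y.
Proof. by rewrite /n2 (bigD1 k)//= lerDl; apply: sumr_ge0 => i _; exact: sqr_ge0. Qed.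

(** Rounding down loses at most [1 / (16 #|K|)] in each of the [#|K|] coordinates. *)
Lemma net_round y : n2 y <= 1 -> exists g : netT, n2 (fun k => y k - gp g k) <= 256^-1.
Proof.
move=> y1.
have [K0|K0] := posnP #|K|.
  exists [ffun=> ord0]; rewrite /n2 big1 => [|k _]; first by rewrite invr_ge0 ler0n.
  by have := fintype0 k K0.
have s0 : 0 < s%:R :> R by rewrite ltr0n muln_gt0.
have yk k : -1 <= y k <= 1.
  rewrite -ler_norml -(@ler_pXn2r _ 2) ?nnegrE// real_normK ?num_real// expr1n.
  by apply: le_trans y1; exact: coord_n2.
have a0 k : 0 <= (y k + 1) * s%:R by rewrite mulr_ge0 ?ler0n//; have /andP[] := yk k; lra.
pose j k := Num.truncn ((y k + 1) * s%:R).
have jb k : (j k < (2 * s).+1)%N.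
  rewrite ltnS /j -(ler_nat R); apply: (@le_trans _ _ ((y k + 1) * s%:R)).
    by rewrite Num.Theory.truncn_le.
  by rewrite natrM ler_wpM2r ?ler0n//; have /andP[] := yk k; lra.
exists [ffun k => Ordinal (jb k)].
apply: (@le_trans _ _ (\sum_(k : K) (s%:R^-1) ^+ 2)).
  apply: ler_sum => k _; rewrite /gp ffunE /=.
  have /andP[h1 h2] := Num.Theory.truncn_itv (a0 k); rewrite -/(j k) in h1 h2.
  have -> : y k - ((j k)%:R / s%:R - 1) = ((y k + 1) * s%:R - (j k)%:R) / s%:R.
    by field; rewrite gt_eqF.
  rewrite exprMn; apply: ler_piMl; first exact: sqr_ge0.
  rewrite -natr1 in h2; rewrite expr_le1//; lra.
rewrite sumr_const -[_ *+ #|_|]mulr_natr natrM /=.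
have k1 : 1 <= #|K|%:R :> R by rewrite (ler_nat R 1).
have k0 : #|K|%:R != 0 :> R by rewrite gt_eqF//; apply: lt_le_trans k1.
have -> : ((16%:R * #|K|%:R)^-1) ^+ 2 * #|K|%:R = 256^-1 * (#|K|%:R)^-1 :> R by field.
by rewrite ler_piMr// invf_le1//; apply: lt_le_trans k1.
Qed.

Section Quad.
Context {J : finType} (w : J -> R) (f : J -> rvec R K).
Hypothesis w0 : forall i, 0 <= w i.
Definition quad y := \sum_i w i * dot (f i) y ^+ 2.

Lemma quad_ge0 y : 0 <= quad y.
Proof. by apply: sumr_ge0 => i _; rewrite mulr_ge0// sqr_ge0. Qed.

Lemma quadZ a y : quad (fun k => a * y k) = a ^+ 2 * quad y.
Proof. by rewrite /quad mulr_sumr; apply: eq_bigr => i _; rewrite dotZr; ring. Qed.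

Lemma quadD y z : quad (fun k => y k + z k) <= 5 / 4 * quad y + 5 * quad z.
Proof.
rewrite /quad !mulr_sumr -big_split; apply: ler_sum => i _ /=.
rewrite dotDr !(mulrCA _ (w i)) -mulrDr; apply: ler_wpM2l => //.
by have := sqr_ge0 (2^-1 * dot (f i) y - 2 * dot (f i) z); nra.
Qed.

(** Some finite constant, from which the iteration in [net_quad] starts. *)
Lemma quad_bounded : exists2 C, 0 <= C & forall y, quad y <= C * n2 y.
Proof.
exists (\sum_i w i * n2 (f i)) => [|y].
  by apply: sumr_ge0 => i _; rewrite mulr_ge0// n2_ge0.
rewrite /quad mulr_suml; apply: ler_sum => i _; rewrite -mulrA; apply: ler_wpM2l => //.
exact: sum_CS1.
Qed.

Lemma net_unit C y : 0 <= C -> (forall z, quad z <= C * n2 z) -> 0 < n2 y ->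
  exists u g, [/\ quad y = n2 y * quad u, n2 u = 1,
     n2 (fun k => u k - gp g k) <= 256^-1 & quad (fun k => u k - gp g k) <= C / 256].
Proof.
move=> C0 H yp.
pose a := Num.sqrt (n2 y); have a2 : a ^+ 2 = n2 y by rewrite sqr_sqrtr// n2_ge0.
have a0 : a != 0 by rewrite sqrtr_eq0 -ltNge.
pose u : rvec R K := fun k => a^-1 * y k.
have yu : y = (fun k => a * u k) by apply/funext => k; rewrite /u mulrA divff// mul1r.
have u1 : n2 u = 1 by rewrite /u n2Z -a2 exprVn mulVf// sqrf_eq0.
have u1' : n2 u <= 1 by rewrite u1.
have [g hg] := net_round u1'; exists u, g; split => //.
  by rewrite {1}yu quadZ a2.
by apply: (le_trans (H _)); apply: ler_wpM2l.
Qed.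

(** A global bound [C] improves to [2 * t + C / 32]: a unit vector is rounded to the grid, and [C]
    is spent on the rounding error only. Iterating removes the dependence on the initial
    constant. *)
Lemma net_quad t : 0 <= t -> (forall g, quad (gp g) <= t * n2 (gp g)) ->
  forall y, quad y <= 4 * t * n2 y.
Proof.
move=> t0 qg.
have step C : 0 <= C -> (forall y, quad y <= C * n2 y) -> forall y, quad y <= (2 * t + C / 32) * n2 y.
  move=> C0 H y.
  have [y0|y0] := eqVneq (n2 y) 0; first by have := H y; rewrite y0 !mulr0.
  have yp : 0 < n2 y by rewrite lt0r y0 n2_ge0.
  have [u [g [qy u1 hg hq]]] := net_unit C0 H yp.
  rewrite qy mulrC; apply: ler_wpM2r; first exact: ltW.
  have h1 := quadD (gp g) (fun k => u k - gp g k).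
  have E : (fun k => gp g k + (u k - gp g k)) = u by apply/funext => k; ring.
  rewrite E in h1.
  have h2 := n2D u (fun k => gp g k - u k).
  have E2 : (fun k => u k + (gp g k - u k)) = gp g by apply/funext => k; ring.
  have E3 : n2 (fun k => gp g k - u k) = n2 (fun k => u k - gp g k).
    by apply: eq_bigr => k _; ring.
  rewrite E2 E3 u1 in h2.
  have h3 := qg g.
  have : t * n2 (gp g) <= t * (3 / 2) by apply: ler_wpM2l => //; lra.
  lra.
have [C C0 HC] := quad_bounded.
have it j : forall y, quad y <= (3 * t + C / 2 ^+ j) * n2 y.
  have e0 i : 0 <= C / 2 ^+ i by rewrite divr_ge0.
  elim: j => [|j IH] y.
    apply: (le_trans (HC y)); apply: ler_wpM2r; first exact: n2_ge0.
    by rewrite expr0 divr1 lerDr mulr_ge0.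
  have c0 : 0 <= 3 * t + C / 2 ^+ j by rewrite addr_ge0// mulr_ge0.
  apply: (le_trans (step _ c0 IH y)); apply: ler_wpM2r; first exact: n2_ge0.
  have := e0 j; have -> : C / 2 ^+ j.+1 = C / 2 ^+ j / 2 by rewrite exprS; field; rewrite expf_neq0.
  by move=> ?; lra.
move=> y; apply: (@le_trans _ _ (3 * t * n2 y)); last first.
  by apply: ler_wpM2r; [exact: n2_ge0|lra].
apply/ler_addgt0Pr => e e0.
(* So many halvings bring the remainder below [e], because [j <= 2 ^ j]. *)
pose j := Num.bound (C * n2 y / e).
apply: (le_trans (it j y)); rewrite mulrDl lerD2l.
have b0 : 0 <= C * n2 y / e by rewrite divr_ge0 ?mulr_ge0 ?n2_ge0// ltW.
have := archi_boundP b0; rewrite -/j ltr_pdivrMr// => h.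
rewrite mulrAC ler_pdivrMr ?exprn_gt0//; apply: (le_trans (ltW h)).
rewrite mulrC; apply: ler_wpM2l; first exact: ltW.
by rewrite -natrX ler_nat; apply: ltnW; exact: ltn_expl.
Qed.

(** The upper bound is proved before the lower one, which needs it for the rounding error. *)
Lemma net_quad_lo : (forall g, `|quad (gp g) - n2 (gp g)| <= 8^-1 * n2 (gp g)) ->
  forall y, 2 / 5 * n2 y <= quad y <= 5 * n2 y.
Proof.
move=> qg.
have up y : quad y <= 9 / 2 * n2 y.
  have -> : 9 / 2 = 4 * (9 / 8) :> R by field.
  apply: net_quad => [|g]; first by [].
  by have := qg g; rewrite ler_norml => /andP[_]; lra.
have up' y : quad y <= 5 * n2 y by have := up y; have := n2_ge0 y; lra.
move=> y; rewrite up' andbT.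
have [y0|y0] := eqVneq (n2 y) 0; first by rewrite y0 mulr0 quad_ge0.
have yp : 0 < n2 y by rewrite lt0r y0 n2_ge0.
have c0 : 0 <= 9 / 2 :> R by [].
have [u [g [qy u1 hg hq]]] := net_unit c0 up yp.
rewrite qy mulrC; apply: ler_wpM2l; first exact: ltW.
have h1 := quadD u (fun k => gp g k - u k).
have E : (fun k => u k + (gp g k - u k)) = gp g by apply/funext => k; ring.
have E3 : quad (fun k => gp g k - u k) = quad (fun k => u k - gp g k).
  apply: eq_bigr => i _; congr (_ * _).
  have -> : (fun k => gp g k - u k) = (fun k => -1 * (u k - gp g k)) by apply/funext => k; ring.
  by rewrite dotZr mulN1r sqrrN.
rewrite E E3 in h1.
have h2 := n2D (gp g) (fun k => u k - gp g k).
have E4 : (fun k => gp g k + (u k - gp g k)) = u by apply/funext => k; ring.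
rewrite E4 u1 in h2.
have := qg g; rewrite ler_norml => /andP[h3 _]; lra.
Qed.

End Quad.

Lemma net_lin (f : rvec R K) (t : R) : 0 <= t ->
  (forall g, dot f (gp g) ^+ 2 <= t * n2 (gp g)) -> forall y, dot f y ^+ 2 <= 4 * t * n2 y.
Proof.
move=> t0 H y.
have E z : quad (fun _ : 'I_1 => 1) (fun=> f) z = dot f z ^+ 2.
  by rewrite /quad big_ord_recl big_ord0 addr0 mul1r.
by rewrite -E; apply: net_quad => // g; rewrite E.
Qed.

(** [net_lin] in each argument in turn, with a factor 4 each time. *)
Lemma net_bilin (b : K -> K -> R) (t : R) : 0 <= t ->
  (forall g g', (\sum_k \sum_k' b k k' * gp g k * gp g' k') ^+ 2 <= t * (n2 (gp g) * n2 (gp g'))) ->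
  forall y y' : rvec R K, (\sum_k \sum_k' b k k' * y k * y' k') ^+ 2 <= 16 * t * (n2 y * n2 y').
Proof.
move=> t0 H y y'.
have E1 (u v : rvec R K) : \sum_k \sum_k' b k k' * u k * v k' = dot (fun k' => \sum_k b k k' * u k) v.
  rewrite exchange_big /dot; apply: eq_bigr => k' _; by rewrite mulr_suml.
have E2 (u v : rvec R K) : \sum_k \sum_k' b k k' * u k * v k' = dot (fun k => \sum_k' b k k' * v k') u.
  rewrite /dot; apply: eq_bigr => k _; rewrite mulr_suml; apply: eq_bigr => k' _; ring.
have H1 g (v : rvec R K) : (\sum_k \sum_k' b k k' * gp g k * v k') ^+ 2 <= 4 * t * n2 (gp g) * n2 v.
  rewrite E1 -(mulrA 4); apply: net_lin => [|g']; first by rewrite mulr_ge0// n2_ge0.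
  by rewrite -E1 -mulrA.
have -> : 16 * t * (n2 y * n2 y') = 4 * (4 * t * n2 y') * n2 y by ring.
rewrite E2; apply: net_lin => [|g]; first by rewrite !mulr_ge0// n2_ge0.
by rewrite -E2; apply: (le_trans (H1 _ _)); rewrite mulrAC.
Qed.

Lemma card_netT : #|netT| = ((2 * s).+1 ^ #|K|)%N.
Proof. by rewrite card_ffun card_ord. Qed.

End Net.

(** * Adaptive Gaussian events *)

Section Measurability.
Context {R : realType} d (T : measurableType d).

Lemma measurable_inv (f : T -> R) : measurable_fun [set: T] f -> (forall x, 0 <= f x) ->
  measurable_fun [set: T] (fun x => (f x)^-1).
Proof.
move=> mf f0.
have -> : (fun x => (f x)^-1) = (fun x => f x `^ (-1)) by apply/funext => x; rewrite powR_inv1.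
exact: (measurableT_comp (@measurable_powR R (-1)) mf).
Qed.

Lemma measurable_lt_set (f g : T -> R) : measurable_fun [set: T] f -> measurable_fun [set: T] g ->
  measurable [set x | f x < g x].
Proof. by move=> mf mg; rewrite -[X in measurable X]setTI; exact: (measurable_fun_ltr mf mg). Qed.

Lemma measurable_forall (A : finType) (S : A -> set T) : (forall a, measurable (S a)) ->
  measurable [set x | forall a, S a x].
Proof.
move=> mS; rewrite (_ : mkset _ = \bigcap_(a in [set: A]) S a).
  by apply: fin_bigcap_measurable.
by apply/seteqP; split => x /= H a //; exact: H.
Qed.

Lemma measurable_exists (A : finType) (S : A -> set T) : (forall a, measurable (S a)) ->
  measurable [set x | exists a, S a x].
Proof.
move=> mS; rewrite (_ : mkset _ = \bigcup_(a in [set: A]) S a).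
  by apply: fin_bigcup_measurable.
by apply/seteqP; split => x /= [a]; [exists a|move=> _; exists a].
Qed.

Lemma union_bound (P : probability T R) (A : finType) (S : A -> set T) (b : R) :
  (forall a, measurable (S a)) -> (forall a, (P (S a) <= b%:E)%E) ->
  (P [set x | exists a, S a x] <= (#|A|%:R * b)%:E)%E.
Proof.
move=> mS Sb.
have H (s : seq A) : measurable [set x | exists2 a, a \in s & S a x] /\
    (P [set x | exists2 a, a \in s & S a x] <= ((size s)%:R * b)%:E)%E.
  elim: s => [|a s [m1 IH]].
    rewrite (_ : mkset _ = set0); first by rewrite measure0 mul0r; split.
    by apply/seteqP; split => x //= -[].
  rewrite (_ : mkset _ = S a `|` [set x | exists2 a, a \in s & S a x]); last first.
    apply/seteqP; split => x /=.
      by move=> [c]; rewrite inE => /orP[/eqP ->|cs Sc]; [left|right; exists c].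
    by move=> [Sa|[c cs Sc]]; [exists a; rewrite ?mem_head|exists c; rewrite ?inE ?cs ?orbT].
  split; first exact: measurableU.
  apply: (le_trans (measureU2 _ (mS a) m1)).
  by rewrite /= -natr1 mulrDl mul1r addrC EFinD; apply: leeD.
have [_] := H (enum A); rewrite -cardE.
congr (P _ <= _)%E; apply/seteqP; split => x /= [a]; first by move=> _; exists a.
by exists a; rewrite ?mem_enum.
Qed.

End Measurability.

Section Conditional.
Context {R : realType} {I A K : finType} (k0 : K).
Context d (T : measurableType d) (P : probability T R) (X : T -> rvec R I).
Hypothesis iX : iidn 1 P X.

(** Quantified over all probability spaces, so as to apply to the Gaussians that conditioning
    produces. *)
Definition stdn (S : rvec R A -> Prop) (b : \bar R) :=
  forall d (T : measurableType d) (P : probability T R) (Z : T -> rvec R A),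
    iidn 1 P Z -> (P [set w | S (Z w)] <= b)%E.

(* Given the coordinates in J, the linear forms below are independent centred
   Gaussians of variance [n2 (Y a)]. *)
Lemma conditional_gauss (e : A * K -> I) (J : pred I) (Y : rvec R I -> A -> rvec R K)
  (S : rvec R I -> rvec R A -> Prop) (b : \bar R) : injective e ->
  (forall x z, Y (mix J x z) = Y x) -> (forall x z, S (mix J x z) = S x) ->
  (forall x a k, J (e (a, k)) -> Y x a k = 0) ->
  (forall x, stdn (fun z => S x (fun a => Num.sqrt (n2 (Y x a)) * z a)) b) ->
  measurable ([set x | S x (fun a => dot (Y x a) (fun k => x (e (a, k))))] : set (Om R I)) ->
  (P [set w | S (X w) (fun a => dot (Y (X w) a) (fun k => X w (e (a, k))))] <= b)%E.
Proof.
move=> ei YJ SJ Y0 HS mS; apply: (@resample_le _ _ _ _ _ _ X J b iX _ mS) => x.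
(* [iidn_lin] asks for unit vectors; where [Y x a = 0] any unit vector serves, as the factor
   [Num.sqrt (n2 (Y x a))] vanishes. *)
pose y a : rvec R K := if n2 (Y x a) == 0 then ebase k0 else fun k => (Num.sqrt (n2 (Y x a)))^-1 * Y x a k.
have y1 a : dot (y a) (y a) = 1.
  rewrite /y; case: eqP => [_|/eqP N0]; first by rewrite dot_ebase /ebase eqxx.
  have s0 : Num.sqrt (n2 (Y x a)) != 0.
    by rewrite sqrtr_eq0 -ltNge lt0r N0 n2_ge0.
  rewrite dotZl dotZr; have -> : dot (Y x a) (Y x a) = Num.sqrt (n2 (Y x a)) ^+ 2.
    by rewrite sqr_sqrtr ?n2_ge0//; apply: eq_bigr => k _; rewrite expr2.
  by field.
have yE a k : Y x a k = Num.sqrt (n2 (Y x a)) * y a k.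
  rewrite /y; case: eqP => [N0|/eqP N0].
    rewrite N0 sqrtr0 mul0r; apply/eqP; rewrite -sqrf_eq0; apply/eqP/le_anti.
    by rewrite sqr_ge0 andbT -N0 coord_n2.
  by rewrite mulrA divff ?mul1r// sqrtr_eq0 -ltNge lt0r N0 n2_ge0.
have iZ := iidn_lin y1 (iidn_sub ei iX).
apply: le_trans (HS x _ _ _ _ iZ); rewrite le_eqVlt; apply/orP; left; apply/eqP.
congr (P _); apply/seteqP; split => w /=; rewrite YJ SJ.
all: have -> : (fun a => dot (Y x a) (fun k => mix J x (X w) (e (a, k)))) =
  (fun a => Num.sqrt (n2 (Y x a)) * \sum_k y a k * X w (e (a, k))) => //.
all: apply/funext => a; rewrite mulr_sumr; apply: eq_bigr => k _; rewrite mulrA -yE /mix.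
all: by case: ifP => // /(Y0 x) ->; rewrite !mul0r.
Qed.

End Conditional.

Section StdTails.
Context {R : realType} {A : finType} (a0 : A).

Lemma stdn_linear (t : rvec R A) (r : R) : 0 < r ->
  stdn (fun z => r * dot t t < dot t z ^+ 2) (2 * expR (- (r / 2)))%:E.
Proof.
move=> r0 d T P Z iZ.
have [t0|t0] := eqVneq (dot t t) 0.
  have tE z : dot t z = 0 by rewrite /dot big1// => a _; rewrite (dot_eq0 t0) mul0r.
  rewrite (_ : mkset _ = set0) ?measure0 ?lee_fin ?mulr_ge0 ?expR_ge0//.
  by apply/seteqP; split => w //=; rewrite t0 tE expr0n mulr0 ltxx.
have tp : 0 < dot t t by rewrite lt0r t0 dot_ge0.
pose s := Num.sqrt (r * dot t t); have s2 : s ^+ 2 = r * dot t t by rewrite sqr_sqrtr// ltW// mulr_gt0.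
have := @tail_linear R A d T P Z iZ t (dot t t) s tp (lexx _) (sqrtr_ge0 _).
rewrite s2 => H.
have -> : r / 2 = r * dot t t / (2 * dot t t) by field.
apply: le_trans H; apply: le_measure; rewrite ?inE.
- by apply: measurable_lt_set => //; apply: measurable_funX; apply: (measurable_coordT iZ); exact: measurable_dot.
- rewrite -[X in measurable X]setTI; apply: (measurable_fun_ler _ _) => //.
  by apply: measurableT_comp => //; apply: (measurable_coordT iZ); exact: measurable_dot.
- by move=> w /= H; rewrite -(@ler_pXn2r _ 2) ?nnegrE ?sqrtr_ge0// real_normK ?num_real// s2 ltW.
Qed.

Lemma argmax_ge (q : A -> R) : exists a, forall b, q b <= q a.
Proof. by case: (arg_maxP (P := xpredT) q (erefl : xpredT a0)) => a _ H; exists a => b; exact: H. Qed.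

Lemma measurable_stdsum (q : A -> R) (f : R -> R) d (T : measurableType d) (P : probability T R) (Z : T -> rvec R A) :
  iidn 1 P Z -> measurable_fun [set: R] f -> measurable_fun [set: T] (fun w => \sum_a q a * f (Z w a)).
Proof. by move=> iZ mf; exact: (measurable_coordT iZ (measurable_wsum q mf)). Qed.

(** Let [b] be the largest weight and [S] the sum of the weights. With Chernoff parameter
    [t / (8 * b)] the part [t * S] of the threshold outweighs the variance term, and the part
    [r * b / t] leaves the exponent [- (r / 8)]. *)
Lemma stdn_chi2 (q : A -> R) (t r : R) : (forall a, 0 <= q a) -> 0 < t -> t <= 1 -> 0 <= r ->
  stdn (fun z => forall a, t * (\sum_b q b) + r * q a / t < `|\sum_b q b * (z b ^+ 2 - 1)|)
    (2 * expR (- (r / 8)))%:E.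
Proof.
move=> q0 t0 t1 r0 d T P Z iZ.
have [a ha] := argmax_ge q; pose b := q a.
have [b0|b0] := eqVneq b 0.
  have qz c : q c = 0 by apply: le_anti; rewrite q0 andbT -b0 ha.
  rewrite (_ : mkset _ = set0) ?measure0 ?lee_fin ?mulr_ge0 ?expR_ge0//.
  apply/seteqP; split => w //= /(_ a).
  have E g : \sum_c q c * g c = 0 by rewrite big1// => c _; rewrite qz mul0r.
  by rewrite E big1// qz normr0 !mulr0 mul0r addr0 ltxx.
have bp : 0 < b by rewrite lt0r b0 q0.
pose S := \sum_c q c; have S0 : 0 <= S by apply: sumr_ge0.
pose l := t / (8 * b); have l0 : 0 < l by rewrite divr_gt0// mulr_gt0.
have qw c : `|q c| <= b by rewrite ger0_norm.
have qV : \sum_c q c ^+ 2 <= b * S.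
  by rewrite mulr_sumr; apply: ler_sum => c _; rewrite expr2; apply: ler_wpM2r.
have lb : l * b <= 8^-1.
  have -> : l * b = t / 8 by rewrite /l; field; rewrite gt_eqF.
  by rewrite ler_pdivrMr// mulVf.
have := @tail_chi2 R A d T P Z iZ q b (b * S) l (t * S + r * b / t) qw qV l0 lb.
move=> H; apply: (@le_trans _ _ (P [set w | (t * S + r * b / t <= `|\sum_b q b * (Z w b ^+ 2 - 1)|)%R])).
  apply: le_measure; rewrite ?inE.
  - apply: measurable_forall => c; apply: measurable_lt_set => //; apply: measurableT_comp => //.
    by apply: (measurable_stdsum (f := fun x => x ^+ 2 - 1) _ iZ); apply: measurable_funB.
  - rewrite -[X in measurable X]setTI; apply: (measurable_fun_ler _ _) => //.
    apply: measurableT_comp => //; apply: (measurable_stdsum (f := fun x => x ^+ 2 - 1) _ iZ).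
    exact: measurable_funB.
  - by move=> w /= /(_ a) /ltW.
apply: (le_trans H); rewrite lee_fin ler_wpM2l// ler_expR.
have -> : 2 * l ^+ 2 * (b * S) - l * (t * S + r * b / t) = - (r / 8) - 3 / 32 * t ^+ 2 * S / b.
  by rewrite /l; field; rewrite !gt_eqF.
by rewrite gerBl divr_ge0 ?(ltW bp)// !mulr_ge0 ?(ltW t0)//.
Qed.

Lemma stdn_square (q : A -> R) (r : R) : (forall a, 0 <= q a) -> 0 <= r ->
  stdn (fun z => forall a, 2 * (\sum_b q b) + 8 * r * q a < \sum_b q b * z b ^+ 2) (expR (- r))%:E.
Proof.
move=> q0 r0 d T P Z iZ.
have [a ha] := argmax_ge q; pose b := q a.
have [b0|b0] := eqVneq b 0.
  have qz c : q c = 0 by apply: le_anti; rewrite q0 andbT -b0 ha.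
  rewrite (_ : mkset _ = set0) ?measure0 ?lee_fin ?expR_ge0//.
  apply/seteqP; split => w //= /(_ a).
  have E g : \sum_c q c * g c = 0 by rewrite big1// => c _; rewrite qz mul0r.
  by rewrite E big1// qz !mulr0 addr0 ltxx.
have bp : 0 < b by rewrite lt0r b0 q0.
have qb c : 0 <= q c <= b by rewrite q0 ha.
have := @tail_square R A d T P Z iZ q b (\sum_c q c) (2 * (\sum_c q c) + 8 * r * b) qb (lexx _) bp.
have -> : (2 * (\sum_c q c) - (2 * (\sum_c q c) + 8 * r * b)) / (8 * b) = - r.
  by field; rewrite gt_eqF.
apply: le_trans; apply: le_measure; rewrite ?inE.
- apply: measurable_forall => c; apply: measurable_lt_set => //.
  by apply: (measurable_stdsum (f := fun x => x ^+ 2) _ iZ).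
- rewrite -[X in measurable X]setTI; apply: (measurable_fun_ler _ _) => //.
  by apply: (measurable_stdsum (f := fun x => x ^+ 2) _ iZ).
- by move=> w /= /(_ a) /ltW.
Qed.

End StdTails.

Section ConditionalTails.
Context {R : realType} {I A K : finType} (k0 : K) (a0 : A).
Context d (T : measurableType d) (P : probability T R) (X : T -> rvec R I).
Hypothesis iX : iidn 1 P X.
Variables (e : A * K -> I) (J : pred I) (Y : rvec R I -> A -> rvec R K) (q : rvec R I -> A -> R).
Hypothesis ei : injective e.
Hypothesis YJ : forall x z, Y (mix J x z) = Y x.
Hypothesis Y0 : forall x a k, J (e (a, k)) -> Y x a k = 0.
Hypothesis mY : forall a k, measurable_fun [set: Om R I] (fun x : Om R I => Y x a k).
Hypothesis qJ : forall x z, q (mix J x z) = q x.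
Hypothesis q0 : forall x a, 0 <= q x a.
Hypothesis mq : forall a, measurable_fun [set: Om R I] (fun x : Om R I => q x a).

Definition lform (x : rvec R I) (a : A) := dot (Y x a) (fun k => x (e (a, k))).

Lemma measurable_lform a : measurable_fun [set: Om R I] (fun x : Om R I => lform x a).
Proof.
apply: measurable_sum => k; apply: measurable_funM => //; exact: measurable_coord.
Qed.

Lemma measurable_n2 a : measurable_fun [set: Om R I] (fun x : Om R I => n2 (Y x a)).
Proof. by apply: measurable_sum => k; exact: measurable_funX. Qed.

Definition bad_linear r (x : rvec R I) := r * (\sum_a n2 (Y x a)) < (\sum_a lform x a) ^+ 2.
Definition bad_chi2 t r (x : rvec R I) := forall a,
  t * (\sum_b q x b * n2 (Y x b)) + r * (q x a * n2 (Y x a)) / t <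
  `|\sum_b q x b * (lform x b ^+ 2 - n2 (Y x b))|.
Definition bad_square r (x : rvec R I) := forall a,
  2 * (\sum_b q x b * n2 (Y x b)) + 8 * r * (q x a * n2 (Y x a)) < \sum_b q x b * lform x b ^+ 2.

Lemma measurable_bad_linear r : measurable ([set x | bad_linear r x] : set (Om R I)).
Proof.
apply: measurable_lt_set.
  by apply: measurable_funM => //; apply: measurable_sum => a; exact: measurable_n2.
by apply: measurable_funX; apply: measurable_sum => a; exact: measurable_lform.
Qed.

Lemma measurable_bad_chi2 t r : measurable ([set x | bad_chi2 t r x] : set (Om R I)).
Proof.
apply: measurable_forall => a; apply: measurable_lt_set.
  apply: measurable_funD.
    apply: measurable_funM => //; apply: measurable_sum => b; apply: measurable_funM => //.
    exact: measurable_n2.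
  do 2 apply: measurable_funM => //; apply: measurable_funM => //; exact: measurable_n2.
apply: measurableT_comp => //; apply: measurable_sum => b; apply: measurable_funM => //.
apply: measurable_funB; last exact: measurable_n2.
by apply: measurable_funX; exact: measurable_lform.
Qed.

Lemma measurable_bad_square r : measurable ([set x | bad_square r x] : set (Om R I)).
Proof.
apply: measurable_forall => a; apply: measurable_lt_set.
  apply: measurable_funD.
    apply: measurable_funM => //; apply: measurable_sum => b; apply: measurable_funM => //.
    exact: measurable_n2.
  apply: measurable_funM => //; apply: measurable_funM => //; exact: measurable_n2.
apply: measurable_sum => b; apply: measurable_funM => //.
by apply: measurable_funX; exact: measurable_lform.
Qed.

Lemma sqrtn2 x a : Num.sqrt (n2 (Y x a)) ^+ 2 = n2 (Y x a).
Proof. by rewrite sqr_sqrtr// n2_ge0. Qed.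

Lemma bad_linear_le r : 0 < r -> (P [set w | bad_linear r (X w)] <= (2 * expR (- (r / 2)))%:E)%E.
Proof.
move=> r0.
apply: (@conditional_gauss R I A K k0 d T P X iX e J Y
  (fun x z => r * (\sum_a n2 (Y x a)) < (\sum_a z a) ^+ 2) _ ei YJ) => //.
- by move=> x z; apply/funext => u; rewrite YJ.
- move=> x; have := stdn_linear (fun a => Num.sqrt (n2 (Y x a))) r0.
  congr stdn; apply/funext => z; rewrite /dot; congr (r * _ < _).
  by apply: eq_bigr => a _; rewrite -expr2 sqrtn2.
- exact: measurable_bad_linear.
Qed.

Lemma bad_chi2_le t r : 0 < t -> t <= 1 -> 0 <= r ->
  (P [set w | bad_chi2 t r (X w)] <= (2 * expR (- (r / 8)))%:E)%E.
Proof.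
move=> t0 t1 r0.
apply: (@conditional_gauss R I A K k0 d T P X iX e J Y
  (fun x z => forall a, t * (\sum_b q x b * n2 (Y x b)) + r * (q x a * n2 (Y x a)) / t <
    `|\sum_b q x b * (z b ^+ 2 - n2 (Y x b))|) _ ei YJ) => //.
- by move=> x z; apply/funext => u; rewrite YJ qJ.
- move=> x; have qn a : 0 <= q x a * n2 (Y x a) by rewrite mulr_ge0// n2_ge0.
  have := stdn_chi2 a0 qn t0 t1 r0.
  congr stdn; apply/funext => z; congr (forall a, _ < `|_|) => //.
  by apply/funext => ?; apply: eq_bigr => a _; rewrite exprMn sqrtn2; ring.
- exact: measurable_bad_chi2.
Qed.

Lemma bad_square_le r : 0 <= r -> (P [set w | bad_square r (X w)] <= (expR (- r))%:E)%E.
Proof.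
move=> r0.
apply: (@conditional_gauss R I A K k0 d T P X iX e J Y
  (fun x z => forall a, 2 * (\sum_b q x b * n2 (Y x b)) + 8 * r * (q x a * n2 (Y x a)) <
    \sum_b q x b * z b ^+ 2) _ ei YJ) => //.
- by move=> x z; apply/funext => u; rewrite YJ qJ.
- move=> x; have qn a : 0 <= q x a * n2 (Y x a) by rewrite mulr_ge0// n2_ge0.
  have := stdn_square a0 qn r0.
  congr stdn; apply/funext => z; congr (forall a, _ < _) => //.
  by apply/funext => ?; apply: eq_bigr => a _; rewrite exprMn sqrtn2; ring.
- exact: measurable_bad_square.
Qed.

End ConditionalTails.

(** * The concentration events *)

Section Model.
Context {R : realType} {Nt Lt Kt : finType} (k0 : Kt) (neg : Lt -> Lt).
Hypothesis negK : involutive neg.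
Local Notation I := (Nt * Lt * Kt)%type.
Variables (mu : Nt -> R) (p : Lt -> R) (w nu t Rl RK : R).
Implicit Types (x : rvec R I) (l : Lt) (n : Nt) (y : rvec R Kt).

(* x is the Hartley transform of the data, cas = cos + sin; the even part of cas is cos and its odd part
   gives the imaginary coefficient - sin. *)
Definition cR x : Nt -> Lt -> Kt -> R := fun n l k => (x (n, l, k) + x (n, neg l, k)) / 2.
Definition cI x : Nt -> Lt -> Kt -> R := fun n l k => (x (n, neg l, k) - x (n, l, k)) / 2.
Definition lf x n l y := dot y (fun k => x (n, l, k)).
(** [fr + i fi] is the conjugate of the [k0] coordinate of c_(l,n) times <c_(l,n), y>, and [c02] is
    the squared modulus of that coordinate. *)
Definition fr x n l y := (x (n, l, k0) * lf x n l y + x (n, neg l, k0) * lf x n (neg l) y) / 2.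
Definition fi x n l y := (x (n, l, k0) * lf x n (neg l) y - x (n, neg l, k0) * lf x n l y) / 2.
Definition c02 x n l := (x (n, l, k0) ^+ 2 + x (n, neg l, k0) ^+ 2) / 2.
Definition perp y : rvec R Kt := fun k => if k == k0 then 0 else y k.
(** The coefficient of [lf x n' l y'] in the block [Gam n n'], see [Gam_coef]. For [n != n'] it
    involves the block [n'] through its coordinate [k0] only. *)
Definition coef x n n' l y := p l * (fr x n l y * x (n', l, k0) - fi x n l y * x (n', neg l, k0)).
Definition SL x l := \sum_n mu n ^+ 2 * c02 x n l.
Definition pairS l : pred Lt := fun l' => (l' == l) || (l' == neg l).
Definition loosol x l : Nt -> Kt -> R := ofrow (psol k0 (cR x) (cI x) mu p (fun l' => ~~ pairS l l')).

Definition eL n (i : Lt * Kt) : I := (n, i.1, i.2).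
Definition eN l (i : Nt * Kt) : I := (i.1, l, i.2).

(** The bad events, at level [RK] for nets and off-diagonal blocks and at level [Rl] otherwise.
    [badA]: size of the coordinates; [badD]: Gram form of a block; [badB] and [badS]: normalization
    of the coordinate [k0] over frequencies and over blocks; [badQ]: fourth moments; [badP]:
    diagonal blocks of [QQ] off [k0]; [badO] and [badO0]: off-diagonal blocks; [badE]: the residual
    [ee]; [badF]: images of the leave-one-out solutions. *)
Definition badA (i : I) x := Rl < x i ^+ 2.
Definition badD (i : Nt * @netT Kt) := bad_chi2 (eL i.1) (fun _ _ => @gp R _ i.2) (fun _ => p) t RK.
Definition badB n := bad_chi2 (eL n) (fun _ _ => ebase k0) (fun _ => p) t Rl.
Definition badS l := bad_chi2 (eN l) (fun _ _ => ebase k0) (fun _ n => mu n ^+ 2) t Rl.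
Definition badQ n x := 40 ^+ 2 + 1 < \sum_l p l * (Num.min (x (n, l, k0) ^+ 2) Rl * x (n, l, k0) ^+ 2).
Definition badP (i : Nt * @netT Kt) :=
  bad_square (eL i.1) (fun _ _ => perp (gp i.2)) (fun x l => p l * c02 x i.1 l) RK.
Definition badO (i : Nt * Nt * (@netT Kt * @netT Kt)) x := i.1.1 != i.1.2 /\
  bad_linear (eL i.1.2) (fun x l k => coef x i.1.1 i.1.2 l (gp i.2.1) * perp (gp i.2.2) k) RK x.
Definition badO0 (i : Nt * Nt) x := i.1 != i.2 /\
  bad_chi2 (eL i.2) (fun _ _ => ebase k0) (fun x l => p l * c02 x i.1 l) t RK x.
Definition badE (i : Nt * Kt) x := i.2 != k0 /\
  bad_linear (eL i.1) (fun x l k => p l / SL x l * x (i.1, l, k0) * ebase i.2 k) Rl x.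
Definition badF l := bad_square (eN l) (fun x n => loosol x l n) (fun _ _ => 1) Rl.

Section Det.
Variable x : rvec R I.
Hypothesis p0 : forall l, 0 <= p l.
Hypothesis p1 : \sum_l p l = 1.
Hypothesis pneg : forall l, p (neg l) = p l.
Hypothesis pw : forall l, p l <= w.
Hypothesis mu0 : forall n, 0 <= mu n.
Hypothesis mu1 : \sum_n mu n ^+ 2 = 1.
Hypothesis munu : forall n, mu n ^+ 2 <= nu.
Hypothesis Rl1 : 1 <= Rl.
Hypothesis RK1 : 1 <= RK.
Hypothesis t0 : 0 < t.
Hypothesis t_small : 64 * 64 * t <= 1.
Hypothesis wRK : w * Rl * RK <= t ^+ 4.
Hypothesis wK : w * Rl * #|Kt|%:R <= t ^+ 4.
Hypothesis nuRl : nu * Rl <= t ^+ 4.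
Hypothesis nA : forall i, ~ badA i x.
Hypothesis nD : forall i, ~ badD i x.
Hypothesis nB : forall n, ~ badB n x.
Hypothesis nS : forall l, ~ badS l x.
Hypothesis nQ : forall n, ~ badQ n x.
Hypothesis nP : forall i, ~ badP i x.
Hypothesis nO : forall i, ~ badO i x.
Hypothesis nO0 : forall i, ~ badO0 i x.
Hypothesis nE : forall i, ~ badE i x.
Hypothesis nF : forall l, ~ badF l x.

Lemma w_ge0 : 0 <= w.
Proof.
have [l _|L0] := pickP (fun _ : Lt => true); first by apply: le_trans (pw l).
by have := oner_neq0 R; rewrite -p1 big1 ?eqxx// => l; have := L0 l.
Qed.

Lemma T_small : t ^+ 4 <= t ^+ 2 / (64 ^+ 2 * 64 ^+ 2).
Proof.
rewrite ler_pdivlMr//.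
have -> : t ^+ 4 * (64 ^+ 2 * 64 ^+ 2) = t ^+ 2 * (64 * 64 * t) ^+ 2 by ring.
by rewrite ler_piMr ?sqr_ge0// expr_le1// mulr_ge0// ltW.
Qed.

Lemma w_le_t4 : w <= t ^+ 4.
Proof.
apply: le_trans wRK; rewrite -mulrA; apply: ler_peMr; first exact: w_ge0.
by have := Rl1; have := RK1; nra.
Qed.

Lemma sum_neg (F : Lt -> R) : \sum_l F (neg l) = \sum_l F l.
Proof. by rewrite [RHS](reindex_inj (inv_inj negK)). Qed.

Lemma sum_sym (u F : Lt -> R) : (forall l, u (neg l) = u l) ->
  \sum_l u l * ((F l + F (neg l)) / 2) = \sum_l u l * F l.
Proof.
move=> us; have E : \sum_l u l * F (neg l) = \sum_l u l * F l.
  by rewrite -(sum_neg (fun l => u l * F l)); apply: eq_bigr => l _; rewrite us.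
transitivity (2^-1 * (\sum_l u l * F l + \sum_l u l * F (neg l))); last by rewrite E; field.
by rewrite -big_split mulr_sumr; apply: eq_bigr => l _ /=; field.
Qed.

Lemma psrE l n v : psr (cR x) l n v = (lf x n l (v n) + lf x n (neg l) (v n)) / 2.
Proof. by rewrite /psr /lf /dot -big_split mulr_suml; apply: eq_bigr => k _; rewrite /cR /=; field. Qed.
Lemma psiE l n v : psi (cI x) l n v = (lf x n (neg l) (v n) - lf x n l (v n)) / 2.
Proof. by rewrite /psi /lf /dot -sumrB mulr_suml; apply: eq_bigr => k _; rewrite /cI /=; field. Qed.
Lemma psri2 l n v : psr (cR x) l n v ^+ 2 + psi (cI x) l n v ^+ 2 =
  (lf x n l (v n) ^+ 2 + lf x n (neg l) (v n) ^+ 2) / 2.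
Proof. by rewrite psrE psiE; field. Qed.
Lemma ari2 l n : ar k0 (cR x) mu l n ^+ 2 + ai k0 (cI x) mu l n ^+ 2 = mu n ^+ 2 * c02 x n l.
Proof. by rewrite /ar /ai /cR /cI /c02; field. Qed.
Lemma slE l : sl k0 (cR x) (cI x) mu l = SL x l.
Proof. by apply: eq_bigr => n _; rewrite ari2. Qed.
Lemma frE l n v : ar k0 (cR x) mu l n * psr (cR x) l n v + ai k0 (cI x) mu l n * psi (cI x) l n v =
  mu n * fr x n l (v n).
Proof. by rewrite psrE psiE /ar /ai /cR /cI /fr; field. Qed.
Lemma fiE l n v : ar k0 (cR x) mu l n * psi (cI x) l n v - ai k0 (cI x) mu l n * psr (cR x) l n v =
  mu n * fi x n l (v n).
Proof. by rewrite psrE psiE /ar /ai /cR /cI /fi; field. Qed.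

Lemma vn_n2 v n : vn v n = n2 (v n : rvec R Kt). Proof. by []. Qed.
Lemma c02neg n l : c02 x n (neg l) = c02 x n l.
Proof. by rewrite /c02 negK addrC. Qed.
Lemma SLneg l : SL x (neg l) = SL x l.
Proof. by apply: eq_bigr => n _; rewrite c02neg. Qed.
Lemma c02_ge0 n l : 0 <= c02 x n l.
Proof. by rewrite divr_ge0// addr_ge0// sqr_ge0. Qed.

Lemma chi2_neg (A : finType) (e : A * Kt -> I) (Y : rvec R I -> A -> rvec R Kt) q r b : 0 <= r ->
  (forall a, q x a * n2 (Y x a) <= b) -> ~ bad_chi2 e Y q t r x ->
  `|\sum_a q x a * (lform e Y x a ^+ 2 - n2 (Y x a))| <= t * (\sum_a q x a * n2 (Y x a)) + r * b / t.
Proof.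
move=> r0 qb /existsNP[a /negP]; rewrite -leNgt => /le_trans; apply.
by rewrite lerD2l; apply: ler_wpM2r; [rewrite invr_ge0 ltW|exact: ler_wpM2l].
Qed.

Lemma square_neg (A : finType) (e : A * Kt -> I) (Y : rvec R I -> A -> rvec R Kt) q r b : 0 <= r ->
  (forall a, q x a * n2 (Y x a) <= b) -> ~ bad_square e Y q r x ->
  \sum_a q x a * lform e Y x a ^+ 2 <= 2 * (\sum_a q x a * n2 (Y x a)) + 8 * r * b.
Proof.
move=> r0 qb /existsNP[a /negP]; rewrite -leNgt => /le_trans; apply.
by rewrite lerD2l; apply: ler_wpM2l; rewrite ?mulr_ge0.
Qed.

Lemma linear_neg (A : finType) (e : A * Kt -> I) (Y : rvec R I -> A -> rvec R Kt) r :
  ~ bad_linear e Y r x -> (\sum_a lform e Y x a) ^+ 2 <= r * \sum_a n2 (Y x a).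
Proof. by move=> /negP; rewrite -leNgt. Qed.

Lemma n2_ebase (k : Kt) : n2 (ebase k : rvec R Kt) = 1.
Proof.
rewrite /n2 (bigD1 k)//= big1 ?addr0 /ebase ?eqxx ?expr1n// => i ik.
by rewrite (negbTE ik) expr0n.
Qed.

Lemma lform_eL n Y l : lform (eL n) Y x l = lf x n l (Y x l). Proof. by []. Qed.
Lemma X_ebase n l k : lf x n l (ebase k) = x (n, l, k).
Proof. by rewrite /lf dotC dot_ebase. Qed.

Lemma t_le1 : t <= 1. Proof. by have := t0; have := t_small; lra. Qed.
Lemma t4_le_t2 : t ^+ 4 <= t ^+ 2.
Proof.
have -> : t ^+ 4 = t ^+ 2 * t ^+ 2 by ring.
by rewrite ler_piMr ?sqr_ge0// expr_le1 ?(ltW t0)//; exact: t_le1.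
Qed.
Lemma RK_nneg : 0 <= RK. Proof. exact: le_trans RK1. Qed.
Lemma Rl_ge0 : 0 <= Rl. Proof. exact: le_trans Rl1. Qed.
Lemma RKw_le : RK * w <= t ^+ 2.
Proof.
apply: le_trans t4_le_t2; apply: le_trans wRK; rewrite (mulrC RK) -mulrA; apply: ler_wpM2l; first exact: w_ge0.
by apply: ler_peMl; [exact: RK_nneg|exact: Rl1].
Qed.
Lemma div_t b : b <= t ^+ 2 -> b / t <= t.
Proof. by move=> bt; rewrite ler_pdivrMr// -expr2. Qed.

(** Outside [badD] the Gram form differs from the identity by at most [t + RK * w / t <= 2 * t] on
    grid points, which is below the tolerance [8^-1] of [net_quad_lo]. *)
Lemma G_bounds n y : 2 / 5 * n2 y <= \sum_l p l * lf x n l y ^+ 2 <= 5 * n2 y.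
Proof.
have E z : \sum_l p l * lf x n l z ^+ 2 = quad p (fun l => (fun k => x (n, l, k)) : rvec R Kt) z.
  by apply: eq_bigr => l _; rewrite /lf dotC.
rewrite E; apply: net_quad_lo => // g; rewrite -E.
have pb l : p l * n2 (gp g : rvec R Kt) <= w * n2 (gp g : rvec R Kt).
  by apply: ler_wpM2r => //; exact: n2_ge0.
have := chi2_neg RK_nneg pb (@nD (n, g)); rewrite /= -mulr_suml p1 mul1r.
have -> : \sum_l p l * (lform (eL n) (fun _ _ => gp g) x l ^+ 2 - n2 (gp g)) =
    \sum_l p l * lf x n l (gp g) ^+ 2 - n2 (gp g).
  by under eq_bigr do rewrite mulrBr; rewrite sumrB -mulr_suml p1 mul1r.
move=> /le_trans; apply; rewrite mulrA mulrAC -mulrDl; apply: ler_wpM2r; first exact: n2_ge0.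
by have := div_t RKw_le; have := t_small; lra.
Qed.

Lemma B_bound n : `|\sum_l p l * x (n, l, k0) ^+ 2 - 1| <= 2 * t.
Proof.
have pb l : p l * n2 (ebase k0 : rvec R Kt) <= w by rewrite n2_ebase mulr1.
have := chi2_neg Rl_ge0 pb (@nB n); under eq_bigr do rewrite lform_eL X_ebase n2_ebase mulrBr mulr1.
have E0 : \sum_a p a * n2 (ebase k0 : rvec R Kt) = 1 by under eq_bigr do rewrite n2_ebase mulr1.
rewrite sumrB p1 E0 mulr1; move=> /le_trans; apply.
have : Rl * w / t <= t.
  apply: div_t; apply: le_trans t4_le_t2; apply: le_trans wRK; rewrite mulrC; apply: ler_peMr => //.
  by apply: mulr_ge0; [exact: w_ge0|exact: Rl_ge0].
lra.
Qed.

Lemma S_bound l : `|SL x l - 1| <= 2 * t.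
Proof.
have H l' : `|\sum_n mu n ^+ 2 * x (n, l', k0) ^+ 2 - 1| <= 2 * t.
  have pb n : mu n ^+ 2 * n2 (ebase k0 : rvec R Kt) <= nu by rewrite n2_ebase mulr1.
  have := chi2_neg Rl_ge0 pb (@nS l').
  have -> : \sum_n mu n ^+ 2 * (lform (eN l') (fun _ _ => ebase k0) x n ^+ 2 - n2 (ebase k0 : rvec R Kt)) =
      \sum_n mu n ^+ 2 * x (n, l', k0) ^+ 2 - 1.
    by rewrite -mu1 -sumrB; apply: eq_bigr => n _; rewrite /lform dotC dot_ebase n2_ebase; ring.
  have E0 : \sum_a mu a ^+ 2 * n2 (ebase k0 : rvec R Kt) = 1 by under eq_bigr do rewrite n2_ebase mulr1.
  rewrite E0 mulr1; move=> /le_trans; apply.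
  have : Rl * nu / t <= t by apply: div_t; apply: le_trans t4_le_t2; rewrite mulrC.
  lra.
have -> : SL x l - 1 = 2^-1 * ((\sum_n mu n ^+ 2 * x (n, l, k0) ^+ 2 - 1) + (\sum_n mu n ^+ 2 * x (n, neg l, k0) ^+ 2 - 1)).
  transitivity (2^-1 * (\sum_n mu n ^+ 2 * x (n, l, k0) ^+ 2 + \sum_n mu n ^+ 2 * x (n, neg l, k0) ^+ 2) - 1); last by field.
  by congr (_ - _); rewrite -big_split mulr_sumr; apply: eq_bigr => n _ /=; rewrite /c02; field.
by have := H l; have := H (neg l); rewrite !ler_norml => /andP[h1 h2] /andP[h3 h4]; apply/andP; split; lra.
Qed.

Lemma SL_bounds l : 1 - 2 * t <= SL x l <= 1 + 2 * t.
Proof. by have := S_bound l; rewrite ler_norml; lra. Qed.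

Lemma x_le i : x i ^+ 2 <= Rl.
Proof. by have /negP := @nA i; rewrite -leNgt. Qed.

Lemma quartic_bound n : \sum_l p l * x (n, l, k0) ^+ 4 <= 40 ^+ 2 + 1.
Proof.
have /negP := @nQ n; rewrite -leNgt; apply: le_trans; rewrite le_eqVlt; apply/orP; left; apply/eqP.
by apply: eq_bigr => l _; rewrite min_l ?x_le//; ring.
Qed.

Lemma c02_le n l : c02 x n l <= Rl.
Proof. by rewrite /c02; have := x_le (n, l, k0); have := x_le (n, neg l, k0); lra. Qed.

Lemma sum_q n : \sum_l p l * c02 x n l <= 1 + 2 * t.
Proof.
rewrite /c02 (sum_sym (fun l => x (n, l, k0) ^+ 2))//.
by have := B_bound n; rewrite ler_norml; lra.
Qed.

Lemma n2_perp y : n2 (perp y) <= n2 y.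
Proof. by apply: ler_sum => k _; rewrite /perp; case: (k == k0); rewrite ?expr0n ?sqr_ge0. Qed.

Lemma dot_perp y z : dot (perp y) z = dot y (perp z).
Proof. by apply: eq_bigr => k _; rewrite /perp; case: (k == k0); rewrite ?mul0r ?mulr0. Qed.

Lemma X_perp n l y : lf x n l y = y k0 * x (n, l, k0) + lf x n l (perp y).
Proof.
rewrite /lf /dot (bigD1 k0)//= [in RHS](bigD1 k0)//= /perp eqxx mul0r add0r; congr (_ + _).
by apply: eq_bigr => k kk; rewrite (negbTE kk).
Qed.

(** The weights [p l * c02 x n l] use the coordinate [k0] and the linear forms use the others, so
    [badP] is a chi-square bound with weights fixed by conditioning. *)
Lemma P_bound n y : \sum_l p l * c02 x n l * lf x n l (perp y) ^+ 2 <= 12 * n2 y.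
Proof.
have q0 l : 0 <= p l * c02 x n l by rewrite mulr_ge0// c02_ge0.
have E z : \sum_l p l * c02 x n l * lf x n l (perp z) ^+ 2 =
    quad (fun l => p l * c02 x n l) (fun l => perp (fun k => x (n, l, k))) z.
  by apply: eq_bigr => l _; rewrite /lf dot_perp dotC.
rewrite E (_ : 12 = 4 * 3 :> R); last by ring.
apply: net_quad => // g; rewrite -E.
have pb l : p l * c02 x n l * n2 (perp (gp g)) <= w * Rl * n2 (perp (gp g)).
  apply: ler_wpM2r; first exact: n2_ge0.
  by apply: ler_pM => //; [exact: c02_ge0|exact: c02_le].
apply: (le_trans (square_neg RK_nneg pb (@nP (n, g)))).
apply: (@le_trans _ _ (3 * n2 (perp (gp g)))); last first.
  by apply: ler_wpM2l => //; exact: n2_perp.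
rewrite -mulr_suml !mulrA -mulrDl; apply: ler_wpM2r; first exact: n2_ge0.
have -> : 8 * RK * w * Rl = 8 * (w * Rl * RK) by ring.
have := sum_q n; have := wRK; have := t4_le_t2; have := t_small; have := t0; nra.
Qed.

Lemma q4_bound n : \sum_l p l * c02 x n l * x (n, l, k0) ^+ 2 <= 40 ^+ 2 + 1.
Proof.
apply: le_trans (quartic_bound n).
have E : \sum_l p l * x (n, neg l, k0) ^+ 4 = \sum_l p l * x (n, l, k0) ^+ 4.
  by rewrite -(sum_neg (fun l => p l * x (n, l, k0) ^+ 4)); apply: eq_bigr => l _; rewrite pneg.
apply: (@le_trans _ _ (3 / 4 * \sum_l p l * x (n, l, k0) ^+ 4 + 4^-1 * \sum_l p l * x (n, neg l, k0) ^+ 4)).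
  rewrite !mulr_sumr -big_split; apply: ler_sum => l _ /=.
  rewrite -mulrA !(mulrCA _ (p l)) -mulrDr; apply: ler_wpM2l => //; rewrite /c02.
  by have := sqr_ge0 (x (n, l, k0) ^+ 2 - x (n, neg l, k0) ^+ 2); nra.
by rewrite E -mulrDl; set Z := \sum_l _; have : 0 <= Z; [apply: sumr_ge0 => l _; rewrite mulr_ge0// (_ : 4%N = (2 * 2)%N)// exprM sqr_ge0|lra].
Qed.

(** A bound for the diagonal blocks of [QQ]: the fourth moment [40 ^+ 2 + 1] for the coordinate [k0]
    and the [12] of [P_bound] for the others; the factors 2 come from splitting a square. *)
Definition CD : R := 2 * (40 ^+ 2 + 1) + 2 * 12.

Lemma b2_bound n y : \sum_l p l * c02 x n l * lf x n l y ^+ 2 <= CD * n2 y.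
Proof.
apply: (@le_trans _ _ (2 * y k0 ^+ 2 * (\sum_l p l * c02 x n l * x (n, l, k0) ^+ 2) +
   2 * \sum_l p l * c02 x n l * lf x n l (perp y) ^+ 2)).
  rewrite !mulr_sumr -big_split; apply: ler_sum => l _ /=.
  have q0 : 0 <= p l * c02 x n l by rewrite mulr_ge0// c02_ge0.
  rewrite X_perp !(mulrCA _ (p l * c02 x n l)) -mulrDr; apply: ler_wpM2l => //.
  by have := sqr_ge0 (y k0 * x (n, l, k0) - lf x n l (perp y)); nra.
have -> : CD * n2 y = 2 * (40 ^+ 2 + 1) * n2 y + 2 * 12 * n2 y by rewrite /CD; ring.
apply: lerD.
  rewrite mulrAC; apply: ler_pM; last exact: coord_n2.
  - apply: mulr_ge0 => //; apply: sumr_ge0 => l _; apply: mulr_ge0; last exact: sqr_ge0.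
    by apply: mulr_ge0 => //; exact: c02_ge0.
  - exact: sqr_ge0.
  - by rewrite ler_wpM2l// q4_bound.
by rewrite -mulrA ler_wpM2l// P_bound.
Qed.

Lemma f2E n l y : fr x n l y ^+ 2 + fi x n l y ^+ 2 =
  c02 x n l * ((lf x n l y ^+ 2 + lf x n (neg l) y ^+ 2) / 2).
Proof. by rewrite /fr /fi /c02; field. Qed.

Lemma f2_bound n y : \sum_l p l * (fr x n l y ^+ 2 + fi x n l y ^+ 2) <= CD * n2 y.
Proof.
apply: le_trans (b2_bound n y); rewrite le_eqVlt; apply/orP; left; apply/eqP.
rewrite -(@sum_sym (fun l => p l * c02 x n l) (fun l => lf x n l y ^+ 2)).
  by apply: eq_bigr => l _; rewrite f2E mulrA.
by move=> l; rewrite pneg c02neg.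
Qed.

Definition Gam n n' y y' := \sum_l p l * (fr x n l y * fr x n' l y' + fi x n l y * fi x n' l y').

Lemma GamC n n' y y' : Gam n n' y y' = Gam n' n y' y.
Proof. by apply: eq_bigr => l _; ring. Qed.

Lemma fr_neg n l y : fr x n (neg l) y = fr x n l y.
Proof. by rewrite /fr negK; ring. Qed.
Lemma fi_neg n l y : fi x n (neg l) y = - fi x n l y.
Proof. by rewrite /fi negK; ring. Qed.

(** Grouping the terms of l and -l exhibits the block as linear in the data of [n']. Given the block
    [n] and the coordinates [k0], it is for [perp y'] a centred Gaussian. *)
Lemma Gam_coef n n' y y' : Gam n n' y y' = \sum_l coef x n n' l y * lf x n' l y'.
Proof.
transitivity (\sum_l (coef x n n' l y * lf x n' l y' + coef x n n' (neg l) y * lf x n' (neg l) y') / 2).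
  by apply: eq_bigr => l _; rewrite /coef fr_neg fi_neg pneg negK /fr /fi; field.
have := @sum_sym (fun=> 1) (fun l => coef x n n' l y * lf x n' l y') (fun _ => erefl).
by under eq_bigr do rewrite mul1r; under [X in _ = X]eq_bigr do rewrite mul1r.
Qed.

Definition cv n n' l : rvec R Kt := fun k => p l / 2 *
  ((x (n, l, k0) * x (n', l, k0) + x (n, neg l, k0) * x (n', neg l, k0)) * x (n, l, k) +
   (x (n, neg l, k0) * x (n', l, k0) - x (n, l, k0) * x (n', neg l, k0)) * x (n, neg l, k)).

Lemma coefE n n' l y : coef x n n' l y = dot y (cv n n' l).
Proof.
rewrite /cv dotZr dotDr !dotZr -!/(lf x _ _ _) /coef /fr /fi; by field.
Qed.

Lemma Gam_bilin n n' y y' : Gam n n' y (perp y') =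
  \sum_k \sum_k' (\sum_l cv n n' l k * perp (fun i => x (n', l, i)) k') * y k * y' k'.
Proof.
rewrite Gam_coef.
under eq_bigr do rewrite coefE /lf dot_perp /dot big_distrlr /=.
rewrite exchange_big; apply: eq_bigr => k _; rewrite exchange_big; apply: eq_bigr => k' _ /=.
by rewrite !mulr_suml; apply: eq_bigr => l _; ring.
Qed.

Lemma coef2_bound n n' y : \sum_l coef x n n' l y ^+ 2 <= 2 * w * Rl * (CD * n2 y).
Proof.
apply: (@le_trans _ _ (2 * w * Rl * \sum_l p l * (fr x n l y ^+ 2 + fi x n l y ^+ 2))); last first.
  by apply: ler_wpM2l; [rewrite !mulr_ge0 ?w_ge0 ?Rl_ge0|exact: f2_bound].
rewrite mulr_sumr; apply: ler_sum => l _; rewrite /coef.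
set f := fr _ _ _ _; set g := fi _ _ _ _; set a := x _; set b := x _.
have ha : a ^+ 2 <= Rl by exact: x_le.
have hb : b ^+ 2 <= Rl by exact: x_le.
have hp := p0 l; have hw := pw l; have hR := Rl_ge0.
rewrite exprMn.
have h1 : (f * a - g * b) ^+ 2 <= (f ^+ 2 + g ^+ 2) * (2 * Rl).
  apply: (@le_trans _ _ ((f ^+ 2 + g ^+ 2) * (a ^+ 2 + b ^+ 2))).
    by have := sqr_ge0 (f * b + g * a); nra.
  by apply: ler_wpM2l; [rewrite addr_ge0 ?sqr_ge0|lra].
have h2 : p l ^+ 2 <= w * p l by rewrite expr2; apply: ler_wpM2r.
apply: (le_trans (ler_pM (sqr_ge0 _) (sqr_ge0 _) h2 h1)).
by rewrite le_eqVlt; apply/orP; left; apply/eqP; ring.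
Qed.

Lemma T_CD : 32 * CD * t ^+ 4 <= t ^+ 2.
Proof. by have := T_small; have := sqr_ge0 t; rewrite /CD; lra. Qed.

Lemma CD_ge0 : 0 <= CD. Proof. by rewrite /CD; lra. Qed.

Lemma O_bound n n' y y' : n != n' -> Gam n n' y (perp y') ^+ 2 <= t ^+ 2 * (n2 y * n2 y').
Proof.
move=> nn'; rewrite Gam_bilin.
have -> : t ^+ 2 * (n2 y * n2 y') = 16 * (t ^+ 2 / 16) * (n2 y * n2 y') by field.
apply: net_bilin => [|g g']; first by rewrite divr_ge0// sqr_ge0.
rewrite -Gam_bilin.
have nb : ~ bad_linear (eL n') (fun x l k => coef x n n' l (gp g) * perp (gp g') k) RK x.
  by move=> H; apply: (@nO ((n, n'), (g, g'))).
have := linear_neg nb.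
have -> : \sum_a lform (eL n') (fun x l k => coef x n n' l (gp g) * perp (gp g') k) x a = Gam n n' (gp g) (perp (gp g')).
  by rewrite Gam_coef; apply: eq_bigr => l _; rewrite /lform dotZl.
move=> /le_trans; apply.
under eq_bigr do rewrite n2Z.
rewrite -mulr_suml mulrA mulrA; apply: ler_pM; rewrite ?n2_ge0//.
- by apply: mulr_ge0; [exact: RK_nneg|apply: sumr_ge0 => l _; exact: sqr_ge0].
- apply: (@le_trans _ _ (RK * (2 * w * Rl * (CD * n2 (gp g))))).
    by apply: ler_wpM2l; [exact: RK_nneg|exact: coef2_bound].
  have -> : RK * (2 * w * Rl * (CD * n2 (gp g))) = 2 * CD * (w * Rl * RK) * n2 (gp g) by ring.
  apply: ler_wpM2r; first exact: n2_ge0.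
  apply: (@le_trans _ _ (2 * CD * t ^+ 4)).
    by apply: ler_wpM2l => //; rewrite mulr_ge0// CD_ge0.
  by have := T_CD; lra.
- exact: n2_perp.
Qed.

Lemma sum_q_abs n : `|\sum_l p l * c02 x n l - 1| <= 2 * t.
Proof. by rewrite /c02 (sum_sym (fun l => x (n, l, k0) ^+ 2))//; exact: B_bound. Qed.

(** In the coordinate [k0] the block is a chi-square sum over the data of [n'] with weights from the
    block [n]; the sum of these weights is close to 1 by [sum_q_abs]. *)
Lemma Gam00 n n' : n != n' -> `|Gam n n' (ebase k0) (ebase k0) - 1| <= 5 * t.
Proof.
move=> nn'.
have E l : coef x n n' l (ebase k0) * lf x n' l (ebase k0) = p l * c02 x n l * x (n', l, k0) ^+ 2.
  by rewrite /coef /fr /fi !X_ebase /c02; field.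
rewrite Gam_coef; under eq_bigr do rewrite E.
have nb : ~ bad_chi2 (eL n') (fun _ _ => ebase k0) (fun x l => p l * c02 x n l) t RK x.
  by move=> H; apply: (@nO0 (n, n')).
have pb l : p l * c02 x n l * n2 (ebase k0 : rvec R Kt) <= w * Rl.
  by rewrite n2_ebase mulr1; apply: ler_pM => //; [exact: c02_ge0|exact: c02_le].
have := chi2_neg RK_nneg pb nb.
have -> : \sum_l p l * c02 x n l * (lform (eL n') (fun _ _ => ebase k0) x l ^+ 2 - n2 (ebase k0 : rvec R Kt)) =
    \sum_l p l * c02 x n l * x (n', l, k0) ^+ 2 - \sum_l p l * c02 x n l.
  by rewrite -sumrB; apply: eq_bigr => l _; rewrite lform_eL X_ebase n2_ebase; ring.
have -> : \sum_l p l * c02 x n l * n2 (ebase k0 : rvec R Kt) = \sum_l p l * c02 x n l.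
  by apply: eq_bigr => l _; rewrite n2_ebase mulr1.
have h1 := sum_q_abs n; have h2 := t0; have h3 := t_small.
have h4 : RK * (w * Rl) / t <= t by apply: div_t; apply: le_trans t4_le_t2; rewrite mulrC.
move: h1; set q := \sum_l _; set Z := \sum_l _; rewrite !ler_norml => /andP[a1 a2] /andP[b1 b2].
have : t * q <= t * 2 by apply: ler_wpM2l; [exact: ltW|lra].
by move=> ?; apply/andP; split; lra.
Qed.

Lemma Gam_lin n n' y y' : Gam n n' y y' = Gam n n' y (perp y') + y' k0 * Gam n n' y (ebase k0).
Proof.
rewrite !Gam_coef mulr_sumr -big_split; apply: eq_bigr => l _ /=.
by rewrite X_perp X_ebase; ring.
Qed.

Lemma abs_coord y : `|y k0| <= Num.sqrt (n2 y).
Proof. by apply: ler_abs_sqr; rewrite ?sqrtr_ge0// sqr_sqrtr ?n2_ge0// coord_n2. Qed.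

(** Both arguments are split along [k0]. Here [7 = 1 + 1 + 5]: the part with [perp y'], the part of
    [perp y] against [k0], and the deviation in [Gam00]. *)
Lemma Gam_off n n' y y' : n != n' ->
  Gam n n' y y' <= y k0 * y' k0 + 7 * t * (Num.sqrt (n2 y) * Num.sqrt (n2 y')).
Proof.
move=> nn'; rewrite (Gam_lin n n' y y') (GamC n n' y (ebase k0)) (Gam_lin n' n (ebase k0) y).
set a := Num.sqrt (n2 y); set b := Num.sqrt (n2 y').
have a0 : 0 <= a by exact: sqrtr_ge0.
have b0 : 0 <= b by exact: sqrtr_ge0.
have t0' := ltW t0.
have h1 : `|Gam n n' y (perp y')| <= t * (a * b).
  apply: ler_abs_sqr; first by rewrite !mulr_ge0.
  by apply: (le_trans (O_bound _ _ nn')); rewrite !exprMn !sqr_sqrtr// n2_ge0.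
have h2 : `|Gam n' n (ebase k0) (perp y)| <= t * a.
  apply: ler_abs_sqr; first by rewrite !mulr_ge0.
  rewrite eq_sym in nn'; apply: (le_trans (O_bound _ _ nn')).
  by rewrite !exprMn !sqr_sqrtr ?n2_ge0// n2_ebase mul1r.
have h3 : `|Gam n' n (ebase k0) (ebase k0) - 1| <= 5 * t by apply: Gam00; rewrite eq_sym.
have hy := abs_coord y; have hy' := abs_coord y'; rewrite -/a -/b in hy hy'.
move: h1 h2 h3 hy hy'; set g1 := Gam _ _ _ _; set g2 := Gam _ _ _ _; set g3 := Gam _ _ _ _.
set u := y k0; set v := y' k0 => h1 h2 h3 hy hy'.
have i1 : v * g2 <= b * (t * a).
  apply: le_trans (ler_norm _) _; rewrite normrM; exact: ler_pM.
have i2 : v * u * (g3 - 1) <= b * a * (5 * t).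
  apply: le_trans (ler_norm _) _; rewrite !normrM; apply: ler_pM => //; exact: ler_pM.
have i3 := le_trans (ler_norm _) h1.
have -> : g1 + v * (g2 + u * g3) = g1 + v * g2 + v * u * (g3 - 1) + u * v by ring.
lra.
Qed.

(** Adding nonnegative diagonal terms completes the means of the off-diagonal blocks to
    [mv v ^+ 2 = 0]. The errors add up to [7 * t] by Cauchy-Schwarz with the weights [mu], and the
    diagonal blocks contribute at most [t], because [mu n ^+ 2] is small. *)
Lemma Q_bound v : mv k0 mu v = 0 -> QQ k0 (cR x) (cI x) mu p xpredT v <= 64^-1 * v2 v.
Proof.
move=> v0; pose s n := Num.sqrt (n2 (v n : rvec R Kt)).
have E : QQ k0 (cR x) (cI x) mu p xpredT v = \sum_n \sum_n' mu n * mu n' * Gam n n' (v n) (v n').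
  transitivity (\sum_l \sum_n \sum_n' mu n * mu n' * (p l * (fr x n l (v n) * fr x n' l (v n') + fi x n l (v n) * fi x n' l (v n')))).
    apply: eq_bigr => l _.
    have -> : hr k0 (cR x) (cI x) mu l v = \sum_n mu n * fr x n l (v n) by apply: eq_bigr => n _; exact: frE.
    have -> : hi k0 (cR x) (cI x) mu l v = \sum_n mu n * fi x n l (v n) by apply: eq_bigr => n _; exact: fiE.
    rewrite !expr2 !big_distrlr /= -big_split mulr_sumr; apply: eq_bigr => n _ /=.
    by rewrite -big_split mulr_sumr; apply: eq_bigr => n' _ /=; ring.
  rewrite exchange_big; apply: eq_bigr => n _ /=; rewrite exchange_big; apply: eq_bigr => n' _ /=.
  by rewrite /Gam mulr_sumr.
have s0 n : 0 <= s n by exact: sqrtr_ge0.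
have s2 n : s n ^+ 2 = vn v n by rewrite sqr_sqrtr// n2_ge0.
have bnd n n' : mu n * mu n' * Gam n n' (v n) (v n') <=
    (if n' == n then mu n ^+ 2 * CD * vn v n else 0) + (mu n * v n k0) * (mu n' * v n' k0) +
    7 * t * ((mu n * s n) * (mu n' * s n')).
  have mm : 0 <= mu n * mu n' by rewrite mulr_ge0.
  have t0' := ltW t0.
  have z : 0 <= 7 * t * ((mu n * s n) * (mu n' * s n')) by rewrite !mulr_ge0.
  move: z; case: eqP => [->|/eqP nn'] z.
    have := f2_bound n (v n); rewrite -vn_n2.
    have -> : Gam n n (v n) (v n) = \sum_l p l * (fr x n l (v n) ^+ 2 + fi x n l (v n) ^+ 2).
      by apply: eq_bigr => l _; ring.
    move=> /(ler_wpM2l (sqr_ge0 (mu n))).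
    have := sqr_ge0 (mu n * v n k0); rewrite -expr2; move: z; rewrite -expr2.
    by set S := \sum_l _; lra.
  rewrite add0r; rewrite eq_sym in nn'; have := ler_wpM2l mm (Gam_off (v n) (v n') nn').
  by rewrite -/(s n) -/(s n'); lra.
rewrite E; apply: (@le_trans _ _ (\sum_n mu n ^+ 2 * CD * vn v n + mv k0 mu v ^+ 2 + 7 * t * (\sum_n mu n * s n) ^+ 2)).
  rewrite /mv !expr2 !big_distrlr /= mulr_sumr -!big_split; apply: ler_sum => n _ /=.
  have -> : mu n * mu n * CD * vn v n = \sum_n' (if n' == n then mu n ^+ 2 * CD * vn v n else 0).
    by rewrite -big_mkcond big_pred1_eq expr2.
  by rewrite [7 * t * _]mulr_sumr -!big_split; apply: ler_sum => n' _; exact: bnd.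
rewrite v0 expr0n addr0.
have h1 : \sum_n mu n ^+ 2 * CD * vn v n <= t * v2 v.
  rewrite /v2 mulr_sumr; apply: ler_sum => n _; apply: ler_wpM2r; first exact: vn_ge0.
  have nu0 : 0 <= nu by apply: le_trans (munu n); exact: sqr_ge0.
  have : mu n ^+ 2 <= t ^+ 4.
    by apply: le_trans nuRl; apply: le_trans (munu n) _; apply: ler_peMr.
  move=> /(ler_wpM2r CD_ge0) /le_trans; apply.
  have := T_CD; have : t ^+ 2 <= t by rewrite expr2; apply: ler_piMr; [exact: ltW|exact: t_le1].
  have : 0 <= CD * t ^+ 4 by rewrite mulr_ge0 ?CD_ge0// exprn_ge0// ltW.
  by lra.
have h2 : (\sum_n mu n * s n) ^+ 2 <= v2 v.
  by apply: (le_trans (sum_CS1 _ _)); rewrite mu1 mul1r; apply: ler_sum => n _; rewrite s2.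
have h3 : 7 * t * (\sum_n mu n * s n) ^+ 2 <= 7 * t * v2 v.
  by apply: ler_wpM2l => //; rewrite mulr_ge0// ltW.
have : 8 * t * v2 v <= 64^-1 * v2 v.
  by apply: ler_wpM2r; [exact: v2_ge0|have := t_small; lra].
lra.
Qed.

Lemma SL_gt0 l : 2^-1 <= SL x l.
Proof. by have /andP[+ _] := SL_bounds l; have := t_small; lra. Qed.

(** In the coordinate [k0], the factor [1 / s_l] is within [3 * t] of 1 and [B_bound] applies. The
    other coordinates are conditionally centred and bounded one at a time through [badE]; their sum
    over [Kt] is covered by [wK]. *)
Lemma e_bound n v : `|\sum_l p l * ((ar k0 (cR x) mu l n * psr (cR x) l n v + ai k0 (cI x) mu l n * psi (cI x) l n v) /
   sl k0 (cR x) (cI x) mu l) - mu n * v n k0| <= 7 * t * mu n * Num.sqrt (vn v n).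
Proof.
pose u l := p l / SL x l; pose y : rvec R Kt := v n.
have usym l : u (neg l) = u l by rewrite /u pneg SLneg.
pose Ek (k : Kt) : R := if k == k0 then 0 else \sum_l u l * x (n, l, k0) * x (n, l, k).
have -> : \sum_l p l * ((ar k0 (cR x) mu l n * psr (cR x) l n v + ai k0 (cI x) mu l n * psi (cI x) l n v) /
   sl k0 (cR x) (cI x) mu l) - mu n * v n k0 = mu n * (y k0 * (\sum_l u l * x (n, l, k0) ^+ 2 - 1) + \sum_k y k * Ek k).
  have -> : \sum_l p l * ((ar k0 (cR x) mu l n * psr (cR x) l n v + ai k0 (cI x) mu l n * psi (cI x) l n v) /
     sl k0 (cR x) (cI x) mu l) = mu n * \sum_l u l * fr x n l (v n).
    by rewrite mulr_sumr; apply: eq_bigr => l _; rewrite frE slE /u; ring.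
  have -> : \sum_l u l * fr x n l (v n) = \sum_l u l * (x (n, l, k0) * lf x n l y).
    exact: (@sum_sym u (fun l => x (n, l, k0) * lf x n l y) usym).
  have -> : \sum_k y k * Ek k = \sum_l u l * x (n, l, k0) * lf x n l (perp y).
    rewrite /lf /dot; under [RHS]eq_bigr do rewrite mulr_sumr.
    rewrite exchange_big; apply: eq_bigr => k _ /=; rewrite /Ek /perp.
    case: (k == k0); first by rewrite mulr0 big1// => l _; rewrite mul0r mulr0.
    by rewrite mulr_sumr; apply: eq_bigr => l _; ring.
  have -> : \sum_l u l * (x (n, l, k0) * lf x n l y) = y k0 * (\sum_l u l * x (n, l, k0) ^+ 2) + \sum_l u l * x (n, l, k0) * lf x n l (perp y).
    by rewrite mulr_sumr -big_split; apply: eq_bigr => l _ /=; rewrite (X_perp n l y); ring.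
  by rewrite /y; ring.
rewrite normrM ger0_norm// -!mulrA (mulrC 7) -!mulrA (mulrCA t) ; apply: ler_wpM2l => //.
have t0' := ltW t0; have ts := t_small.
set s := Num.sqrt _; have s0 : 0 <= s by exact: sqrtr_ge0.
have s2 : s ^+ 2 = n2 y by rewrite sqr_sqrtr// vn_ge0.
have h1 : `|\sum_l u l * x (n, l, k0) ^+ 2 - 1| <= 6 * t.
  have ub l : (1 - 3 * t) * p l <= u l <= (1 + 3 * t) * p l.
    have sp : 0 < SL x l by apply: lt_le_trans (SL_gt0 l).
    have /andP[a1 a2] := SL_bounds l; have pl := p0 l.
    rewrite /u ler_pdivlMr// ler_pdivrMr//; apply/andP; split.
      rewrite mulrAC ler_piMl//; nra.
    rewrite mulrAC ler_peMl//; nra.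
  have := B_bound n; rewrite !ler_norml => /andP[b1 b2].
  have c1 : \sum_l u l * x (n, l, k0) ^+ 2 <= (1 + 3 * t) * \sum_l p l * x (n, l, k0) ^+ 2.
    rewrite mulr_sumr; apply: ler_sum => l _; rewrite mulrA; apply: ler_wpM2r; first exact: sqr_ge0.
    by case/andP: (ub l).
  have c2 : (1 - 3 * t) * \sum_l p l * x (n, l, k0) ^+ 2 <= \sum_l u l * x (n, l, k0) ^+ 2.
    rewrite mulr_sumr; apply: ler_sum => l _; rewrite mulrA; apply: ler_wpM2r; first exact: sqr_ge0.
    by case/andP: (ub l).
  move: b1 b2 c1 c2; set A := \sum_l _; set B := \sum_l _ => b1 b2 c1 c2.
  by apply/andP; split; nra.
have h2 : `|\sum_k y k * Ek k| <= t * s.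
  apply: ler_abs_sqr; first by rewrite mulr_ge0.
  apply: (le_trans (sum_CS1 _ _)); rewrite exprMn s2 mulrC; apply: ler_wpM2r; first exact: n2_ge0.
  apply: (@le_trans _ _ (\sum_(k : Kt) 8 * w * Rl)).
    apply: ler_sum => k _; rewrite /Ek; case: eqP => [_|/eqP kk].
      by rewrite expr0n !mulr_ge0 ?w_ge0 ?Rl_ge0.
    have nb : ~ bad_linear (eL n) (fun x l k' => p l / SL x l * x (n, l, k0) * ebase k k') Rl x.
      by move=> H; apply: (@nE (n, k)).
    have := linear_neg nb.
    have -> : \sum_a lform (eL n) (fun x l k' => p l / SL x l * x (n, l, k0) * ebase k k') x a =
        \sum_l u l * x (n, l, k0) * x (n, l, k).
      by apply: eq_bigr => l _; rewrite /lform dotZl dotC dot_ebase.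
    move=> /le_trans; apply.
    rewrite (mulrC _ Rl); apply: ler_wpM2l; first exact: Rl_ge0.
    apply: (@le_trans _ _ (\sum_l 4 * w * (p l * x (n, l, k0) ^+ 2))).
      apply: ler_sum => l _; rewrite n2Z n2_ebase mulr1 exprMn mulrA; apply: ler_wpM2r; first exact: sqr_ge0.
      have sp := SL_gt0 l; have pl := p0 l; have := pw l.
      rewrite expr_div_n ler_pdivrMr ?exprn_gt0//; last by apply: lt_le_trans sp.
      have : 4^-1 <= SL x l ^+ 2 by nra.
      set S := SL x l ^+ 2 => hS hw.
      have : p l ^+ 2 <= w * p l by rewrite expr2; apply: ler_wpM2r.
      have : 0 <= w * p l by rewrite mulr_ge0 ?w_ge0.
      nra.
    rewrite -mulr_sumr; have := B_bound n; rewrite ler_norml => /andP[_ b2].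
    have : 4 * w * (\sum_l p l * x (n, l, k0) ^+ 2) <= 4 * w * 2.
      by apply: ler_wpM2l; [rewrite mulr_ge0 ?w_ge0|lra].
    lra.
  rewrite sumr_const -[_ *+ #|_|]mulr_natr.
  have -> : 8 * w * Rl * #|Kt|%:R = 8 * (w * Rl * #|Kt|%:R) by ring.
  by have := T_CD; have := wK; have := T_small; have := sqr_ge0 t; lra.
apply: (le_trans (ler_normD _ _)); rewrite normrM.
have := ler_pM (normr_ge0 _) (normr_ge0 _) (abs_coord y) h1.
rewrite -[Num.sqrt (n2 y)]/s; lra.
Qed.

Let cm : R := #|Kt|%:R * Rl.

Lemma cm_ge0 : 0 <= cm. Proof. by rewrite mulr_ge0// Rl_ge0. Qed.

Lemma w_cm_le : w * cm <= t ^+ 4.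
Proof. by apply: le_trans wK; rewrite /cm (mulrC _ Rl) mulrA. Qed.

Lemma t4_le_t64 : t ^+ 4 <= t / 64.
Proof.
have := T_small; have h : t ^+ 2 <= t by rewrite expr2 ler_piMr ?(ltW t0) ?t_le1.
have := t0; lra.
Qed.

(** [badF] concerns the solution without the inverse determinant; since both sides are homogeneous,
    any multiple [c] of it obeys the same bound. Both frequencies of a pair share one leave-one-out
    solution. *)
Lemma loosol_dPsi l l' c : pairS l l' ->
  dPsi (cR x) (cI x) l' (fun n k => c * loosol x l n k) (fun n k => c * loosol x l n k) <=
  2 * v2 (fun n k => c * loosol x l n k) + 8 * Rl * \big[Num.max/0]_n vn (fun n k => c * loosol x l n k) n.
Proof.
move=> ll'; set v := fun n k => _; set mx := \big[_/_]_n _.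
have S' m : pairS l m -> \sum_n lf x n m (v n) ^+ 2 <= 2 * v2 v + 8 * Rl * mx.
  move=> lm; have PS : pairS l = pairS m.
    apply/funext => j; rewrite /pairS; move: lm; rewrite /pairS => /orP[] /eqP -> //.
    by rewrite negK orbC.
  have Xv n : lf x n m (v n) = c * lf x n m (loosol x l n) by rewrite /lf /v dotZl.
  have vnv n : vn v n = c ^+ 2 * n2 (loosol x l n : rvec R Kt) by rewrite vn_n2 /v n2Z.
  have /existsNP[n0 /negP] := @nF m; rewrite -leNgt.
  have LE n : loosol x m n = loosol x l n by rewrite /loosol -PS.
  have -> : \sum_b 1 * n2 (loosol x m b : rvec R Kt) = \sum_n n2 (loosol x l n : rvec R Kt).
    by apply: eq_bigr => n _; rewrite mul1r LE.
  have -> : \sum_b 1 * lform (eN m) (fun x n => loosol x m n) x b ^+ 2 = \sum_n lf x n m (loosol x l n) ^+ 2.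
    by apply: eq_bigr => n _; rewrite mul1r /lform LE.
  rewrite LE mul1r => /(ler_wpM2l (sqr_ge0 c)).
  have -> : c ^+ 2 * \sum_n lf x n m (loosol x l n) ^+ 2 = \sum_n lf x n m (v n) ^+ 2.
    by rewrite mulr_sumr; apply: eq_bigr => n _; rewrite Xv exprMn.
  move=> /le_trans; apply; rewrite mulrDr; apply: lerD.
    rewrite mulrCA; apply: ler_wpM2l => //; rewrite /v2 mulr_sumr.
    by apply: ler_sum => n _; rewrite vnv.
  rewrite mulrCA; apply: ler_wpM2l; first by rewrite mulr_ge0 ?Rl_ge0.
  by rewrite -vnv; exact: le_bigmax.
rewrite /dPsi; under eq_bigr do rewrite -!expr2 psri2.
have h1 := S' l' ll'.
have h2 : \sum_n lf x n (neg l') (v n) ^+ 2 <= 2 * v2 v + 8 * Rl * mx.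
  by apply: S'; move: ll'; rewrite /pairS => /orP[] /eqP ->; rewrite ?negK eqxx ?orbT.
have -> : \sum_i (lf x i l' (v i) ^+ 2 + lf x i (neg l') (v i) ^+ 2) / 2 =
  2^-1 * (\sum_n lf x n l' (v n) ^+ 2 + \sum_n lf x n (neg l') (v n) ^+ 2).
  by rewrite -big_split mulr_sumr; apply: eq_bigr => n _ /=; rewrite mulrC.
lra.
Qed.

(** Outside the bad events the deterministic part applies with [epsQ = 64^-1] and [epse = 7 * t];
    the leave-one-out bounds are then multiples of powers of [t] small enough for [1 / 64]. *)
Lemma good_of_not_bad : exists v,
  [/\ solves k0 (cR x) (cI x) mu p xpredT v,
      (forall l, p l * beta k0 (cR x) (cI x) mu l v v <= p l / 64),
      (forall l, 2^-1 <= sl k0 (cR x) (cI x) mu l <= 2),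
      (forall n v, 2 / 5 * vn v n <= \sum_l p l * (psr (cR x) l n v ^+ 2 + psi (cI x) l n v ^+ 2) <= 5 * vn v n)
    & (forall v, mv k0 mu v = 0 -> QQ k0 (cR x) (cI x) mu p xpredT v <= 64^-1 * v2 v)].
Proof.
have ts := t_small; have tp := t0.
have s_lo l : 2^-1 <= sl k0 (cR x) (cI x) mu l by rewrite slE SL_gt0.
have s_hi l : sl k0 (cR x) (cI x) mu l <= 2.
  by rewrite slE; have /andP[_] := SL_bounds l; lra.
have GE n v : \sum_l p l * (psr (cR x) l n v ^+ 2 + psi (cI x) l n v ^+ 2) = \sum_l p l * lf x n l (v n) ^+ 2.
  rewrite -(sum_sym (fun l => lf x n l (v n) ^+ 2))//; by apply: eq_bigr => l _; rewrite psri2.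
have G n v : 2 / 5 * vn v n <= \sum_l p l * (psr (cR x) l n v ^+ 2 + psi (cI x) l n v ^+ 2) <= 5 * vn v n.
  by rewrite GE; exact: G_bounds.
have Glo n v : 2 / 5 * vn v n <= \sum_l p l * (psr (cR x) l n v ^+ 2 + psi (cI x) l n v ^+ 2).
  by case/andP: (G n v).
have c_le n l : \sum_k (cR x n l k ^+ 2 + cI x n l k ^+ 2) <= cm.
  have -> : cm = \sum_(k : Kt) Rl by rewrite sumr_const -[RHS]mulr_natr /cm mulrC.
  apply: ler_sum => k _; rewrite /cR /cI.
  have := x_le (n, l, k); have := x_le (n, neg l, k); nra.
have wc : 2 * w * cm <= 16^-1 by rewrite -mulrA; have := w_cm_le; have := t4_le_t64; lra.
have e32 : 64^-1 <= 64^-1 :> R by [].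
have D_le n v : \sum_l p l * ((ar k0 (cR x) mu l n ^+ 2 + ai k0 (cI x) mu l n ^+ 2) *
    (psr (cR x) l n v ^+ 2 + psi (cI x) l n v ^+ 2)) <= CD * mu n ^+ 2 * vn v n.
  have -> : \sum_l p l * ((ar k0 (cR x) mu l n ^+ 2 + ai k0 (cI x) mu l n ^+ 2) *
    (psr (cR x) l n v ^+ 2 + psi (cI x) l n v ^+ 2)) = mu n ^+ 2 * \sum_l p l * (fr x n l (v n) ^+ 2 + fi x n l (v n) ^+ 2).
    by rewrite mulr_sumr; apply: eq_bigr => l _; rewrite ari2 psri2 f2E; ring.
  have -> : CD * mu n ^+ 2 * vn v n = mu n ^+ 2 * (CD * vn v n) by ring.
  apply: ler_wpM2l; first exact: sqr_ge0.
  exact: f2_bound.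
have t70 : 0 <= 7 * t by rewrite mulr_ge0// ltW.
have v_sol := psol_solves (ltac:(by []) : 0 < 4^-1 :> R) (M'_lo p0 mu1 s_lo Glo Q_bound e32).
exists (ofrow ((\det (smx k0 (cR x) (cI x) mu p xpredT))^-1 *: psol k0 (cR x) (cI x) mu p xpredT)).
split; [exact: v_sol| |by move=> l; rewrite s_lo s_hi|exact: G|exact: Q_bound].
move=> l.
have Sw : \sum_(j | pairS l j) p j <= 2 * p l.
  apply: (@le_trans _ _ (\sum_j ((if j == l then p j else 0) + (if j == neg l then p j else 0)))).
    rewrite big_mkcond; apply: ler_sum => j _; rewrite /pairS.
    by case: (j == l); case: (j == neg l); rewrite /= ?addr0 ?add0r ?lerDl.
  by rewrite big_split /= -!big_mkcond !big_pred1_eq pneg mulr2n mulrDl mul1r.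
have Sw' : \sum_(j | pairS l j) p j <= 2 * w by apply: (le_trans Sw); rewrite ler_pM2l.
have v0_sol := psol_solves (ltac:(by []) : 0 < 8^-1 :> R)
  (MNS'_lo p0 mu1 s_lo c_le Glo Q_bound e32 cm_ge0 wc Sw').
set c := (\det _)^-1 in v0_sol.
set v0 := ofrow _ in v0_sol.
have v0E : v0 = (fun n k => c * loosol x l n k).
  by apply/funext => n; apply/funext => k; rewrite /v0 /loosol /ofrow mxE.
have hv2 := loo_v2 p0 p1 mu1 mu0 s_lo c_le Glo Q_bound e_bound e32 cm_ge0 wc Sw' w_ge0 t70 v0_sol.
have hvn n := loo_vn p0 p1 mu1 mu0 s_lo c_le Glo Q_bound e_bound D_le e32 cm_ge0 wc Sw' w_ge0 t70 CD_ge0 n v0_sol.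
set ep := 7 * t + _ in hv2 hvn.
have ep0 : 0 <= ep by rewrite addr_ge0// !mulr_ge0 ?w_ge0// addr_ge0// mulr_ge0 ?cm_ge0.
have ep9 : ep <= 8 * t.
  by rewrite /ep; have := w_cm_le; have := w_le_t4; have := t4_le_t64; lra.
clearbody ep.
have sCD : Num.sqrt CD <= 57.
  rewrite -(@ler_pXn2r _ 2) ?nnegrE ?sqrtr_ge0// sqr_sqrtr ?CD_ge0// /CD.
  by rewrite -subr_ge0 (_ : 57 ^+ 2 - _ = 23) //; ring.
have sCD0 : 0 <= Num.sqrt CD by exact: sqrtr_ge0.
set mx := \big[Num.max/0]_n vn v0 n.
have nu0 : 0 <= nu.
  have [n _|N0] := pickP (fun _ : Nt => true); first by apply: le_trans (munu n); exact: sqr_ge0.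
  by have := oner_neq0 R; rewrite -mu1 big1 ?eqxx// => n; have := N0 n.
(* [4 * 8 * (1 + 16 * 57)] is below [30 * 30 * 30 * 2]. *)
have mxb : mx <= (30 * 30 * 30 * 2 * t) ^+ 2 * nu.
  apply: bigmax_le => [|n _]; first by rewrite mulr_ge0// sqr_ge0.
  apply: (le_trans (hvn n)); apply: ler_pM; rewrite ?sqr_ge0//.
  rewrite ler_pXn2r ?nnegrE//.
  - apply: (@le_trans _ _ (4 * (8 * t) * (1 + 16 * 57))); last by lra.
    apply: ler_pM; rewrite ?mulr_ge0 ?addr_ge0//; last by lra.
    by rewrite ler_pM2l.
  - by rewrite !mulr_ge0// addr_ge0// mulr_ge0.
  - by rewrite !mulr_ge0// ltW.
have HF l' : pairS l l' -> dPsi (cR x) (cI x) l' v0 v0 <= 2 * (8 * (8 * t)) ^+ 2 + 8 * ((30 * 30 * 30 * 2 * t) ^+ 2 * t ^+ 4).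
  move=> ll'; have := loosol_dPsi c ll'; rewrite -v0E -/mx => /le_trans; apply; apply: lerD.
    apply: ler_wpM2l => //; apply: (le_trans hv2).
    by rewrite ler_pXn2r ?nnegrE ?mulr_ge0 ?(ltW tp)// ler_pM2l.
  rewrite -mulrA; apply: ler_wpM2l => //.
  apply: (@le_trans _ _ (Rl * ((30 * 30 * 30 * 2 * t) ^+ 2 * nu))).
    by apply: ler_wpM2l => //; exact: Rl_ge0.
  by rewrite mulrCA; apply: ler_wpM2l; [exact: sqr_ge0|rewrite mulrC].
have Sl : pairS l l by rewrite /pairS eqxx.
have H := loo_conclusion p0 mu1 s_lo c_le Glo Q_bound e32 cm_ge0 wc Sw' Sl Sw (pw l) v_sol v0_sol HF.
apply: (le_trans H).
apply: ler_wpM2l => //.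
have k1 : (64 * t) ^+ 2 <= 64^-1 ^+ 2 by rewrite ler_pXn2r ?nnegrE ?mulr_ge0 ?(ltW tp)//; lra.
have k2 : (30 * 30 * 30 * 2 * t) ^+ 2 <= 16 ^+ 2 by rewrite ler_pXn2r ?nnegrE ?mulr_ge0 ?(ltW tp)//; lra.
have k3 : (30 * 30 * 30 * 2 * t) ^+ 2 * t ^+ 4 <= 16 ^+ 2 * t ^+ 4 by rewrite ler_wpM2r// exprn_ge0// ltW.
have k4 := t4_le_t64; have k5 := w_cm_le; have k6 := T_small.
have k7 : t ^+ 2 <= t / (64 * 64) by rewrite expr2; apply: ler_wpM2l; [exact: ltW|lra].
rewrite (_ : 8 * (8 * t) = 64 * t); last by ring.
lra.
Qed.
End Det.
End Model.

Ltac measurable_poly := repeat first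
  [ exact: measurable_cst | exact: measurable_coord | apply: measurable_funB | apply: measurable_funD
  | apply: measurable_funM | apply: measurable_funX | (apply: measurable_sum => ?) ].

(** * Events with a probability bound, and measurability of the leave-one-out solution *)

Section Events.
Context {R : realType} {I : finType}.
Context d (T : measurableType d) (P : probability T R) (X : T -> rvec R I).
Hypothesis iX : iidn 1 P X.

Definition evt (S : set (Om R I)) (b : R) := measurable S /\ (P [set w | S (X w)] <= b%:E)%E.

Lemma evt_le S a b : evt S a -> a <= b -> evt S b.
Proof. by move=> [mS PS] ab; split => //; apply: (le_trans PS); rewrite lee_fin. Qed.

Lemma evt_pre S b : evt S b -> measurable [set w | S (X w)].
Proof. by move=> [mS _]; exact: (measurable_preimageT (iidn_measurable iX) mS). Qed.

Lemma evtU S S' a b : evt S a -> evt S' b -> evt (S `|` S') (a + b).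
Proof.
move=> eS eS'; split; first exact: measurableU eS.1 eS'.1.
rewrite (_ : mkset _ = [set w | S (X w)] `|` [set w | S' (X w)]); last by apply/seteqP; split.
by apply: (le_trans (measureU2 _ (evt_pre eS) (evt_pre eS'))); rewrite EFinD; apply: leeD; [exact: eS.2|exact: eS'.2].
Qed.

Lemma evt_ex (A : finType) (S : A -> set (Om R I)) b : (forall a, evt (S a) b) ->
  evt [set x | exists a, S a x] (#|A|%:R * b).
Proof.
move=> eS; split; first by apply: measurable_exists => a; exact: (eS a).1.
by apply: (union_bound (S := fun a => [set w | S a (X w)])) => a; [exact: evt_pre (eS a)|exact: (eS a).2].
Qed.

Lemma evt0 b : 0 <= b -> evt set0 b.
Proof.
by move=> b0; split => //; rewrite (_ : mkset _ = set0) ?measure0 ?lee_fin//; apply/seteqP; split.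
Qed.

Lemma evt_and (c : bool) S b : 0 <= b -> (c -> evt S b) -> evt [set x | c /\ S x] b.
Proof.
move=> b0; case: c => [H|_].
  by rewrite (_ : mkset _ = S); [exact: H|apply/seteqP; split => x /=; [case|split]].
by rewrite (_ : mkset _ = set0); [exact: evt0|apply/seteqP; split => x //= -[]].
Qed.

End Events.

Section MeasurablePsol.
Context {R : realType} d (T : measurableType d) {Nt Lt Kt : finType} (k0 : Kt).
Variables (cr ci : T -> Nt -> Lt -> Kt -> R) (mu : Nt -> R) (p : Lt -> R).
Hypothesis mcr : forall n l k, measurable_fun [set: T] (fun x => cr x n l k).
Hypothesis mci : forall n l k, measurable_fun [set: T] (fun x => ci x n l k).

Lemma measurable_psr l n v : measurable_fun [set: T] (fun x => psr (cr x) l n v).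
Proof. by apply: measurable_sum => k; apply: measurable_funM. Qed.
Lemma measurable_psi l n v : measurable_fun [set: T] (fun x => psi (ci x) l n v).
Proof. by apply: measurable_sum => k; apply: measurable_funM. Qed.
Lemma measurable_ar l n : measurable_fun [set: T] (fun x => ar k0 (cr x) mu l n).
Proof. by apply: measurable_funM. Qed.
Lemma measurable_ai l n : measurable_fun [set: T] (fun x => ai k0 (ci x) mu l n).
Proof. by apply: measurable_funM. Qed.
Lemma measurable_sl l : measurable_fun [set: T] (fun x => sl k0 (cr x) (ci x) mu l).
Proof.
by apply: measurable_sum => n; apply: measurable_funD; apply: measurable_funX;
  [exact: measurable_ar|exact: measurable_ai].
Qed.
Lemma measurable_hr l v : measurable_fun [set: T] (fun x => hr k0 (cr x) (ci x) mu l v).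
Proof.
by apply: measurable_sum => n; apply: measurable_funD; apply: measurable_funM;
  [exact: measurable_ar|exact: measurable_psr|exact: measurable_ai|exact: measurable_psi].
Qed.
Lemma measurable_hi l v : measurable_fun [set: T] (fun x => hi k0 (cr x) (ci x) mu l v).
Proof.
by apply: measurable_sum => n; apply: measurable_funB; apply: measurable_funM;
  [exact: measurable_ar|exact: measurable_psi|exact: measurable_ai|exact: measurable_psr].
Qed.
Lemma measurable_slV l : measurable_fun [set: T] (fun x => (sl k0 (cr x) (ci x) mu l)^-1).
Proof. by apply: measurable_inv; [exact: measurable_sl|move=> x; exact: sl_ge0]. Qed.

Lemma measurable_MM Q u v : measurable_fun [set: T] (fun x => MM k0 (cr x) (ci x) mu p Q u v).
Proof.
rewrite /MM; under eq_fun do rewrite big_mkcond.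
apply: measurable_sum => l; case: (Q l) => //; apply: measurable_funM => //; apply: measurable_funB.
  apply: measurable_sum => n; apply: measurable_funD; apply: measurable_funM;
  by [exact: measurable_psr|exact: measurable_psi].
apply: measurable_funM; last exact: measurable_slV.
apply: measurable_funD; apply: measurable_funM; by [exact: measurable_hr|exact: measurable_hi].
Qed.

Lemma measurable_ee Q v : measurable_fun [set: T] (fun x => ee k0 (cr x) (ci x) mu p Q v).
Proof.
rewrite /ee; under eq_fun do rewrite big_mkcond.
apply: measurable_sum => l; case: (Q l) => //; apply: measurable_funM => //; apply: measurable_funB => //.
by apply: measurable_funM; [exact: measurable_hr|exact: measurable_slV].
Qed.

Lemma measurable_det m (A : T -> 'M[R]_m) : (forall i j, measurable_fun [set: T] (fun x => A x i j)) ->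
  measurable_fun [set: T] (fun x => \det (A x)).
Proof.
move=> mA; apply: measurable_sum => s; apply: measurable_funM => //.
by apply: measurable_prod => i _; exact: mA.
Qed.

Lemma measurable_psol Q n k : measurable_fun [set: T] (fun x => ofrow (psol k0 (cr x) (ci x) mu p Q) n k).
Proof.
rewrite /ofrow /psol; under eq_fun do rewrite mxE.
apply: measurable_sum => j; apply: measurable_funM.
  under eq_fun do rewrite mxE; apply: measurableT_comp => //; exact: measurable_ee.
under eq_fun do rewrite mxE /cofactor; apply: measurable_funM => //.
apply: measurable_det => a b; under eq_fun do rewrite !mxE.
by apply: measurable_funD => //; exact: measurable_MM.
Qed.

Lemma psol_ext (Q : pred Lt) (c1 c2 e1 e2 : Nt -> Lt -> Kt -> R) :
  (forall n l k, Q l -> c1 n l k = c2 n l k /\ e1 n l k = e2 n l k) ->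
  psol k0 c1 e1 mu p Q = psol k0 c2 e2 mu p Q.
Proof.
move=> H.
have c12 n l k : Q l -> c1 n l k = c2 n l k by move=> /(H n l k)[].
have e12 n l k : Q l -> e1 n l k = e2 n l k by move=> /(H n l k)[].
have Er l n v : Q l -> psr c1 l n v = psr c2 l n v by move=> Ql; apply: eq_bigr => k _; rewrite c12.
have Ei l n v : Q l -> psi e1 l n v = psi e2 l n v by move=> Ql; apply: eq_bigr => k _; rewrite e12.
have Es l : Q l -> sl k0 c1 e1 mu l = sl k0 c2 e2 mu l.
  by move=> Ql; apply: eq_bigr => n _; rewrite /ar /ai c12// e12.
have Ehr l v : Q l -> hr k0 c1 e1 mu l v = hr k0 c2 e2 mu l v.
  by move=> Ql; apply: eq_bigr => n _; rewrite /ar /ai c12// e12// Er// Ei.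
have Ehi l v : Q l -> hi k0 c1 e1 mu l v = hi k0 c2 e2 mu l v.
  by move=> Ql; apply: eq_bigr => n _; rewrite /ar /ai c12// e12// Er// Ei.
rewrite /psol; congr (_ *m \adj _).
  by apply/rowP => j; rewrite !mxE; congr (- _); apply: eq_bigr => l Ql; rewrite Ehr// Es.
apply/matrixP => i j; rewrite !mxE; congr (_ + _); apply: eq_bigr => l Ql.
rewrite /beta !Ehr// !Ehi// Es//; congr (_ * (_ - _)).
by apply: eq_bigr => n _; rewrite !Er// !Ei.
Qed.

End MeasurablePsol.

(** * Probabilities of the bad events *)

Section Probability.
Context {R : realType} {Nt Lt Kt : finType} (k0 : Kt) (n0 : Nt) (l0 : Lt) (neg : Lt -> Lt).
Hypothesis negK : involutive neg.
Local Notation I := (Nt * Lt * Kt)%type.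
Variables (mu : Nt -> R) (p : Lt -> R) (w t Rl RK : R).
Context d (T : measurableType d) (P : probability T R) (X : T -> rvec R I).
Hypothesis iX : iidn 1 P X.
Hypothesis p0 : forall l, 0 <= p l.
Hypothesis p1 : \sum_l p l = 1.
Hypothesis pw : forall l, p l <= w.
Hypothesis Rl1 : 1 <= Rl.
Hypothesis RK1 : 1 <= RK.
Hypothesis t0 : 0 < t.
Hypothesis t1 : t <= 1.

Lemma eL_inj n : injective (eL n : Lt * Kt -> I).
Proof. by move=> [a b] [c e] [-> ->]. Qed.
Lemma eN_inj l : injective (eN l : Nt * Kt -> I).
Proof. by move=> [a b] [c e] [-> ->]. Qed.

Lemma Rl_nneg : 0 <= Rl. Proof. exact: le_trans Rl1. Qed.
Lemma Rl_gt0 : 0 < Rl. Proof. exact: lt_le_trans Rl1. Qed.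
Lemma RK_ge0 : 0 <= RK. Proof. exact: le_trans RK1. Qed.
Lemma RK_gt0 : 0 < RK. Proof. exact: lt_le_trans RK1. Qed.
Lemma exp2_ge0 r : 0 <= 2 * expR r :> R. Proof. by rewrite mulr_ge0 ?expR_ge0. Qed.

Lemma evt_badA i : evt P X [set x | badA Rl i x] (2 * expR (- (Rl / 2))).
Proof.
split; first by apply: measurable_lt_set => //; apply: measurable_funX; exact: measurable_coord.
have := stdn_linear (ebase i : rvec R I) Rl_gt0 iX.
congr (P _ <= _)%E; apply/seteqP; split => y /=; rewrite dot_ebase /ebase eqxx mulr1 dotC dot_ebase //.
Qed.

Lemma evt_chi2_const (A : finType) (a0 : A) (e : A * Kt -> I) (y : rvec R Kt) (q : A -> R) r : injective e ->
  0 <= r -> (forall a, 0 <= q a) ->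
  evt P X [set x | bad_chi2 e (fun _ _ => y) (fun _ => q) t r x] (2 * expR (- (r / 8))).
Proof.
move=> ei r0 q0; split.
  by apply: measurable_bad_chi2 => *; exact: measurable_cst.
by apply: (@bad_chi2_le R I A Kt k0 a0 d T P X iX e xpred0) => // *; exact: measurable_cst.
Qed.

Lemma evt_badD i : evt P X [set x | badD p t RK i x] (2 * expR (- (RK / 8))).
Proof. by apply: evt_chi2_const => //; [exact: eL_inj|exact: RK_ge0]. Qed.

Lemma evt_badB n : evt P X [set x | badB k0 p t Rl n x] (2 * expR (- (Rl / 8))).
Proof. by apply: evt_chi2_const => //; [exact: eL_inj|exact: Rl_nneg]. Qed.

Lemma evt_badS l : evt P X [set x | badS k0 mu t Rl l x] (2 * expR (- (Rl / 8))).
Proof. by apply: evt_chi2_const => //; [exact: eN_inj|exact: Rl_nneg|move=> n; exact: sqr_ge0]. Qed.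

Lemma evt_badQ n : 0 < w -> evt P X [set x | badQ k0 p Rl n x] (expR (- (16 * w * Rl)^-1)).
Proof.
move=> wp; split.
  apply: measurable_lt_set => //; apply: measurable_sum => l; apply: measurable_funM => //.
  apply: measurable_funM; last by apply: measurable_funX; exact: measurable_coord.
  by apply: measurable_minr => //; apply: measurable_funX; exact: measurable_coord.
have inj : injective (fun l : Lt => (n, l, k0) : I) by move=> a b [].
have iY := iidn_sub inj iX.
have pb l : 0 <= p l <= w by rewrite p0 pw.
have p1' : \sum_l p l <= 1 by rewrite p1.
have := tail_quartic iY (40 ^+ 2 + 1) pb p1' wp Rl_gt0.
have -> : (40 ^+ 2 - (40 ^+ 2 + 1)) / (16 * w * Rl) = - (16 * w * Rl)^-1 by field; rewrite !gt_eqF// Rl_gt0.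
apply: le_trans; apply: le_measure; rewrite ?inE.
- apply: measurable_lt_set => //; apply: measurable_sum => l; apply: measurable_funM => //.
  apply: measurable_funM; last by apply: measurable_funX; exact: iX.1.
  by apply: measurable_minr => //; apply: measurable_funX; exact: iX.1.
- rewrite -[X in measurable X]setTI; apply: (measurable_fun_ler _ _) => //.
  apply: measurable_sum => l; apply: measurable_funM => //.
  apply: measurable_funM; last by apply: measurable_funX; exact: iX.1.
  by apply: measurable_minr => //; apply: measurable_funX; exact: iX.1.
- by move=> y /= /ltW.
Qed.

Lemma measurable_x i : measurable_fun [set: Om R I] (fun x : Om R I => x i).
Proof. exact: measurable_coord. Qed.

Lemma measurable_c02 n l : measurable_fun [set: Om R I] (fun x : Om R I => c02 k0 neg x n l).
Proof. by rewrite /c02; measurable_poly. Qed.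

Lemma evt_badP i : evt P X [set x | badP k0 neg p RK i x] (expR (- RK)).
Proof.
have q0 x a : 0 <= p a * c02 k0 neg x i.1 a by rewrite mulr_ge0// c02_ge0.
have mq a : measurable_fun [set: Om R I] (fun x : Om R I => p a * c02 k0 neg x i.1 a).
  by apply: measurable_funM => //; exact: measurable_c02.
split; first by apply: measurable_bad_square => // *; exact: measurable_cst.
(* Frozen are the coordinates [k0], which determine the weights. *)
apply: (@bad_square_le R I Lt Kt k0 l0 d T P X iX _ (fun i => i.2 == k0)) => //.
- exact: eL_inj.
- by move=> _ a k /= /eqP ->; rewrite /perp eqxx.
- by move=> x z; apply/funext => l; rewrite /c02 /mix /= eqxx.
- exact: RK_ge0.
Qed.

Lemma measurable_coef n n' l y : measurable_fun [set: Om R I] (fun x : Om R I => coef k0 neg p x n n' l y).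
Proof. rewrite /coef /fr /fi /lf /dot; measurable_poly. Qed.

Lemma evt_badO i : evt P X [set x | badO k0 neg p RK i x] (2 * expR (- (RK / 2))).
Proof.
apply: evt_and; first exact: exp2_ge0.
case: i => -[n n'] [g g'] /= nn'.
have mY a k : measurable_fun [set: Om R I] (fun x : Om R I => coef k0 neg p x n n' a (gp g) * perp k0 (gp g') k).
  by apply: measurable_funM => //; exact: measurable_coef.
split; first exact: measurable_bad_linear.
(* Frozen are all blocks but [n'], and the coordinates [k0] of [n']; together they determine
   [coef]. *)
apply: (@bad_linear_le R I Lt Kt k0 d T P X iX _ (fun i => (i.1.1 != n') || (i.2 == k0))) => //.
- exact: eL_inj.
- move=> x z; apply/funext => l; apply/funext => k; congr (_ * _).
  by rewrite /coef /fr /fi /lf /mix /= nn' !eqxx /=.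
- by move=> x a k /=; rewrite eqxx /= => /eqP ->; rewrite /perp eqxx mulr0.
- exact: RK_gt0.
Qed.

Lemma evt_badO0 i : evt P X [set x | badO0 k0 neg p t RK i x] (2 * expR (- (RK / 8))).
Proof.
apply: evt_and; first exact: exp2_ge0.
case: i => n n' /= nn'.
have q0 x a : 0 <= p a * c02 k0 neg x n a by rewrite mulr_ge0// c02_ge0.
have mq a : measurable_fun [set: Om R I] (fun x : Om R I => p a * c02 k0 neg x n a).
  by apply: measurable_funM => //; exact: measurable_c02.
split; first by apply: measurable_bad_chi2 => // *; exact: measurable_cst.
(* Frozen are all blocks but [n']. *)
apply: (@bad_chi2_le R I Lt Kt k0 l0 d T P X iX _ (fun i => i.1.1 != n')) => //.
- exact: eL_inj.
- by move=> x a k /=; rewrite eqxx.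
- by move=> x z; apply/funext => l; rewrite /c02 /mix /= nn'.
- exact: RK_ge0.
Qed.

Lemma SL_ge0 x l : 0 <= SL k0 neg mu x l :> R.
Proof. by apply: sumr_ge0 => n _; rewrite mulr_ge0 ?sqr_ge0// c02_ge0. Qed.

Lemma evt_badE i : evt P X [set x | badE k0 neg mu p Rl i x] (2 * expR (- (Rl / 2))).
Proof.
apply: evt_and; first exact: exp2_ge0.
case: i => n k /= kk0.
have mY a k' : measurable_fun [set: Om R I]
    (fun x : Om R I => p a / SL k0 neg mu x a * x (n, a, k0) * ebase k k').
  apply: measurable_funM => //; apply: measurable_funM; last exact: measurable_x.
  apply: measurable_funM => //; apply: measurable_inv; last by move=> x; exact: SL_ge0.
  by apply: measurable_sum => m; apply: measurable_funM => //; exact: measurable_c02.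
split; first exact: measurable_bad_linear.
(* Frozen are the coordinates [k0], which determine [SL]. *)
apply: (@bad_linear_le R I Lt Kt k0 d T P X iX _ (fun i => i.2 == k0)) => //.
- exact: eL_inj.
- by move=> x z; apply/funext => l; apply/funext => k'; rewrite /SL /c02 /mix /= eqxx.
- by move=> x a k' /= /eqP ->; rewrite /ebase eq_sym (negbTE kk0) mulr0.
- exact: Rl_gt0.
Qed.

Lemma evt_badF l : evt P X [set x | badF k0 neg mu p Rl l x] (expR (- Rl)).
Proof.
have mY a k : measurable_fun [set: Om R I] (fun x : Om R I => loosol k0 neg mu p x l a k).
  apply: measurable_psol => n m j; rewrite /cR /cI; measurable_poly.
split; first by apply: measurable_bad_square => // *; exact: measurable_cst.
(* Frozen are all frequencies outside the pair of [l]. *)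
apply: (@bad_square_le R I Nt Kt k0 n0 d T P X iX _ (fun i => ~~ pairS neg l i.1.2)) => //.
- exact: eN_inj.
- move=> x z; apply/funext => n; congr (ofrow _ n); apply: psol_ext => m j k' Qj.
  have Qj' : ~~ pairS neg l (neg j).
    apply: contra Qj; rewrite /pairS => /orP[] /eqP; first by move=> <-; rewrite negK eqxx orbT.
    by move=> /(inv_inj negK) ->; rewrite eqxx.
  by rewrite /cR /cI /mix /= Qj Qj'.
- by move=> x a k /=; rewrite /pairS eqxx.
- exact: Rl_nneg.
Qed.

End Probability.

Section GoodEvent.
Context {R : realType} {Nt Lt Kt : finType} (k0 : Kt) (n0 : Nt) (l0 : Lt) (neg : Lt -> Lt).
Hypothesis negK : involutive neg.
Local Notation I := (Nt * Lt * Kt)%type.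
Variables (mu : Nt -> R) (p : Lt -> R) (w nu t be al el : R).
Let K : R := #|Kt|%:R.
Let Rl : R := 8 * (be * el).
Let RK : R := 8 * (4 * K * al + be * el).
Context d (T : measurableType d) (P : probability T R) (X : T -> rvec R I).
Hypothesis iX : iidn 1 P X.
Hypothesis p0 : forall l, 0 <= p l.
Hypothesis p1 : \sum_l p l = 1.
Hypothesis pneg : forall l, p (neg l) = p l.
Hypothesis pw : forall l, p l <= w.
Hypothesis mu0 : forall n, 0 <= mu n.
Hypothesis mu1 : \sum_n mu n ^+ 2 = 1.
Hypothesis munu : forall n, mu n ^+ 2 <= nu.
Hypothesis be1 : 1 <= be.
Hypothesis el1 : 1 <= el.
Hypothesis al0 : 0 <= al.
Hypothesis NL : (#|Nt| * #|Lt|)%:R <= expR el.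
Hypothesis KL : (#|Kt| <= #|Lt|)%N.
Hypothesis netK : #|@netT Kt|%:R <= expR (2 * K * al).
Hypothesis t0 : 0 < t.
Hypothesis t_small : 64 * 64 * t <= 1.
Hypothesis wRK : w * Rl * RK <= t ^+ 4.
Hypothesis wK : w * Rl * K <= t ^+ 4.
Hypothesis nuRl : nu * Rl <= t ^+ 4.
Hypothesis wQ : be * el * (16 * w * Rl) <= 1.

(** A union of ten families, each of probability at most [2 * expR ((2 - be) * el)]. The index sets
    contribute at most [2 * el] to the exponent; the nets contribute up to [4 * K * al] more, for
    which the first term of [RK] pays. *)
Lemma good_event : exists S : set (Om R I),
  [/\ measurable S, (P [set z | S (X z)] <= (20 * expR ((2 - be) * el))%:E)%E &
   forall x, ~ S x -> exists v,
  [/\ solves k0 (cR neg x) (cI neg x) mu p xpredT v,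
      (forall l, p l * beta k0 (cR neg x) (cI neg x) mu l v v <= p l / 64),
      (forall l, 2^-1 <= sl k0 (cR neg x) (cI neg x) mu l <= 2),
      (forall n v, 2 / 5 * vn v n <= \sum_l p l * (psr (cR neg x) l n v ^+ 2 + psi (cI neg x) l n v ^+ 2) <= 5 * vn v n)
    & (forall v, mv k0 mu v = 0 -> QQ k0 (cR neg x) (cI neg x) mu p xpredT v <= 64^-1 * v2 v)]].
Proof.
have be_el : 1 <= be * el by have := be1; have := el1; nra.
have el0 : 1 <= el := el1.
have K0 : 0 <= K by exact: ler0n.
have Kal : 0 <= K * al by rewrite mulr_ge0.
have Rl1 : 1 <= Rl by rewrite /Rl; lra.
have RK1 : 1 <= RK by rewrite /RK -!mulrA; lra.
have t1 : t <= 1 by have := t_small; have := t0; lra.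
have wp : 0 < w.
  rewrite lt0r (le_trans (p0 l0) (pw l0)) andbT; apply/eqP => w_eq0.
  have pz l : p l = 0 by apply/eqP; rewrite eq_le p0 andbT -w_eq0 pw.
  by have := oner_neq0 R; rewrite -p1 big1 ?eqxx.
pose e := (2 - be) * el.
have N1 : (0 < #|Nt|)%N by apply/card_gt0P; exists n0.
have L1 : (0 < #|Lt|)%N by apply/card_gt0P; exists l0.
have cN : #|Nt|%:R <= expR el.
  by apply: le_trans NL; rewrite ler_nat leq_pmulr.
have cL : #|Lt|%:R <= expR el.
  by apply: le_trans NL; rewrite ler_nat leq_pmull.
have cK : #|Kt|%:R <= expR el by apply: le_trans cL; rewrite ler_nat.
have fam (c b a b' : R) : 0 <= c -> 0 <= b -> c <= expR a -> b <= 2 * expR b' -> a + b' <= e -> c * b <= 2 * expR e.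
  move=> c0 b0 ca bb ab; apply: (le_trans (ler_pM c0 b0 ca bb)).
  by rewrite mulrCA -expRD ler_wpM2l// ler_expR.
have mul_exp (c c' a a' : R) : 0 <= c -> 0 <= c' -> c <= expR a -> c' <= expR a' -> c * c' <= expR (a + a').
  by move=> c0 c0' h h'; rewrite expRD; exact: ler_pM.
have ge1 r : expR r <= 2 * expR r :> R by rewrite mulr2n mulrDl mul1r lerDl expR_ge0.
have e2 r : 0 <= 2 * expR r :> R by rewrite mulr_ge0// expR_ge0.
have ebe : e = 2 * el - be * el by rewrite /e; ring.
have wRKn : 0 <= RK by apply: le_trans RK1.
have fA := evt_le (evt_ex iX (evt_badA iX Rl1)) (fam _ _ (el + el) (- (be * el)) _ _ _ _ _).
have cA : #|{: Nt * Lt * Kt}|%:R <= expR (el + el).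
  rewrite !card_prod natrM; exact: mul_exp.
have {}fA := fA (ler0n _ _) (e2 _) cA _ _.
have rl2 : - (Rl / 2) <= - (be * el) by rewrite /Rl; lra.
have {}fA := fA ltac:(by rewrite ler_pM2l// ler_expR) ltac:(rewrite ebe; lra).
have cD : #|{: Nt * @netT Kt}|%:R <= expR (el + 2 * K * al).
  by rewrite card_prod natrM; exact: mul_exp.
have rk8 : - (RK / 8) = - (4 * K * al) - be * el by rewrite /RK; field.
have fD := evt_le (evt_ex iX (fun i => @evt_badD _ _ _ _ k0 l0 p t RK _ _ _ _ iX p0 RK1 t0 t1 i))
  (fam _ _ _ (- (RK / 8)) (ler0n _ _) (e2 _) cD (lexx _) ltac:(rewrite rk8 ebe; lra)).
have rl8 : - (Rl / 8) = - (be * el) by rewrite /Rl; field.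
have fB := evt_le (evt_ex iX (fun i => @evt_badB _ _ _ _ k0 l0 p t Rl _ _ _ _ iX p0 Rl1 t0 t1 i))
  (fam _ _ _ (- (Rl / 8)) (ler0n _ _) (e2 _) cN (lexx _) ltac:(rewrite rl8 ebe; lra)).
have fS := evt_le (evt_ex iX (fun i => @evt_badS _ _ _ _ k0 n0 mu t Rl _ _ _ _ iX Rl1 t0 t1 i))
  (fam _ _ _ (- (Rl / 8)) (ler0n _ _) (e2 _) cL (lexx _) ltac:(rewrite rl8 ebe; lra)).
have rq : - (16 * w * Rl)^-1 <= - (be * el).
  have Rp : 0 < Rl by exact: lt_le_trans Rl1.
  have z : 0 < 16 * w * Rl by apply: mulr_gt0 => //; exact: mulr_gt0.
  by rewrite lerN2 -[leRHS]mul1r ler_pdivlMr.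
have fQ := evt_le (evt_ex iX (fun i => @evt_badQ _ _ _ _ k0 p w Rl _ _ _ _ iX p0 p1 pw Rl1 i wp))
  (fam _ _ _ (- (be * el)) (ler0n _ _) (expR_ge0 _) cN ltac:(apply: le_trans (ge1 _); rewrite ler_expR; exact: rq) ltac:(rewrite ebe; lra)).
have fP := evt_le (evt_ex iX (fun i => @evt_badP _ _ _ _ k0 l0 neg p RK _ _ _ _ iX p0 RK1 i))
  (fam _ _ _ (- RK) (ler0n _ _) (expR_ge0 _) cD (ge1 _) ltac:(rewrite ebe /RK; lra)).
have cO : #|{: Nt * Nt * (@netT Kt * @netT Kt)}|%:R <= expR (el + el + (2 * K * al + 2 * K * al)).
  by rewrite !card_prod !natrM; apply: (mul_exp _ _ (el + el)); rewrite ?mulr_ge0//; exact: (mul_exp).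
have fO := evt_le (evt_ex iX (fun i => @evt_badO _ _ _ _ k0 neg p RK _ _ _ _ iX RK1 i))
  (fam _ _ _ (- (RK / 2)) (ler0n _ _) (e2 _) cO (lexx _) ltac:(rewrite ebe /RK; lra)).
have cO0 : #|{: Nt * Nt}|%:R <= expR (el + el) by rewrite card_prod natrM; exact: mul_exp.
have fO0 := evt_le (evt_ex iX (fun i => @evt_badO0 _ _ _ _ k0 l0 neg p t RK _ _ _ _ iX p0 RK1 t0 t1 i))
  (fam _ _ _ (- (RK / 8)) (ler0n _ _) (e2 _) cO0 (lexx _) ltac:(rewrite rk8 ebe; lra)).
have cE : #|{: Nt * Kt}|%:R <= expR (el + el) by rewrite card_prod natrM; exact: mul_exp.
have fE := evt_le (evt_ex iX (fun i => @evt_badE _ _ _ _ k0 neg mu p Rl _ _ _ _ iX Rl1 i))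
  (fam _ _ _ (- (Rl / 2)) (ler0n _ _) (e2 _) cE (lexx _) ltac:(rewrite ebe; lra)).
have fF := evt_le (evt_ex iX (fun i => @evt_badF _ _ _ _ k0 n0 neg negK mu p Rl _ _ _ _ iX Rl1 i))
  (fam _ _ _ (- Rl) (ler0n _ _) (expR_ge0 _) cL (ge1 _) ltac:(rewrite ebe /Rl; lra)).
have [mS PS] := evtU iX fA (evtU iX fD (evtU iX fB (evtU iX fS (evtU iX fQ (evtU iX fP (evtU iX fO
  (evtU iX fO0 (evtU iX fE fF)))))))).
eexists; split; [exact: mS| |].
  apply: (le_trans PS); rewrite lee_fin /e; set E := expR _.
  by rewrite le_eqVlt; apply/orP; left; apply/eqP; ring.
move=> x nS.
apply: (@good_of_not_bad _ _ _ _ k0 neg negK mu p w nu t Rl RK x) => //.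
all: move=> i H; apply: nS.
- by left; exists i.
- by right; left; exists i.
- by do 2 right; left; exists i.
- by do 3 right; left; exists i.
- by do 4 right; left; exists i.
- by do 5 right; left; exists i.
- by do 6 right; left; exists i.
- by do 7 right; left; exists i.
- by do 8 right; left; exists i.
- by do 9 right; exists i.
Qed.

End GoodEvent.

(** * Complex certificates *)

Section ComplexBasics.
Context {R : realType}.
Implicit Types (x y z : R[i]).

Lemma Re_add x y : complex.Re (x + y) = complex.Re x + complex.Re y.
Proof. by case: x; case: y. Qed.
Lemma Im_add x y : complex.Im (x + y) = complex.Im x + complex.Im y.
Proof. by case: x; case: y. Qed.
Lemma Re_opp x : complex.Re (- x) = - complex.Re x. Proof. by case: x. Qed.
Lemma Im_opp x : complex.Im (- x) = - complex.Im x. Proof. by case: x. Qed.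
Lemma Re_mul x y : complex.Re (x * y) = complex.Re x * complex.Re y - complex.Im x * complex.Im y.
Proof. by case: x; case: y. Qed.
Lemma Im_mul x y : complex.Im (x * y) = complex.Re x * complex.Im y + complex.Im x * complex.Re y.
Proof. by case: x; case: y. Qed.
Lemma Re_sum (I : Type) (r : seq I) (Q : pred I) (F : I -> R[i]) :
  complex.Re (\sum_(i <- r | Q i) F i) = \sum_(i <- r | Q i) complex.Re (F i).
Proof. by apply: (big_morph _ Re_add). Qed.
Lemma Im_sum (I : Type) (r : seq I) (Q : pred I) (F : I -> R[i]) :
  complex.Im (\sum_(i <- r | Q i) F i) = \sum_(i <- r | Q i) complex.Im (F i).
Proof. by apply: (big_morph _ Im_add). Qed.
Lemma Re_cconj x : complex.Re (cconj x) = complex.Re x. Proof. by case: x. Qed.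
Lemma Im_cconj x : complex.Im (cconj x) = - complex.Im x. Proof. by case: x. Qed.
Lemma cplx_eq x y : complex.Re x = complex.Re y -> complex.Im x = complex.Im y -> x = y.
Proof. by case: x => a b; case: y => c d /= -> ->. Qed.

Definition ReImE := (Re_add, Im_add, Re_opp, Im_opp, Re_mul, Im_mul, Re_cconj, Im_cconj).

Lemma cconjM x y : cconj (x * y) = cconj x * cconj y.
Proof. by apply: cplx_eq; rewrite !ReImE; ring. Qed.
Lemma cconjD x y : cconj (x + y) = cconj x + cconj y.
Proof. by apply: cplx_eq; rewrite !ReImE; ring. Qed.
Lemma cconjK x : cconj (cconj x) = x.
Proof. by apply: cplx_eq; rewrite !ReImE; ring. Qed.
Lemma cconj0 : cconj (0 : R[i]) = 0.
Proof. by apply: cplx_eq; rewrite /= ?oppr0. Qed.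
Lemma cconj_sum (I : Type) (r : seq I) (Q : pred I) (F : I -> R[i]) :
  cconj (\sum_(i <- r | Q i) F i) = \sum_(i <- r | Q i) cconj (F i).
Proof. by apply: (big_morph _ cconjD cconj0). Qed.
Lemma cconj_rc (a : R) : cconj (rc a) = rc a.
Proof. by apply: cplx_eq; rewrite /= ?oppr0. Qed.
Lemma rcM (a b : R) : rc (a * b) = rc a * rc b.
Proof. by apply: cplx_eq; rewrite !ReImE /=; ring. Qed.
Lemma rcD (a b : R) : rc (a + b) = rc a + rc b.
Proof. by apply: cplx_eq; rewrite !ReImE /=; ring. Qed.
Lemma rc0 : rc (0 : R) = 0. Proof. by []. Qed.
Lemma rc1 : rc (1 : R) = 1. Proof. by []. Qed.
Lemma rc_sum (I : Type) (r : seq I) (Q : pred I) (F : I -> R) :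
  rc (\sum_(i <- r | Q i) F i) = \sum_(i <- r | Q i) rc (F i).
Proof. by apply: (big_morph _ rcD rc0). Qed.

Lemma cmod2_ge0 z : 0 <= cmod2 z.
Proof. by rewrite addr_ge0 ?sqr_ge0. Qed.
Lemma cmod2M x y : cmod2 (x * y) = cmod2 x * cmod2 y.
Proof. by rewrite /cmod2 !ReImE; ring. Qed.
Lemma cmod2_cconj x : cmod2 (cconj x) = cmod2 x.
Proof. by rewrite /cmod2 !ReImE; ring. Qed.
Lemma cmod2_rc (a : R) : cmod2 (rc a) = a ^+ 2.
Proof. by rewrite /cmod2 /=; ring. Qed.
Lemma cmod2D_le x y : cmod2 (x + y) <= 2 * cmod2 x + 2 * cmod2 y.
Proof.
rewrite /cmod2 !ReImE; have := sqr_ge0 (complex.Re x - complex.Re y).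
by have := sqr_ge0 (complex.Im x - complex.Im y); nra.
Qed.
Lemma cmod2_eq0 z : cmod2 z = 0 -> z = 0.
Proof.
move=> H; apply: cplx_eq => /=.
  by apply/eqP; rewrite -sqrf_eq0; apply/eqP/le_anti; rewrite sqr_ge0 andbT -H lerDl sqr_ge0.
by apply/eqP; rewrite -sqrf_eq0; apply/eqP/le_anti; rewrite sqr_ge0 andbT -H lerDr sqr_ge0.
Qed.
Lemma cmod2_0 : cmod2 (0 : R[i]) = 0. Proof. by rewrite /cmod2 /= expr0n addr0. Qed.
Lemma cconj_mul z : cconj z * z = rc (cmod2 z).
Proof. by apply: cplx_eq; rewrite !ReImE /cmod2 /=; ring. Qed.
Lemma rc_inj (a : R) : rc a = 0 -> a = 0. Proof. by case. Qed.

Lemma cmod2_CS (I : finType) (f g : I -> R[i]) :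
  cmod2 (\sum_i f i * g i) <= (\sum_i cmod2 (f i)) * (\sum_i cmod2 (g i)).
Proof.
pose nu (z : R[i]) := Num.sqrt (cmod2 z).
have nu2 z : nu z ^+ 2 = cmod2 z by rewrite sqr_sqrtr ?cmod2_ge0.
have nuD x y : nu (x + y) <= nu x + nu y.
  rewrite -(@ler_pXn2r _ 2) ?nnegrE ?addr_ge0 ?sqrtr_ge0// sqrrD !nu2.
  have -> : cmod2 (x + y) = cmod2 x + 2 * (complex.Re x * complex.Re y + complex.Im x * complex.Im y) + cmod2 y.
    by rewrite /cmod2 !ReImE; ring.
  rewrite lerD2r lerD2l -[leRHS]mulr_natl ler_wpM2l//.
  apply: le_trans (ler_norm _) _; apply: ler_abs_sqr; first by rewrite mulr_ge0 ?sqrtr_ge0.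
  rewrite exprMn !nu2 /cmod2; have := sqr_ge0 (complex.Re x * complex.Im y - complex.Im x * complex.Re y); nra.
have nu0 z : 0 <= nu z by exact: sqrtr_ge0.
have nuM x y : nu (x * y) = nu x * nu y by rewrite /nu cmod2M sqrtrM ?cmod2_ge0.
have nuS : nu (\sum_i f i * g i) <= \sum_i nu (f i) * nu (g i).
  elim/big_rec2: _ => [|i y z _ H]; first by rewrite /nu cmod2_0 sqrtr0.
  by apply: (le_trans (nuD _ _)); rewrite nuM lerD2l.
have -> : \sum_i cmod2 (f i) = \sum_i nu (f i) ^+ 2 by apply: eq_bigr => i _; rewrite nu2.
have -> : \sum_i cmod2 (g i) = \sum_i nu (g i) ^+ 2 by apply: eq_bigr => i _; rewrite nu2.
apply: le_trans (sum_CS1 _ _); rewrite -nu2 ler_pXn2r ?nnegrE//.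
by apply: sumr_ge0 => i _; rewrite mulr_ge0.
Qed.

End ComplexBasics.

Section Certificate.
Context {R : realType} {Nt Lt Kt : finType}.
Local Notation C := R[i].
Implicit Types (cc : Nt -> Lt -> Kt -> C) (m : Nt -> Kt -> R) (e : Lt -> C).

Definition bil cc l n (x : Nt -> Kt -> C) : C := \sum_k cc n l k * x n k.
Definition rcf (u : Nt -> Kt -> R) : Nt -> Kt -> C := fun n k => rc (u n k).
Definition cn2 (x : Nt -> Kt -> C) : R := \sum_n \sum_k cmod2 (x n k).

(* The matrix Y with entries Y l (n, k) = z l n * cconj (cc n l k) lies in the range of the adjoint of the
   measurement map; the clauses say Y m = e, e^* Y = m^*, and that Y contracts the complement of m. *)
Definition dual_cert cc m e := exists z : Lt -> Nt -> C,
  [/\ forall l, \sum_n \sum_k z l n * cconj (cc n l k) * rc (m n k) = e l,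
      forall n k, \sum_l cconj (e l) * (z l n * cconj (cc n l k)) = rc (m n k) &
      forall x : Nt -> Kt -> C, \sum_n \sum_k rc (m n k) * x n k = 0 ->
        \sum_l cmod2 (\sum_n \sum_k z l n * cconj (cc n l k) * x n k) <= 9 / 16 * cn2 x].

(** Injectivity of the measurements on the tangent space at e m^T. Its elements are e q^T + g m^T,
    and requiring [g] orthogonal to [e] makes this representation unique. *)
Definition tangent_inj cc m e := forall (q : Nt -> Kt -> C) (g : Lt -> C),
  (forall l n, e l * bil cc l n q + g l * bil cc l n (rcf m) = 0) ->
  \sum_l cconj (e l) * g l = 0 -> (forall n k, q n k = 0) /\ (forall l, g l = 0).

Section Core.
Variables (k0 : Kt) (neg : Lt -> Lt) (x : rvec R (Nt * Lt * Kt)%type) (mu : Nt -> R) (p : Lt -> R) (e : Lt -> C).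
Hypothesis negK : involutive neg.
Let cr := cR neg x.
Let ci := cI neg x.
Let cc : Nt -> Lt -> Kt -> C := fun n l k => Complex (cr n l k) (ci n l k).
Let m := mbase k0 mu.
Hypothesis p0 : forall l, 0 <= p l.
Hypothesis p1 : \sum_l p l = 1.
Hypothesis pneg : forall l, p (neg l) = p l.
Hypothesis pe : forall l, cmod2 (e l) = p l.
Hypothesis mu1 : \sum_n mu n ^+ 2 = 1.
Variable v : Nt -> Kt -> R.
Hypothesis v_sol : solves k0 cr ci mu p xpredT v.
Hypothesis v_le : forall l, p l * beta k0 cr ci mu l v v <= p l / 64.
Hypothesis s_lh : forall l, 2^-1 <= sl k0 cr ci mu l <= 2.
Hypothesis G_lh : forall n v, 2 / 5 * vn v n <= \sum_l p l * (psr cr l n v ^+ 2 + psi ci l n v ^+ 2) <= 5 * vn v n.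
Hypothesis Q_le : forall v, mv k0 mu v = 0 -> QQ k0 cr ci mu p xpredT v <= 64^-1 * v2 v.

Local Notation "'s_'" := (sl k0 cr ci mu).
Let a l n : C := Complex (ar k0 cr mu l n) (ai k0 ci mu l n).
Let Ps l n u : C := Complex (psr cr l n u) (psi ci l n u).
Let h l u : C := Complex (hr k0 cr ci mu l u) (hi k0 cr ci mu l u).
Let Bv l n u : C := Complex (Br k0 cr ci mu l n u) (Bi k0 cr ci mu l n u).
Let z l n : C := e l * (rc (s_ l)^-1 * a l n + Bv l n v).

Lemma s_lo' l : 2^-1 <= s_ l. Proof. by case/andP: (s_lh l). Qed.
Lemma s_pos l : 0 < s_ l. Proof. by apply: lt_le_trans (s_lo' l). Qed.
Lemma s_ne0 l : s_ l != 0. Proof. by rewrite gt_eqF ?s_pos. Qed.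

Lemma bil_real l n u : bil cc l n (rcf u) = Ps l n u.
Proof.
by apply: cplx_eq; rewrite /bil ?Re_sum ?Im_sum /=; apply: eq_bigr => k _; rewrite /= ?mulr0 ?mul0r ?subr0 ?addr0 ?add0r.
Qed.

Lemma Ps_base l n : Ps l n m = a l n.
Proof. by rewrite /Ps /a psr_base psi_base. Qed.

Lemma hE l u : h l u = \sum_n cconj (a l n) * Ps l n u.
Proof.
by apply: cplx_eq; rewrite ?Re_sum ?Im_sum /=; apply: eq_bigr => n _; rewrite /=; ring.
Qed.

Lemma BvE l n u : Bv l n u = Ps l n u - rc (s_ l)^-1 * (a l n * h l u).
Proof.
by apply: cplx_eq; rewrite !ReImE /= /Br /Bi; ring.
Qed.

Lemma sum_aa l : \sum_n cconj (a l n) * a l n = rc (s_ l).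
Proof.
rewrite rc_sum; apply: eq_bigr => n _; rewrite cconj_mul /cmod2 /=; congr rc.
Qed.

Lemma aB l u : \sum_n cconj (a l n) * Bv l n u = 0.
Proof.
under eq_bigr do rewrite BvE mulrBr.
rewrite sumrB -hE.
have -> : \sum_n cconj (a l n) * (rc (s_ l)^-1 * (a l n * h l u)) = rc (s_ l)^-1 * (\sum_n cconj (a l n) * a l n) * h l u.
  by rewrite mulr_sumr mulr_suml; apply: eq_bigr => n _; ring.
by rewrite sum_aa -rcM mulVf ?s_ne0// rc1 mul1r subrr.
Qed.

Lemma cconj_bil l n u : \sum_k cconj (cc n l k) * rc (u n k) = cconj (Ps l n u).
Proof.
rewrite -bil_real /bil cconj_sum; apply: eq_bigr => k _; by rewrite cconjM cconj_rc.
Qed.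

Lemma cert_i l : \sum_n \sum_k z l n * cconj (cc n l k) * rc (m n k) = e l.
Proof.
have -> : \sum_n \sum_k z l n * cconj (cc n l k) * rc (m n k) = \sum_n z l n * cconj (a l n).
  apply: eq_bigr => n _; rewrite -Ps_base -cconj_bil mulr_sumr; apply: eq_bigr => k _; ring.
have -> : \sum_n z l n * cconj (a l n) = e l * (rc (s_ l)^-1 * (\sum_n cconj (a l n) * a l n) + \sum_n cconj (a l n) * Bv l n v).
  by rewrite mulr_sumr -big_split mulr_sumr; apply: eq_bigr => n _ /=; rewrite /z; ring.
by rewrite sum_aa aB addr0 -rcM mulVf ?s_ne0// rc1 mulr1.
Qed.

Definition delta (n : Nt) (k : Kt) : Nt -> Kt -> R := fun n' k' => ((n' == n) && (k' == k))%:R.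

Lemma psr_delta (c : Nt -> Lt -> Kt -> R) l n k n' : psr c l n' (delta n k) = (n' == n)%:R * c n l k :> R.
Proof.
rewrite /psr /delta; case: eqP => [->|_] /=; last by rewrite mul0r big1// => j _; rewrite mulr0.
rewrite mul1r (bigD1 k)//= eqxx mulr1 big1 ?addr0// => j jk; by rewrite (negbTE jk) mulr0.
Qed.

Lemma psi_delta (c : Nt -> Lt -> Kt -> R) l n k n' : psi c l n' (delta n k) = (n' == n)%:R * c n l k :> R.
Proof. exact: psr_delta. Qed.

Lemma sum_delta (n : Nt) (F : Nt -> R) : \sum_n' (n' == n)%:R * F n' = F n.
Proof.
rewrite (bigD1 n)//= eqxx mul1r big1 ?addr0// => j jn; by rewrite (negbTE jn) mul0r.
Qed.

Lemma cr_neg n l k : cr n (neg l) k = cr n l k.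
Proof. by rewrite /cr /cR negK; congr (_ / _); rewrite addrC. Qed.
Lemma ci_neg n l k : ci n (neg l) k = - ci n l k.
Proof. by rewrite /ci /cI negK; ring. Qed.
Lemma psr_neg l n u : psr cr (neg l) n u = psr cr l n u.
Proof. by apply: eq_bigr => k _; rewrite cr_neg. Qed.
Lemma psi_neg l n u : psi ci (neg l) n u = - psi ci l n u.
Proof. by rewrite -sumrN; apply: eq_bigr => k _; rewrite ci_neg mulNr. Qed.
Lemma ar_neg l n : ar k0 cr mu (neg l) n = ar k0 cr mu l n.
Proof. by rewrite /ar cr_neg. Qed.
Lemma ai_neg l n : ai k0 ci mu (neg l) n = - ai k0 ci mu l n.
Proof. by rewrite /ai ci_neg mulrN. Qed.
Lemma sl_neg l : s_ (neg l) = s_ l.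
Proof. by apply: eq_bigr => n _; rewrite ar_neg ai_neg sqrrN. Qed.
Lemma hr_neg l u : hr k0 cr ci mu (neg l) u = hr k0 cr ci mu l u.
Proof. by apply: eq_bigr => n _; rewrite ar_neg ai_neg psr_neg psi_neg; ring. Qed.
Lemma hi_neg l u : hi k0 cr ci mu (neg l) u = - hi k0 cr ci mu l u.
Proof. by rewrite -sumrN; apply: eq_bigr => n _; rewrite ar_neg ai_neg psr_neg psi_neg; ring. Qed.
Lemma a_neg l n : a (neg l) n = cconj (a l n).
Proof. by rewrite /a ar_neg ai_neg; apply: cplx_eq. Qed.
Lemma Ps_neg l n u : Ps (neg l) n u = cconj (Ps l n u).
Proof. by rewrite /Ps psr_neg psi_neg; apply: cplx_eq. Qed.
Lemma Bv_neg l n u : Bv (neg l) n u = cconj (Bv l n u).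
Proof.
apply: cplx_eq; rewrite /Bv /Br /Bi /= !sl_neg ?psr_neg ?psi_neg ar_neg ai_neg hr_neg hi_neg; ring.
Qed.
Lemma cc_neg n l k : cc n (neg l) k = cconj (cc n l k).
Proof. by rewrite /cc cr_neg ci_neg; apply: cplx_eq. Qed.

Lemma v_mv : mv k0 mu v = 0.
Proof.
exact: (solves_mv mu1 s_lo' v_sol).
Qed.

(** The terms of l and -l are conjugate, so the imaginary part cancels; the real part is the
    equation [v_sol] tested against a unit vector. *)
Lemma cert_ii n k : \sum_l cconj (e l) * (z l n * cconj (cc n l k)) = rc (m n k).
Proof.
pose F l := rc (p l) * ((rc (s_ l)^-1 * a l n + Bv l n v) * cconj (cc n l k)).
have -> : \sum_l cconj (e l) * (z l n * cconj (cc n l k)) = \sum_l F l.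
  by apply: eq_bigr => l _; rewrite /F -pe -cconj_mul /z; ring.
apply: cplx_eq; last first.
  rewrite Im_sum /=.
  have E : \sum_l complex.Im (F (neg l)) = \sum_l complex.Im (F l).
    by rewrite [RHS](reindex_inj (inv_inj negK)).
  have E2 : \sum_l complex.Im (F (neg l)) = - \sum_l complex.Im (F l).
    rewrite -sumrN; apply: eq_bigr => l _; rewrite -Im_cconj; congr complex.Im.
    by rewrite /F pneg sl_neg a_neg Bv_neg cc_neg !(cconjM, cconjD, cconj_rc, cconjK).
  lra.
rewrite Re_sum /=.
have := v_sol (delta n k); rewrite v_mv mul0r addr0 => E.
have mvd : mv k0 mu (delta n k) = m n k.
  rewrite /mv (eq_bigr (fun n' => (n' == n)%:R * (mu n' * (k0 == k)%:R))) => [|n' _].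
    rewrite (sum_delta n (fun n' => mu n' * (k0 == k)%:R)) /m /mbase eq_sym.
    by case: (k == k0); rewrite ?mulr1 ?mulr0.
  by rewrite /delta; case: (n' == n); rewrite ?mul1r ?mul0r ?mulr0.
rewrite -mvd; have -> : mv k0 mu (delta n k) = MM k0 cr ci mu p xpredT v (delta n k) + \sum_l p l * (hr k0 cr ci mu l (delta n k) / s_ l).
  rewrite E /ee; under [X in - X]eq_bigr do rewrite mulrBr.
  by rewrite sumrB -mulr_suml p1 mul1r; ring.
rewrite -big_split; apply: eq_bigr => l _ /=.
have dP : dPsi cr ci l v (delta n k) = psr cr l n v * cr n l k + psi ci l n v * ci n l k.
  rewrite -(sum_delta n (fun n' => psr cr l n' v * cr n l k + psi ci l n' v * ci n l k)).
  by apply: eq_bigr => n' _ /=; rewrite psr_delta psi_delta; case: eqP => [->|_]; rewrite /=; ring.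
have hrd : hr k0 cr ci mu l (delta n k) = ar k0 cr mu l n * cr n l k + ai k0 ci mu l n * ci n l k.
  rewrite -(sum_delta n (fun n' => ar k0 cr mu l n' * cr n l k + ai k0 ci mu l n' * ci n l k)).
  by apply: eq_bigr => n' _ /=; rewrite psr_delta psi_delta; case: eqP => [->|_]; rewrite /=; ring.
have hid : hi k0 cr ci mu l (delta n k) = ar k0 cr mu l n * ci n l k - ai k0 ci mu l n * cr n l k.
  rewrite -(sum_delta n (fun n' => ar k0 cr mu l n' * ci n l k - ai k0 ci mu l n' * cr n l k)).
  by apply: eq_bigr => n' _ /=; rewrite psr_delta psi_delta; case: eqP => [->|_]; rewrite /=; ring.
rewrite /beta dP hrd hid /Br /Bi; ring.
Qed.

(** For [y] orthogonal to m, the part along a_l contributes at most [16 * QQ], that is [1 / 4]. The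
    part along B_l v contributes by Cauchy-Schwarz and [v_le] at most [16^-1] times the Gram form,
    that is [5 / 16]. *)
Lemma cert_iii (y : Nt -> Kt -> C) : \sum_n \sum_k rc (m n k) * y n k = 0 ->
  \sum_l cmod2 (\sum_n \sum_k z l n * cconj (cc n l k) * y n k) <= 9 / 16 * cn2 y.
Proof.
move=> my; pose yr n k := complex.Re (y n k); pose yi n k := complex.Im (y n k).
have mvE u : mv k0 mu u = \sum_n \sum_k m n k * u n k.
  apply: eq_bigr => n _; rewrite (bigD1 k0)//= /m /mbase eqxx big1 ?addr0// => k kk.
  by rewrite (negbTE kk) mul0r.
have mr : mv k0 mu yr = 0.
  rewrite mvE; have := congr1 (@complex.Re R) my; rewrite Re_sum /= => E; rewrite -[RHS]E; apply: eq_bigr => n _.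
  by rewrite Re_sum; apply: eq_bigr => k _; rewrite Re_mul /= mul0r subr0.
have mi : mv k0 mu yi = 0.
  rewrite mvE; have := congr1 (@complex.Im R) my; rewrite Im_sum /= => E; rewrite -[RHS]E; apply: eq_bigr => n _.
  by rewrite Im_sum; apply: eq_bigr => k _; rewrite Im_mul /= mul0r addr0.
have cn2E : cn2 y = v2 yr + v2 yi.
  by rewrite /cn2 /v2 -big_split; apply: eq_bigr => n _; rewrite /vn -big_split.
pose J : C := Complex 0 1.
have J1 : cmod2 J = 1 by rewrite /cmod2 /= expr0n expr1n add0r.
pose Q l n := cconj (Ps l n yr) + J * cconj (Ps l n yi).
have QE l n : \sum_k cconj (cc n l k) * y n k = Q l n.
  rewrite /Q -!cconj_bil mulr_sumr -big_split; apply: eq_bigr => k _ /=.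
  by apply: cplx_eq; rewrite !ReImE /= /yr /yi; ring.
have TE l : \sum_n \sum_k z l n * cconj (cc n l k) * y n k =
    e l * (rc (s_ l)^-1 * (cconj (h l yr) + J * cconj (h l yi)) + \sum_n Bv l n v * Q l n).
  have -> : cconj (h l yr) + J * cconj (h l yi) = \sum_n a l n * Q l n.
    rewrite !hE !cconj_sum mulr_sumr -big_split; apply: eq_bigr => n _ /=.
    by apply: cplx_eq; rewrite /Q /=; ring.
  rewrite mulr_sumr -big_split mulr_sumr; apply: eq_bigr => n _ /=; rewrite -QE !mulr_sumr -big_split mulr_sumr.
  by apply: eq_bigr => k _ /=; rewrite /z; ring.
have bnd l : cmod2 (\sum_n \sum_k z l n * cconj (cc n l k) * y n k) <=
    p l * (16 * (hr k0 cr ci mu l yr ^+ 2 + hi k0 cr ci mu l yr ^+ 2) + 16 * (hr k0 cr ci mu l yi ^+ 2 + hi k0 cr ci mu l yi ^+ 2)) +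
    p l * (16^-1 * (dPsi cr ci l yr yr + dPsi cr ci l yi yi)).
  rewrite TE cmod2M pe.
  have c1 : cmod2 (rc (s_ l)^-1 * (cconj (h l yr) + J * cconj (h l yi))) <=
      8 * (hr k0 cr ci mu l yr ^+ 2 + hi k0 cr ci mu l yr ^+ 2) + 8 * (hr k0 cr ci mu l yi ^+ 2 + hi k0 cr ci mu l yi ^+ 2).
    rewrite cmod2M cmod2_rc.
    have i4 : (s_ l)^-1 ^+ 2 <= 4.
      rewrite exprVn -[4]invrK lef_pV2 ?posrE ?exprn_gt0 ?s_pos ?invr_gt0//.
      by have := s_lo' l; nra.
    have := cmod2D_le (cconj (h l yr)) (J * cconj (h l yi)); rewrite cmod2M J1 mul1r !cmod2_cconj => hh.
    apply: (le_trans (ler_pM (sqr_ge0 _) (cmod2_ge0 _) i4 hh)).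
    by rewrite /cmod2 /=; lra.
  have c2 : cmod2 (\sum_n Bv l n v * Q l n) <= beta k0 cr ci mu l v v * (2 * (dPsi cr ci l yr yr + dPsi cr ci l yi yi)).
    apply: (le_trans (cmod2_CS _ _)); rewrite betaE ?s_ne0//; apply: ler_wpM2l.
      by apply: sumr_ge0 => n _; exact: cmod2_ge0.
    rewrite -big_split mulr_sumr; apply: ler_sum => n _ /=.
    apply: (le_trans (cmod2D_le _ _)); rewrite cmod2M J1 mul1r !cmod2_cconj /cmod2 /=; lra.
  set c := rc _ * _; set d := \sum_n _.
  apply: (@le_trans _ _ (p l * (2 * cmod2 c + 2 * cmod2 d))).
    by apply: ler_wpM2l => //; exact: cmod2D_le.
  rewrite mulrDr; apply: lerD; first by apply: ler_wpM2l => //; lra.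
  have D0 : 0 <= dPsi cr ci l yr yr + dPsi cr ci l yi yi by rewrite addr_ge0 ?dPsi_ge0.
  have := ler_wpM2l (p0 l) c2; have := ler_wpM2r D0 (v_le l).
  set b := beta _ _ _ _ _ _ _; set D := dPsi _ _ _ _ _ + _; set pl := p l; set cd := cmod2 d; lra.
apply: (le_trans (ler_sum _ (fun l _ => bnd l))).
have G5 u : \sum_l p l * dPsi cr ci l u u <= 5 * v2 u.
  rewrite /v2 mulr_sumr; apply: (@le_trans _ _ (\sum_n \sum_l p l * (psr cr l n u ^+ 2 + psi ci l n u ^+ 2))).
    rewrite exchange_big /=; apply: ler_sum => l _; rewrite -mulr_sumr; apply: ler_wpM2l => //.
  by apply: ler_sum => n _; case/andP: (G_lh n u).
have q1 := Q_le mr; have q2 := Q_le mi; have g1 := G5 yr; have g2 := G5 yi.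
rewrite big_split cn2E /=.
have -> : \sum_l p l * (16 * (hr k0 cr ci mu l yr ^+ 2 + hi k0 cr ci mu l yr ^+ 2) + 16 * (hr k0 cr ci mu l yi ^+ 2 + hi k0 cr ci mu l yi ^+ 2))
  = 16 * QQ k0 cr ci mu p xpredT yr + 16 * QQ k0 cr ci mu p xpredT yi.
  by rewrite /QQ !mulr_sumr -big_split; apply: eq_bigr => l _ /=; ring.
have -> : \sum_l p l * (16^-1 * (dPsi cr ci l yr yr + dPsi cr ci l yi yi)) =
  16^-1 * (\sum_l p l * dPsi cr ci l yr yr + \sum_l p l * dPsi cr ci l yi yi).
  by rewrite -big_split mulr_sumr; apply: eq_bigr => l _ /=; ring.
have := v2_ge0 yr; have := v2_ge0 yi; lra.
Qed.

Lemma dual_cert_core : dual_cert cc m e.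
Proof. by exists z; split; [exact: cert_i|exact: cert_ii|exact: cert_iii]. Qed.

(** The relation at l gives Psi_l qr + i Psi_l qi as a multiple of a_l; the one at -l, conjugated,
    does so for Psi_l qr - i Psi_l qi. Hence the real vectors [qr] and [qi] both have zero energy
    [MM], and by coercivity they are multiples of m. Then [g] is a multiple of [e], and
    orthogonality to [e] makes everything vanish. *)
Lemma tangent_inj_core : tangent_inj cc m e.
Proof.
move=> q g H eg; pose qr n k := complex.Re (q n k); pose qi n k := complex.Im (q n k).
pose J : C := Complex 0 1.
have bilE l n : bil cc l n q = Ps l n qr + J * Ps l n qi.
  rewrite -!bil_real /bil mulr_sumr -big_split; apply: eq_bigr => k _ /=.
  by apply: cplx_eq; rewrite !ReImE /= /qr /qi; ring.
have bilm l n : bil cc l n (rcf m) = a l n by rewrite bil_real Ps_base.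
have par l : p l != 0 -> exists c d : C, forall n, Ps l n qr = c * a l n /\ Ps l n qi = d * a l n.
  move=> pl.
  have el : e l != 0 by apply: contraNneq pl => el; rewrite -pe el cmod2_0.
  have el' : e (neg l) != 0 by apply: contraNneq pl => el'; rewrite -pneg -pe el' cmod2_0.
  pose c1 := - g l / e l; pose c2 := cconj (- g (neg l) / e (neg l)).
  have h1 n : Ps l n qr + J * Ps l n qi = c1 * a l n.
    have := H l n; rewrite bilE bilm => /eqP; rewrite addr_eq0 => /eqP E.
    by apply: (mulfI el); rewrite E /c1; field.
  have h2 n : Ps l n qr - J * Ps l n qi = c2 * a l n.
    have := H (neg l) n; rewrite bilE bilm !Ps_neg a_neg => /eqP; rewrite addr_eq0 => /eqP E.
    have E' : cconj (Ps l n qr) + J * cconj (Ps l n qi) = - g (neg l) / e (neg l) * cconj (a l n).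
      by apply: (mulfI el'); rewrite E; field.
    have := congr1 cconj E'; rewrite cconjM cconjK -/c2 => <-.
    by rewrite cconjD cconjM !cconjK; congr (_ + _); rewrite -mulNr; congr (_ * _); apply: cplx_eq; rewrite /= ?oppr0.
  clearbody c1 c2.
  have JJ : J * J = -1 by apply: cplx_eq; rewrite !ReImE /=; ring.
  exists ((c1 + c2) / 2), (- J * (c1 - c2) / 2) => n; split.
    have -> : Ps l n qr = ((Ps l n qr + J * Ps l n qi) + (Ps l n qr - J * Ps l n qi)) / 2 by field.
    by rewrite h1 h2; field.
  have -> : Ps l n qi = - J * ((Ps l n qr + J * Ps l n qi) - (Ps l n qr - J * Ps l n qi)) / 2.
    transitivity (- (J * J) * Ps l n qi); first by rewrite JJ; ring.
    by field.
  by rewrite h1 h2; field.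
have beta0 u (Hu : forall l, p l != 0 -> exists c : C, forall n, Ps l n u = c * a l n) : MM k0 cr ci mu p xpredT u u = 0.
  rewrite /MM big1// => l _; have [->|pl] := eqVneq (p l) 0; first by rewrite mul0r.
  have [c Hc] := Hu l pl.
  have B0 n : Bv l n u = 0.
    rewrite BvE Hc hE; under eq_bigr do rewrite Hc mulrCA.
    rewrite -mulr_sumr sum_aa.
    have -> : rc (s_ l)^-1 * (a l n * (c * rc (s_ l))) = rc (s_ l)^-1 * rc (s_ l) * (c * a l n) by ring.
    by rewrite -rcM mulVf ?s_ne0// rc1 mul1r subrr.
  rewrite betaE ?s_ne0// big1 ?mulr0// => n _.
  have := B0 n; rewrite /Bv => -[-> ->]; by rewrite expr0n addr0.
have G2 n u : 2 / 5 * vn u n <= \sum_l p l * (psr cr l n u ^+ 2 + psi ci l n u ^+ 2) by case/andP: (G_lh n u).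
have e64 : 64^-1 <= 64^-1 :> R by [].
have col u : MM k0 cr ci mu p xpredT u u = 0 -> exists t, forall n k, u n k = t * m n k.
  move=> M0; exists (mv k0 mu u).
  pose w := lc (- mv k0 mu u) m u.
  have mw : mv k0 mu w = 0 by rewrite mv_lc mv_base mu1; ring.
  have Mm y : MM k0 cr ci mu p xpredT y m = 0 by apply: MM_base; exact: s_ne0.
  have Mw : MM k0 cr ci mu p xpredT w w = 0.
    by rewrite /w MM_lc !MM_lcr M0 !Mm (MMC _ _ _ _ _ _ m u) Mm; ring.
  have := M_lo p0 s_lo' G2 Q_le e64 mw; rewrite Mw pmulr_rle0// => w0.
  have w00 : v2 w = 0 by apply: le_anti; rewrite w0 v2_ge0.
  move=> n k; have /psumr_eq0P H1 := w00.
  have /psumr_eq0P H2 := H1 (fun n _ => vn_ge0 _ _) n isT.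
  have /eqP := H2 (fun k _ => sqr_ge0 _) k isT; rewrite sqrf_eq0 /w /lc => /eqP.
  by lra.
have [tr Hr] := col qr (beta0 qr (fun l pl => let: ex_intro c (ex_intro d Hcd) := par l pl in ex_intro _ c (fun n => (Hcd n).1))).
have [ti Hi] := col qi (beta0 qi (fun l pl => let: ex_intro c (ex_intro d Hcd) := par l pl in ex_intro _ d (fun n => (Hcd n).2))).
pose t : C := Complex tr ti.
have qE n k : q n k = t * rc (m n k).
  by apply: cplx_eq; rewrite !ReImE /= mulr0 ?subr0 ?add0r -?Hr -?Hi.
have gE l : g l = - t * e l.
  have bq n : bil cc l n q = t * a l n.
    by rewrite -bilm /bil mulr_sumr; apply: eq_bigr => k _; rewrite qE /rcf; ring.
  have H0 n : (e l * t + g l) * a l n = 0 by rewrite -[RHS](H l n) bq bilm; ring.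
  have : (e l * t + g l) * rc (s_ l) = 0.
    rewrite -sum_aa mulr_sumr big1// => n _; by rewrite mulrCA H0 mulr0.
  move=> /eqP; rewrite mulf_eq0 => /orP[|/eqP/rc_inj/eqP]; last by rewrite (negbTE (s_ne0 l)).
  by rewrite addrC addr_eq0 => /eqP ->; ring.
have t0 : t = 0.
  move: eg; under eq_bigr do rewrite gE mulrCA cconj_mul pe.
  by rewrite -mulr_sumr -rc_sum p1 rc1 mulr1 => /eqP; rewrite oppr_eq0 => /eqP.
by split=> [n k|l]; [rewrite qE t0 mul0r|rewrite gE t0 oppr0 mul0r].
Qed.

End Core.
End Certificate.

(** * Invariance of the certificate under rotations of the blocks *)

Section Rotation.
Context {R : realType} {Nt Lt Kt : finType}.
Local Notation C := R[i].
Variable U : Nt -> Kt -> rvec R Kt.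
Hypothesis oU : forall n, orthog (U n).
Implicit Types (cc : Nt -> Lt -> Kt -> C) (m : Nt -> Kt -> R) (e : Lt -> C) (y : Nt -> Kt -> C).

Definition rotx y : Nt -> Kt -> C := fun n k => \sum_j rc (U n k j) * y n j.
Definition rotc cc : Nt -> Lt -> Kt -> C := fun n l => rotx (fun n k => cc n l k) n.
Definition rotm m : Nt -> Kt -> R := fun n k => \sum_j U n k j * m n j.

Lemma rotxK y n k : \sum_i rc (U n i k) * rotx y n i = y n k.
Proof.
rewrite /rotx; under eq_bigr do rewrite mulr_sumr.
rewrite exchange_big /=; under eq_bigr do (under eq_bigr do rewrite mulrA -rcM); under eq_bigr do rewrite -mulr_suml -rc_sum.
rewrite (bigD1 k)//= [X in _ + X]big1 => [|j jk].
  have := oU n k k; rewrite /dot /col eqxx => ->; by rewrite rc1 mul1r addr0.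
have := oU n k j; rewrite /dot /col eq_sym (negbTE jk) => ->; by rewrite rc0 mul0r.
Qed.

Lemma rotx_bil y y' n : \sum_k rotx y n k * rotx y' n k = \sum_k y n k * y' n k.
Proof.
under eq_bigr do rewrite {1}/rotx mulr_suml.
rewrite exchange_big; apply: eq_bigr => j _ /=.
rewrite -[y' n j]rotxK mulr_sumr; apply: eq_bigr => i _; ring.
Qed.

Lemma rotx_rcf m : rcf (rotm m) = rotx (rcf m).
Proof.
apply/funext => n; apply/funext => k; rewrite /rcf /rotm rc_sum; apply: eq_bigr => j _; by rewrite rcM.
Qed.

Lemma rotx_conj y : (fun n k => cconj (rotx y n k)) = rotx (fun n k => cconj (y n k)).
Proof.
apply/funext => n; apply/funext => k; rewrite /rotx cconj_sum; apply: eq_bigr => j _.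
by rewrite cconjM cconj_rc.
Qed.

Lemma rotx_cn2 y : cn2 (rotx y) = cn2 y.
Proof.
rewrite /cn2; apply: eq_bigr => n _.
have E (u : Nt -> Kt -> C) : rc (\sum_k cmod2 (u n k)) = \sum_k cconj (u n k) * u n k.
  by rewrite rc_sum; apply: eq_bigr => k _; rewrite cconj_mul.
have : rc (\sum_k cmod2 (rotx y n k)) = rc (\sum_k cmod2 (y n k)).
  rewrite !E -(rotx_bil (fun n k => cconj (y n k)) y n); apply: eq_bigr => k _.
  by rewrite -rotx_conj.
by case.
Qed.

Lemma rotc_conj_bil cc l n y : \sum_k cconj (rotc cc n l k) * rotx y n k = \sum_k cconj (cc n l k) * y n k.
Proof.
rewrite -(rotx_bil (fun n k => cconj (cc n l k)) y n); apply: eq_bigr => k _; by rewrite -rotx_conj.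
Qed.

Lemma dual_cert_rot cc m e : dual_cert (rotc cc) (rotm m) e -> dual_cert cc m e.
Proof.
move=> [z [c1 c2 c3]]; exists z; split=> [l|n k|y my].
- rewrite -(c1 l); apply: eq_bigr => n _.
  under eq_bigr do rewrite -mulrA; under [RHS]eq_bigr do rewrite -mulrA.
  rewrite -!mulr_sumr; congr (_ * _); rewrite -(rotc_conj_bil cc l n (rcf m)) -rotx_rcf.
  by [].
- rewrite -[rc (m n k)]/(rcf m n k) -(rotxK (rcf m)) -rotx_rcf.
  under [RHS]eq_bigr do rewrite /rcf -c2 mulr_sumr.
  rewrite exchange_big; apply: eq_bigr => l _ /=.
  under [RHS]eq_bigr do rewrite mulrCA (mulrCA _ (z l n)).
  rewrite -!mulr_sumr; congr (_ * (_ * _)).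
  rewrite -(rotxK (fun n k => cconj (cc n l k)) n k); apply: eq_bigr => i _; by rewrite -rotx_conj.
have mr : \sum_n \sum_k rc (rotm m n k) * rotx y n k = 0.
  rewrite -[RHS]my; apply: eq_bigr => n _; rewrite -(rotx_bil (rcf m) y n) -rotx_rcf; by [].
have := c3 _ mr; rewrite rotx_cn2; congr (_ <= _); apply: eq_bigr => l _; congr cmod2; apply: eq_bigr => n _.
under eq_bigr do rewrite -mulrA; under [RHS]eq_bigr do rewrite -mulrA.
by rewrite -!mulr_sumr rotc_conj_bil.
Qed.

Lemma tangent_inj_rot cc m e : tangent_inj (rotc cc) (rotm m) e -> tangent_inj cc m e.
Proof.
move=> H q g Hq eg.
have E l n y : bil (rotc cc) l n (rotx y) = bil cc l n y by exact: rotx_bil.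
have Hq' l n : e l * bil (rotc cc) l n (rotx q) + g l * bil (rotc cc) l n (rcf (rotm m)) = 0.
  by rewrite rotx_rcf !E.
have [q0 g0] := H (rotx q) g Hq' eg.
split=> // n k; rewrite -(rotxK q n k) big1// => i _; by rewrite q0 mulr0.
Qed.

End Rotation.

(** * Nuclear norm *)

Section MatrixBasics.
Context {R : realType}.
Local Notation C := R[i].

Definition fn2 m n (A : 'M[C]_(m, n)) : R := \sum_i \sum_j cmod2 (A i j).

Lemma adjE m n (A : 'M[C]_(m, n)) i j : adj A i j = cconj (A j i).
Proof. by rewrite !mxE. Qed.
Lemma adjM m n q (A : 'M[C]_(m, n)) (B : 'M[C]_(n, q)) : adj (A *m B) = adj B *m adj A.
Proof.
apply/matrixP => i j; rewrite adjE !mxE cconj_sum; apply: eq_bigr => k _.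
by rewrite !adjE cconjM mulrC.
Qed.
Lemma adjK m n (A : 'M[C]_(m, n)) : adj (adj A) = A.
Proof. by apply/matrixP => i j; rewrite !adjE cconjK. Qed.
Lemma adjD m n (A B : 'M[C]_(m, n)) : adj (A + B) = adj A + adj B.
Proof. by apply/matrixP => i j; rewrite !(adjE, mxE) cconjD. Qed.
Lemma adjZ m n (a : C) (A : 'M[C]_(m, n)) : adj (a *: A) = cconj a *: adj A.
Proof. by apply/matrixP => i j; rewrite !(adjE, mxE) cconjM. Qed.
Lemma cconjN (z : C) : cconj (- z) = - cconj z.
Proof. by apply: cplx_eq; rewrite !ReImE. Qed.
Lemma adjN m n (A : 'M[C]_(m, n)) : adj (- A) = - adj A.
Proof. by apply/matrixP => i j; rewrite !(adjE, mxE) cconjN. Qed.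
Lemma adj1 n : adj 1%:M = 1%:M :> 'M[C]_n.
Proof.
apply/matrixP => i j; rewrite adjE !mxE eq_sym; case: (i == j); last exact: cconj0.
by rewrite -rc1 cconj_rc.
Qed.

Lemma fn2_ge0 m n (A : 'M[C]_(m, n)) : 0 <= fn2 A.
Proof. by apply: sumr_ge0 => i _; apply: sumr_ge0 => j _; exact: cmod2_ge0. Qed.

Lemma fn2E m n (A : 'M[C]_(m, n)) : finner A A = rc (fn2 A).
Proof.
rewrite /finner /mxtrace /fn2 exchange_big rc_sum; apply: eq_bigr => j _.
rewrite mxE rc_sum; apply: eq_bigr => i _; by rewrite adjE cconj_mul.
Qed.

Lemma fn2_eq0 m n (A : 'M[C]_(m, n)) : fn2 A = 0 -> A = 0.
Proof.
move=> /psumr_eq0P H; apply/matrixP => i j; rewrite mxE; apply: cmod2_eq0.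
have /psumr_eq0P H2 := H (fun i _ => sumr_ge0 _ (fun j _ => cmod2_ge0 _)) i isT.
by rewrite H2// => k _; exact: cmod2_ge0.
Qed.

Lemma finnerDr m n (A B D : 'M[C]_(m, n)) : finner A (B + D) = finner A B + finner A D.
Proof. by rewrite /finner mulmxDr mxtraceD. Qed.
Lemma finnerDl m n (A B D : 'M[C]_(m, n)) : finner (A + B) D = finner A D + finner B D.
Proof. by rewrite /finner adjD mulmxDl mxtraceD. Qed.
Lemma finnerZl m n a (A D : 'M[C]_(m, n)) : finner (a *: A) D = cconj a * finner A D.
Proof. by rewrite /finner adjZ -scalemxAl mxtraceZ. Qed.
Lemma finnerZr m n a (A D : 'M[C]_(m, n)) : finner A (a *: D) = a * finner A D.
Proof. by rewrite /finner -scalemxAr mxtraceZ. Qed.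
Lemma finner_adjl m n q (A : 'M[C]_(m, n)) (W : 'M[C]_(n, q)) (X : 'M[C]_(m, q)) :
  finner (A *m W) X = finner W (adj A *m X).
Proof. by rewrite /finner adjM mulmxA. Qed.
Lemma finnerC m n (A D : 'M[C]_(m, n)) : finner A D = cconj (finner D A).
Proof.
rewrite /finner /mxtrace cconj_sum; apply: eq_bigr => i _.
by rewrite -adjE adjM adjK.
Qed.
Lemma finner_colE m (u v : 'cV[C]_m) : adj u *m v = (finner u v)%:M.
Proof. by rewrite [LHS]mx11_scalar /finner /mxtrace big_ord1. Qed.
Lemma finner_rank1 m n (W : 'M[C]_(m, n)) (u : 'cV[C]_m) (v : 'cV[C]_n) :
  finner W (u *m adj v) = finner (W *m v) u.
Proof. by rewrite /finner mulmxA mxtrace_mulC adjM mulmxA. Qed.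

Lemma fn2_unitary m n q (A : 'M[C]_(q, m)) (X : 'M[C]_(m, n)) : adj A *m A = 1%:M -> fn2 (A *m X) = fn2 X.
Proof.
move=> UA; have : rc (fn2 (A *m X)) = rc (fn2 X).
  by rewrite -!fn2E finner_adjl mulmxA UA mul1mx.
by case.
Qed.

Lemma Re_finner_le m (u v : 'cV[C]_m) : complex.Re (finner u v) ^+ 2 <= fn2 u * fn2 v.
Proof.
have -> : finner u v = \sum_i cconj (u i 0) * v i 0.
  by rewrite /finner /mxtrace big_ord1 mxE; apply: eq_bigr => i _; rewrite adjE.
have H := cmod2_CS (fun i => cconj (u i 0)) (fun i => v i 0).
apply: (@le_trans _ _ (cmod2 (\sum_i cconj (u i 0) * v i 0))).
  by rewrite /cmod2 lerDl sqr_ge0.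
apply: (le_trans H); rewrite le_eqVlt; apply/orP; left; apply/eqP; rewrite /fn2; congr (_ * _).
  by apply: eq_bigr => i _; rewrite big_ord1 cmod2_cconj.
by apply: eq_bigr => i _; rewrite big_ord1.
Qed.

Lemma fn2D_le m n (A D : 'M[C]_(m, n)) : fn2 (A + D) <= 4 / 3 * fn2 A + 4 * fn2 D.
Proof.
rewrite /fn2 !mulr_sumr -big_split; apply: ler_sum => i _ /=; rewrite !mulr_sumr -big_split; apply: ler_sum => j _ /=.
rewrite mxE /cmod2 !ReImE.
have := sqr_ge0 (complex.Re (A i j) - 3 * complex.Re (D i j)).
have := sqr_ge0 (complex.Im (A i j) - 3 * complex.Im (D i j)); nra.
Qed.

Lemma fn2Z m n (a : C) (A : 'M[C]_(m, n)) : fn2 (a *: A) = cmod2 a * fn2 A.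
Proof.
by rewrite /fn2 mulr_sumr; apply: eq_bigr => i _; rewrite mulr_sumr; apply: eq_bigr => j _; rewrite mxE cmod2M.
Qed.

Lemma fn2_mul_le m n (A : 'M[C]_(m, n)) (x : 'cV[C]_n) : fn2 (A *m x) <= fn2 A * fn2 x.
Proof.
rewrite /fn2 mulr_suml; apply: ler_sum => i _; rewrite big_ord1 mxE.
apply: (le_trans (cmod2_CS _ _)); rewrite le_eqVlt; apply/orP; left; apply/eqP; congr (_ * _).
by apply: eq_bigr => j _; rewrite big_ord1.
Qed.

Definition contraction m n (W : 'M[C]_(m, n)) := forall x : 'cV[C]_n, fn2 (W *m x) <= fn2 x.

End MatrixBasics.

Section SVD.
Context {R : realType}.
Local Notation C := R[i].

Lemma unitary_adj n (U : 'M[C]_n) : unitary U -> adj U *m U = 1%:M.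
Proof. exact: mulmx1C. Qed.

(** Gram-Schmidt is applied to a matrix with first row [u]. Then [u] is a nonnegative multiple of
    the first row of the result, and the factor is 1 as both have norm 1. *)
Lemma unitary_of_row n (u : 'rV[C]_n.+1) : u *m adj u = 1%:M ->
  exists U : 'M[C]_n.+1, unitary U /\ row 0 U = u.
Proof.
move=> u1; pose A : 'M[C]_(1 + n, n.+1) := col_mx u 0.
have A0 : row 0 A = u.
  have E0 : (0 : 'I_(1 + n)) = lshift n 0 by apply: val_inj.
  by apply/rowP => j; rewrite mxE [X in A X _]E0 col_mxEu.
have adjC m q (M : 'M[C]_(m, q)) : adj M = map_mx Num.conj M^T by apply/matrixP => i j; rewrite !mxE.
have US : schmidt A \is unitarymx by exact: schmidt_unitarymx.
exists (schmidt A); split; first by rewrite /unitary adjC; apply/unitarymxP.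
have := row_schmidt_sub A 0; rewrite (eq_bigl (fun k => k == 0)); last first.
  by move=> k; rewrite leqn0 -val_eqE.
rewrite big_pred1_eq genmxE A0 => /submxP[a ua].
have := form1_row_schmidt A 0; rewrite A0 dotmxE.
have UU : row 0 (schmidt A) *m adj (row 0 (schmidt A)) = 1%:M.
  have := row_unitarymxP US 0 0; rewrite dotmxE -adjC => E.
  by rewrite [LHS]mx11_scalar E.
rewrite -adjC ua -mulmxA UU mulmx1 => a0.
have aa : a *m adj a = 1%:M by move: u1; rewrite ua adjM !mulmxA -(mulmxA a) UU mulmx1.
have -> : a = 1%:M; last by rewrite mul1mx.
rewrite [a]mx11_scalar; congr (_%:M); move: aa => /matrixP/(_ 0 0); rewrite mxE big_ord1 adjE mxE eqxx.
have -> : cconj (a 0 0) = a 0 0.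
  by apply/CrealP; exact: ger0_real.
rewrite -expr2 => /eqP; rewrite sqrf_eq1 => /orP[/eqP//|/eqP a1].
by move: a0; rewrite a1 oppr_ge0 ler10.
Qed.

(** [c] is a unit eigenvector of [adj X *m X] for a nonzero eigenvalue, from the spectral theorem,
    and [u] is [X *m c] normalized. *)
Lemma singular_pair m n (X : 'M[C]_(m, n)) : X != 0 ->
  exists (s : R) (u : 'cV[C]_m) (c : 'cV[C]_n), [/\ 0 < s, adj u *m u = 1%:M, adj c *m c = 1%:M,
    X *m c = rc s *: u & adj X *m u = rc s *: c].
Proof.
move=> X0; pose A := adj X *m X.
have adjC k q (M : 'M[C]_(k, q)) : adj M = map_mx Num.conj M^T by apply/matrixP => i j; rewrite !mxE.
have An : A \is normalmx.
  by apply/normalmxP; rewrite -adjC /A adjM adjK.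
have A0 : A != 0.
  apply: contraNneq X0 => A0; apply/eqP/fn2_eq0; apply: rc_inj.
  by rewrite -fn2E /finner -/A A0 mxtrace0.
pose P := spectralmx A; pose d := spectral_diag A.
have PU : P \is unitarymx by exact: spectral_unitarymx.
have AE : A = invmx P *m diag_mx d *m P by apply/orthomx_spectralP.
have PA : P *m A = diag_mx d *m P by rewrite AE !mulmxA mulmxV ?mul1mx// unitarymx_unit.
clearbody P d.
have [i di] : exists i, d 0 i != 0.
  apply/existsP; apply: contraNT A0; rewrite negb_exists => /forallP H.
  have d0 : diag_mx d = 0.
    apply/matrixP => a b; rewrite !mxE; have := H a; rewrite negbK => /eqP ->.
    by rewrite mul0rn.
  by rewrite AE d0 mulmx0 mul0mx.
pose c := adj (row i P).
have cc : adj c *m c = 1%:M.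
  have := row_unitarymxP PU i i; rewrite dotmxE eqxx -adjC => E.
  by rewrite /c adjK [LHS]mx11_scalar E.
have cA : adj c *m A = d 0 i *: adj c.
  by rewrite /c adjK -row_mul PA row_mul row_diag_mx -scalemxAl -rowE.
have AA : adj A = A by rewrite /A adjM adjK.
have Ac : A *m c = cconj (d 0 i) *: c.
  by rewrite -[A in LHS]AA -[c in LHS]adjK -adjM cA adjZ adjK.
have lam : cconj (d 0 i) = rc (fn2 (X *m c)).
  rewrite -fn2E finner_adjl mulmxA -/A Ac finnerZr /finner cc mxtrace1 mulr1n mulr1 //.
have F0 : 0 < fn2 (X *m c).
  rewrite lt0r fn2_ge0 andbT; apply: contraNneq di => F0; move: lam; rewrite F0 rc0 => /(congr1 cconj).
  by rewrite cconjK cconj0 => ->.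
pose s := Num.sqrt (fn2 (X *m c)).
have s0 : 0 < s by rewrite sqrtr_gt0.
have s2 : s ^+ 2 = fn2 (X *m c) by rewrite sqr_sqrtr// ltW.
exists s, (rc s^-1 *: (X *m c)), c; split => //.
- rewrite adjZ cconj_rc -scalemxAl -scalemxAr scalerA -rcM finner_colE fn2E.
  rewrite -s2 scale_scalar_mx -rcM (_ : s^-1 * s^-1 * s ^+ 2 = 1) ?rc1//.
  by field; rewrite gt_eqF.
- by rewrite scalerA -rcM divff ?gt_eqF// rc1 scale1r.
- rewrite -scalemxAr mulmxA -/A Ac scalerA lam -rcM -s2 (_ : s^-1 * s ^+ 2 = s)//.
  by field; rewrite gt_eqF.
Qed.

Definition diag_nonneg m n (Sg : 'M[C]_(m, n)) :=
  (forall (i : 'I_m) (j : 'I_n), (i : nat) != j -> Sg i j = 0) /\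
  (forall (i : 'I_m) (j : 'I_n), (i : nat) = j -> 0 <= Sg i j).

Lemma adj_block m1 m2 n1 n2 (A : 'M[C]_(m1, n1)) B D (E : 'M[C]_(m2, n2)) :
  adj (block_mx A B D E) = block_mx (adj A) (adj D) (adj B) (adj E).
Proof. by rewrite /adj map_block_mx tr_block_mx. Qed.

Lemma adj0 m n : adj (0 : 'M[C]_(m, n)) = 0.
Proof. by apply/matrixP => i j; rewrite adjE !mxE cconj0. Qed.

Lemma block_diag_nonneg m n (s : R) (Sg : 'M[C]_(m, n)) : 0 <= s -> diag_nonneg Sg ->
  diag_nonneg (block_mx (rc s)%:M 0 0 Sg : 'M[C]_(1 + m, 1 + n)).
Proof.
move=> s0 [dS pS]; split=> i j; case: (split_ordP i) => i' ->; case: (split_ordP j) => j' -> ij.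
- by move: ij; rewrite !ord1 eqxx.
- by rewrite block_mxEur mxE.
- by rewrite block_mxEdl mxE.
- by rewrite block_mxEdr dS//; move: ij; rewrite /= eqn_add2l.
- by rewrite block_mxEul !ord1 mxE mulr1n lecE /= eqxx.
- by rewrite block_mxEur mxE.
- by rewrite block_mxEdl mxE.
- by rewrite block_mxEdr pS//; move: ij => /= /addnI.
Qed.

Lemma block_svd m n (a : 'M[C]_1) (U : 'M[C]_m) (Sg : 'M[C]_(m, n)) (V : 'M[C]_n) :
  block_mx a 0 0 (U *m Sg *m adj V) =
  block_mx 1%:M 0 0 U *m block_mx a 0 0 Sg *m adj (block_mx (1%:M : 'M[C]_1) 0 0 V).
Proof.
rewrite adj_block !adj0 adj1 !mulmx_block.
by rewrite !mul0mx !mulmx0 !mulmx1 !mul1mx !addr0 !add0r ?mul0mx ?mulmx0 ?addr0.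
Qed.

(** Induction on the number of rows: completing [u] and [c] to unitary matrices splits off the
    singular value [s] as a block of size 1. *)
Lemma svd_exists m n (X : 'M[C]_(m, n)) : exists Sg, is_svd_sigma X Sg.
Proof.
elim: m n X => [|m IH] n X.
  exists 0, 1%:M, 1%:M; rewrite /unitary !adj1 !mulmx1; split => // [[]//|[]//|].
  by rewrite [X]flatmx0 mulmx0.
case: n X => [|n] X.
  exists 0, 1%:M, 1%:M; rewrite /unitary !adj1 !mulmx1; split => // [i []//|i []//|].
  by rewrite [X]thinmx0 mulmx0.
have [->|X0] := eqVneq X 0.
  exists 0, 1%:M, 1%:M; rewrite /unitary !adj1 !mulmx1 mulmx0; split => // i j _; by rewrite mxE.
have [s [u [c [s0 uu cc Xc Xu]]]] := singular_pair X0.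
have [U [uU U0]] : exists U : 'M[C]_m.+1, unitary U /\ row 0 U = adj u.
  by apply: unitary_of_row; rewrite adjK.
have [V [uV V0]] : exists V : 'M[C]_n.+1, unitary V /\ row 0 V = adj c.
  by apply: unitary_of_row; rewrite adjK.
pose Z : 'M[C]_(1 + m, 1 + n) := U *m X *m adj V.
have Zr : row 0 Z = rc s *: row 0 (1%:M : 'M[C]_n.+1).
  rewrite /Z !row_mul U0 -[adj u *m X]adjK adjM adjK Xu adjZ cconj_rc -scalemxAl -V0 -row_mul.
  by rewrite uV.
have Zc : matrix.col 0 Z = rc s *: matrix.col 0 (1%:M : 'M[C]_m.+1).
  have cV : matrix.col 0 (adj V) = c by rewrite -[c]adjK -V0; apply/colP => i; rewrite !(mxE, adjE).
  have cU : matrix.col 0 (adj U) = u by rewrite -[u]adjK -U0; apply/colP => i; rewrite !(mxE, adjE).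
  rewrite /Z !colE -!mulmxA -colE cV Xc -scalemxAr -cU colE mulmxA; congr (_ *: (_ *m _)).
  exact: uU.
have XE : X = adj U *m Z *m V.
  by rewrite /Z !mulmxA (unitary_adj uU) mul1mx -mulmxA (unitary_adj uV) mulmx1.
clearbody Z.
have E0 k : (0 : 'I_k.+1) = lshift k (0 : 'I_1) by apply: val_inj.
have ZE : Z = block_mx (rc s)%:M 0 0 (drsubmx Z).
  rewrite -[LHS]submxK; congr block_mx.
  - apply/matrixP => i j; rewrite !ord1 !mxE.
    have := congr1 (fun M : 'rV[C]_n.+1 => M 0 0) Zr; rewrite !mxE eqxx mulr1 => E.
    by rewrite -!E0 E.
  - apply/rowP => j; rewrite !mxE.
    have := congr1 (fun M : 'rV[C]_n.+1 => M 0 (rshift 1 j)) Zr; rewrite !mxE => E.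
    by rewrite -E0 E mulr0.
  - apply/colP => i; rewrite !mxE.
    have := congr1 (fun M : 'cV[C]_m.+1 => M (rshift 1 i) 0) Zc; rewrite !mxE => E.
    by rewrite -E0 E mulr0.
have [Sg' [U' [V' [uU' uV' dS pS E']]]] := IH n (drsubmx Z).
pose B1 : 'M[C]_(1 + m) := block_mx 1%:M 0 0 U'.
pose B2 : 'M[C]_(1 + n) := block_mx 1%:M 0 0 V'.
have ub k (W : 'M[C]_k) : unitary W -> block_mx 1%:M 0 0 W *m adj (block_mx (1%:M : 'M[C]_1) 0 0 W) = 1%:M.
  move=> uW; rewrite adj_block !adj0 adj1 mulmx_block !mul0mx !mulmx0 mulmx1 !addr0 add0r uW.
  by rewrite -scalar_mx_block.
exists (block_mx (rc s)%:M 0 0 Sg' : 'M[C]_(1 + m, 1 + n)), (adj U *m B1), (adj V *m B2); split.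
- by rewrite /unitary adjM adjK mulmxA -(mulmxA (adj U)) (ub _ _ uU') mulmx1 (unitary_adj uU).
- by rewrite /unitary adjM adjK mulmxA -(mulmxA (adj V)) (ub _ _ uV') mulmx1 (unitary_adj uV).
- exact: (block_diag_nonneg (ltW s0) (conj dS pS)).1.
- exact: (block_diag_nonneg (ltW s0) (conj dS pS)).2.
rewrite adjM adjK {1}XE ZE {1}E' block_svd -/B1 -/B2 !mulmxA //.
Qed.

End SVD.

Section NuclearNorm.
Context {R : realType}.
Local Notation C := R[i].

(** A decomposition exists, so the default of [xget] is not taken. The arguments below apply to
    whichever decomposition [xget] selects. *)
Lemma nuclear_normP m n (X : 'M[C]_(m, n)) : exists Sg, is_svd_sigma X Sg /\
  nuclear_norm X = complex.Re (\sum_i \sum_j Sg i j).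
Proof. by exists (xget 0 (is_svd_sigma X)); split=> //; exact: (xgetPex 0 (svd_exists X)). Qed.

Lemma contraction_entry m n (W : 'M[C]_(m, n)) (U : 'M[C]_m) (V : 'M[C]_n) i j :
  contraction W -> unitary U -> unitary V -> cmod2 ((adj U *m W *m V) i j) <= 1.
Proof.
move=> cW uU uV.
have cnorm k (Y : 'M[C]_k) l : unitary Y -> fn2 (matrix.col l Y) = 1.
  move=> uY; have E : (adj Y *m Y) l l = 1 by rewrite unitary_adj// mxE eqxx.
  have : rc (fn2 (matrix.col l Y)) = rc 1.
    rewrite -fn2E rc1 -E /finner /mxtrace big_ord1 !mxE; apply: eq_bigr => a _; by rewrite !(adjE, mxE).
  by case.
have -> : (adj U *m W *m V) i j = \sum_a cconj (matrix.col i U a 0) * (W *m matrix.col j V) a 0.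
  rewrite -mulmxA mxE; apply: eq_bigr => a _; rewrite adjE !mxE; congr (_ * _).
  by apply: eq_bigr => b _; rewrite !mxE.
apply: (le_trans (cmod2_CS _ _)).
have -> : \sum_a cmod2 (cconj (matrix.col i U a 0)) = 1.
  rewrite -(cnorm _ U i uU); apply: eq_bigr => a _; by rewrite big_ord1 cmod2_cconj.
rewrite mul1r; apply: le_trans (_ : fn2 (W *m matrix.col j V) <= 1).
  by rewrite le_eqVlt; apply/orP; left; apply/eqP/eq_bigr => a _; rewrite big_ord1.
by apply: le_trans (cW _) _; rewrite cnorm.
Qed.

(** Expressed in the singular bases, [W] still has entries of modulus at most 1, and only its
    diagonal meets the singular values. *)
Lemma le_nuclear_norm m n (X W : 'M[C]_(m, n)) : contraction W ->
  complex.Re (finner W X) <= nuclear_norm X.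
Proof.
move=> cW; have [Sg [[U [V [uU uV dS pS XE]]] ->]] := nuclear_normP X.
have -> : finner W X = finner (adj U *m W *m V) Sg.
  rewrite XE /finner !adjM adjK mulmxA mxtrace_mulC !mulmxA //.
pose M := adj U *m W *m V.
have -> : finner (adj U *m W *m V) Sg = \sum_i \sum_j cconj (M i j) * Sg i j.
  rewrite /finner /mxtrace exchange_big; apply: eq_bigr => j _; rewrite mxE; apply: eq_bigr => i _.
  by rewrite adjE.
rewrite !Re_sum; apply: ler_sum => i _; rewrite !Re_sum; apply: ler_sum => j _.
have [ij|ij] := eqVneq (i : nat) j; last by rewrite dS// mulr0.
have := pS i j ij; rewrite lecE /= => /andP[/eqP S0 S1].
rewrite Re_mul S0 mulr0 subr0 ler_piMl// Re_cconj.
have := contraction_entry i j cW uU uV; rewrite -/M /cmod2 => M1.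
apply: le_trans (ler_norm _) _; apply: ler_abs_sqr => //; rewrite expr1n.
by apply: le_trans M1; rewrite lerDl sqr_ge0.
Qed.

(** Equality holds for [U *m E *m adj V], where [E] is the rectangular identity. *)
Lemma nuclear_norm_dual m n (X : 'M[C]_(m, n)) : exists W : 'M[C]_(m, n),
  contraction W /\ nuclear_norm X = complex.Re (finner W X).
Proof.
have [Sg [[U [V [uU uV dS pS XE]]] ->]] := nuclear_normP X.
pose E : 'M[C]_(m, n) := \matrix_(i, j) ((i : nat) == j)%:R.
exists (U *m E *m adj V); split.
  move=> x; rewrite -!mulmxA fn2_unitary; last exact: unitary_adj.
  rewrite -(@fn2_unitary _ _ _ _ (adj V) x) ?adjK//; set y := adj V *m x.
  have Ey i : (E *m y) i 0 = \sum_(j < n | (i : nat) == j) y j 0.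
    rewrite mxE [RHS]big_mkcond; apply: eq_bigr => j _; rewrite mxE.
    by case: eqP; rewrite ?mul1r ?mul0r.
  rewrite /fn2; under eq_bigr do rewrite big_ord1; under [leRHS]eq_bigr do rewrite big_ord1.
  apply: (@le_trans _ _ (\sum_(i < m) \sum_(j < n | (i : nat) == j) cmod2 (y j 0))).
    apply: ler_sum => i _; rewrite Ey.
    have [/existsP[j /eqP ij]|/existsPn H] := boolP [exists j : 'I_n, (i : nat) == j].
      rewrite !(big_pred1 j)// => j'; by rewrite ij eq_sym (inj_eq (@ord_inj n)).
    by rewrite !big_pred0 ?cmod2_0// => j; apply/negbTE; exact: H.
  rewrite (exchange_big_dep xpredT)//=; apply: ler_sum => j _.
  have [/existsP[i /eqP ij]|/existsPn H] := boolP [exists i : 'I_m, (i : nat) == j].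
    by rewrite (big_pred1 i)// => i'; rewrite -ij (inj_eq (@ord_inj m)).
  by rewrite big_pred0 ?cmod2_ge0// => i; apply/negbTE; exact: H.
congr complex.Re; rewrite [in RHS]XE /finner !adjM adjK !mulmxA.
rewrite -(mulmxA _ (adj U) U) (unitary_adj uU) mulmx1 mxtrace_mulC !mulmxA (unitary_adj uV) mul1mx.
rewrite /mxtrace exchange_big; apply: eq_bigr => j _; rewrite mxE; apply: eq_bigr => i _.
rewrite adjE mxE; have [ij|ij] := eqVneq (i : nat) j.
  by rewrite -rc1 cconj_rc rc1 mul1r.
by rewrite dS// mulr0.
Qed.

Lemma nuclear_norm_rank1_le m n (u : 'cV[C]_m) (v : 'cV[C]_n) (a b : R) : 0 <= a -> 0 <= b ->
  fn2 u = a ^+ 2 -> fn2 v = b ^+ 2 -> nuclear_norm (u *m adj v) <= a * b.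
Proof.
move=> a0 b0 ua vb; have [W [cW ->]] := nuclear_norm_dual (u *m adj v).
rewrite finner_rank1; apply: le_trans (ler_norm _) _; apply: ler_abs_sqr; first exact: mulr_ge0.
apply: (le_trans (Re_finner_le _ _)); rewrite exprMn mulrC ua; apply: ler_wpM2l; first exact: sqr_ge0.
by rewrite -vb; exact: cW.
Qed.

End NuclearNorm.

(** * From certificates to recovery *)

Section Descent.
Context {R : realType} (L J : nat).
Local Notation C := R[i].
Variables (e : 'cV[C]_L) (f : 'cV[C]_J) (Y H : 'M[C]_(L, J)).
Hypothesis ee1 : adj e *m e = 1%:M.
Hypothesis ff1 : adj f *m f = 1%:M.
Hypothesis Yf : Y *m f = e.
Hypothesis eY : adj e *m Y = adj f.
Hypothesis Yperp : forall x : 'cV[C]_J, adj f *m x = 0 -> fn2 (Y *m x) <= 9 / 16 * fn2 x.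
Hypothesis YH : finner Y H = 0.

Let Pe := 1%:M - e *m adj e.
Let Qf := 1%:M - f *m adj f.
Let G := Pe *m H *m Qf.

Lemma adj_proj k (u : 'cV[C]_k) : adj (1%:M - u *m adj u) = 1%:M - u *m adj u.
Proof. by rewrite adjD adjN adj1 adjM adjK. Qed.

Lemma proj_idem k (u : 'cV[C]_k) : adj u *m u = 1%:M ->
  (1%:M - u *m adj u) *m (1%:M - u *m adj u) = 1%:M - u *m adj u.
Proof.
by move=> u1; rewrite mulmxBr mulmx1 mulmxBl mul1mx mulmxA -(mulmxA u) u1 mulmx1 subrr subr0.
Qed.

Lemma proj_vec k (u : 'cV[C]_k) : adj u *m u = 1%:M -> (1%:M - u *m adj u) *m u = 0.
Proof. by move=> u1; rewrite mulmxBl mul1mx -mulmxA u1 mulmx1 subrr. Qed.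

Lemma fn2_orth k q (u : 'cV[C]_k) (a : 'M[C]_(1, q)) (v : 'M[C]_(k, q)) :
  adj u *m u = 1%:M -> adj u *m v = 0 -> fn2 (u *m a + v) = fn2 a + fn2 v.
Proof.
move=> u1 uv; have : rc (fn2 (u *m a + v)) = rc (fn2 a + fn2 v).
  rewrite rcD -!fn2E finnerDl !finnerDr !finner_adjl mulmxA u1 mul1mx uv.
  rewrite [finner v (u *m a)]finnerC finner_adjl uv /finner mulmx0 mxtrace0 cconj0; ring.
by case.
Qed.

Lemma Gf : G *m f = 0.
Proof. by rewrite /G -mulmxA proj_vec// mulmx0. Qed.

Lemma eG : adj e *m G = 0.
Proof.
by rewrite /G !mulmxA -[adj e *m Pe]adjK adjM adj_proj adjK proj_vec// adj0 !mul0mx.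
Qed.

Lemma finner_GH : finner G H = rc (fn2 G).
Proof.
rewrite -fn2E {1 3}/G /finner !adjM !adj_proj -!mulmxA.
rewrite [RHS]mxtrace_mulC [LHS]mxtrace_mulC !mulmxA -!(mulmxA _ Pe Pe) proj_idem//.
by rewrite -!(mulmxA _ Qf Qf) proj_idem.
Qed.

(** [Y] itself is orthogonal to [H]. A small multiple of [G], the part of [H] off the tangent space,
    makes the pairing positive, and the slack in [Yperp] absorbs it:
    [4 / 3 * 9 / 16 + 4 / 16 = 1]. *)
Lemma nuclear_descent : G != 0 -> exists W : 'M[C]_(L, J),
  [/\ contraction W, finner W (e *m adj f) = 1 & 0 < complex.Re (finner W H)].
Proof.
move=> G0; have g0 : 0 < fn2 G.
  by rewrite lt0r fn2_ge0 andbT; apply: contraNneq G0 => /fn2_eq0 ->.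
(* This makes [t ^+ 2 * fn2 G] at most [1 / 16], whatever the size of [G]. *)
pose t := (4 * (1 + fn2 G))^-1.
have t0 : 0 < t by rewrite invr_gt0 mulr_gt0// addr_gt0.
have tG : t ^+ 2 * fn2 G <= 16^-1.
  rewrite /t exprVn mulrC ler_pdivrMr; last by rewrite exprn_gt0// mulr_gt0// addr_gt0.
  have := sqr_ge0 (fn2 G); nra.
exists (Y + rc t *: G); split.
- move=> x; pose a := adj f *m x; pose y := Qf *m x.
  have xE : x = f *m a + y by rewrite /y mulmxBl mul1mx mulmxA addrC subrK.
  have fy : adj f *m y = 0.
    by rewrite /y mulmxBl mul1mx mulmxBr !mulmxA ff1 mul1mx subrr.
  have WE : (Y + rc t *: G) *m x = e *m a + (Y *m y + rc t *: (G *m y)).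
    rewrite {1}xE mulmxDr !mulmxDl mulmxA Yf -!scalemxAl mulmxA Gf mul0mx scaler0 addr0.
    by [].
  rewrite WE fn2_orth//; last first.
    by rewrite mulmxDr mulmxA eY fy -scalemxAr mulmxA eG mul0mx scaler0 addr0.
  have -> : fn2 x = fn2 a + fn2 y by rewrite {1}xE fn2_orth.
  rewrite lerD2l.
  apply: (le_trans (fn2D_le _ _)); rewrite fn2Z cmod2_rc.
  have h1 := Yperp fy; have h2 := fn2_mul_le G y.
  have h3 := ler_wpM2l (sqr_ge0 t) h2.
  have h4 := ler_wpM2r (fn2_ge0 y) tG.
  have := fn2_ge0 y; lra.
- rewrite finnerDl finnerZl !finner_rank1 Yf Gf fn2E.
  have -> : finner (0 : 'cV[C]_L) e = 0 by rewrite finnerC /finner mulmx0 mxtrace0 cconj0.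
  rewrite mulr0 addr0; move: ee1; rewrite finner_colE fn2E => /matrixP/(_ 0 0).
  by rewrite !mxE eqxx !mulr1n.
by rewrite finnerDl finnerZl YH add0r cconj_rc finner_GH -rcM /= mulr_gt0.
Qed.

(** When the component off the tangent space vanishes, [H] takes the form expected by [tangent_inj],
    with second factor orthogonal to [e]. *)
Lemma tangentE : G = 0 -> H = e *m (adj e *m H) + (H *m f - e *m (adj e *m (H *m f))) *m adj f.
Proof.
move=> G0; apply/eqP; rewrite -subr_eq0; apply/eqP; rewrite -G0 /G /Pe /Qf.
rewrite !(mulmxBr, mulmxBl) !mul1mx !mulmx1 !mulmxA.
by rewrite opprD addrA.
Qed.

End Descent.

Section Vectorize.
Context {R : realType} (L N K : nat).
Local Notation C := R[i].

Definition vcol (x : 'I_N -> 'I_K -> C) : 'cV[C]_(N * K) := (mxvec (\matrix_(n, k) x n k))^T.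
Definition vmx (Y : 'I_L -> 'I_N -> 'I_K -> C) : 'M[C]_(L, N * K) :=
  \matrix_(l, j) mxvec (\matrix_(n, k) Y l n k) 0 j.

Lemma vcolE x n k : vcol x (mxvec_index n k) 0 = x n k.
Proof. by rewrite mxE mxvecE mxE. Qed.
Lemma vmxE Y l n k : vmx Y l (mxvec_index n k) = Y l n k.
Proof. by rewrite mxE mxvecE mxE. Qed.

Lemma sum_mxvec (V : nmodType) (F : 'I_(N * K) -> V) :
  \sum_j F j = \sum_n \sum_k F (mxvec_index n k).
Proof.
by rewrite (reindex _ (curry_mxvec_bij _ _)) pair_bigA; apply: eq_bigr => -[n k] _.
Qed.

Lemma vcol_surj (x : 'cV[C]_(N * K)) : x = vcol (fun n k => x (mxvec_index n k) 0).
Proof. by apply/colP => j; case/mxvec_indexP: j => n k; rewrite vcolE. Qed.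

Lemma fn2_vcol x : fn2 (vcol x) = cn2 x.
Proof.
rewrite /fn2 /cn2; under eq_bigr do rewrite big_ord1.
by rewrite sum_mxvec; apply: eq_bigr => n _; apply: eq_bigr => k _; rewrite vcolE.
Qed.

End Vectorize.

(** * Discrete Fourier and Hartley transforms *)

Section Fourier.
Context {R : realType} (L : nat).
Local Notation C := R[i].
Hypothesis L0 : (0 < L)%N.

Definition th : R := pi *+ 2 / L%:R.
Definition cexp (k : nat) : C := Complex (cos (k%:R * th)) (- sin (k%:R * th)).

Let Ln0 : L%:R != 0 :> R. Proof. by rewrite pnatr_eq0 -lt0n. Qed.

Lemma cexpD j k : cexp (j + k) = cexp j * cexp k.
Proof. by apply: cplx_eq; rewrite !ReImE /= natrD mulrDl ?cosD ?sinD; ring. Qed.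

Lemma cexp0 : cexp 0 = 1.
Proof. by apply: cplx_eq; rewrite /= mul0r ?cos0 ?sin0 ?oppr0. Qed.

Lemma cexpL : cexp L = 1.
Proof.
have E : L%:R * th = 0 + pi *+ 2 by rewrite /th mulrC divfK// add0r.
by apply: cplx_eq; rewrite /= E ?cosD2pi ?sinD2pi ?cos0 ?sin0 ?oppr0.
Qed.

Lemma cexpX j k : cexp (j * k) = cexp j ^+ k.
Proof. by elim: k => [|k IH]; [rewrite muln0 cexp0 expr0|rewrite mulnS cexpD IH exprS]. Qed.

Lemma cexp_mod k : cexp (k %% L) = cexp k.
Proof. by rewrite [in RHS](divn_eq k L) cexpD mulnC cexpX cexpL expr1n mul1r. Qed.

Lemma cexp_conj k : cconj (cexp k) * cexp k = 1.
Proof. by rewrite cconj_mul /cmod2 /= sqrrN cos2Dsin2. Qed.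

Lemma cexp_neq1 k : (0 < k < L)%N -> cexp k != 1.
Proof.
move=> /andP[k0 kL]; apply/eqP => H; have /= := congr1 (@complex.Re R) H.
have pip : 0 < pi :> R by exact: pi_gt0.
have Lp : 0 < L%:R :> R by rewrite ltr0n.
have -> : k%:R * th = (k%:R / L%:R * pi) *+ 2 by rewrite /th -mulrnAr; ring.
rewrite cos_mulr2n => c2.
have : 0 < sin (k%:R / L%:R * pi : R).
  apply: sin_gt0_pi; apply/andP; split; first by rewrite mulr_gt0// divr_gt0// ltr0n.
  by rewrite gtr_pMl// ltr_pdivrMr// mul1r ltr_nat.
have := sin2cos2 (k%:R / L%:R * pi : R); set s := sin _; set c := cos _ in c2 *.
move: c2; rewrite -mulr_natr => c2 s2 s0.
have : s ^+ 2 = 0 by rewrite s2; lra.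
by move/eqP; rewrite sqrf_eq0 gt_eqF.
Qed.

Lemma sum_cexp k : ~~ (L %| k)%N -> \sum_(i < L) cexp (k * i) = 0.
Proof.
move=> kL; have k1 : cexp k != 1.
  rewrite -cexp_mod; apply: cexp_neq1; rewrite ltn_mod L0 andbT lt0n.
  by apply: contra kL; rewrite /dvdn.
have := subrX1 (cexp k) L; rewrite -cexpX mulnC cexpX cexpL expr1n subrr => /esym/eqP.
rewrite mulf_eq0 subr_eq0 (negbTE k1) /= => /eqP E; rewrite -[RHS]E.
by apply: eq_bigr => i _; rewrite cexpX.
Qed.

Lemma sum_cexp_dvd k : (L %| k)%N -> \sum_(i < L) cexp (k * i) = rc L%:R.
Proof.
move=> kL; have k1 : cexp k = 1 by rewrite -cexp_mod (eqP kL) cexp0.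
under eq_bigr do rewrite cexpX k1 expr1n.
rewrite sumr_const card_ord; by elim: L => [|n IH]; rewrite ?mulr0n// mulrS IH -natr1 rcD addrC.
Qed.

(** The frequency [- l] modulo [L]; the outer [%%] matters at [l = 0]. *)
Definition negI (l : 'I_L) : 'I_L := Ordinal (ltn_pmod (L - l) L0).

Lemma cexp_neg (l : 'I_L) i : cexp (negI l * i) = cconj (cexp (l * i)).
Proof.
have -> : cexp (negI l * i) = cexp ((L - l) * i) by rewrite !cexpX /= cexp_mod.
have E : cexp ((L - l) * i) * cexp (l * i) = 1.
  by rewrite -cexpD -mulnDl subnK ?cexpX ?cexpL ?expr1n// ltnW.
transitivity (cconj (cexp (l * i)) * (cexp ((L - l) * i) * cexp (l * i))); last by rewrite E mulr1.
by rewrite mulrCA cexp_conj mulr1.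
Qed.

Lemma negIK : involutive negI.
Proof.
move=> l; apply: val_inj => /=; have [l0|l0] := posnP l.
  by rewrite l0 subn0 modnn subn0 modnn.
rewrite (modn_small (_ : L - l < L)%N) ?ltn_subrL ?l0// subKn ?modn_small// ltnW//.
Qed.

Lemma sum_cexp_diff (l l' : 'I_L) :
  \sum_(i < L) cconj (cexp (l * i)) * cexp (l' * i) = if l == l' then rc L%:R else 0.
Proof.
have E i : cconj (cexp (l * i)) * cexp (l' * i) = cexp ((L - l + l') * i).
  rewrite -cexp_neg mulnDl cexpD; congr (_ * _); by rewrite !cexpX /= cexp_mod.
under eq_bigr do rewrite E.
have lL := ltn_ord l; have lL' := ltn_ord l'.
case: eqP => [<-|ll']; first by rewrite subnK ?sum_cexp_dvd// ltnW.
apply: sum_cexp; apply/negP => /dvdnP[q qE]; apply: ll'; apply: val_inj => /=.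
have : (0 < q * L)%N by rewrite -qE addn_gt0 subn_gt0 lL.
rewrite muln_gt0 L0 andbT => q0.
have : (q * L < 2 * L)%N.
  rewrite -qE mul2n -addnn; apply: leq_ltn_trans (leq_add (leq_subr l L) (leqnn l')) _.
  by rewrite ltn_add2l.
rewrite ltn_pmul2r// => q2; have q1 : q = 1%N by case: q q0 q2 {qE} => [|[|]].
move: qE; rewrite q1 mul1n => qE.
have := congr1 (addn^~ (l : nat)) qE; rewrite /= addnAC subnK; last exact: ltnW.
by move=> /addnI.
Qed.

Lemma dftE w l : dft L w l = rc (Num.sqrt (L%:R : R))^-1 * cexp (w * l) :> C.
Proof.
rewrite mxE; congr (_ * _).
have -> : (pi *+ 2 * (w%:R * l%:R) / L%:R : R) = (w * l)%:R * th by rewrite natrM /th; ring.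
by [].
Qed.

Lemma sqrtL2 : Num.sqrt (L%:R : R) ^+ 2 = L%:R.
Proof. by rewrite sqr_sqrtr. Qed.

Lemma sqrtL_neq0 : Num.sqrt (L%:R : R) != 0.
Proof. by rewrite sqrtr_eq0 -ltNge ltr0n. Qed.

Lemma dft_unitary : adj (dft L) *m dft L = 1%:M :> 'M[C]_L.
Proof.
apply/matrixP => l l'; rewrite !mxE.
have -> : \sum_j adj (dft L) l j * dft L j l' =
    rc (Num.sqrt (L%:R : R))^-1 * rc (Num.sqrt (L%:R : R))^-1 * \sum_(i < L) cconj (cexp (l * i)) * cexp (l' * i).
  rewrite mulr_sumr; apply: eq_bigr => i _; rewrite adjE !dftE cconjM cconj_rc (mulnC l) (mulnC l'); ring.
rewrite sum_cexp_diff; case: (l == l'); last by rewrite mulr0.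
rewrite -!rcM -{3}sqrtL2 -rc1; congr rc; field; exact: sqrtL_neq0.
Qed.

Definition hartley (l i : 'I_L) : R := (cos ((l * i)%:R * th) + sin ((l * i)%:R * th)) / Num.sqrt L%:R.

(** [(cos a + sin a) (cos b + sin b) = cos (a - b) + sin (a + b)], and the sines sum to zero over a
    full period. *)
Lemma hartley_orthog : orthog (fun l => hartley l : rvec R 'I_L).
Proof.
move=> j k; rewrite /dot /col /hartley.
pose S1 := \sum_(i < L) cconj (cexp (j * i)) * cexp (k * i).
pose S2 := \sum_(i < L) cexp ((j + k) * i).
have E : \sum_(i < L) (cos ((i * j)%:R * th) + sin ((i * j)%:R * th)) / Num.sqrt L%:R *
   ((cos ((i * k)%:R * th) + sin ((i * k)%:R * th)) / Num.sqrt L%:R) = (complex.Re S1 - complex.Im S2) / L%:R.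
  rewrite /S1 /S2 Re_sum Im_sum -sumrB mulr_suml; apply: eq_bigr => i _.
  rewrite -{3}sqrtL2 mulnDl cexpD !ReImE /= !(mulnC i); field; exact: sqrtL_neq0.
rewrite E.
have -> : complex.Im S2 = 0.
  rewrite /S2; have [d|d] := boolP (L %| j + k)%N; first by rewrite sum_cexp_dvd.
  by rewrite sum_cexp.
rewrite subr0 /S1 sum_cexp_diff; case: (j == k); last by rewrite /= mul0r.
by rewrite /= divff.
Qed.

End Fourier.

Section Recovery.
Context {R : realType} (L N K : nat).
Local Notation C := R[i].
Hypothesis L0 : (0 < L)%N.
Variables (B : 'M[R]_L) (h : 'cV[R]_L) (m : 'I_N -> 'cV[R]_K) (Cm : 'I_N -> 'M[R]_(L, K)).
Hypothesis BB : B *m B^T = 1%:M.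
Hypothesis h0 : h != 0.
Hypothesis m0 : mrow m != 0.

Definition ccoef (n : 'I_N) (l : 'I_L) (k : 'I_K) : C := \sum_i rc (Cm n i k) * cexp L (l * i).

Lemma bvec_row l : adj (bvec B l) = row l (Bhat B).
Proof. by rewrite /bvec adjM adjK /fvec adjK -row_mul. Qed.

Lemma cvecE n l k : cvec (Cm n) l k 0 = ccoef n l k.
Proof.
rewrite !mxE cconjM cconj_rc cconj_sum mulr_sumr; apply: eq_bigr => i _.
rewrite adjE /fvec adjE cconjM cconjK [row l _ _ _]mxE cconjK dftE// mxE.
set r := Num.sqrt _; have r0 : r != 0 by exact: sqrtL_neq0.
have -> : rc r * (rc (Cm n i k) * (rc r^-1 * cexp L (l * i))) = rc r * rc r^-1 * (rc (Cm n i k) * cexp L (l * i)) by ring.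
by rewrite -rcM divff// rc1 mul1r.
Qed.

Lemma AopE X l n : Aop B Cm X l n = \sum_k (Bhat B *m X) l (mxvec_index n k) * ccoef n l k.
Proof.
rewrite /Aop /finner adjM adjK -mulmxA mxtrace_mulC bvec_row -row_mul /mxtrace big_ord1 mxE sum_mxvec.
rewrite (bigD1 n)//= [X in _ + X]big1 ?addr0 => [|n' nn'].
  by apply: eq_bigr => k _; rewrite mxE /phivec [in X in _ * X]mxE mxvecE mxE eqxx cvecE.
rewrite big1// => k _; by rewrite /phivec [X in _ * X]mxE mxvecE mxE (negbTE nn') mulr0.
Qed.

Lemma rmxM (p q r : nat) (A : 'M[R]_(p, q)) (D : 'M[R]_(q, r)) : rmx (A *m D) = rmx A *m rmx D.
Proof.
apply/matrixP => i j; rewrite !mxE rc_sum; apply: eq_bigr => k _; by rewrite !mxE rcM.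
Qed.

Lemma adj_rmx (p q : nat) (A : 'M[R]_(p, q)) : adj (rmx A) = rmx A^T.
Proof. by apply/matrixP => i j; rewrite adjE !mxE cconj_rc. Qed.

Lemma Bhat_unitary : adj (Bhat B) *m Bhat B = 1%:M.
Proof.
rewrite /Bhat adjM mulmxA -(mulmxA _ (adj _) (dft L)) dft_unitary// mulmx1 adj_rmx -rmxM (mulmx1C BB).
by apply/matrixP => i j; rewrite !mxE; case: (i == j).
Qed.

Lemma nrm2_gt0 p (v : 'cV[R]_p) : v != 0 -> 0 < nrm2 v.
Proof.
move=> v0; have n0 : 0 <= nrm2 v by apply: sumr_ge0 => i _; exact: sqr_ge0.
rewrite lt0r n0 andbT; apply: contraNneq v0 => /psumr_eq0P H; apply/eqP/colP => i; rewrite mxE.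
by have /eqP := H (fun i _ => sqr_ge0 _) i isT; rewrite sqrf_eq0 => /eqP.
Qed.

Lemma fn2_rmx p (v : 'cV[R]_p) : fn2 (rmx v) = nrm2 v.
Proof. by apply: eq_bigr => i _; rewrite big_ord1 mxE cmod2_rc. Qed.

Definition hn : R := Num.sqrt (nrm2 h).
Definition mn : R := Num.sqrt (nrm2 (mrow m)^T).
Definition evec (l : 'I_L) : C := rc hn^-1 * (Bhat B *m rmx h) l 0.
Definition munit (n : 'I_N) (k : 'I_K) : R := mn^-1 * m n k 0.

Lemma hn2 : hn ^+ 2 = nrm2 h.
Proof. by rewrite sqr_sqrtr// ltW// nrm2_gt0. Qed.
Lemma mT0 : (mrow m)^T != 0.
Proof. by apply: contraNneq m0 => H; rewrite -[mrow m]trmxK H trmx0. Qed.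
Lemma mn2 : mn ^+ 2 = nrm2 (mrow m)^T.
Proof. by rewrite sqr_sqrtr// ltW// nrm2_gt0// mT0. Qed.
Lemma hn_gt0 : 0 < hn. Proof. by rewrite sqrtr_gt0 nrm2_gt0. Qed.
Lemma mn_gt0 : 0 < mn. Proof. by rewrite sqrtr_gt0 nrm2_gt0// mT0. Qed.

Let em : 'cV[C]_L := \col_l evec l.
Let fm : 'cV[C]_(N * K) := vcol (rcf munit).
Let X0 : 'M[C]_(L, N * K) := rmx h *m rmx (mrow m).

Lemma emE : em = rc hn^-1 *: (Bhat B *m rmx h).
Proof. by apply/colP => l; rewrite mxE [RHS]mxE. Qed.

Lemma mrowE : rmx (mrow m) = rc mn *: adj fm.
Proof.
apply/rowP => j; case/mxvec_indexP: j => n k.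
rewrite [LHS]mxE /mrow mxvecE mxE [RHS]mxE adjE vcolE cconj_rc /munit -rcM mulrA divff ?mul1r//.
by rewrite gt_eqF// mn_gt0.
Qed.

Lemma BhatX0 : Bhat B *m X0 = rc (hn * mn) *: (em *m adj fm).
Proof.
rewrite /X0 mrowE emE mulmxA -scalemxAr -scalemxAl scalerA rcM; congr (_ *: _).
by rewrite mulrAC -rcM divff ?gt_eqF ?hn_gt0// rc1 mul1r.
Qed.

Lemma em_unit : adj em *m em = 1%:M.
Proof.
rewrite finner_colE fn2E emE fn2Z fn2_unitary ?Bhat_unitary// fn2_rmx -hn2 cmod2_rc.
by congr (_%:M); rewrite -rc1; congr rc; field; rewrite gt_eqF// hn_gt0.
Qed.

Lemma fm_unit : adj fm *m fm = 1%:M.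
Proof.
have E : fm = rc mn^-1 *: adj (rmx (mrow m)).
  by rewrite mrowE adjZ adjK cconj_rc scalerA -rcM mulVf ?gt_eqF ?mn_gt0// rc1 scale1r.
rewrite finner_colE fn2E E adj_rmx fn2Z fn2_rmx -mn2 cmod2_rc.
by congr (_%:M); rewrite -rc1; congr rc; field; rewrite gt_eqF// mn_gt0.
Qed.

Lemma nuclear_X0 : nuclear_norm X0 <= hn * mn.
Proof.
rewrite /X0 -[rmx (mrow m)]adjK; apply: nuclear_norm_rank1_le.
- exact: ltW hn_gt0.
- exact: ltW mn_gt0.
- by rewrite fn2_rmx hn2.
- by rewrite adj_rmx fn2_rmx mn2.
Qed.

(** [H] is the error in the Fourier domain. The certificate lies in the range of the adjoint of the
    measurements, hence is orthogonal to [H]. If [H] were tangent, injectivity would give [H = 0];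
    so [nuclear_descent] applies, and its contraction, carried back from the Fourier domain, yields
    the strict inequality by duality. *)
Lemma unique_minimizer : dual_cert ccoef munit evec -> tangent_inj ccoef munit evec ->
  forall X, (forall l n, Aop B Cm X l n = Aop B Cm X0 l n) -> X != X0 -> nuclear_norm X0 < nuclear_norm X.
Proof.
move=> [z [c1 c2 c3]] inj X XA XX0.
pose H : 'M[C]_(L, N * K) := Bhat B *m (X - X0).
have HA l n : \sum_k H l (mxvec_index n k) * ccoef n l k = 0.
  transitivity (Aop B Cm X l n - Aop B Cm X0 l n); last by rewrite XA subrr.
  rewrite !AopE -sumrB; apply: eq_bigr => k _; rewrite -mulrBl; congr (_ * _).
  by rewrite /H mulmxBr [LHS]mxE; congr (_ + _); rewrite mxE.
have H0 : H != 0.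
  apply: contraNneq XX0 => H0; rewrite -subr_eq0; apply/eqP.
  by rewrite -[X - X0]mul1mx -Bhat_unitary -mulmxA -/H H0 mulmx0.
pose Y : 'M[C]_(L, N * K) := vmx (fun l n k => z l n * cconj (ccoef n l k)).
have Yf : Y *m fm = em.
  apply/colP => l; rewrite mxE sum_mxvec mxE -c1; apply: eq_bigr => n _; apply: eq_bigr => k _.
  by rewrite vmxE vcolE.
have eY : adj em *m Y = adj fm.
  apply/rowP => j; case/mxvec_indexP: j => n k; rewrite mxE adjE vcolE cconj_rc -c2.
  by apply: eq_bigr => l _; rewrite adjE vmxE mxE.
have Yp (x : 'cV[C]_(N * K)) : adj fm *m x = 0 -> fn2 (Y *m x) <= 9 / 16 * fn2 x.
  move=> fx; pose y n k := x (mxvec_index n k) 0; have xE : x = vcol y by exact: vcol_surj.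
  have fy : \sum_n \sum_k rc (munit n k) * y n k = 0.
    have := congr1 (fun M : 'M[C]_1 => M 0 0) fx; rewrite mxE sum_mxvec mxE => E; rewrite -[RHS]E.
    by apply: eq_bigr => n _; apply: eq_bigr => k _; rewrite adjE vcolE cconj_rc.
  rewrite [in leRHS]xE fn2_vcol; apply: le_trans (c3 y fy); rewrite le_eqVlt; apply/orP; left; apply/eqP.
  apply: eq_bigr => l _; rewrite big_ord1 mxE sum_mxvec; congr cmod2.
  by apply: eq_bigr => n _; apply: eq_bigr => k _; rewrite vmxE.
have YH : finner Y H = 0.
  have -> : finner Y H = \sum_l \sum_n \sum_k cconj (z l n) * (H l (mxvec_index n k) * ccoef n l k).
    rewrite /finner /mxtrace; under eq_bigr do rewrite mxE.
    rewrite exchange_big; apply: eq_bigr => l _; rewrite sum_mxvec; apply: eq_bigr => n _; apply: eq_bigr => k _.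
    by rewrite adjE vmxE cconjM cconjK; ring.
  by rewrite big1// => l _; rewrite big1// => n _; rewrite -mulr_sumr HA mulr0.
pose G := (1%:M - em *m adj em) *m H *m (1%:M - fm *m adj fm).
have G0 : G != 0.
  apply/eqP => G0; have HE := tangentE G0.
  pose q n k := (adj em *m H) 0 (mxvec_index n k).
  pose g := H *m fm - em *m (adj em *m (H *m fm)).
  have Hq l n k : H l (mxvec_index n k) = evec l * q n k + g l 0 * rc (munit n k).
    rewrite [in LHS]HE mxE; congr (_ + _); first by rewrite mxE big_ord1 mxE.
    by rewrite mxE big_ord1 adjE vcolE cconj_rc.
  have i1 l n : evec l * bil ccoef l n q + g l 0 * bil ccoef l n (rcf munit) = 0.
    rewrite -(HA l n) /bil !mulr_sumr -big_split; apply: eq_bigr => k _ /=.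
    by rewrite Hq /rcf; ring.
  have i2 : \sum_l cconj (evec l) * g l 0 = 0.
    have : (adj em *m g) 0 0 = 0.
      by rewrite /g mulmxBr [adj em *m (em *m _)]mulmxA em_unit mul1mx subrr mxE.
    rewrite [LHS]mxE => E; rewrite -[RHS]E; apply: eq_bigr => l _; rewrite adjE.
    by rewrite [em l 0]mxE.
  have [q0 g0] := inj q (fun l => g l 0) i1 i2.
  move/eqP: H0; apply; apply/matrixP => l j; case/mxvec_indexP: j => n k.
  by rewrite Hq q0 g0 mulr0 mul0r addr0 mxE.
have [W' [cW W1 W2]] := nuclear_descent em_unit fm_unit Yf eY Yp YH G0.
pose W := adj (Bhat B) *m W'.
have cW2 : contraction W.
  move=> x; rewrite /W -mulmxA fn2_unitary; first exact: cW.
  by rewrite adjK; apply: mulmx1C; exact: Bhat_unitary.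
apply: (le_lt_trans nuclear_X0); apply: lt_le_trans (le_nuclear_norm X cW2).
rewrite /W finner_adjl adjK.
have -> : Bhat B *m X = Bhat B *m X0 + H by rewrite /H -mulmxDr addrC subrK.
rewrite finnerDr BhatX0 finnerZr W1 mulr1 Re_add /= ltrDl //.
Qed.
End Recovery.

(** * Choice of constants *)

Section Numerics.
Context {R : realType}.

(* tnum is the accuracy asked of every concentration estimate, and Anum beta the value of alpha_1 from which
   the coherence hypotheses with constant 1 imply all numerical conditions of [good_event]. *)
Definition tnum : R := (64 ^+ 2)^-1.
Definition Anum (be : R) : R := 64 * be * (4 + be) / tnum ^+ 4.

Lemma tnum_gt0 : 0 < tnum. Proof. by rewrite invr_gt0 exprn_gt0. Qed.

Lemma tnum_le1 : tnum <= 1.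
Proof. by rewrite invf_le1 ?exprn_gt0// exprn_ege1//; lra. Qed.

Lemma tnum_small : 64 * 64 * tnum <= 1.
Proof. by rewrite -expr2 /tnum divff// expf_neq0. Qed.

Variables (be el al K w nu : R).
Hypothesis be4 : 4 <= be.
Hypothesis el1 : 1 <= el.
Hypothesis alA : Anum be <= al.
Hypothesis K1 : 1 <= K.
Hypothesis w0 : 0 <= w.
Hypothesis nu0 : 0 <= nu.
Hypothesis wb : w * K * al ^+ 2 * el ^+ 2 <= 1.
Hypothesis nub : nu * al * el <= 1.

Lemma num_t4 : 0 < (tnum : R) ^+ 4 <= 1 / 2.
Proof.
have h := tnum_small; have h0 := tnum_gt0; have h1 := tnum_le1.
rewrite exprn_gt0//=.
have -> : tnum ^+ 4 = tnum * tnum ^+ 3 by rewrite exprS.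
have : tnum ^+ 3 <= 1 by rewrite exprn_ile1// ltW.
have : 0 <= tnum ^+ 3 by rewrite exprn_ge0// ltW.
by nra.
Qed.

Lemma num_al : 64 * be * (4 + be) <= tnum ^+ 4 * al.
Proof.
have /andP[h0 _] := num_t4.
by move: alA; rewrite /Anum ler_pdivrMr// [al * _]mulrC.
Qed.

Lemma num_al33 : 33 <= al.
Proof.
have /andP[h0 h1] := num_t4; have h := num_al; have b := be4.
have : 64 * be * (4 + be) >= 64 * 4 by nra.
have [al0|] := ltP al 33; last by [].
have : tnum ^+ 4 * al <= 1/2 * 33 by nra.
lra.
Qed.

(** [W] dominates both terms of [w * Rl * RK] up to constants depending on [be], and a whole factor
    alpha_1 is left over. *)
Lemma num_W : exists2 W, 0 <= W & [/\ w * el ^+ 2 <= W, w * el * (K * al) <= W & W * al <= 1].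
Proof.
have a := num_al33; have e := el1; have k := K1; have w' := w0.
have Kal : 1 <= K * al by nra.
exists (w * el ^+ 2 * (K * al)).
  by rewrite !mulr_ge0// ?sqr_ge0//; lra.
split.
- by rewrite ler_peMr// mulr_ge0// sqr_ge0.
- by rewrite ler_wpM2r//; [lra | rewrite expr2 mulrA ler_peMr// mulr_ge0//; lra].
- by apply: le_trans wb; rewrite le_eqVlt; apply/orP; left; apply/eqP; ring.
Qed.

Lemma num_wRK : w * (8 * (be * el)) * (8 * (4 * K * al + be * el)) <= tnum ^+ 4.
Proof.
have [W W0 [W1 W2 W3]] := num_W; have b := be4; have h := num_al; have /andP[t0 _] := num_t4.
have a := num_al33.
apply: (@le_trans _ _ (64 * be * (4 + be) * W)).
  have -> : w * (8 * (be * el)) * (8 * (4 * K * al + be * el)) =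
    64 * be * (4 * (w * el * (K * al)) + be * (w * el ^+ 2)) by ring.
  rewrite -[leRHS]mulrA ler_wpM2l; [by []|lra|nra].
apply: (@le_trans _ _ (tnum ^+ 4 * al * W)); first by rewrite ler_wpM2r.
by rewrite -mulrA -[leRHS]mulr1 ler_wpM2l 1?mulrC// ltW.
Qed.

Lemma num_wK : w * (8 * (be * el)) * K <= tnum ^+ 4.
Proof.
apply: le_trans num_wRK; have b := be4; have e := el1; have a := num_al33; have k := K1; have w' := w0.
have be_el : 0 <= be * el by nra.
rewrite ler_wpM2l ?mulr_ge0//; nra.
Qed.

Lemma num_nu : nu * (8 * (be * el)) <= tnum ^+ 4.
Proof.
have b := be4; have e := el1; have a := num_al33; have h := num_al; have n := nub; have /andP[t0 _] := num_t4.
have ne : 0 <= nu * el by rewrite mulr_ge0//; lra.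
have -> : nu * (8 * (be * el)) = 8 * be * (nu * el) by ring.
have : 8 * be * (nu * el) <= tnum ^+ 4 * al * (nu * el) by rewrite ler_wpM2r//; nra.
move=> /le_trans; apply; rewrite -[leRHS]mulr1 -mulrA (ler_wpM2l (ltW t0))//.
by apply: le_trans nub; rewrite le_eqVlt; apply/orP; left; apply/eqP; ring.
Qed.

Lemma num_wQ : be * el * (16 * w * (8 * (be * el))) <= 1.
Proof.
have [W W0 [W1 W2 W3]] := num_W; have b := be4; have h := num_al; have /andP[t0 t1] := num_t4.
have a := num_al33.
have -> : be * el * (16 * w * (8 * (be * el))) = 128 * be ^+ 2 * (w * el ^+ 2) by ring.
apply: (@le_trans _ _ (128 * be ^+ 2 * W)); first by rewrite ler_wpM2l// mulr_ge0// sqr_ge0.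
apply: le_trans W3; rewrite [leRHS]mulrC ler_wpM2r//.
nra.
Qed.

(** Each coordinate of a grid point takes [32 * K + 1 <= 33 * K] values, and both [33] and [K] are
    at most [expR al]. *)
Lemma num_net (Kt : finType) : #|Kt|%:R = K -> K <= expR al -> #|@netT Kt|%:R <= expR (2 * #|Kt|%:R * al).
Proof.
move=> KE Kal; have a := num_al33; have k := K1.
have -> : 2 * #|Kt|%:R * al = #|Kt|%:R * (al + al) by ring.
rewrite expRM_natl card_netT natrX.
have h : (2 * (16 * #|Kt|)).+1%:R <= expR (al + al).
  rewrite -natr1 !natrM KE expRD.
  have e33 : 33 <= expR al by apply: (le_trans _ (expR_ge1Dx al)); lra.
  by nra.
by apply: lerXn2r; rewrite ?nnegrE ?expR_ge0.
Qed.

End Numerics.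

(** * The standard Gaussian array behind the measurements *)

Section GaussianModel.
Context {R : realType} (L N K : nat).
Local Notation C := R[i].
Hypothesis L0 : (0 < L)%N.

Lemma gauss_iidn d (T : measurableType d) (P : probability T R) (Cm : T -> 'I_N -> 'M[R]_(L, K)) (s : R) :
  gauss_iid P Cm s -> iidn s P (fun w (i : 'I_N * 'I_L * 'I_K) => Cm w i.1.1 i.1.2 i.2).
Proof.
move=> [mC PC]; split; first by move=> [[n i] k]; exact: mC.
move=> B mB.
have := PC (fun n i k => B (n, i, k)) (fun n i k => mB (n, i, k)).
rewrite pair_bigA pair_bigA/= => E.
rewrite (eq_bigr (fun p : 'I_N * 'I_L * 'I_K => normal_prob 0 s (B (p.1.1, p.1.2, p.2)))) ?E //; last by move=> [[n i] k].
rewrite -E; congr (P _); apply/seteqP; split => w /= H.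
  by move=> n i k; exact: (H (n, i, k)).
by move=> [[n i] k]; exact: H.
Qed.

(** The double inverse is the rescaling of [iidn_scale] at the standard deviation
    [(Num.sqrt L%:R)^-1]. *)
Definition gam (V : 'I_N -> 'I_K -> rvec R 'I_K) (Cn : 'I_N -> 'M[R]_(L, K)) : rvec R ('I_N * 'I_L * 'I_K)%type :=
  fun i => \sum_j V i.1.1 i.2 j * (\sum_i' hartley i.1.2 i' * ((Num.sqrt L%:R)^-1^-1 * Cn i.1.1 i' j)).

Lemma gam_iid d (T : measurableType d) (P : probability T R) (Cm : T -> 'I_N -> 'M[R]_(L, K))
    (V : 'I_N -> 'I_K -> rvec R 'I_K) : (forall n, orthog (V n)) ->
  gauss_iid P Cm (Num.sqrt (L%:R : R))^-1 -> iidn 1 P (fun w => gam V (Cm w)).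
Proof.
move=> oV /gauss_iidn iX.
have s0 : 0 < (Num.sqrt (L%:R : R))^-1 by rewrite invr_gt0 sqrtr_gt0 ltr0n.
have i1 := iidn_scale s0 iX.
pose f (i : 'I_N * 'I_K * 'I_L) : 'I_N * 'I_L * 'I_K := (i.1.1, i.2, i.1.2).
pose g (i : 'I_N * 'I_L * 'I_K) : 'I_N * 'I_K * 'I_L := (i.1.1, i.2, i.1.2).
have fI : injective f by move=> [[a b] c] [[a' b'] c'] [-> -> ->].
have gI : injective g by move=> [[a b] c] [[a' b'] c'] [-> -> ->].
have i2 := iidn_sub fI i1.
have i3 := iidn_blocks (U := fun (a : 'I_N * 'I_K) => (fun l => hartley l : rvec R 'I_L)) (oner_neq0 R) (fun a => hartley_orthog L0) i2.
have i4 := iidn_sub gI i3.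
exact: (iidn_blocks (U := fun a : 'I_N * 'I_L => V a.1) (oner_neq0 R) (fun a => oV a.1) i4).
Qed.

Lemma gam_hE V (Cn : 'I_N -> 'M[R]_(L, K)) n l k : gam V Cn (n, l, k) =
  \sum_j V n k j * \sum_(i < L) (complex.Re (cexp L (l * i) : C) - complex.Im (cexp L (l * i) : C)) * Cn n i j.
Proof.
apply: eq_bigr => j _ /=; congr (_ * _); apply: eq_bigr => i _; rewrite /hartley /= opprK invrK mulrA.
by rewrite mulfVK// sqrtL_neq0.
Qed.

(** The Hartley kernel is the real part minus the imaginary part of [cexp], and [negI] conjugates
    [cexp]; half sums and half differences thus return the real and imaginary parts of the rotated
    coefficients. *)
Lemma gam_rotc V (Cn : 'I_N -> 'M[R]_(L, K)) :
  (fun n l k => Complex (cR (negI L0) (gam V Cn) n l k) (cI (negI L0) (gam V Cn) n l k)) =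
  rotc V (ccoef Cn).
Proof.
apply/funext => n; apply/funext => l; apply/funext => k.
have hr : complex.Re (rotc V (ccoef Cn) n l k) =
    \sum_j V n k j * \sum_(i < L) complex.Re (cexp L (l * i) : C) * Cn n i j.
  rewrite Re_sum; apply: eq_bigr => j _; rewrite Re_mul /= mul0r subr0 Re_sum; congr (_ * _).
  by apply: eq_bigr => i _; rewrite Re_mul /= mul0r subr0 mulrC.
have hi : complex.Im (rotc V (ccoef Cn) n l k) =
    \sum_j V n k j * \sum_(i < L) complex.Im (cexp L (l * i) : C) * Cn n i j.
  rewrite Im_sum; apply: eq_bigr => j _; rewrite Im_mul /= mul0r addr0 Im_sum; congr (_ * _).
  by apply: eq_bigr => i _; rewrite Im_mul /= mul0r addr0 mulrC.
have g1 : gam V Cn (n, l, k) = complex.Re (rotc V (ccoef Cn) n l k) - complex.Im (rotc V (ccoef Cn) n l k).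
  rewrite gam_hE hr hi -sumrB; apply: eq_bigr => j _; rewrite -mulrBr; congr (_ * _).
  by rewrite -sumrB; apply: eq_bigr => i _; rewrite mulrBl.
have g2 : gam V Cn (n, negI L0 l, k) = complex.Re (rotc V (ccoef Cn) n l k) + complex.Im (rotc V (ccoef Cn) n l k).
  rewrite gam_hE hr hi -big_split; apply: eq_bigr => j _; apply: (etrans _ (mulrDr _ _ _)); congr (_ * _).
  rewrite -big_split; apply: eq_bigr => i _.
  by rewrite cexp_neg Re_cconj Im_cconj opprK; exact: mulrDl.
apply: cplx_eq; rewrite /= /cR /cI g1 g2; lra.
Qed.

End GaussianModel.

(** In each block, an orthogonal matrix whose row [k0] is the normalized vector [m n]; for a zero
    block any orthogonal matrix serves. *)
Lemma rot_base {R : realType} (Nt Kt : finType) (k0 : Kt) (m : Nt -> Kt -> R) :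
  exists V : Nt -> Kt -> rvec R Kt, (forall n, orthog (V n)) /\
    rotm V m = mbase k0 (fun n => Num.sqrt (\sum_k m n k ^+ 2)).
Proof.
have H n : exists U : Kt -> rvec R Kt, orthog U /\
    forall k, \sum_j U k j * m n j = if k == k0 then Num.sqrt (\sum_k m n k ^+ 2) else 0.
  set s := Num.sqrt _.
  have s2 : s ^+ 2 = \sum_k m n k ^+ 2 by rewrite sqr_sqrtr// sumr_ge0// => k _; exact: sqr_ge0.
  have [s0|sN0] := eqVneq s 0.
    have z j : m n j = 0.
      apply/eqP; rewrite -sqrf_eq0; apply/eqP; move: s2; rewrite s0 expr0n/= => /esym/eqP.
      by rewrite psumr_eq0 ?(fun _ => sqr_ge0)// => [/allP/(_ j (mem_index_enum j))/eqP|i _]//; exact: sqr_ge0.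
    have e1 : dot (ebase k0) (ebase k0) = 1 :> R.
      rewrite /dot (bigD1 k0)//= /ebase eqxx mulr1 big1 ?addr0// => i /negPf ->; exact: mul0r.
    have [U [oU _]] := orthog_row k0 e1; exists U; split => // k.
    by rewrite s0 if_same big1// => j _; rewrite z mulr0.
  have y1 : dot (fun j => s^-1 * m n j) (fun j => s^-1 * m n j) = 1.
    rewrite /dot (eq_bigr (fun j => s^-1 ^+ 2 * m n j ^+ 2)) => [|j _]; last by ring.
    by rewrite -mulr_sumr -s2 -exprMn mulVf// expr1n.
  have [U [oU [U0 rU]]] := orthog_row k0 y1; exists U; split => // k.
  rewrite (eq_bigr (fun j => s * (U k j * U k0 j))) => [|j _]; last first.
    by rewrite U0 mulrCA mulVKf// mulrC.
  by rewrite -mulr_sumr [X in _ * X]rU; case: eqP; rewrite ?mulr1 ?mulr0.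
have [V HV] := choice H.
exists V; split => [n|]; first by have [] := HV n.
by apply/funext => n; apply/funext => k; exact: (HV n).2.
Qed.

Section Coherence.
Context {R : realType} (L N K : nat).
Local Notation C := R[i].
Hypothesis L0 : (0 < L)%N.
Variables (B : 'M[R]_L) (h : 'cV[R]_L) (m : 'I_N -> 'cV[R]_K).
Hypothesis BB : B *m B^T = 1%:M.
Hypothesis h0 : h != 0.
Hypothesis m0 : mrow m != 0.

Lemma evec_sum : \sum_l cmod2 (evec B h l) = 1.
Proof.
have /matrixP/(_ 0 0) := em_unit L0 BB h0.
rewrite !mxE eqxx /= => E; apply: (@complexI R).
rewrite -[RHS]E; apply/esym; rewrite rmorph_sum; apply: eq_bigr => l _.
by rewrite !mxE cconj_mul.
Qed.

(** [B] and [h] are real, so conjugation acts on the Fourier kernel alone. *)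
Lemma evec_neg l : evec B h (negI L0 l) = cconj (evec B h l).
Proof.
rewrite /evec cconjM cconj_rc; congr (_ * _).
rewrite /Bhat -!mulmxA -rmxM [LHS]mxE [in RHS]mxE cconj_sum; apply: eq_bigr => i _.
by rewrite !dftE cexp_neg !cconjM !cconj_rc [in RHS]mxE cconj_rc [in LHS]mxE.
Qed.

Lemma evec_le l : cmod2 (evec B h l) <= inf2 (Bhat B *m rmx h) / nrm2 h.
Proof.
have hp : 0 <= (nrm2 h)^-1 by rewrite invr_ge0 ltW// nrm2_gt0.
have -> : cmod2 (evec B h l) = cmod2 ((Bhat B *m rmx h) l 0) * (nrm2 h)^-1.
  by rewrite /evec cmod2M cmod2_rc exprVn (hn2 h0) mulrC.
apply: (ler_wpM2r hp).
exact: (le_bigmax _ (fun i => cmod2 ((Bhat B *m rmx h) i 0))).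
Qed.

Lemma munit_sum : \sum_n \sum_k munit m n k ^+ 2 = 1.
Proof.
have mm := mn_gt0 m0.
transitivity ((mn m)^-1 ^+ 2 * nrm2 (mrow m)^T).
  rewrite /nrm2 sum_mxvec !mulr_sumr; apply: eq_bigr => n _; rewrite mulr_sumr; apply: eq_bigr => k _.
  by rewrite /munit exprMn !mxE mxvecE mxE.
by rewrite -(mn2 m0) exprVn mulVf// expf_neq0// gt_eqF.
Qed.

Lemma munit_le n : \sum_k munit m n k ^+ 2 <= (\big[Num.max/0]_(n < N) nrm2 (m n)) / nrm2 (mrow m)^T.
Proof.
have -> : \sum_k munit m n k ^+ 2 = nrm2 (m n) / nrm2 (mrow m)^T.
  rewrite -(mn2 m0) {1}/nrm2 mulr_suml; apply: eq_bigr => k _.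
  by rewrite /munit exprMn exprVn mulrC.
have mp : 0 <= (nrm2 (mrow m)^T)^-1 by rewrite invr_ge0 ltW// nrm2_gt0// mT0.
apply: (ler_wpM2r mp).
exact: (le_bigmax _ (fun n => nrm2 (m n))).
Qed.

End Coherence.

(** Consecutive intervals of length [Q] form a partition, so the average over the partitions has a
    nonzero denominator. *)
Lemma golf_parts_neq0 L N P Q : (0 < Q)%N -> L = (P * Q)%N -> (0 < #|golf_parts L N P Q|)%N.
Proof.
move=> Q0 LE; apply/card_gt0P.
exists [ffun _ => [ffun p : 'I_P => [set i : 'I_L | (i %/ Q)%N == p]%SET]].
rewrite inE; apply/forallP => n; rewrite ffunE; apply/and3P; split.
- apply/forallP => p; rewrite ffunE; apply/eqP.
  have lt (i : 'I_Q) : (p * Q + i < L)%N.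
    rewrite LE; apply: (@leq_trans (p.+1 * Q)); first by rewrite mulSn addnC ltn_add2r.
    by rewrite leq_mul2r ltn_ord orbT.
  have inj : injective (fun i => Ordinal (lt i)) by move=> i j [] /addnI/val_inj.
  rewrite -[RHS]card_ord -(card_codom inj); apply: eq_card => i; rewrite inE.
  apply/idP/idP => [/eqP ip|/codomP[j ->]]; last by rewrite /= divnMDl// divn_small ?addn0.
  apply/codomP; exists (Ordinal (ltn_pmod i Q0)); apply: val_inj => /=.
  by rewrite -ip -divn_eq.
- apply/forallP => p; apply/forallP => q; apply/implyP => pq.
  rewrite -setI_eq0; apply/eqP/setP => i; rewrite !inE !ffunE !inE.
  by apply/negP => /andP[/eqP ip /eqP iq]; move/eqP: pq; apply; apply: val_inj; exact: etrans (esym ip) iq.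
- apply/eqP/setP => i; rewrite !inE; apply/bigcupP.
  have ip : (i %/ Q < P)%N by rewrite ltn_divLR// -LE.
  by exists (Ordinal ip) => //; rewrite ffunE inE.
Qed.

(** One event, defined through the Gaussian matrices, that serves all partitions at once. *)
Lemma recovery_whp {R : realType} (beta : R) (L N K : nat) (B : 'M[R]_L) (h : 'cV[R]_L)
    (m : 'I_N -> 'cV[R]_K) (d : measure_display) (T : measurableType d)
    (Pr : probability T R) (Cm : T -> 'I_N -> 'M[R]_(L, K)) :
  4 <= beta -> (0 < L)%N -> (0 < K)%N -> (0 < N)%N -> (K <= L)%N ->
  B *m B^T = 1%:M -> h != 0 -> mrow m != 0 -> gauss_iid Pr Cm (Num.sqrt (L%:R : R))^-1 ->
  let el := ln ((L * N)%:R : R) in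
  let al := ln (K%:R * el) in
  1 <= el -> Anum beta <= al ->
  inf2 (Bhat B *m rmx h) / nrm2 h * K%:R * al ^+ 2 * el ^+ 2 <= 1 ->
  (\big[Num.max/0]_(n < N) nrm2 (m n)) / nrm2 (mrow m)^T * al * el <= 1 ->
  let X0 : 'M[R[i]]_(L, N * K) := rmx h *m rmx (mrow m) in
  exists A : set T, [/\ measurable A, 1 - 20 * expR ((2 - beta) * el) <= fine (Pr A) &
    forall w, A w -> forall X, (forall l n, Aop B (Cm w) X l n = Aop B (Cm w) X0 l n) ->
      X != X0 -> nuclear_norm X0 < nuclear_norm X].
Proof.
move=> be4 L0 K0 N0 KL BB h0 m0 gC el al el1 alA.
set w := inf2 _ / _; set nu := _ / nrm2 (mrow m)^T => wb nub X0.
pose k0 := Ordinal K0; pose n0 := Ordinal N0; pose l0 := Ordinal L0.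
have [V [oV VE]] := rot_base k0 (munit m).
pose mu n := Num.sqrt (\sum_k munit m n k ^+ 2).
have mu2 n : mu n ^+ 2 = \sum_k munit m n k ^+ 2.
  by rewrite sqr_sqrtr// sumr_ge0// => k _; exact: sqr_ge0.
have iX := gam_iid L0 oV gC.
pose p l := cmod2 (evec B h l).
have p0 l : 0 <= p l by exact: cmod2_ge0.
have p1 : \sum_l p l = 1 by exact: evec_sum.
have pneg l : p (negI L0 l) = p l by rewrite /p evec_neg cmod2_cconj.
have pw l : p l <= w by exact: evec_le.
have mu0 n : 0 <= mu n by exact: sqrtr_ge0.
have mu1 : \sum_n mu n ^+ 2 = 1.
  by rewrite (eq_bigr _ (fun n _ => mu2 n)); exact: munit_sum.
have munu n : mu n ^+ 2 <= nu by rewrite mu2; exact: munit_le.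
have w0 : 0 <= w := le_trans (p0 l0) (pw l0).
have nu0 : 0 <= nu := le_trans (sqr_ge0 _) (munu n0).
have K1 : 1 <= K%:R :> R by rewrite ler1n.
have Kel : K%:R <= expR al.
  by rewrite lnK ?ler_peMr// posrE mulr_gt0// ?ltr0n//; lra.
have be1 : 1 <= beta by lra.
have al0 : 0 <= al by have := num_al33 be4 alA; lra.
have NLe : (#|'I_N| * #|'I_L|)%:R <= expR el.
  by rewrite !card_ord mulnC lnK// posrE ltr0n muln_gt0 L0.
have KLe : (#|'I_K| <= #|'I_L|)%N by rewrite !card_ord.
have cK : #|'I_K|%:R = K%:R :> R by rewrite card_ord.
have hRK := num_wRK be4 el1 alA K1 w0 wb.
have hK := num_wK be4 el1 alA K1 w0 wb.
have hnu := num_nu be4 el1 alA nu0 nub.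
have hQ := num_wQ be4 el1 alA K1 w0 wb.
have hnet := num_net be4 alA K1 cK Kel.
rewrite -cK in hRK hK.
have [S [mS PS HS]] := good_event k0 n0 l0 (negIK L0) iX p0 p1 pneg pw mu0 mu1 munu be1 el1 al0
  NLe KLe hnet tnum_gt0 tnum_small hRK hK hnu hQ.
pose E := [set z | S (gam V (Cm z))].
have mE : measurable E by exact: (measurable_preimageT (iidn_measurable iX) mS).
exists (~` E); split; first exact: measurableC.
  rewrite probability_setC//.
  have Efin : Pr E \is a fin_num by exact: fin_num_measure.
  have : fine (Pr E) <= 20 * expR ((2 - beta) * el) by rewrite -lee_fin fineK.
  by rewrite fineB//= lerD2l lerN2.
move=> z /HS[v [vs vb ss GG QQ]].
have pe l : cmod2 (evec B h l) = p l by [].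
have dc := dual_cert_core (negIK L0) p0 p1 pneg pe mu1 vs vb ss GG QQ.
have ti := tangent_inj_core (negIK L0) p0 p1 pneg pe mu1 ss GG QQ.
rewrite gam_rotc -VE in dc ti.
exact: (unique_minimizer L0 BB h0 m0 (dual_cert_rot oV dc) (tangent_inj_rot oV ti)).
Qed.

Lemma average_const {R : realType} (I : finType) (G : {set I}) (a : R) : (0 < #|G|)%N ->
  #|G|%:R^-1 * (\sum_(D in G) a) = a.
Proof. by move=> G0; rewrite sumr_const -[a *+ _]mulr_natl mulKf// pnatr_eq0 -lt0n. Qed.

Lemma powR_LN {R : realType} (n : nat) (x : R) : (0 < n)%N -> n%:R `^ x = expR (x * ln n%:R) :> R.
Proof. by move=> n0; rewrite /powR pnatr_eq0 (gtn_eqF n0). Qed.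

Theorem theorem1 (R : realType) :
  exists c : R, 0 < c /\
  forall beta : R, 4 <= beta ->
  exists Cb : R, 0 < Cb /\ Cb <= c * beta /\
  exists Dcst : R, 0 < Dcst /\
  forall (L K N S P Q : nat)
    (B : 'M[R]_L) (h : 'cV[R]_L) (m : 'I_N -> 'cV[R]_K)
    (d : measure_display) (T : measurableType d) (Pr : probability T R)
    (Cm : T -> 'I_N -> 'M[R]_(L, K)),
    (0 < L)%N -> ~~ odd L -> (0 < K)%N -> (0 < N)%N -> (0 < S)%N ->
    (K <= L)%N -> (S <= L)%N ->
    B *m B^T = 1%:M ->
    h != 0 -> (#|supp h| <= S)%N ->
    mrow m != 0 ->
    (* golfing partition: L = P Q, P = (1/2) log2 (4 beta K log(LN)) *)
    (0 < Q)%N -> L = (P * Q)%N ->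
    (P%:R : R) = ln (4 * beta * K%:R * ln ((L * N)%:R)) / (2 * ln 2) ->
    (* entries of the C_n: iid N(0, 1/L) *)
    gauss_iid Pr Cm (Num.sqrt (L%:R : R))^-1 ->
    let LN : R := (L * N)%:R in
    let alpha1 := ln (K%:R * ln LN) in
    let alpha2 := ln (S%:R * ln LN) in
    N%:R >= Cb * rho0sq m * alpha1 * ln LN ->
    let X0 : 'M[R[i]]_(L, N * K) := rmx h *m rmx (mrow m) in
    (* probability over (C_n)_n and the independent uniformly random partition D *)
    exists A : {ffun 'I_N -> {ffun 'I_P -> {set 'I_L}}} -> set T,
      (forall D, measurable (A D)) /\
      (forall D, D \in golf_parts L N P Q -> forall w, A D w ->
         (sdag_ok B h D /\
          Num.max (mu0sq Q B h D * alpha1 * K%:R)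
                  (mumaxsq B * S%:R * alpha2 * ln (S%:R) ^+ 2)
            <= L%:R / (Cb * alpha1 * ln LN ^+ 2)) ->
         forall X : 'M[R[i]]_(L, N * K),
           (forall l n, Aop B (Cm w) X l n = Aop B (Cm w) X0 l n) ->
           X != X0 -> nuclear_norm X0 < nuclear_norm X) /\
      (#|golf_parts L N P Q|%:R)^-1 * (\sum_(D in golf_parts L N P Q) fine (Pr (A D)))
        >= 1 - Dcst * LN `^ (4 - beta).
Proof.
exists 1; split=> // beta be4; exists 1; do 2 split=> //; first by rewrite mul1r; lra.
(* [ln LN >= e0] forces [alpha1 >= Anum beta], because [K >= 1]. In [Dc], the 20 is the constant of
   [good_event], and the second summand raises the error term above 1 when [ln LN < e0]. *)
pose e0 := expR (Anum beta); pose Dc := 20 + expR ((beta - 4) * e0).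
exists Dc; split; first by rewrite addr_gt0 ?expR_gt0.
move=> L K N S P Q B h m d T Pr Cm L0 oL K0 N0 S0 KL SL BB h0 hS m0 Q0 LE PE gC LN al1 al2 hN X0.
pose el := ln LN.
have LN0 : (0 < L * N)%N by rewrite muln_gt0 L0.
have gp := golf_parts_neq0 N Q0 LE.
have PW : LN `^ (4 - beta) = expR ((4 - beta) * el) by exact: powR_LN.
have Dc0 : 0 <= Dc by rewrite addr_ge0 ?expR_ge0.
have trivial_bound : el < e0 -> 1 <= Dc * LN `^ (4 - beta).
  move=> small; rewrite PW.
  have : 1 <= expR ((beta - 4) * e0) * expR ((4 - beta) * el).
    rewrite -expRD -{1}expR0 ler_expR.
    have -> : (beta - 4) * e0 + (4 - beta) * el = (beta - 4) * (e0 - el) by ring.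
    by rewrite mulr_ge0//; lra.
  by move=> /le_trans; apply; rewrite ler_wpM2r ?expR_ge0// lerDr.
(* [Dcst] makes the probability bound trivial for small dimensions. *)
have [small|large] := ltP el e0.
  exists (fun=> set0); split=> //; split=> //.
  by rewrite measure0/= average_const// subr_le0 trivial_bound.
have A0 : 0 <= Anum beta.
  by rewrite /Anum divr_ge0 ?exprn_ge0 ?(ltW tnum_gt0)//; nra.
have el1 : 1 <= el by apply: le_trans large; rewrite -expR0 ler_expR.
have alA : Anum beta <= al1.
  rewrite -[leLHS]expRK ler_ln ?posrE ?expR_gt0//; last first.
    by rewrite mulr_gt0 ?ltr0n//; apply: lt_le_trans el1.
  by apply: (le_trans large); rewrite ler_peMl ?ler1n//; apply: le_trans el1.
have al33 := num_al33 be4 alA.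
have elp : 0 < el by lra.
have alp : 0 < al1 by lra.
set nu := (\big[Num.max/0]_(n < N) nrm2 (m n)) / nrm2 (mrow m)^T.
have nub : nu * al1 * el <= 1.
  move: hN; rewrite /rho0sq mul1r -[_ / nrm2 _]mulrA -/nu -!mulrA.
  by rewrite -[leRHS]mulr1 ler_pM2l ?ltr0n// !mulrA.
set w := inf2 (Bhat B *m rmx h) / nrm2 h.
have wb : forall D : {ffun 'I_N -> {ffun 'I_P -> {set 'I_L}}},
    Num.max (mu0sq Q B h D * al1 * K%:R) (mumaxsq B * S%:R * al2 * ln (S%:R) ^+ 2)
      <= L%:R / (1 * al1 * el ^+ 2) -> w * K%:R * al1 ^+ 2 * el ^+ 2 <= 1.
  move=> D; rewrite ge_max => /andP[+ _].
  (* [w] is the first entry of the maximum that defines [mu0sq]. *)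
  have ge : L%:R * w <= mu0sq Q B h D by rewrite ler_wpM2l// le_max lexx.
  have q0 : 0 < al1 * el ^+ 2 by rewrite mulr_gt0// exprn_gt0.
  rewrite mul1r ler_pdivlMr// => H.
  have : L%:R * w * al1 * K%:R * (al1 * el ^+ 2) <= L%:R.
    apply: le_trans H; do 3 (apply: ler_wpM2r; first by rewrite ?ler0n ?ltW).
    exact: ge.
  rewrite -[leRHS]mulr1 -!(mulrA L%:R) ler_pM2l ?ltr0n//.
  by congr (_ <= _); ring.
have prob : 1 - Dc * LN `^ (4 - beta) <= 1 - 20 * expR ((2 - beta) * el).
  rewrite lerD2l lerN2 PW; apply: ler_pM; rewrite ?expR_ge0//.
    by rewrite /Dc lerDl expR_ge0.
  by rewrite ler_expR ler_wpM2r ?ltW//; lra.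
have [wb1|wbN] := boolP (w * K%:R * al1 ^+ 2 * el ^+ 2 <= 1); last first.
  (* No partition satisfies the coherence hypothesis. *)
  exists (fun=> setT); split=> //; split.
    by move=> D _ z _ [_ /wb]; rewrite (negbTE wbN).
  rewrite probability_setT/= average_const//.
  by rewrite gerBl mulr_ge0// powR_ge0.
have [A [mA PA HA]] := recovery_whp be4 L0 K0 N0 KL BB h0 m0 gC el1 alA wb1 nub.
exists (fun=> A); split=> //; split; first by move=> D _ z /HA.
by rewrite average_const// (le_trans prob).
Qed.
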